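(* Assume that (H1) (i.e. (H1.1), (H1.2), (H1.3)) and (H2) hold. Suppose that there exist positive numbers $C$ and $\Lambda$ such that $$L_\mu V(x)\le C-\Lambda V(x)\quad\text{for all } x\in\mathbb R^d \text{ and all } \mu\in\mathcal P(V).$$ Then equation (E) has a probability solution belonging to $\mathcal P(V)$.
   Context: Standing setting. Let $d\ge 1$. For every Borel probability measure $\mu$ on $\mathbb R^d$ there are given Borel functions $x\mapsto a^{ij}(x,\mu)$ and $x\mapsto b^i(x,\mu)$ on $\mathbb R^d$, $1\le i,j\le d$, such that the matrix $A(x,\mu)=(a^{ij}(x,\mu))_{i,j}$ is symmetric and nonnegative definite. For a measure $\mu$ put $L_\mu u(x)=\sum_{i,j=1}^d a^{ij}(x,\mu)\partial_{x_i}\partial_{x_j}u(x)+\sum_{i=1}^d b^i(x,\mu)\partial_{x_i}u(x)$. Consider the nonlinear stationary Kolmogorov equation (E): $\sum_{i,j=1}^d\partial_{x_i}\partial_{x_j}\big(a^{ij}(x,\mu)\mu\big)-\sum_{i=1}^d\partial_{x_i}\big(b^i(x,\mu)\mu\big)=0$. A nonnegative locally finite Borel measure $\mu$ on $\mathbb R^d$ is a solution of (E) if the functions $a^{ij}(\cdot,\mu)$, $b^i(\cdot,\mu)$ are $\mu$-integrable over every compact set and $\int_{\mathbb R^d} L_\mu u\,d\mu=0$ for all $u\in C_0^\infty(\mathbb R^d)$; it is a probability solution if in addition $\mu(\mathbb R^d)=1$. Fix $V\in C^2(\mathbb R^d)$ with $V\ge0$ and $V(x)\to+\infty$ as $|x|\to\infty$.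 For $R>0$, $\mathcal P_R(V)$ is the set of Borel probability measures $\mu$ on $\mathbb R^d$ with $\int V\,d\mu\le R$; $\mathcal P(V)$ is the set of Borel probability measures $\mu$ with $V\in L^1(\mu)$. A sequence $\mu_n\in\mathcal P(V)$ converges $V$-weakly to $\mu\in\mathcal P(V)$ if $\int f\,d\mu_n\to\int f\,d\mu$ for every continuous $f$ with $f(x)/V(x)\to0$ as $|x|\to\infty$. Fix an integer $0\le m\le d$ and write $x=(y,z)$ with $y=(x_1,\dots,x_m)\in\mathbb R^m$, $z=(x_{m+1},\dots,x_d)\in\mathbb R^{d-m}$ (if $m=0$ there is no $y$; if $m=d$ there is no $z$). Cubes have edges parallel to the coordinate axes; a cube $K\subset\mathbb R^d$ is written $K=K_y\times K_z$. (H1.1) For every $R>0$ and every cube $K\subset\mathbb R^d$ there is $\lambda_{K,R}>0$ such that $\sum_{i,j\le m}a^{ij}(x,\mu)\xi_i\xi_j\ge\lambda_{K,R}|\xi|^2$ for all $x\in K$, $\mu\in\mathcal P_R(V)$, $\xi\in\mathbb R^m$. (H1.2) For every $R>0$, every cube $K$ and all $i,j$: $\sup_{x\in K,\ \mu\in\mathcal P_R(V)}\big(|a^{ij}(x,\mu)|+|b^i(x,\mu)|\big)<\infty$. (H1.3) For every $R>0$ and every cube $K=K_y\times K_z$ there is a nonnegative continuous monotone function $\omega_{K,R}$ on $[0,\infty)$ with $\omega_{K,R}(0)=0$ such that for all $i,j$ and all $z,z'\in K_z$: $\sup_{y\in K_y,\ \mu\in\mathcal P_R(V)}\big(|a^{ij}(y,z,\mu)-a^{ij}(y,z',\mu)|+|b^i(y,z,\mu)-b^i(y,z',\mu)|\big)\le\omega_{K,R}(|z-z'|)$.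 (H1) means (H1.1), (H1.2), (H1.3) together. (H2) For every $R>0$, every sequence $\mu_n\in\mathcal P_R(V)$ converging $V$-weakly to some $\mu\in\mathcal P_R(V)$, and all $i,j$: – if $m=0$: $|a^{ij}(x,\mu_n)-a^{ij}(x,\mu)|+|b^i(x,\mu_n)-b^i(x,\mu)|\to0$ for every $x\in\mathbb R^d$; – if $m=1$: for a fixed number $\gamma>0$, for every cube $K_y\subset\mathbb R^m$ and every $z\in\mathbb R^{d-m}$, $\int_{K_y}\big(|a^{ij}(y,z,\mu)-a^{ij}(y,z,\mu_n)|^{1+\gamma}+|b^i(y,z,\mu)-b^i(y,z,\mu_n)|^{1+\gamma}\big)dy\to0$; – if $m\ge2$: for every cube $K_y\subset\mathbb R^m$ and every $z\in\mathbb R^{d-m}$, $\int_{K_y}\big(|a^{ij}(y,z,\mu)-a^{ij}(y,z,\mu_n)|^{m}+|b^i(y,z,\mu)-b^i(y,z,\mu_n)|^{m}\big)dy\to0$. *)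

(* Defs.v *)
From HB Require Import structures.
From mathcomp Require Import all_boot all_order all_algebra.
From mathcomp Require Import all_classical all_reals all_analysis.
Set Implicit Arguments. Unset Strict Implicit. Unset Printing Implicit Defensive.
Import Order.TTheory GRing.Theory Num.Theory.
Import numFieldNormedType.Exports.
Local Open Scope classical_set_scope.
Local Open Scope ring_scope.

(* R^n is represented by row vectors 'rV[R]_n (product = Euclidean topology).
   Rd R n is the same carrier equipped with the Borel sigma-algebra, i.e. the
   sigma-algebra generated by the open sets. *)
Definition Rd (R : realType) (n : nat) := g_sigma_algebraType (@open 'rV[R]_n).

Definition enorm (R : realType) (n : nat) (x : 'rV[R]_n) : R :=
  Num.sqrt (\sum_(i < n) x 0 i ^+ 2).

Definition cube (R : realType) (n : nat) (c : 'rV[R]_n) (r : R) : set 'rV[R]_n :=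
  [set x | forall i, `|x 0 i - c 0 i| <= r].

Definition pder (R : realType) (n : nat) (s : seq 'I_n) (f : 'rV[R]_n -> R)
  : 'rV[R]_n -> R :=
  foldr (fun i g => fun x => derive g x (delta_mx 0 i)) f s.

Definition Ck (R : realType) (n : nat) (k : nat) (f : 'rV[R]_n -> R) : Prop :=
  (forall s : seq 'I_n, (size s <= k)%N -> continuous (pder s f)) /\
  (forall (s : seq 'I_n) (i : 'I_n) (x : 'rV[R]_n),
      (size s < k)%N -> derivable (pder s f) x (delta_mx 0 i)).

Definition smooth (R : realType) (n : nat) (f : 'rV[R]_n -> R) : Prop :=
  forall k, Ck k f.

Definition test_fun (R : realType) (n : nat) (u : 'rV[R]_n -> R) : Prop :=
  smooth u /\ compact (closure [set x | u x != 0]).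

Definition Lop (R : realType) (n : nat) (A : 'rV[R]_n -> 'M[R]_n)
  (b : 'rV[R]_n -> 'rV[R]_n) (u : 'rV[R]_n -> R) (x : 'rV[R]_n) : R :=
  \sum_(i < n) \sum_(j < n) A x i j * pder [:: i; j] u x
  + \sum_(i < n) b x 0 i * pder [:: i] u x.

Definition inPV (R : realType) (n : nat) (V : 'rV[R]_n -> R)
  (mu : probability (Rd R n) R) : Prop :=
  mu.-integrable setT (fun x : Rd R n => (V x)%:E).

Definition inPRV (R : realType) (n : nat) (V : 'rV[R]_n -> R) (Rb : R)
  (mu : probability (Rd R n) R) : Prop :=
  (\int[mu]_(x in setT) (V x)%:E <= Rb%:E)%E.

Definition Vweak_cvg (R : realType) (n : nat) (V : 'rV[R]_n -> R)
  (mun : nat -> probability (Rd R n) R) (mu : probability (Rd R n) R) : Prop :=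
  forall f : 'rV[R]_n -> R, continuous f ->
    (forall e : R, 0 < e -> exists r : R, forall x, r < enorm x -> `|f x / V x| < e) ->
    (fun p => (\int[mun p]_(x in setT) (f x)%:E)%E) @ \oo -->
      (\int[mu]_(x in setT) (f x)%:E)%E.

(* Iterated Lebesgue integral over the box prod_{i<n} [lo i, hi i] of a
   function of n real variables (coordinates indexed by nat, i < n used). *)
Fixpoint itint (R : realType) (n : nat) (lo hi : nat -> R)
  (g : (nat -> R) -> \bar R) : \bar R :=
  match n with
  | 0 => g (fun _ => 0)
  | n'.+1 => (\int[@lebesgue_measure R]_(t in `[lo n', hi n']%classic)
               itint n' lo hi (fun x => g (fun i => if i == n' then t else x i)))%E
  end.

Definition coord (R : realType) (n : nat) (c : 'rV[R]_n) (i : nat) : R :=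
  match @insub nat (fun i => (i < n)%N) 'I_n i with Some j => c 0 j | None => 0 end.

(* Lebesgue integral (over R^n) of a nonnegative F over the cube (c, r) *)
Definition cube_int (R : realType) (n : nat) (c : 'rV[R]_n) (r : R)
  (F : 'rV[R]_n -> \bar R) : \bar R :=
  itint n (fun i => coord c i - r) (fun i => coord c i + r)
        (fun x => F (\row_(j < n) x j)).

Definition H11 (R : realType) (m k : nat) (V : 'rV[R]_(m + k) -> R)
  (A : probability (Rd R (m + k)) R -> 'rV[R]_(m + k) -> 'M[R]_(m + k)) : Prop :=
  forall (Rb : R), 0 < Rb -> forall (c : 'rV[R]_(m + k)) (r : R), 0 < r ->
  exists lam : R, 0 < lam /\
    forall x mu (xi : 'rV[R]_m), cube c r x -> inPRV V Rb mu ->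
      \sum_(i < m) \sum_(j < m) A mu x (lshift k i) (lshift k j) * xi 0 i * xi 0 j
      >= lam * enorm xi ^+ 2.

Definition H12 (R : realType) (m k : nat) (V : 'rV[R]_(m + k) -> R)
  (A : probability (Rd R (m + k)) R -> 'rV[R]_(m + k) -> 'M[R]_(m + k))
  (b : probability (Rd R (m + k)) R -> 'rV[R]_(m + k) -> 'rV[R]_(m + k)) : Prop :=
  forall (Rb : R), 0 < Rb -> forall (c : 'rV[R]_(m + k)) (r : R), 0 < r ->
  forall i j, exists M : R, forall x mu, cube c r x -> inPRV V Rb mu ->
      `|A mu x i j| + `|b mu x 0 i| <= M.

Definition H13 (R : realType) (m k : nat) (V : 'rV[R]_(m + k) -> R)
  (A : probability (Rd R (m + k)) R -> 'rV[R]_(m + k) -> 'M[R]_(m + k))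
  (b : probability (Rd R (m + k)) R -> 'rV[R]_(m + k) -> 'rV[R]_(m + k)) : Prop :=
  forall (Rb : R), 0 < Rb -> forall (c : 'rV[R]_(m + k)) (r : R), 0 < r ->
  exists omega : R -> R,
    (forall t, 0 <= t -> 0 <= omega t) /\
    {within `[0, +oo[%classic, continuous omega} /\
    (forall s t, 0 <= s -> s <= t -> omega s <= omega t) /\
    omega 0 = 0 /\
    forall i j (z z' : 'rV[R]_k), cube (rsubmx c) r z -> cube (rsubmx c) r z' ->
    forall (y : 'rV[R]_m) mu, cube (lsubmx c) r y -> inPRV V Rb mu ->
      `|A mu (row_mx y z) i j - A mu (row_mx y z') i j|
      + `|b mu (row_mx y z) 0 i - b mu (row_mx y z') 0 i| <= omega (enorm (z - z')).

Definition H2 (R : realType) (m k : nat) (gamma : R) (V : 'rV[R]_(m + k) -> R)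
  (A : probability (Rd R (m + k)) R -> 'rV[R]_(m + k) -> 'M[R]_(m + k))
  (b : probability (Rd R (m + k)) R -> 'rV[R]_(m + k) -> 'rV[R]_(m + k)) : Prop :=
  forall (Rb : R), 0 < Rb ->
  forall (mun : nat -> probability (Rd R (m + k)) R) (mu : probability (Rd R (m + k)) R),
    (forall p, inPRV V Rb (mun p)) -> inPRV V Rb mu -> Vweak_cvg V mun mu ->
    forall i j,
    if m == 0%N then
      forall x, (fun p => `|A (mun p) x i j - A mu x i j|
                         + `|b (mun p) x 0 i - b mu x 0 i|) @ \oo --> 0
    else if m == 1%N then
      forall (cy : 'rV[R]_m) (r : R), 0 < r -> forall z : 'rV[R]_k,
        (fun p => cube_int cy r (fun y =>
           (`|A mu (row_mx y z) i j - A (mun p) (row_mx y z) i j| `^ (1 + gamma)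
          + `|b mu (row_mx y z) 0 i - b (mun p) (row_mx y z) 0 i| `^ (1 + gamma))%:E))
        @ \oo --> 0%E
    else
      forall (cy : 'rV[R]_m) (r : R), 0 < r -> forall z : 'rV[R]_k,
        (fun p => cube_int cy r (fun y =>
           (`|A mu (row_mx y z) i j - A (mun p) (row_mx y z) i j| ^+ m
          + `|b mu (row_mx y z) 0 i - b (mun p) (row_mx y z) 0 i| ^+ m)%:E))
        @ \oo --> 0%E.

Definition prob_solution (R : realType) (n : nat)
  (A : probability (Rd R n) R -> 'rV[R]_n -> 'M[R]_n)
  (b : probability (Rd R n) R -> 'rV[R]_n -> 'rV[R]_n)
  (mu : probability (Rd R n) R) : Prop :=
  (forall K : set 'rV[R]_n, compact K -> forall i j,
     mu.-integrable (K : set (Rd R n)) (fun x => (A mu x i j)%:E) /\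
     mu.-integrable (K : set (Rd R n)) (fun x => (b mu x 0 i)%:E)) /\
  (forall u : 'rV[R]_n -> R, test_fun u ->
     (\int[mu]_(x in setT) (Lop (A mu) (b mu) u x)%:E)%E = 0%E).

(* Main.v *)
(* The equation is nonlinear in the measure, so a solution is found by a minimax argument rather than by
   solving linear equations.  For a finite set of points of R^d, a finite family of test functions and
   coefficients averaged in y over cells of mesh N^-4, Ky Fan's inequality (proved from Scarf's
   combinatorial lemma) is applied to psi(p, x) = L_p (sum_u g_u(p) u - phi(p) V)(x), where g_u(p) is the
   mean of L_p u and phi(p) the excess of the V-moment.  At a maximum point of the function in brackets psi
   is almost nonpositive, and the Lyapunov inequality then forces all g_u to be small and the V-moment to
   stay bounded: this gives finitely supported measures almost solving the equation.

   A subsequence converges V-weakly.  The coefficients are merely measurable in y, so the limit passage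
   needs a Krylov type estimate: a field that is small in L^m(dy) has small mean along these measures.
   It follows by testing with Z^2 (w + w^2 / kappa), where w is the smooth interpolation of the minimal
   lattice supersolution of a Pucci equation, bounded by a lattice version of the Aleksandrov-Bakelman-Pucci
   argument.  For m = 0 the estimate is trivial, which is why (H2) is pointwise in that case. *)
From HB Require Import structures.
From mathcomp Require Import all_boot.
Set Implicit Arguments. Unset Strict Implicit. Unset Printing Implicit Defensive.

(** * Scarf's lemma *)

(** Ky Fan's inequality needs a payoff continuous in the weights [p], while (H2) controls the
    coefficients only through integrals over [y]-cubes at fixed [z]: their values at an atom need
    not converge. Cell means do, hence the averaged coefficients. The price is that the limit
    equation has to be recovered from averages integrated against atomic measures, which have no
    density. The Krylov type estimate comes from testing with a function adapted to a field, but the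
    field that matters depends on the laws themselves. Quantization breaks this circle: at stage [n]
    every lattice field with values in {0, 1/n, ..., n} and small power sum has its test function in
    the finite family before the law is produced; the relevant field is rounded to one of them
    afterwards. So the mesh must be fixed before the family, and the threshold for [N] may depend
    only on the radius of the supports. The exponent 4 leaves a rate: with step N^-4 and width 1/N,
    second differences miss the second derivatives by N^-9, against the factor N^-8 of the squared
    step. *)

Section Fibers.
Variables (S T : finType) (g : S -> T).

(** By counting, one fibre of [g] on [A] has two points and all others have one; the two points of
    that fibre are exactly the removable ones. Every pairing of size two in Scarf's argument comes
    from here. *)
Lemma imset_setD1_card2 (A : {set S}) (B : {set T}) :
  g @: A = B -> #|A| = #|B|.+1 ->
  #|[set a in A | g @: (A :\ a) == B]| = 2.
Proof.
move=> gA cA.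
have /dinjectivePn [a aA [a' /andP[a'a a'A] gaa']] : ~~ dinjectiveb g A.
  apply/negP => /dinjectiveP inj; move: (card_in_imset inj).
  by rewrite gA cA => /eqP; rewrite eqn_leq ltnn andbF.
have gAa : g @: (A :\ a) = B.
  apply/setP => y; rewrite -gA; apply/imsetP/imsetP.
    by case=> x /setD1P[_ xA] ->; exists x.
  case=> x xA ->; case: (eqVneq x a) => [->|xa].
    by exists a' => //; rewrite !inE a'a.
  by exists x => //; rewrite !inE xa.
have inja : {in A :\ a &, injective g}.
  apply/imset_injP; rewrite gAa; have := cardsD1 a A.
  by rewrite aA cA add1n => -[->].
suff -> : [set a in A | g @: (A :\ a) == B] = [set a; a'].
  by rewrite cards2 eq_sym a'a.
apply/setP => x; rewrite !inE; apply/andP/orP.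
  move=> [xA /eqP gx]; case: (eqVneq x a) => [|xa]; first by left.
  right; have : g x \in B by rewrite -gA imset_f.
  rewrite -gx => /imsetP[y /setD1P[yx yA] gxy].
  case: (eqVneq y a) => [ya|ya].
    by apply/eqP/inja; rewrite ?inE ?xa ?a'a // -gaa' -ya.
  by move: yx; rewrite (inja x y) ?inE ?xa ?ya ?eqxx.
case=> /eqP ->; rewrite ?aA ?a'A ?gAa; split => //.
apply/eqP/setP => y; rewrite -gA; apply/imsetP/imsetP.
  by case=> z /setD1P[_ zA] ->; exists z.
case=> z zA ->; case: (eqVneq z a') => [->|za].
  by exists a => //; rewrite !inE eq_sym a'a.
by exists z => //; rewrite !inE za.
Qed.

End Fibers.

Section Scarf.
Variables (X I : finType) (le : I -> rel X) (c : X -> I) (i0 : I) (x0 : X).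
Hypothesis le_total : forall i, total (le i).
Hypothesis le_anti : forall i, antisymmetric (le i).
Hypothesis le_trans : forall i, transitive (le i).

Let lexx i : reflexive (le i).
Proof. by move=> x; have := le_total i x x; rewrite orbb. Qed.

(** Scarf's notion: no point lies strictly above the minimum of [s] in all the orders indexed by [C]
    at once. For empty [s] it only asks that [C] be nonempty. *)
Definition dominant (s : {set X}) (C : {set I}) : bool :=
  [forall x, [exists (i | i \in C), [forall (y | y \in s), le i x y]]].

Lemma dominantP (s : {set X}) (C : {set I}) :
  reflect (forall x, exists2 i, i \in C & forall y, y \in s -> le i x y)
          (dominant s C).
Proof.
apply: (iffP forallP) => h x.
  have /existsP[i /andP[iC /forallP H]] := h x.
  by exists i => // y ys; have := H y; rewrite ys.
have [i iC H] := h x; apply/existsP; exists i; rewrite iC /=.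
by apply/forallP => y; apply/implyP => /H.
Qed.

Lemma dominantS (s s' : {set X}) (C C' : {set I}) :
  s' \subset s -> C \subset C' -> dominant s C -> dominant s' C'.
Proof.
move=> /subsetP ss /subsetP CC /dominantP d; apply/dominantP => x.
by have [i iC h] := d x; exists i => [|y ys]; [exact: CC | exact: h (ss _ ys)].
Qed.

Lemma le_min i (s : {set X}) x : x \in s ->
  exists2 y, y \in s & forall z, z \in s -> le i y z.
Proof.
have [n sn] := ubnP #|s|; elim: n s sn x => [//|n IH] s sn x xs.
have [sx|/set0Pn[x' x's]] := eqVneq (s :\ x) set0.
  exists x => // z zs; case: (eqVneq z x) => [->|zx]; first exact: lexx.
  by move/setP/(_ z): sx; rewrite !inE zx zs.
have sxn : #|s :\ x| < n by move: sn; rewrite (cardsD1 x s) xs.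
have [y /setD1P[_ ys] hy] := IH _ sxn _ x's.
have [xy|yx] := orP (le_total i x y).
  exists x => // z zs; case: (eqVneq z x) => [->|zx]; first exact: lexx.
  by apply: le_trans xy _; apply: hy; rewrite !inE zx.
exists y => // z zs; case: (eqVneq z x) => [-> //|zx].
by apply: hy; rewrite !inE zx.
Qed.

Lemma le_max i (s : {set X}) x : x \in s ->
  exists2 y, y \in s & forall z, z \in s -> le i z y.
Proof.
have [n sn] := ubnP #|s|; elim: n s sn x => [//|n IH] s sn x xs.
have [sx|/set0Pn[x' x's]] := eqVneq (s :\ x) set0.
  exists x => // z zs; case: (eqVneq z x) => [->|zx]; first exact: lexx.
  by move/setP/(_ z): sx; rewrite !inE zx zs.
have sxn : #|s :\ x| < n by move: sn; rewrite (cardsD1 x s) xs.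
have [y /setD1P[_ ys] hy] := IH _ sxn _ x's.
have [yx|xy] := orP (le_total i y x).
  exists x => // z zs; case: (eqVneq z x) => [->|zx]; first exact: lexx.
  by apply: le_trans yx; apply: hy; rewrite !inE zx.
exists y => // z zs; case: (eqVneq z x) => [-> //|zx].
by apply: hy; rewrite !inE zx.
Qed.

Definition least (t : {set X}) (i : I) : X :=
  odflt x0 [pick y in t | [forall (z | z \in t), le i y z]].

Lemma leastP (t : {set X}) i x : x \in t ->
  (least t i \in t) /\ (forall z, z \in t -> le i (least t i) z).
Proof.
move=> xt; rewrite /least; case: pickP => [y /andP[yt /forallP h]|n].
  by split=> //= z zt; have := h z; rewrite zt.
have [y yt hy] := le_min i xt; have /negP[] := negbT (n y).
by rewrite /= yt /=; apply/forallP => z; apply/implyP => /hy.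
Qed.

(** Dominance applied to a point [y] of [t] itself gives an order in which [y] is below all of [t],
    so [y] is the least point there. *)
Lemma dominant_least (t : {set X}) (D : {set I}) x : x \in t -> dominant t D -> least t @: D = t.
Proof.
move=> xt /dominantP d; apply/setP => y; apply/imsetP/idP.
  by case=> i _ ->; case: (leastP i xt).
move=> yt; have [i iD h] := d y; exists i => //.
have [lt hl] := leastP i xt; apply: (@le_anti i).
by rewrite h // hl.
Qed.

Lemma door_rooms (t : {set X}) (D : {set I}) x : x \in t -> dominant t D -> #|D| = #|t|.+1 ->
  #|[set k in D | dominant t (D :\ k)]|
  + #|[set z | (z \notin t) && dominant (z |: t) D]| = 2.
Proof.
move=> xt dD cD.
have rem2 := imset_setD1_card2 (dominant_least xt dD) cD.
pose rem := [set k in D | least t @: (D :\ k) == t].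
(* [M k] collects the points that defeat [D :\ k]: they are strictly above the minimum of [t] in
   every order of [D] other than [k]. If it is empty, [k] may be dropped; otherwise its [k]-greatest
   element is the point to add. *)
pose M k := [set z | [forall (l | l \in D :\ k), ~~ le l z (least t l)]].
have MP k z : reflect (forall l, l \in D -> l != k -> ~~ le l z (least t l)) (z \in M k).
  rewrite inE; apply: (iffP forallP) => h l.
    by move=> lD lk; have := h l; rewrite !inE lD lk.
  by apply/implyP; rewrite !inE => /andP[lk lD]; apply: h.
have lt l : least t l \in t by case: (leastP l xt).
have ltl l z : z \in t -> le l (least t l) z by case: (leastP l xt) => _; apply.
pose xk k := odflt x0 [pick y in M k | [forall (z | z \in M k), le k z y]].
have xkP k : M k != set0 -> xk k \in M k /\ forall z, z \in M k -> le k z (xk k).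
  case/set0Pn=> z zM; rewrite /xk; case: pickP => [y /andP[yt /forallP h]|n].
    by split=> //= w wt; have := h w; rewrite wt.
  have [y yt hy] := le_max k zM; have /negP[] := negbT (n y).
  by rewrite /= yt /=; apply/forallP => w; apply/implyP => /hy.
have MkD k z : k \in D -> z \in M k -> forall y, y \in t -> le k z y.
  move=> kD /MP zM y yt; have /dominantP/(_ z)[l lD h] := dD.
  case: (eqVneq l k) => [<-|lk]; first exact: h.
  by have := zM _ lD lk; rewrite h // lt.
have -> : [set k in D | dominant t (D :\ k)] = [set k in rem | M k == set0].
  apply/setP => k; rewrite !inE -andbA; apply: andb_id2l => kD.
  apply/idP/andP => [d|[/eqP r /eqP M0]].
    split; first by apply/eqP/(dominant_least xt d).
    apply/set0Pn => -[z /MP zM]; have /dominantP/(_ z)[l] := d.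
    by rewrite !inE => /andP[lk lD] h; have := zM l lD lk; rewrite h // lt.
  apply/dominantP => z; have : z \notin M k by rewrite M0 inE.
  rewrite inE negb_forall => /existsP[l]; rewrite negb_imply negbK => /andP[lD h].
  by exists l => // y yt; apply: le_trans h (ltl _ _ yt).
have -> : [set z | (z \notin t) && dominant (z |: t) D]
        = xk @: [set k in rem | M k != set0].
  apply/setP => z; apply/idP/imsetP.
    rewrite inE => /andP[zt dz].
    have zzt : z \in z |: t by rewrite !inE eqxx.
    have imz := dominant_least zzt dz.
    have cz : #|z |: t| = #|t|.+1 by rewrite cardsU1 zt.
    have inj : {in D &, injective (least (z |: t))}.
      by apply/imset_injP; rewrite imz cz cD.
    have : z \in least (z |: t) @: D by rewrite imz.
    case/imsetP => k kD zk.
    have lz l : l \in D -> l != k -> least (z |: t) l = least t l.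
      move=> lD lk; have [h1 h2] := leastP l zzt.
      have h3 : least (z |: t) l \in t.
        move: h1; rewrite !inE; case/orP => // /eqP E.
        by move: lk; rewrite (inj l k) ?eqxx // E.
      apply: (@le_anti l); rewrite ltl // h2 //.
      by rewrite !inE lt orbT.
    have zM : z \in M k.
      apply/MP => l lD lk; apply/negP => h.
      have [h1 h2] := leastP l zzt.
      have zl : z = least (z |: t) l.
        by apply: (@le_anti l); rewrite h2 // lz // h.
      by move: lk; rewrite (inj l k) ?eqxx // -zk -zl.
    have Mk0 : M k != set0 by apply/set0Pn; exists z.
    exists k.
      rewrite !inE kD Mk0 andbT /=; apply/eqP/setP => y; apply/imsetP/idP.
        by case=> l _ ->.
      move=> yt; have : y \in least (z |: t) @: D by rewrite imz !inE yt orbT.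
      case/imsetP=> l lD E; case: (eqVneq l k) => [lk|lk].
        by move: zt; rewrite zk -lk -E yt.
      by exists l; rewrite ?inE ?lk // -lz.
    have [h1 h2] := xkP _ Mk0; apply: (@le_anti k); rewrite h2 //=.
    have /dominantP/(_ (xk k))[l lD h] := dz.
    case: (eqVneq l k) => [E|lk]; first by rewrite -{1}E; apply: h.
    have /MP/(_ l lD lk)/negP[] := h1.
    by apply: h; rewrite !inE lt orbT.
  case=> k; rewrite !inE => /andP[/andP[kD /eqP r] Mk] ->.
  have [h1 h2] := xkP _ Mk; apply/andP; split.
    apply/negP => zt; have : xk k \in least t @: (D :\ k) by rewrite r.
    case/imsetP=> l /setD1P[lk lD] E; have /MP/(_ l lD lk) := h1.
    by rewrite -E lexx.
  apply/dominantP => w; case: (boolP (w \in M k)) => [wM|].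
    exists k => // y /setU1P[->|yt]; first exact: h2.
    exact: MkD.
  rewrite inE negb_forall => /existsP[l]; rewrite negb_imply negbK => /andP[lD h].
  move: lD; rewrite !inE => /andP[lk lD].
  exists l => // y /setU1P[->|yt]; last by apply: le_trans h (ltl _ _ yt).
  have /MP/(_ l lD lk) := h1 => nh.
  apply: le_trans h _; have := le_total l (xk k) (least t l).
  by rewrite (negbTE nh).
rewrite card_in_imset => [|k k'].
  rewrite -[RHS]rem2 -/rem -(cardsID [set k | M k == set0] rem); congr (_ + _);
    by apply: eq_card => k; rewrite !inE // andbC.
rewrite !inE => /andP[/andP[kD _] Mk] /andP[/andP[k'D _] Mk'] E.
apply/eqP/negP => /negP kk'; have [h1 _] := xkP _ Mk; have [h1' _] := xkP _ Mk'.
have /MP/(_ k' k'D) := h1; rewrite eq_sym kk' => /(_ isT)/negP[].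
by rewrite E; apply: (MkD k' _ k'D h1').
Qed.

(** The empty door leads to one room only: its index cannot be dropped, and only the greatest point
    of order [i] can be added. This unpaired door makes the total odd. *)
Lemma door_rooms0 i :
  #|[set k in [set i] | dominant set0 ([set i] :\ k)]|
  + #|[set z | (z \notin set0) && dominant (z |: set0) [set i]]| = 1.
Proof.
have -> : [set k in [set i] | dominant set0 ([set i] :\ k)] = set0.
  apply/setP => k; rewrite !inE; apply/negP => /andP[/eqP -> /dominantP/(_ x0)[j]].
  by rewrite !inE; case: (j == i).
rewrite cards0 add0n; have [y _ hy] := @le_max i setT x0 (in_setT _).
apply/eqP/cards1P; exists y; apply/setP => z; rewrite !inE /=.
apply/dominantP/eqP => [/(_ y)[j]|-> w].
  rewrite inE => /eqP -> h; apply: (@le_anti i); rewrite hy ?in_setT //=.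
  by apply: h; rewrite !inE eqxx.
by exists i; rewrite ?inE // => u; rewrite !inE orbF => /eqP ->; apply: hy.
Qed.

Let door (p : {set X} * {set I}) :=
  [&& dominant p.1 p.2, #|p.2| == #|p.1|.+1, i0 \in p.2 & c @: p.1 == p.2 :\ i0].
Let room (p : {set X} * {set I}) := dominant p.1 p.2 && (#|p.2| == #|p.1|).

(** Case count. If [i0] is not in [C], the only possible door adds [i0], and it needs [C] as label
    set. If [i0] is in [C], there are two doors when the labels are [C :\ i0], possibly with one
    label foreign to [C], one door when they are exactly [C], none otherwise. *)
Lemma room_doors p : room p ->
  odd (#|[set k | (k \notin p.2) && door (p.1, k |: p.2)]|
       + #|[set z in p.1 | door (p.1 :\ z, p.2)]|) = (c @: p.1 == p.2).
Proof.
case: p => s C /andP[/= d /eqP cC].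
have dA k : k \notin C -> door (s, k |: C) = (i0 \in k |: C) && (c @: s == (k |: C) :\ i0).
  move=> kC; rewrite /door /= cardsU1 kC add1n cC eqxx (dominantS _ _ d) //.
  exact: subsetU1.
have dB z : z \in s -> door (s :\ z, C) = (i0 \in C) && (c @: (s :\ z) == C :\ i0).
  move=> zs; rewrite /door /= (dominantS _ _ d) ?subD1set //=.
  by have := cardsD1 z s; rewrite zs add1n cC => ->; rewrite eqxx.
case: (boolP (i0 \in C)) => i0C; last first.
  have -> : [set z in s | door (s :\ z, C)] = set0.
    apply/setP => z; rewrite !inE; apply/negP => /andP[zs].
    by rewrite dB // (negbTE i0C).
  rewrite cards0 addn0; case: eqP => [E|nE].
    have -> : [set k | (k \notin C) && door (s, k |: C)] = [set i0].
      apply/setP => k; rewrite !inE; case: (boolP (k \in C)) => kC /=.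
        by apply/esym/negP => /eqP ki; rewrite -ki kC in i0C.
      rewrite dA // !inE (negbTE i0C) orbF eq_sym.
      apply: andb_idr => /eqP ->; rewrite setU1K // E eqxx //.
    by rewrite cards1.
  have -> : [set k | (k \notin C) && door (s, k |: C)] = set0.
    apply/setP => k; rewrite !inE; case: (boolP (k \in C)) => kC //=.
    rewrite dA // !inE (negbTE i0C) orbF; apply/negP => /andP[/eqP <-].
    by rewrite setU1K // => /eqP.
  by rewrite cards0.
set Y := C :\ i0.
have cY : #|s| = #|Y|.+1 by rewrite -cC (cardsD1 i0 C) i0C.
have -> : [set z in s | door (s :\ z, C)] = [set z in s | c @: (s :\ z) == Y].
  by apply/setP => z; rewrite !inE; apply: andb_id2l => zs; rewrite dB // i0C.
have -> : [set k | (k \notin C) && door (s, k |: C)]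
        = [set k | (k \notin C) && (c @: s == k |: Y)].
  apply/setP => k; rewrite !inE; apply: andb_id2l => kC.
  rewrite dA // !inE i0C orbT /=; congr (_ == _).
  by apply/setP => l; rewrite !inE; case: (eqVneq l k) => [->|]//=; rewrite andbT;
     apply/negP => /eqP ki; rewrite ki i0C in kC.
case: (boolP (c @: s == Y)) => [/eqP E|nE].
  rewrite (imset_setD1_card2 E cY).
  have -> : [set k | (k \notin C) && (c @: s == k |: Y)] = set0.
    apply/setP => k; rewrite !inE; apply/negP => /andP[kC]; rewrite E => /eqP/setP/(_ k).
    by rewrite !inE eqxx (negbTE kC) andbF.
  rewrite cards0 /=; apply/esym/negP => /eqP; rewrite E /Y => /setP/(_ i0).
  by rewrite !inE eqxx i0C.
case: (boolP [exists k, (k \notin Y) && (c @: s == k |: Y)]) => [|/existsPn nk].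
  case/existsP=> k /andP[kY /eqP E].
  have inj : {in s &, injective c}.
    by apply/imset_injP; rewrite E cardsU1 kY cY.
  have : k \in c @: s by rewrite E !inE eqxx.
  case/imsetP=> x xs kx.
  have -> : [set z in s | c @: (s :\ z) == Y] = [set x].
    apply/setP => z; rewrite !inE; apply/andP/eqP => [[zs /eqP zY]|->].
      apply/eqP/negP => /negP zx; move: kY; rewrite -zY kx => /negP[].
      by apply: imset_f; rewrite !inE eq_sym zx.
    split=> //; apply/eqP/setP => l; apply/imsetP/idP.
      case=> y /setD1P[yx ys] ->; have : c y \in c @: s by apply: imset_f.
      rewrite E => /setU1P[cy|//]; move: yx; rewrite (inj y x) ?eqxx //.
      by rewrite cy kx.
    move=> lY; have : l \in c @: s by rewrite E !inE; case/setD1P: (lY) => -> ->; rewrite orbT.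
    case/imsetP=> y ys ly; exists y => //; rewrite !inE ys andbT.
    by apply: contraNneq kY => yx; rewrite kx -yx -ly.
  rewrite cards1; case: (eqVneq k i0) => [ki|ki].
    have -> : [set k | (k \notin C) && (c @: s == k |: Y)] = set0.
      apply/setP => l; rewrite !inE; apply/negP => /andP[lC]; rewrite E.
      move=> /eqP/setP/(_ l); rewrite !inE eqxx (negbTE lC) andbF orbF ki => /eqP li.
      by rewrite li i0C in lC.
    by rewrite cards0 E ki /Y setD1K // eqxx.
  have kC : k \notin C by move: kY; rewrite !inE ki.
  have -> : [set k | (k \notin C) && (c @: s == k |: Y)] = [set k].
    apply/setP => l; rewrite !inE; apply/andP/eqP => [[lC]|-> //]; last by rewrite E eqxx.
    rewrite E => /eqP/setP/(_ l); rewrite !inE eqxx (negbTE lC) andbF orbF.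
    by move/eqP.
  rewrite cards1 E; apply/esym/negP => /eqP/setP/(_ k).
  by rewrite !inE eqxx (negbTE kC).
have -> : [set z in s | c @: (s :\ z) == Y] = set0.
  apply/setP => z; rewrite !inE; apply/negP => /andP[zs /eqP zY].
  have E : c @: s = c z |: Y by rewrite -zY -imsetU1 setD1K.
  case: (boolP (c z \in Y)) => czY.
    by move: nE; rewrite E (setUidPr _) ?eqxx // sub1set.
  by have := nk (c z); rewrite czY E eqxx.
have -> : [set k | (k \notin C) && (c @: s == k |: Y)] = set0.
  apply/setP => k; rewrite !inE; apply/negP => /andP[kC h].
  by have := nk k; rewrite h andbT negbK !inE (negbTE kC) andbF.
rewrite !cards0; apply/esym/negP => h.
have := nk i0; rewrite /Y setD1K // h andbT negbK.
by rewrite !inE eqxx.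
Qed.

Lemma sum_card_pairs (A B : finType) (P : pred A) (Q : A -> pred B) :
  \sum_(a | P a) #|[set b | Q a b]| = #|[set u : A * B | P u.1 && Q u.1 u.2]|.
Proof.
under eq_bigr do rewrite -sum1_card.
rewrite -sum1_card pair_big_dep /=; apply: eq_bigl => -[a b].
by rewrite !inE.
Qed.

(** Parity of the incidences between rooms and doors. By rooms it is the parity of the number of
    fully labelled rooms; by doors it is odd, since every door has two rooms except the empty
    one. *)
Theorem scarf : exists (s : {set X}) (C : {set I}), [/\ s != set0, C = c @: s & dominant s C].
Proof.
suff : odd #|[set p | room p & c @: p.1 == p.2]|.
  case: (posnP #|[set p | room p & c @: p.1 == p.2]|) => [-> //|].
  rewrite card_gt0 => /set0Pn[[s C]]; rewrite !inE /= => /andP[/andP[/= d _] /eqP E] _.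
  exists s, C; split => //; apply/negP => /eqP s0.
  have /dominantP/(_ x0)[i] := d; by rewrite -E s0 imset0 inE.
have -> : odd #|[set p | room p & c @: p.1 == p.2]| =
  odd (\sum_(p | room p) (#|[set k | (k \notin p.2) && door (p.1, k |: p.2)]|
       + #|[set z in p.1 | door (p.1 :\ z, p.2)]|)).
  rewrite -sum1_card (big_morph odd oddD (erefl _)).
  rewrite [RHS](big_morph odd oddD (erefl _)).
  rewrite [RHS](bigID (fun p : {set X} * {set I} => c @: p.1 == p.2)) /=.
  rewrite [X in _ = X (+) _](eq_bigr (fun=> true)); last first.
    by move=> p /andP[rp E]; rewrite room_doors.
  rewrite [X in _ = _ (+) X]big1 ?addbF; last first.
    by move=> p /andP[rp /negbTE E]; rewrite room_doors.
  by apply: eq_bigl => p; rewrite inE.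
(* Incidences counted from the doors: an index added to a room is one dropped from the door, a point
   removed from a room is one added to the door. *)
have -> : \sum_(p | room p) (#|[set k | (k \notin p.2) && door (p.1, k |: p.2)]|
       + #|[set z in p.1 | door (p.1 :\ z, p.2)]|) =
   \sum_(p | door p) (#|[set k in p.2 | dominant p.1 (p.2 :\ k)]|
       + #|[set z | (z \notin p.1) && dominant (z |: p.1) p.2]|).
  rewrite !big_split /= !sum_card_pairs; congr (_ + _).
    pose f (u : {set X} * {set I} * I) := ((u.1.1, u.2 |: u.1.2), u.2).
    rewrite -(card_in_imset (f := f)); last first.
      move=> [[s C] k] [[s' C'] k']; rewrite !inE /= => /and3P[_ kC _] /and3P[_ kC' _].
      rewrite /f /= => -[-> E kk]; rewrite kk in kC E *; congr (_, _, _).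
      by rewrite -(setU1K kC) E setU1K.
    apply: eq_card => -[[s C] k]; apply/imsetP/idP.
      case=> -[[s' C'] k']; rewrite !inE /= => /and3P[/andP[/= r _] kC d] [-> -> ->].
      by rewrite d !inE eqxx setU1K // r.
    rewrite !inE /= => /and3P[d kC r]; exists ((s, C :\ k), k).
      rewrite !inE /= eqxx /= setD1K // d andbT /room /= r /=.
      case/and4P: d => _ /= /eqP cC _ _; have := cardsD1 k C.
      by rewrite kC cC add1n => -[->].
    by rewrite /f /= setD1K.
  pose f (u : {set X} * {set I} * X) := ((u.1.1 :\ u.2, u.1.2), u.2).
  rewrite -(card_in_imset (f := f)); last first.
    move=> [[s C] k] [[s' C'] k']; rewrite !inE /= => /and3P[_ kC _] /and3P[_ kC' _].
    rewrite /f /= => -[E -> kk]; rewrite kk in kC E *; congr (_, _, _).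
    by rewrite -(setD1K kC) E setD1K.
  apply: eq_card => -[[s C] k]; apply/imsetP/idP.
    case=> -[[s' C'] k']; rewrite !inE /= => /and3P[/andP[/= r _] kC d] [-> -> ->].
    by rewrite d !inE eqxx setD1K // r.
  rewrite !inE /= => /and3P[d kC r]; exists ((k |: s, C), k).
    rewrite !inE /= eqxx /= setU1K // d andbT /room /= r /= cardsU1 kC.
    by case/and4P: d => _ /= /eqP ->.
  by rewrite /f /= setU1K.
rewrite (bigD1 (set0, [set i0])) /=; last first.
  rewrite /door /= cards0 cards1 !inE eqxx imset0 setDv !eqxx /= ?andbT.
  apply/dominantP => x; exists i0; rewrite ?inE // => y; by rewrite inE.
rewrite door_rooms0 oddD /= (big_morph odd oddD (erefl _)) big1 //.
move=> [s C] /andP[/and4P[/= d /eqP cC i0C /eqP E] ne].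
have /set0Pn[x xs] : s != set0.
  apply: contraNneq ne => s0; rewrite s0 in cC *; rewrite xpair_eqE eqxx /=.
  rewrite cards0 in cC; have /cards1P[j Cj] : #|C| == 1 by rewrite cC.
  by move: i0C; rewrite Cj !inE => /eqP ->.
by rewrite (door_rooms xs).
Qed.

End Scarf.

From mathcomp Require Import all_order all_algebra.
From mathcomp Require Import all_classical all_reals all_analysis.
From mathcomp Require Import measurable_realfun.
From mathcomp Require Import ring lra zify.
Require Import Defs.
Import Order.TTheory GRing.Theory Num.Theory.
Import numFieldNormedType.Exports.
Local Open Scope classical_set_scope.
Local Open Scope ring_scope.

(** * Convergent subsequences of real sequences *)

Section Sequences.
Variable R : realType.

Lemma ultra_bounded_cvg (U : set_system nat) (u : nat -> R) (M : R) :
  UltraFilter U -> (forall n, `|u n| <= M) -> exists l : R, u @ U --> l.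
Proof.
move=> UU uM.
have PU : ProperFilter (u @ U) by apply: fmap_proper_filter.
have UM : (u @ U) [set` `[- M, M]].
  by apply: (@filterS nat U _ setT) => [n _ /=|]; [rewrite in_itv /= -ler_norml | exact: filterT].
have [l [_ cl]] := @segment_compact R (- M) M (u @ U) PU UM.
exists l => A Al /=.
have [//|UA] := in_ultra_setVsetC (u @^-1` A) UU.
by have [x [/=]] := cl (~` A) A UA Al.
Qed.

(** One ultrafilter finer than the tail filter gives the limits [l j] for all [j] simultaneously.
    Each [phi k] is then picked beyond the previous one with the coordinates [0, ..., k] within
    1/(k+1) of their limits, so no nested extraction occurs. *)
Lemma diag_subseq (a : nat -> nat -> R) (M : nat -> R) :
  (forall n j, `|a n j| <= M j) ->
  exists phi : nat -> nat, exists l : nat -> R,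
    (forall k, (phi k < phi k.+1)%N) /\
    forall j, (fun k => a (phi k) j) @ \oo --> l j.
Proof.
move=> aM; have [U [UU ooU]] := ultraFilterLemma (@eventually_filter).
have /choice[l al] : forall j, exists l : R, (fun n => a n j) @ U --> l.
  by move=> j; apply: ultra_bounded_cvg => n; exact: aM.
have pick k N : exists n, (N < n)%N /\ forall j, (j <= k)%N -> `|a n j - l j| < k.+1%:R^-1.
  have UN : U [set n | (N < n)%N] by apply: ooU; exists N.+1.
  have Uj j : U [set n | `|a n j - l j| < k.+1%:R^-1].
    have /cvgrPdist_lt/(_ k.+1%:R^-1) := al j.
    rewrite invr_gt0 ltr0n => /(_ isT); apply: filterS => n /=.
    by rewrite distrC.
  have : U [set n | forall j, (j <= k)%N -> `|a n j - l j| < k.+1%:R^-1].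
    elim: {-2}k => [|i IH].
      by apply: filterS (Uj 0%N) => n h j; rewrite leqn0 => /eqP ->.
    apply: filterS2 IH (Uj i.+1) => n h1 h2 j; rewrite leq_eqVlt => /orP[/eqP -> //|].
    exact: h1.
  move=> Uk; have [n [h1 h2]] := @filter_ex _ U _ _ (filterI UN Uk); by exists n.
have /choice[f fP] : forall kN : nat * nat, exists n, (kN.2 < n)%N /\
    forall j, (j <= kN.1)%N -> `|a n j - l j| < kN.1.+1%:R^-1.
  by move=> [k N]; exact: pick.
pose phi := fix phi k := if k is k'.+1 then f (k, phi k') else f (0%N, 0%N).
exists phi, l; split; first by move=> k /=; case: (fP (k.+1, phi k)).
move=> j; apply/cvgrPdist_lt => e e0.
have [N _ hN] : \forall k \near \oo, (k.+1%:R^-1 : R) < e.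
  by near=> k; rewrite invf_plt ?posrE// -natr1; apply: ltr_pwDr => //; near: k; exact: nbhs_infty_ger.
exists (maxn N j) => // k /=; rewrite geq_max => /andP[Nk jk].
apply: lt_trans (hN _ Nk); rewrite distrC.
case: k jk {Nk} => [|k] jk; first by case: (fP (0%N, 0%N)) => _; apply.
by case: (fP (k.+1, phi k)) => _; apply.
Unshelve. all: by end_near. Qed.

Lemma subseq_ge (phi : nat -> nat) : (forall k, (phi k < phi k.+1)%N) ->
  forall k, (k <= phi k)%N.
Proof. by move=> h; elim=> // k IH; apply: leq_ltn_trans (h k). Qed.

Lemma cvg_subseq (T : topologicalType) (u : nat -> T) (l : T) (phi : nat -> nat) :
  (forall k, (phi k < phi k.+1)%N) -> u @ \oo --> l -> (u \o phi) @ \oo --> l.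
Proof.
move=> h ul A /ul [N _ hN]; exists N => // k /= Nk; apply: hN => /=.
exact: leq_trans Nk (subseq_ge h k).
Qed.

Lemma cvgn_ge (u : nat -> R) (l a : R) :
  u @ \oo --> l -> (forall n, a <= u n) -> a <= l.
Proof.
move=> ul h; rewrite -(cvg_lim _ ul) //; apply: limr_ge; last by near=> n; exact: h.
by apply/cvg_ex; exists l.
Unshelve. all: by end_near. Qed.

Lemma cvgn_le (u : nat -> R) (l a : R) :
  u @ \oo --> l -> (forall n, u n <= a) -> l <= a.
Proof.
move=> ul h; rewrite -(cvg_lim _ ul) //; apply: limr_le; last by near=> n; exact: h.
by apply/cvg_ex; exists l.
Unshelve. all: by end_near. Qed.

End Sequences.

(** * Ky Fan's inequality *)

Section KyFan.
Variables (R : realType) (n : nat).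

Definition simplex (p : 'I_n.+1 -> R) : Prop :=
  (forall i, 0 <= p i) /\ \sum_i p i = 1.

Variable G : 'I_n.+1 -> ('I_n.+1 -> R) -> R.

(* Grid points are labelled by an index minimizing [G]; Scarf's lemma yields grid points [q i] close to
   each other, the label of [q i] being [i] unless [p i] is of the order of the mesh. *)
Lemma approx_labels (N : nat) : (0 < N)%N ->
  exists (p : 'I_n.+1 -> R) (q : 'I_n.+1 -> 'I_n.+1 -> R),
  [/\ simplex p, forall i, simplex (q i),
      forall i k, `|q i k - p k| <= n.+1%:R / N%:R &
      forall i j, p i * (G i (q i) - G j (q i))
        <= n.+1%:R / N%:R * `|G i (q i) - G j (q i)|].
Proof.
move=> N0.
pose X := {x : {ffun 'I_n.+1 -> 'I_N.+1} | (\sum_i x i == N)%N}.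
pose x0f : {ffun 'I_n.+1 -> 'I_N.+1} := [ffun i => if i == ord0 then ord_max else ord0].
have x0P : (\sum_i x0f i == N)%N.
  rewrite (bigD1 ord0) //= ffunE eqxx big1 ?addn0 //= => i /negbTE i0.
  by rewrite ffunE i0.
pose x0 : X := exist _ x0f x0P.
(* Ties in coordinate [i] are broken by the enumeration of [X], because Scarf's lemma needs
   antisymmetric orders. *)
pose le (i : 'I_n.+1) (x y : X) := (sval x i < sval y i)%N ||
  ((sval x i == sval y i) && (enum_rank x <= enum_rank y)%N).
have leX_total i : total (le i).
  move=> x y; rewrite /le; case: (ltngtP (sval x i) (sval y i)) => [h|h|/val_inj ->] /=.
  - by [].
  - by rewrite orbT.
  - by rewrite eqxx /= leq_total.
have leX_anti i : antisymmetric (le i).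
  move=> x y; rewrite /le; case: (ltngtP (sval x i) (sval y i)) => [h|h|/val_inj ->] /=.
  - by rewrite (_ : (sval y i == sval x i) = false) //; apply/negP => /eqP E; rewrite E ltnn in h.
  - by rewrite (_ : (sval x i == sval y i) = false) //; apply/negP => /eqP E; rewrite E ltnn in h.
  - by rewrite !eqxx /= -eqn_leq => /eqP/val_inj/enum_rank_inj.
have leX_trans i : transitive (le i).
  move=> y x z; rewrite /le => /orP[h1|/andP[/eqP -> h1]] /orP[h2|/andP[/eqP <- h2]].
  - by rewrite (ltn_trans h1 h2).
  - by rewrite h1.
  - by rewrite h2.
  - by rewrite eqxx (leq_trans h1 h2) orbT.
have leW i x y : le i x y -> (sval x i <= sval y i)%N.
  by rewrite /le => /orP[/ltnW|/andP[/eqP -> _]].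
pose pt (x : X) : 'I_n.+1 -> R := fun i => (sval x i)%:R / N%:R.
have ptS x : simplex (pt x).
  split=> [i|]; first by rewrite divr_ge0.
  by rewrite -mulr_suml -natr_sum (eqP (svalP x)) divff // pnatr_eq0 -lt0n.
pose c (x : X) : 'I_n.+1 := [arg min_(i < ord0) G i (pt x)]%O.
have cP x j : G (c x) (pt x) <= G j (pt x).
  by rewrite /c; case: arg_minP => // i _; apply.
have [s [C [s0 EC /dominantP dom]]] := scarf c ord0 x0 leX_total leX_anti leX_trans.
case/set0Pn: s0 => x1 x1s.
pose m (i : 'I_n.+1) : nat := sval (least le x0 s i) i.
have ms i x : x \in s -> (m i <= sval x i)%N.
  move=> xs; apply: leW.
  by have [_] := leastP x0 leX_total leX_trans i xs; apply.
have C0 : C != finset.set0.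
  by apply/set0Pn; exists (c x1); rewrite EC imset_f.
(* Otherwise the integers [m i + 1], completed by the remainder [r] at one index [i1], form a grid
   point above the minimum of [s] in all orders of [C], against dominance. *)
have sumC : (N < \sum_(i in C) (m i).+1)%N.
  rewrite ltnNge; apply/negP => h.
  case/set0Pn: C0 => i1 i1C.
  have mle i : i \in C -> ((m i).+1 <= N)%N.
    by move=> iC; apply: leq_trans h; rewrite (bigD1 i) //= leq_addr.
  pose r := (N - \sum_(i in C) (m i).+1)%N.
  pose w i := (if i \in C then (m i).+1 + (if i == i1 then r else 0) else 0)%N.
  have ws : (\sum_i w i = N)%N.
    rewrite /w -big_mkcond /= big_split /= -big_mkcondr /= [X in (_ + X)%N](big_pred1 i1) => [|i].
      by rewrite /r subnKC.
    by rewrite /=; case: eqP => [->|]; rewrite ?i1C ?andbF.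
  have wN i : (w i < N.+1)%N by rewrite ltnS -ws (bigD1 i) //= leq_addr.
  pose xf : {ffun 'I_n.+1 -> 'I_N.+1} := [ffun i => Ordinal (wN i)].
  have xP : (\sum_i xf i == N)%N.
    by rewrite -[X in _ == X]ws; apply/eqP; apply: eq_bigr => i _; rewrite ffunE.
  have [i iC hi] := dom (exist _ xf xP).
  have [ls _] := leastP x0 leX_total leX_trans i x1s.
  have := leW _ _ _ (hi _ ls); rewrite /= ffunE /= /w iC -/(m i).
  by rewrite addSn ltnNge leq_addr.
have sumx (x : X) : (\sum_i sval x i = N)%N by exact/eqP/(svalP x).
(* Over [C] the coordinates sum to at most [N], which is below the sum of the [m j + 1], and none is
   below [m j]; so no single excess passes [n + 1]. *)
have near_C i x : x \in s -> i \in C -> (sval x i <= m i + n.+1)%N.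
  move=> xs iC; have h : (\sum_(j in C) sval x j <= N)%N.
    by rewrite -[X in (_ <= X)%N](sumx x) [X in (_ <= X)%N](bigID (mem C)) /= leq_addr.
  have := leq_ltn_trans h sumC; rewrite (bigD1 i) //= [X in (_ < X)%N](bigD1 i) //= => h1.
  have h2 : (\sum_(j in C | j != i) (m j).+1 <= \sum_(j in C | j != i) sval x j + n)%N.
    have -> : (\sum_(j in C | j != i) (m j).+1 = \sum_(j in C | j != i) m j + \sum_(j in C | j != i) 1)%N.
      by rewrite -big_split /=; apply: eq_bigr => j _; rewrite addn1.
    apply: leq_add; first by apply: leq_sum => j _; exact: ms.
    rewrite sum1_card; apply: (@leq_trans #|[pred j | j != i]|).
      by apply/subset_leq_card/fintype.subsetP => j; rewrite !inE => /andP[].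
    by have := cardC1 i; rewrite card_ord /= => E; rewrite -[X in (_ <= X)%N]E; apply: eq_leq; apply: eq_card => j; rewrite !inE.
  move: h1; rewrite addSn ltnS => h1.
  rewrite -(leq_add2r (\sum_(j in C | j != i) sval x j)); apply: leq_trans h1 _.
  by rewrite -addnA leq_add2l; apply: leq_trans h2 _; rewrite addnC leq_add2r.
have near_nC i x : x \in s -> i \notin C -> (sval x i <= n.+1)%N.
  move=> xs iC; have : (sval x i + \sum_(j in C) sval x j <= N)%N.
    rewrite -[X in (_ <= X)%N](sumx x) [X in (_ <= X)%N](bigID (mem C)) /= addnC leq_add2l.
    by rewrite (bigD1 i) //= leq_addr.
  have h2 : (\sum_(j in C) (m j).+1 <= \sum_(j in C) sval x j + n.+1)%N.
    have -> : (\sum_(j in C) (m j).+1 = \sum_(j in C) m j + \sum_(j in C) 1)%N.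
      by rewrite -big_split /=; apply: eq_bigr => j _; rewrite addn1.
    apply: leq_add; first by apply: leq_sum => j _; exact: ms.
    by rewrite sum1_card (leq_trans (max_card _)) // card_ord.
  move=> h1; have := leq_ltn_trans h1 (leq_trans sumC h2).
  by rewrite addnC ltn_add2l => /ltnW.
have near_s i x y : x \in s -> y \in s -> `|pt x i - pt y i| <= n.+1%:R / N%:R.
  move=> xs ys; rewrite /pt -mulrBl normrM [X in _ * X]gtr0_norm ?invr_gt0 ?ltr0n //.
  rewrite ler_pM2r ?invr_gt0 ?ltr0n // ler_norml lerBlDr -natrD ler_nat.
  rewrite lerNl opprB lerBlDr -natrD ler_nat.
  have := ms i x xs; have := ms i y ys.
  case: (boolP (i \in C)) => iC.
    by have := near_C i x xs iC; have := near_C i y ys iC; move: (nat_of_ord (sval x i)) (nat_of_ord (sval y i)) (m i) => a b d; lia.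
  by have := near_nC i x xs iC; have := near_nC i y ys iC; move: (nat_of_ord (sval x i)) (nat_of_ord (sval y i)) (m i) => a b d; lia.
(* For an index outside [C] any point of [s] will do: there the coordinates are at most [n + 1],
   which the right-hand side of the claim absorbs. *)
have /choice[qx qxP] : forall i, exists x, x \in s /\ (i \in C -> c x = i).
  move=> i; case: (boolP (i \in C)) => iC; last by exists x1.
  by move: (iC); rewrite EC => /imsetP[x xs ->]; exists x.
exists (pt x1), (fun i => pt (qx i)); split => // [i k|i j].
  by apply: near_s => //; case: (qxP i).
case: (boolP (i \in C)) => iC.
  have [_ /(_ iC) qi] := qxP i.
  apply: (@le_trans _ _ 0).
    rewrite mulr_ge0_le0 //; first by case: (ptS x1).
    by rewrite subr_le0 -{1}qi.
  by rewrite mulr_ge0 // divr_ge0.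
apply: (@le_trans _ _ (pt x1 i * `|G i (pt (qx i)) - G j (pt (qx i))|)).
  by apply: ler_wpM2l; [case: (ptS x1) | exact: ler_norm].
apply: ler_wpM2r => //; rewrite /pt ler_pM2r ?invr_gt0 ?ltr0n // ler_nat.
exact: near_nC.
Qed.

Hypothesis Gcont : forall j (p_ : nat -> 'I_n.+1 -> R) p,
  (forall k, simplex (p_ k)) -> simplex p ->
  (forall i, (fun k => p_ k i) @ \oo --> p i) ->
  (fun k => G j (p_ k)) @ \oo --> G j p.

(** As the mesh tends to 0, [p i * (G i p - G j p)] becomes nonpositive for all [i] and [j]: an
    index of positive weight minimizes. Summing over [i] gives the claim. *)
Theorem ky_fan :
  exists p, simplex p /\ forall j, \sum_i p i * G i p <= G j p.
Proof.
have /choice[P_ hP_] : forall N, exists p, exists (q : 'I_n.+1 -> 'I_n.+1 -> R),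
  [/\ simplex p, forall i, simplex (q i),
      forall i k, `|q i k - p k| <= n.+1%:R / N.+1%:R &
      forall i j, p i * (G i (q i) - G j (q i))
        <= n.+1%:R / N.+1%:R * `|G i (q i) - G j (q i)|].
  by move=> N; apply: approx_labels.
have [q_ H] := choice hP_.
have Pb N j : `|P_ N (inord j)| <= 1.
  have [[p0 p1] _ _ _] := H N; rewrite ger0_norm // -p1 (bigD1 (inord j)) //=.
  by rewrite lerDl sumr_ge0.
have [phi [l [phiI lP]]] := diag_subseq Pb.
pose p (i : 'I_n.+1) := l i.
have Pl i : (fun k => P_ (phi k) i) @ \oo --> p i.
  by have := lP i; rewrite inord_val.
have pS : simplex p.
  split=> [i|].
    by apply: (cvgn_ge (Pl i)) => k; have [[+ _] _ _ _] := H (phi k); apply.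
  have : (fun k => \sum_i P_ (phi k) i) @ \oo --> \sum_i p i.
    by apply: cvg_big => [|i _]; [exact: add_continuous | exact: Pl].
  move/cvg_lim => <- //; apply: lim_near_cst => //.
  by near=> k; have [[_ ->] _ _ _] := H (phi k).
have eps0 : (fun k => n.+1%:R / (phi k).+1%:R : R) @ \oo --> 0.
  rewrite -[X in _ --> X](mulr0 n.+1%:R); apply: cvgMr.
  apply: (@cvg_subseq R (fun k => k.+1%:R^-1) 0 phi phiI).
  exact: cvg_harmonic.
have Ql i k : (fun N => q_ (phi N) i k) @ \oo --> p k.
  have -> : (fun N => q_ (phi N) i k)
    = (fun N => P_ (phi N) k) \+ (fun N => q_ (phi N) i k - P_ (phi N) k).
    by apply/funext => N /=; rewrite addrC subrK.
  rewrite -[X in _ --> X]addr0; apply: cvgD; first exact: Pl.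
  apply/norm_cvg0P; apply: squeeze_cvgr (@cvg_cst _ 0 _ \oo _) eps0.
  by near=> N; rewrite normr_ge0 /=; have [_ _ -> _] := H (phi N).
have QG i j : (fun N => G j (q_ (phi N) i)) @ \oo --> G j p.
  apply: Gcont => //.
  by move=> N; have [_ + _ _] := H (phi N); apply.
have key i j : p i * (G i p - G j p) <= 0.
  have L : (fun N => P_ (phi N) i * (G i (q_ (phi N) i) - G j (q_ (phi N) i))
    - n.+1%:R / (phi N).+1%:R * `|G i (q_ (phi N) i) - G j (q_ (phi N) i)|) @ \oo
    --> p i * (G i p - G j p) - 0 * `|G i p - G j p|.
    apply: cvgB; apply: cvgM => //; first exact: cvgB.
    by apply: cvg_norm; exact: cvgB.
  rewrite mul0r subr0 in L.
  by apply: (cvgn_le L) => N; rewrite subr_le0; have [_ _ _ ->] := H (phi N).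
exists p; split => // j; have [_ p1] := pS.
rewrite -subr_le0 -[X in _ - X]mul1r -p1 mulr_suml -sumrB.
by apply: sumr_le0 => i _; rewrite -mulrBr.
Unshelve. all: by end_near. Qed.

End KyFan.

(** * A covering inequality for cubes, by counting grid points *)

Section CubeCover.
Variable R : realType.

Lemma count_grid (N : nat) (J : pred 'I_N) (D : R) : 0 <= D ->
  (forall i j, J i -> J j -> (j%:R : R) <= i%:R + D) ->
  \sum_(j < N) (J j)%:R <= D + 1.
Proof.
move=> D0 JD; rewrite -natr_sum.
have -> : (\sum_(j < N) J j = #|J|)%N.
  by rewrite -sum1_card [RHS]big_mkcond /=; apply: eq_bigr => j _; rewrite unfold_in; case: (J j).
case: (pickP J) => [j0 Jj0|J0]; last by rewrite eq_card0 // addr_ge0.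
case: (@arg_minnP _ j0 J (fun j => nat_of_ord j) Jj0) => a Ja amin.
case: (@arg_maxnP _ j0 J (fun j => nat_of_ord j) Jj0) => b Jb bmax.
have ab : (a <= b)%N by exact: amin.
have cJ : (#|J| <= (b - a).+1)%N.
  rewrite -(size_iota a (b - a).+1) cardE -(size_map (@nat_of_ord N)).
  apply: uniq_leq_size; first by rewrite map_inj_uniq ?enum_uniq //; exact: val_inj.
  move=> x /mapP[j]; rewrite mem_enum => Jj ->; rewrite mem_iota.
  rewrite amin //= addnS ltnS subnKC //; exact: bmax.
apply: (@le_trans _ _ ((b - a).+1)%:R); first by rewrite ler_nat.
by rewrite -natr1 lerD2r natrB // lerBlDl JD.
Qed.

(** Grid points replace volume: the big cube holds [N ^ m] of them, and a cube of side [l] at most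
    [(l / d + 1) ^ m], where [d] is the step. Letting [N] grow gives the volume inequality without
    measure theory. *)
Lemma cube_cover_grid (m N : nat) (T : Type) (K : seq T) (lo : T -> 'I_m -> R)
  (l : T -> R) (s : R) : 0 < s -> (0 < N)%N -> (forall k, 0 <= l k) ->
  (forall p : 'I_m -> R, (forall i, `|p i| <= s) ->
    has (fun k => [forall i, lo k i <= p i <= lo k i + l k]) K) ->
  (2 * s) ^+ m <= \sum_(k <- K) (l k + 2 * s / N%:R) ^+ m.
Proof.
move=> s0 N0 l0 cov.
have N0' : 0 < N%:R :> R by rewrite ltr0n.
pose d := 2 * s / N%:R; have d0 : 0 < d by rewrite divr_gt0 // mulr_gt0.
pose pt (x : 'I_N) : R := - s + d * x%:R.
have pts x : `|pt x| <= s.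
  rewrite ler_norml /pt; apply/andP; split; first by rewrite lerDl mulr_ge0 // ltW.
  suff : d * x%:R <= 2 * s by lra.
  rewrite /d mulrAC ler_pdivrMr // ler_wpM2l //; first by rewrite mulr_ge0 // ltW.
  by rewrite ler_nat ltnW.
pose J k i (x : 'I_N) := lo k i <= pt x <= lo k i + l k.
have H : (N%:R ^+ m : R) <= \sum_(k <- K) (l k / d + 1) ^+ m.
  have -> : N%:R ^+ m = \sum_(f : {ffun 'I_m -> 'I_N}) 1 :> R.
    by rewrite sumr_const card_ffun !card_ord natrX.
  apply: (@le_trans _ _ (\sum_(f : {ffun 'I_m -> 'I_N}) \sum_(k <- K)
    \prod_(i < m) (J k i (f i))%:R)).
    apply: ler_sum => f _.
    have := cov (fun i => pt (f i)) (fun i => pts (f i)).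
    elim: K {cov} => [//|k K IH] /= /orP[/forallP h|/IH h]; rewrite big_cons.
      rewrite big1 => [|i _]; last by rewrite /J h.
      by rewrite lerDl sumr_ge0 // => k' _; rewrite prodr_ge0.
    by apply: le_trans h _; rewrite lerDr prodr_ge0.
  rewrite exchange_big /=; apply: ler_sum => k _.
  rewrite -(bigA_distr_bigA (fun i x => (J k i x)%:R)) /=.
  rewrite -[X in _ <= _ ^+ X](card_ord m) -prodr_const.
  apply: ler_prod => i _; apply/andP; split; first by apply: sumr_ge0.
  apply: count_grid; first by rewrite divr_ge0 // ltW.
  move=> x y /andP[h1 h2] /andP[h3 h4].
  rewrite -(ler_pM2l d0) mulrDr mulrCA divff ?gt_eqF // mulr1.
  by move: h1 h4; rewrite /pt; lra.
have -> : (2 * s) ^+ m = N%:R ^+ m * d ^+ m.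
  by rewrite -exprMn /d mulrCA divff ?mulr1 // gt_eqF.
apply: (@le_trans _ _ ((\sum_(k <- K) (l k / d + 1) ^+ m) * d ^+ m)).
  by rewrite ler_wpM2r // exprn_ge0 // ltW.
rewrite mulr_suml; apply: ler_sum => k _; rewrite -exprMn mulrDl mul1r.
by rewrite divfK // gt_eqF.
Qed.

Lemma cube_cover (m : nat) (T : Type) (K : seq T) (lo : T -> 'I_m -> R)
  (l : T -> R) (s : R) : 0 < s -> (forall k, 0 <= l k) ->
  (forall p : 'I_m -> R, (forall i, `|p i| <= s) ->
    has (fun k => [forall i, lo k i <= p i <= lo k i + l k]) K) ->
  (2 * s) ^+ m <= \sum_(k <- K) l k ^+ m.
Proof.
move=> s0 l0 cov.
have h N := cube_cover_grid s0 (ltn0Sn N) l0 cov.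
apply: (cvgn_ge _ h).
apply: cvg_big => [|k _]; first exact: add_continuous.
apply: (@continuous_cvg _ _ _ _ _ _ (fun x : R => x ^+ m)); first exact: exprn_continuous.
rewrite -[X in _ --> X]addr0; apply: cvgD; first exact: cvg_cst.
rewrite -[X in _ --> X](mulr0 (2 * s)); apply: cvgMr.
exact: cvg_harmonic.
Qed.

End CubeCover.

(** * Lattice Pucci equation *)

Section Lattice.
Variables (m : nat).
Implicit Types k v : 'rV[int]_m.

Definition inbox (P : nat) k : bool := [forall i, (`|k 0%R i| <= P)%N].

Definition zbox (P : nat) : seq 'rV[int]_m :=
  [seq \row_i ((f i)%:Z - P%:Z) | f : {ffun 'I_m -> 'I_(2 * P).+1}].

Lemma inboxP P k : reflect (forall i, (`|k 0%R i| <= P)%N) (inbox P k).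
Proof. exact: forallP. Qed.

Lemma mem_zbox P k : (k \in zbox P) = inbox P k.
Proof.
apply/fintype.imageP/inboxP => [[f _ ->] i|h].
  by rewrite mxE; have := ltn_ord (f i); move: (nat_of_ord (f i)) => a; lia.
have lt i : (absz (k 0 i + P%:Z)%R < (2 * P).+1)%N by have := h i; move: (k 0 i) => a; lia.
exists [ffun i => Ordinal (lt i)] => //; apply/rowP => i; rewrite mxE ffunE /=.
by have := h i; move: (k 0 i) => a; lia.
Qed.

Lemma zbox_uniq P : uniq (zbox P).
Proof.
rewrite map_inj_uniq ?enum_uniq // => f g /rowP fg; apply/ffunP => i.
by have := fg i; rewrite !mxE => /addIr[] /val_inj.
Qed.

Lemma inboxD P Q k v : inbox P k -> inbox Q v -> inbox (P + Q) (k + v).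
Proof.
by move=> /inboxP hk /inboxP hv; apply/inboxP => i; rewrite mxE; have := hk i; have := hv i; move: (k 0 i) (v 0 i) => a b; lia.
Qed.

Lemma inboxN Q v : inbox Q (- v) = inbox Q v.
Proof. by apply: eq_forallb => i; rewrite mxE abszN. Qed.

Lemma inboxW P Q k : (P <= Q)%N -> inbox P k -> inbox Q k.
Proof. by move=> PQ /inboxP h; apply/inboxP => i; apply: leq_trans PQ. Qed.

Lemma inbox_delta i Q : (0 < Q)%N -> inbox Q (delta_mx 0 i).
Proof. by move=> Q0; apply/inboxP => j; rewrite mxE; case: (_ && _). Qed.

Variable R : realType.

Definition ddiff (u : 'rV[int]_m -> R) v k : R := u (k + v) + u (k - v) - 2 * u k.

Variables (a0 am : R) (P Q : nat) (f : 'rV[int]_m -> R) (M : R).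
Hypotheses (a0_gt0 : 0 < a0) (am_ge0 : 0 <= am) (Q_gt0 : (0 < Q)%N) (m_gt0 : (0 < m)%N).
Hypotheses (f_ge0 : forall k, 0 <= f k) (f_le : forall k, f k <= M).

(** The centre value [c] is an argument of its own: the operator is nondecreasing in the off-centre
    values of [u] and Lipschitz in [c], and Perron's method uses the two facts separately. *)
Let opc (c : R) (u : 'rV[int]_m -> R) k : R :=
  a0 * (\sum_i (u (k + delta_mx 0 i) + u (k - delta_mx 0 i) - 2 * c))
  + am * (\sum_(v <- zbox Q | v != 0) Num.max 0 (u (k + v) + u (k - v) - 2 * c)).

Let super (u : 'rV[int]_m -> R) :=
  (forall k, 0 <= u k) /\ (forall k, inbox P k -> opc (u k) u k <= - f k).

Let opc_mono c u u' k : (forall k', k' != k -> u k' <= u' k') ->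
  opc c u k <= opc c u' k.
Proof.
move=> uu'.
have ne (v : 'rV[int]_m) : v != 0 -> (k + v != k) && (k - v != k).
  by move=> v0; rewrite -subr_eq0 addrC addKr v0 -subr_eq0 addrC addKr oppr_eq0 v0.
rewrite /opc lerD //.
  apply: ler_wpM2l; first exact: ltW.
  apply: ler_sum => i _; have /andP[h1 h2] : (k + delta_mx 0 i != k) && (k - delta_mx 0 i != k).
    by apply: ne; apply/eqP => /rowP/(_ i); rewrite !mxE !eqxx.
  by have := uu' _ h1; have := uu' _ h2; lra.
apply: ler_wpM2l => //; apply: ler_sum => v v0.
have /andP[h1 h2] := ne _ v0.
rewrite ge_max le_max lexx /= le_max; apply/orP; right.
by have := uu' _ h1; have := uu' _ h2; lra.
Qed.

Let L : R := a0 * (2 * m%:R) + am * (2 * (size (zbox Q))%:R).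

Let opc_lip c d u k : 0 <= d -> opc (c - d) u k <= opc c u k + L * d.
Proof.
move=> d0; rewrite /opc /L [X in _ <= _ + X]mulrDl addrACA lerD //.
  rewrite -mulrA -mulrDr ler_pM2l //.
  rewrite (eq_bigr (fun i => (u (k + delta_mx 0 i) + u (k - delta_mx 0 i) - 2 * c) + 2 * d)); last first.
    by move=> i _; ring.
  rewrite big_split /= lerD2l sumr_const card_ord -mulr_natr; lra.
rewrite -mulrA -mulrDr ler_wpM2l //.
have -> : 2 * (size (zbox Q))%:R * d = \sum_(v <- zbox Q) 2 * d.
  by rewrite big_const_seq count_predT iter_addr_0 -mulr_natr; ring.
rewrite -lerBlDl.
apply: (@le_trans _ _ (\sum_(v <- zbox Q | v != 0) 2 * d)).
  rewrite -sumrB; apply: ler_sum => v _.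
  set x := u _ + u _; rewrite lerBlDr ge_max; apply/andP; split.
    by apply: addr_ge0; [lra | rewrite le_max lexx].
  have : x - 2 * c <= Num.max 0 (x - 2 * c) by rewrite le_max lexx orbT.
  lra.
rewrite [leRHS](bigID (fun v => v != 0)) /= lerDl sumr_ge0 // => v _; lra.
Qed.

(** Perron's principle. At [k] take a supersolution [w] almost equal to the infimum there: replacing
    its neighbours by smaller values lowers the operator, and moving the centre from [w k] to [u k]
    costs at most [L] times their difference. *)
Let super_inf (W : set ('rV[int]_m -> R)) u :
  (forall w, W w -> super w) -> (forall w k, W w -> u k <= w k) ->
  (forall k e, 0 < e -> exists2 w, W w & w k < u k + e) -> (forall k, 0 <= u k) -> super u.
Proof.
move=> Ws ule uinf u0; split => // k kP.
have L0 : 0 <= L.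
  by rewrite /L addr_ge0 // mulr_ge0 ?mulr_ge0 //; exact: ltW.
apply/ler_addgt0Pl => e e0.
have [w Ww wk] := uinf k (e / (L + 1)) (divr_gt0 e0 (ltr_wpDl L0 ltr01)).
have [_ /(_ k kP) h] := Ws _ Ww.
have d0 : 0 <= w k - u k by rewrite subr_ge0; exact: ule.
have := opc_lip (w k) u k d0; rewrite opprB addrC subrK => h1.
apply: (le_trans h1).
have h2 : opc (w k) u k <= opc (w k) w k by apply: opc_mono => k' _; exact: ule.
have h3 : L * (w k - u k) <= e.
  apply: (@le_trans _ _ (L * (e / (L + 1)))); first by rewrite ler_wpM2l //; lra.
  rewrite mulrCA ger_pMr // ler_pdivrMr; lra.
lra.
Qed.

Let barrier : exists u, super u.
Proof.
have M0 : 0 <= M by exact: le_trans (f_ge0 0) (f_le 0).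
pose q (k : 'rV[int]_m) : R := \sum_i ((k 0 i)%:~R) ^+ 2.
(* The concave paraboloid has second difference [- 2 b] along each axis, and [a0 * m * 2 b = M]. The
   constant [c] keeps it nonnegative on the box [P + Q], so the truncation at zero is not felt by
   second differences taken from the box [P]. *)
pose b := M / (2 * a0 * m%:R).
have m0 : 0 < m%:R :> R by rewrite ltr0n.
have b0 : 0 <= b by rewrite divr_ge0 // !mulr_ge0 // ltW.
pose c : R := m%:R * ((P + Q)%N%:R) ^+ 2.
pose u k := Num.max 0 (b * (c - q k)).
have uE k : inbox (P + Q) k -> u k = b * (c - q k).
  move=> /inboxP h; apply/max_idPr; rewrite mulr_ge0 // subr_ge0 /q /c.
  rewrite -mulr_natr -[X in _ * X%:R]card_ord mulr_natr mulrC mulr_natr -sumr_const.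
  apply: ler_sum => i _; rewrite -[leLHS]real_normK ?num_real // lerXn2r ?nnegrE //.
  by rewrite -intr_norm -abszE ler_nat; exact: h.
have dq k v : q (k + v) + q (k - v) - 2 * q k = 2 * q v.
  rewrite /q mulr_sumr -big_split /= -sumrB mulr_sumr.
  by apply: eq_bigr => i _; rewrite !mxE !rmorphD /= rmorphN /=; ring.
have q0 v : 0 <= q v by apply: sumr_ge0 => i _; rewrite sqr_ge0.
have du k v : inbox P k -> inbox Q v -> u (k + v) + u (k - v) - 2 * u k = - (2 * b * q v).
  move=> kP vQ; rewrite !uE //; last 3 first.
  - by apply: inboxW kP; rewrite leq_addr.
  - by apply: inboxD => //; rewrite inboxN.
  - exact: inboxD.
  by have := dq k v; nra.
exists u; split => [k|k kP]; first by rewrite /u le_max lexx.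
rewrite /opc (eq_bigr (fun=> - (2 * b))); last first.
  move=> i _; rewrite du ?inbox_delta // /q (bigD1 i) //= mxE !eqxx big1 ?addr0 ?expr1n ?mulr1 //.
  by move=> j ji; rewrite mxE (negbTE ji) andbF expr0n.
rewrite [X in _ + am * X]big_seq_cond [X in _ + am * X]big1 ?mulr0 ?addr0; last first.
  move=> v /andP[]; rewrite mem_zbox => vQ _; apply/max_idPl.
  by rewrite du // oppr_le0 mulr_ge0 ?q0 // mulr_ge0.
have -> : \sum_(i < m) - (2 * b) = - (2 * b) * m%:R by rewrite sumr_const card_ord mulr_natr.
rewrite /b; have -> : a0 * (- (2 * (M / (2 * a0 * m%:R))) * m%:R) = - M.
  by field; rewrite !gt_eqF.
by rewrite lerN2.
Qed.

(* The minimal supersolution: the last clause is what minimality gives at points without positive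
   second differences. *)
Lemma lattice_obstacle : exists u : 'rV[int]_m -> R,
  [/\ forall k, 0 <= u k,
      forall k, ~~ inbox P k -> u k = 0,
      forall k, inbox P k -> a0 * (\sum_i ddiff u (delta_mx 0 i) k)
        + am * (\sum_(v <- zbox Q | v != 0) Num.max 0 (ddiff u v k)) <= - f k &
      forall k i, 0 < u k -> (forall v, inbox Q v -> ddiff u v k <= 0) ->
        - ddiff u (delta_mx 0 i) k <= f k / a0].
Proof.
pose u k := inf [set x | exists2 w, super w & x = w k].
have [w0 w0s] := barrier.
have hi k : has_inf [set x | exists2 w, super w & x = w k].
  split; first by exists (w0 k), w0.
  by exists 0 => x [w [w_ge0 _] ->].
have ule w k : super w -> u k <= w k.
  by move=> ws; apply: ge_inf; [case: (hi k) | exists w].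
have uinf k e : 0 < e -> exists2 w, super w & w k < u k + e.
  move=> e0; have [x [w ws ->] h] := inf_adherent e0 (hi k); by exists w.
have u0 k : 0 <= u k.
  by apply: lb_le_inf; [case: (hi k) | move=> x [w [w_ge0 _] ->]].
have us : super u by apply: (@super_inf [set w | super w]) => // k e e0; exact: uinf.
(* Lowering one value keeps the inequality at all other points by monotonicity; only the point [k]
   has to be examined. *)
have modif k c : 0 <= c <= u k -> (inbox P k -> opc c u k <= - f k) ->
    super (fun k' => if k' == k then c else u k').
  move=> /andP[c0 cu] h; split=> [k'|k' k'P]; first by case: eqP.
  case: (eqVneq k' k) => [E|ne].
    rewrite E in k'P *; apply: le_trans (h k'P); apply: opc_mono => k'' /negbTE -> //.
  apply: le_trans (us.2 k' k'P); apply: opc_mono => k'' _.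
  by case: eqP => [->|].
exists u; split => // [k kP|k kP|k i uk0 dle].
- apply/eqP; rewrite eq_le u0 andbT.
  have /(ule _ k) : super (fun k' => if k' == k then 0 else u k').
    by apply: modif; [rewrite lexx u0 | rewrite (negbTE kP)].
  by rewrite eqxx.
- exact: us.2.
have kP : inbox P k.
  apply/negPn/negP => kP.
  have /(ule _ k) : super (fun k' => if k' == k then 0 else u k').
    by apply: modif; [rewrite lexx u0 | rewrite (negbTE kP)].
  by rewrite eqxx leNgt uk0.
have dele j : ddiff u (delta_mx 0 j) k <= 0 by apply: dle; exact: inbox_delta.
have opE : opc (u k) u k = a0 * (\sum_i ddiff u (delta_mx 0 i) k).
  rewrite /opc [X in _ + am * X]big_seq_cond [X in _ + am * X]big1 ?mulr0 ?addr0 // => v /andP[].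
  by rewrite mem_zbox => vQ _; apply/max_idPl; exact: dle.
suff : - f k <= opc (u k) u k.
  rewrite opE ler_pdivlMr // => h.
  have : \sum_i ddiff u (delta_mx 0 i) k <= ddiff u (delta_mx 0 i) k.
    by rewrite (bigD1 i) //= gerDl sumr_le0.
  move/(ler_wpM2l (ltW a0_gt0)); lra.
(* If the inequality were strict at [k], the value there could be lowered by [d], against
   minimality. So equality holds, and at such a point only the Laplacian part survives, with all its
   terms nonpositive. *)
rewrite leNgt; apply/negP => lt.
have L0 : 0 <= L.
  by rewrite /L addr_ge0 // mulr_ge0 ?mulr_ge0 //; exact: ltW.
pose g := - f k - opc (u k) u k.
pose d := Num.min (u k) (g / (L + 1)).
have g0 : 0 < g by rewrite /g; lra.
have d0 : 0 < d by rewrite /d lt_min uk0 divr_gt0 //; lra.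
have du : d <= u k by rewrite /d ge_min lexx.
have dg : L * d <= g.
  have : d <= g / (L + 1) by rewrite /d ge_min lexx orbT.
  rewrite ler_pdivlMr; nra.
have /(ule _ k) : super (fun k' => if k' == k then u k - d else u k').
  apply: modif; first by lra.
  move=> _; have := opc_lip (u k) u k (ltW d0); rewrite /g in dg; lra.
rewrite eqxx; lra.
Qed.

(* Every small slope is that of a plane touching [u] from above at some lattice point [k], and the slopes
   touching at [k] lie in a cube of side [f k / a0]. *)
Lemma lattice_abp (u : 'rV[int]_m -> R) :
  (forall k, 0 <= u k) ->
  (forall k, ~~ inbox P k -> u k = 0) ->
  (forall k i, 0 < u k -> (forall v, inbox Q v -> ddiff u v k <= 0) ->
        - ddiff u (delta_mx 0 i) k <= f k / a0) ->
  forall k0, u k0 ^+ m <= (2 * m * (P + Q))%:R ^+ m * \sum_(k <- zbox P) (f k / a0) ^+ m.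
Proof.
move=> u0 uout ucon k0.
have rhs0 : 0 <= \sum_(k <- zbox P) (f k / a0) ^+ m.
  by apply: sumr_ge0 => k _; rewrite exprn_ge0 // divr_ge0 // ltW.
have [uk0|] := ltP 0 (u k0); last first.
  move=> h; have -> : u k0 = 0 by apply/eqP; rewrite eq_le h u0.
  by rewrite expr0n gtn_eqF // mulr_ge0 // exprn_ge0.
have c0 : 0 < (2 * m * (P + Q))%:R :> R.
  by rewrite ltr0n !muln_gt0 m_gt0 addn_gt0 Q_gt0 orbT.
(* With slopes bounded by [s] a linear function stays within [u k0 / 4] on the box [P + Q], so [u]
   minus it is maximal at a point where [u] is still positive, hence inside the box [P]. *)
pose s := u k0 / (2 * m * (P + Q))%:R / 2.
have s0 : 0 < s by rewrite !divr_gt0.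
have s2 : 2 * s = u k0 / (2 * m * (P + Q))%:R by rewrite /s mulrC divfK.
have -> : u k0 ^+ m = (2 * m * (P + Q))%:R ^+ m * (2 * s) ^+ m.
  by rewrite s2 -exprMn mulrC divfK // gt_eqF.
apply: ler_wpM2l; first by rewrite exprn_ge0 // ltW.
apply: (@cube_cover R m _ (zbox P) (fun k i => u (k + delta_mx 0 i) - u k)) => // [k|p ps].
  by rewrite divr_ge0 // ltW.
pose pk k := \sum_i p i * (k 0 i)%:~R.
have pk_le k : inbox (P + Q) k -> `|pk k| <= u k0 / 4.
  move=> /inboxP kb; apply: (le_trans (ler_norm_sum _ _ _)).
  apply: (@le_trans _ _ (\sum_(i < m) s * (P + Q)%:R)).
    apply: ler_sum => i _; rewrite normrM ler_pM //.
    by rewrite -intr_norm -abszE ler_nat; exact: kb.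
  rewrite sumr_const card_ord -[leLHS]mulr_natr.
  have -> : s * (P + Q)%:R * m%:R = 2 * s * (2 * m * (P + Q))%:R / 4.
    by rewrite !natrM; field.
  by rewrite s2 divfK // gt_eqF.
have pkD k v : pk (k + v) = pk k + pk v.
  by rewrite /pk -big_split /=; apply: eq_bigr => i _; rewrite mxE rmorphD /= mulrDr.
have pkN v : pk (- v) = - pk v.
  by rewrite /pk -sumrN; apply: eq_bigr => i _; rewrite mxE rmorphN /= mulrN.
have k0P : inbox P k0.
  by apply/negPn/negP => /uout E; rewrite E ltxx in uk0.
have k0PQ : k0 \in zbox (P + Q) by rewrite mem_zbox; apply: inboxW k0P; exact: leq_addr.
have [k1 k1P k1max] : exists2 k1, k1 \in zbox (P + Q) &
    forall k, k \in zbox (P + Q) -> u k - pk k <= u k1 - pk k1.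
  elim: (zbox (P + Q)) k0 k0PQ {uk0 k0P s0 s2 ps pk_le c0 s} => // x l IH k0.
  case: l IH => [_ _|y l IH _]; first by exists x; rewrite ?inE // => k; rewrite inE => /eqP ->.
  have [k1 k1l h] := IH y (mem_head _ _).
  have [hx|hx] := leP (u x - pk x) (u k1 - pk k1).
    exists k1; first by rewrite in_cons k1l orbT.
    by move=> k; rewrite in_cons => /orP[/eqP -> //|]; exact: h.
  exists x; first exact: mem_head.
  move=> k; rewrite in_cons => /orP[/eqP -> //|/h h']; exact: le_trans h' (ltW hx).
rewrite mem_zbox in k1P.
have uk1 : 0 < u k1.
  have := k1max _ k0PQ; have := pk_le _ k1P; rewrite mem_zbox in k0PQ.
  have := pk_le _ k0PQ; rewrite !ler_norml; lra.
have k1b : inbox P k1.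
  by apply/negPn/negP => /uout E; rewrite E ltxx in uk1.
have step v : inbox Q v -> u (k1 + v) - u k1 <= pk v.
  move=> vQ; have := k1max (k1 + v); rewrite mem_zbox inboxD // => /(_ isT).
  by rewrite pkD; lra.
have stepN v : inbox Q v -> u (k1 - v) - u k1 <= - pk v.
  by move=> vQ; rewrite -pkN; apply: step; rewrite inboxN.
apply/hasP; exists k1; first by rewrite mem_zbox.
apply/forallP => i.
have pke : pk (delta_mx 0 i) = p i.
  rewrite /pk (bigD1 i) //= mxE !eqxx mulr1 big1 ?addr0 // => j ji.
  by rewrite mxE (negbTE ji) andbF mulr0.
have := step _ (inbox_delta i Q_gt0); have := stepN _ (inbox_delta i Q_gt0).
have := ucon k1 i uk1; rewrite pke /ddiff => h h1 h2.
have : forall v, inbox Q v -> u (k1 + v) + u (k1 - v) - 2 * u k1 <= 0.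
  by move=> v vQ; have := step _ vQ; have := stepN _ vQ; lra.
by move/h; lra.
Qed.

End Lattice.

(** * Nonnegative definite matrices *)

Section PSD.
Variables (R : realType) (n : nat).
Implicit Types (A : 'M[R]_n) (x : 'rV[R]_n).

Definition psd A := A^T = A /\ forall x, 0 <= (x *m A *m x^T) 0 0.

Lemma quadE A x : (x *m A *m x^T) 0 0 = \sum_i \sum_j A i j * (x 0 i * x 0 j).
Proof.
rewrite !mxE exchange_big /=; apply: eq_bigr => j _.
rewrite !mxE mulr_suml; apply: eq_bigr => i _; ring.
Qed.

Lemma psd_sym A i j : psd A -> A j i = A i j.
Proof. by case=> + _ => /matrixP/(_ i j); rewrite mxE. Qed.

Lemma quad_shift A x (t : R) (k : 'I_n) : psd A ->
  ((x - t *: delta_mx 0 k) *m A *m (x - t *: delta_mx 0 k)^T) 0 0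
  = (x *m A *m x^T) 0 0 - 2 * t * (x *m A) 0 k + t ^+ 2 * A k k.
Proof.
move=> Ap; rewrite !quadE.
have -> : (x *m A) 0 k = \sum_i A i k * x 0 i.
  by rewrite mxE; apply: eq_bigr => i _; rewrite mulrC.
have split_ i : \sum_j A i j * ((x - t *: delta_mx 0 k) 0 i * (x - t *: delta_mx 0 k) 0 j)
  = \sum_j A i j * (x 0 i * x 0 j) - t * (A i k * x 0 i)
    - (i == k)%:R * (t * \sum_j A k j * x 0 j) + (i == k)%:R * (t ^+ 2 * A k k).
  rewrite (eq_bigr (fun j => A i j * (x 0 i * x 0 j) - t * ((j == k)%:R * (A i j * x 0 i))
    - (i == k)%:R * (t * (A k j * x 0 j)) + (i == k)%:R * (t ^+ 2 * ((j == k)%:R * A k j)))); last first.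
    move=> j _; rewrite !mxE /=; case: (eqVneq i k) => [->|_]; case: (eqVneq j k) => [->|_] /=; ring.
  rewrite big_split /= !sumrB -!mulr_sumr; congr (_ - _ * _ - _ + _ * (_ * _)).
    rewrite (bigD1 k) //= eqxx mul1r big1 ?addr0 // => j /negbTE ->; by rewrite mul0r.
  rewrite (bigD1 k) //= eqxx mul1r big1 ?addr0 // => j /negbTE ->; by rewrite mul0r.
rewrite (eq_bigr _ (fun i _ => split_ i)) big_split /= !sumrB -mulr_sumr -!mulr_suml.
have -> : \sum_(i < n) (i == k)%:R = 1 :> R.
  by rewrite (bigD1 k) //= eqxx big1 ?addr0 // => j /negbTE ->.
have -> : \sum_j A k j * x 0 j = \sum_i A i k * x 0 i.
  by apply: eq_bigr => j _; rewrite (psd_sym _ _ Ap).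
ring.
Qed.

Lemma psd_diag A k : psd A -> 0 <= A k k.
Proof.
move=> Ap; have := quad_shift 0 1 k Ap; have [_ /(_ (0 - 1 *: delta_mx 0 k))] := Ap.
move=> + E; rewrite E !mul0mx !mxE; lra.
Qed.

Lemma psd_col0 A k : psd A -> A k k = 0 -> forall j, A j k = 0.
Proof.
move=> Ap Akk j; apply/eqP/negPn/negP => ne.
have h t : 0 <= A j j - 2 * t * A j k.
  have := quad_shift (delta_mx 0 j) t k Ap; rewrite Akk mulr0 addr0 -rowE.
  have [_ /(_ (delta_mx 0 j - t *: delta_mx 0 k))] := Ap => + E; rewrite E.
  by rewrite trmx_delta -colE !mxE.
have := h ((A j j + 1) / (2 * A j k)).
have -> : 2 * ((A j j + 1) / (2 * A j k)) * A j k = A j j + 1.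
  by field.
lra.
Qed.

(** One Cholesky step: [v] is row [k] divided by the square root of the pivot. The remainder stays
    nonnegative because its form at [x] is the form of [A] at [x] shifted along axis [k] to the
    minimum. A zero pivot has a zero column, and then [v = 0] serves. *)
Lemma psd_step A k : psd A -> exists v : 'rV[R]_n,
  [/\ psd (A - v^T *m v), forall j, (A - v^T *m v) j k = 0 &
      forall i, (forall j, A j i = 0) -> forall j, (A - v^T *m v) j i = 0].
Proof.
move=> Ap; have [Akk|Akk] := eqVneq (A k k) 0.
  exists 0; rewrite mulmx0 subr0; split => //; exact: psd_col0.
have Akk0 : 0 < A k k by rewrite lt_neqAle eq_sym Akk psd_diag.
pose c := Num.sqrt (A k k); have c0 : 0 < c by rewrite sqrtr_gt0.
have cc : c * c = A k k by rewrite -expr2 sqr_sqrtr // ltW.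
pose v := \row_j (A k j / c).
have vE i j : (A - v^T *m v) i j = A i j - A i k * A k j / A k k.
  rewrite !mxE big_ord1 !mxE -cc (psd_sym i k Ap); congr (_ - _); field.
  by rewrite gt_eqF.
exists v; split.
- split.
    by apply/matrixP => i j; rewrite mxE !vE (psd_sym i j Ap) (psd_sym k j Ap) -(psd_sym i k Ap); ring.
  move=> x; pose t := (x *m A) 0 k / A k k.
  have [_ /(_ (x - t *: delta_mx 0 k))] := Ap.
  rewrite quad_shift //.
  have -> : (x *m A *m x^T) 0 0 - 2 * t * (x *m A) 0 k + t ^+ 2 * A k k
    = (x *m A *m x^T) 0 0 - (x *m A) 0 k ^+ 2 / A k k.
    by rewrite /t; field.
  have xv : (x *m v^T) 0 0 = (x *m A) 0 k / c.
    rewrite !mxE mulr_suml; apply: eq_bigr => j _.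
    by rewrite !mxE (psd_sym k j Ap) mulrA.
  have vx : (v *m x^T) 0 0 = (x *m v^T) 0 0.
    by rewrite -[in LHS](trmxK v) -trmx_mul mxE.
  suff -> : (x *m (A - v^T *m v) *m x^T) 0 0 =
    (x *m A *m x^T) 0 0 - (x *m A) 0 k ^+ 2 / A k k by [].
  rewrite mulmxBr mulmxBl !mulmxA mxE [X in _ + X]mxE -[x *m v^T *m v *m x^T]mulmxA.
  congr (_ - _); rewrite mxE big_ord1 vx xv -cc; field.
  by rewrite gt_eqF.
- by move=> j; rewrite vE mulfK // subrr.
- by move=> i h j; rewrite vE !h mulr0 mul0r subr0.
Qed.

Lemma psd_decomp A : psd A -> exists s : seq 'rV[R]_n, size s = n /\ forall i j, A i j = \sum_(v <- s) v 0 i * v 0 j.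
Proof.
move=> Ap.
have H k : (k <= n)%N -> exists (s : seq 'rV[R]_n) A', [/\ size s = k, psd A',
    forall i : 'I_n, (i < k)%N -> forall j, A' j i = 0 &
    forall i j, A i j = A' i j + \sum_(v <- s) v 0 i * v 0 j]; last first.
  have [s [A' [ss A'p A'0 AE]]] := H n (leqnn n).
  by exists s; split => // i j; rewrite AE A'0 ?add0r.
elim: k => [_|k IH kn].
  by exists [::], A; split => // i j; rewrite big_nil addr0.
have [s [A' [ss A'p A'0 AE]]] := IH (ltnW kn).
have [v [h1 h2 h3]] := psd_step (Ordinal kn) A'p.
exists (v :: s), (A' - v^T *m v); split => //=; first by rewrite ss.
  move=> i; rewrite ltnS leq_eqVlt => /orP[/eqP ik|ik].
    have -> : i = Ordinal kn by exact/val_inj.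
    exact: h2.
  by apply: h3 => j; exact: A'0.
by move=> i j; rewrite big_cons addrA AE !mxE big_ord1 !mxE subrK.
Qed.

(** With [A] written as a sum of squares [v^T v], the trace is a sum of values of the form of
    [H]. *)
Lemma psd_trace_nonpos A (H : 'M[R]_n) : psd A ->
  (forall v : 'rV[R]_n, \sum_i \sum_j H i j * (v 0 i * v 0 j) <= 0) ->
  \sum_i \sum_j A i j * H i j <= 0.
Proof.
move=> Ap Hn; have [s [_ AE]] := psd_decomp Ap.
have -> : \sum_i \sum_j A i j * H i j
    = \sum_(v <- s) \sum_i \sum_j H i j * (v 0 i * v 0 j).
  rewrite [RHS]exchange_big; apply: eq_bigr => i _.
  rewrite [RHS]exchange_big; apply: eq_bigr => j _.
  by rewrite AE mulr_suml; apply: eq_bigr => v _; rewrite mulrC.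
by apply: sumr_le0.
Qed.

End PSD.

(** * Elliptic matrices as sums of squares of integer directions *)

Section Integer.
Variables (R : realType) (m : nat).

Lemma sum_delta (k : 'I_m) (F : 'I_m -> R) : \sum_i (i == k)%:R * F i = F k.
Proof.
rewrite (bigD1 k) //= eqxx mul1r big1 ?addr0 // => i /negbTE ->; by rewrite mul0r.
Qed.

(** Each ordered off-diagonal pair contributes [|F i j| / 2] times the square of [e i] plus or minus
    [e j], and dominance leaves a nonnegative rest on the diagonal. The box has radius 2 because the
    pairs [i = j], of weight zero, stay in the list. *)
Lemma diag_dominant (F : 'M[R]_m) : F^T = F ->
  (forall i, \sum_(j | j != i) `|F i j| <= F i i) ->
  exists s : seq (R * 'rV[int]_m),
  [/\ forall cv, cv \in s -> 0 <= cv.1 /\ inbox 2 cv.2,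
      forall k l, F k l = \sum_(cv <- s) cv.1 * ((cv.2 0 k)%:~R * (cv.2 0 l)%:~R) &
      \sum_(cv <- s) cv.1 <= \sum_i F i i].
Proof.
move=> Fs Fd; have sym i j : F j i = F i j by move/matrixP/(_ i j) : Fs; rewrite mxE.
pose sg i j : int := if 0 <= F i j then 1 else -1.
pose g i j : R := if i == j then 0 else `|F i j| / 2.
pose e i : 'rV[int]_m := delta_mx 0 i.
pose s1 := [seq (F i i - \sum_(j | j != i) `|F i j|, e i) | i <- enum 'I_m].
pose s2 := [seq (g i j, e i + sg i j *: e j) | i <- enum 'I_m, j <- enum 'I_m].
exists (s1 ++ s2); split.
- move=> cv; rewrite mem_cat => /orP[/mapP[i _ ->]|/allpairsP[[i j] /= [_ _ ->]]] /=.
    by split; [rewrite subr_ge0 Fd | exact: inbox_delta].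
  split; first by rewrite /g; case: eqP.
  apply/inboxP => k; rewrite !mxE /sg.
  by case: (_ && _); case: (_ && _); case: (0 <= _).
- move=> k l; rewrite big_cat big_map big_allpairs_dep /= big_enum /=.
  have E1 : \sum_i (F i i - \sum_(j | j != i) `|F i j|) * ((e i 0 k)%:~R * (e i 0 l)%:~R)
      = (k == l)%:R * (F k k - \sum_(j | j != k) `|F k j|).
    rewrite -[RHS](sum_delta k (fun i => (i == l)%:R * (F i i - \sum_(j | j != i) `|F i j|))).
    apply: eq_bigr => i _; rewrite !mxE !eqxx /= (eq_sym k) (eq_sym l).
    by case: (i == k); case: (i == l) => /=; ring.
  rewrite E1.
  have E2 : \sum_(i <- enum 'I_m) \sum_(j <- enum 'I_m)
      g i j * (((e i + sg i j *: e j) 0 k)%:~R * ((e i + sg i j *: e j) 0 l)%:~R)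
    = (k == l)%:R * (\sum_j g k j) + (k == l)%:R * (\sum_j g j k)
      + g k l * (sg k l)%:~R + g l k * (sg l k)%:~R.
    rewrite big_enum /=.
    under eq_bigr do rewrite big_enum /=.
    have sg2 i j : (sg i j)%:~R * (sg i j)%:~R = 1 :> R.
      by rewrite /sg; case: ifP; rewrite ?mul1r ?mulrNN ?mulr1.
    rewrite (eq_bigr (fun i => (i == k)%:R * ((k == l)%:R * \sum_j g i j)
      + (i == k)%:R * (g i l * (sg i l)%:~R) + (i == l)%:R * (g i k * (sg i k)%:~R)
      + (k == l)%:R * g i k)) => [|i _]; last first.
      rewrite (eq_bigr (fun j => (i == k)%:R * (k == l)%:R * g i j
        + (j == l)%:R * ((i == k)%:R * (g i j * (sg i j)%:~R))
        + (j == k)%:R * ((i == l)%:R * (g i j * (sg i j)%:~R))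
        + (j == k)%:R * ((k == l)%:R * g i j))) => [|j _]; last first.
        rewrite !mxE !eqxx /= (eq_sym k i) (eq_sym l i) (eq_sym k j) (eq_sym l j).
        rewrite !rmorphD /= !rmorphM /= ?rmorph_nat.
        have dd (x : 'I_m) : (x == k)%:R * (x == l)%:R = (k == l)%:R * (x == k)%:R :> R.
          by case: (eqVneq x k) => [->|_]; rewrite ?mul1r ?mulr1 ?mul0r ?mulr0.
        have := dd i; have := dd j; have := sg2 i j.
        move: (sg i j)%:~R ((i == k)%:R) ((i == l)%:R) ((j == k)%:R) ((j == l)%:R) ((k == l)%:R) (g i j).
        move=> t a b c d q G tt D1 D2.
        have -> : G * ((a + t * c) * (b + t * d)) = G * (a * b + t * (a * d + c * b) + t * t * (c * d)).
          by ring.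
        by rewrite tt D1 D2; ring.
      rewrite !big_split /= -!mulr_sumr !sum_delta; ring.
    rewrite !big_split /= !sum_delta -!mulr_sumr; ring.
  rewrite E2.
  have gs i j : g j i = g i j by rewrite /g eq_sym sym.
  have sgs i j : sg j i = sg i j by rewrite /sg sym.
  rewrite (gs k l) (sgs k l) (eq_bigr (fun j => g k j) (fun j _ => gs k j)).
  have gsum : \sum_j g k j = (\sum_(j | j != k) `|F k j|) / 2.
    rewrite (bigD1 k) //= {1}/g eqxx add0r mulr_suml.
    by apply: eq_bigr => j /negbTE jk; rewrite /g eq_sym jk.
  rewrite gsum.
  case: (eqVneq k l) => [<-|kl]; first by rewrite /g !eqxx /= !mul0r !mul1r; lra.
  rewrite /g (negbTE kl) /sg.
  case: ifPn => h; first by rewrite (ger0_norm h) !mul0r !mulr1z; lra.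
  by rewrite ltr0_norm ?ltNge // !mulrNz !mulr1z !mul0r; lra.
rewrite big_cat big_map big_allpairs_dep /= big_enum /= big_enum /=.
under [X in _ + X <= _]eq_bigr do rewrite big_enum /=.
rewrite -big_split /=; apply: ler_sum => i _.
have -> : \sum_j g i j = (\sum_(j | j != i) `|F i j|) / 2.
  rewrite (bigD1 i) //= {1}/g eqxx add0r mulr_suml.
  by apply: eq_bigr => j /negbTE jk; rewrite /g eq_sym jk.
have : 0 <= \sum_(j | j != i) `|F i j| by apply: sumr_ge0.
lra.
Qed.

End Integer.

Section Elliptic.
Variables (R : realType) (m : nat).

Definition elliptic (lam Lam : R) (a : 'M[R]_m) :=
  [/\ a^T = a, forall x : 'rV[R]_m, lam * \sum_i x 0 i ^+ 2 <= (x *m a *m x^T) 0 0 &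
      forall i j, `|a i j| <= Lam].

(** A decomposition of Motzkin-Wasow type; since directions and total weight are uniform over the
    ellipticity class, one lattice operator dominates all its members. Split off [3 lam / 4], write
    the rest as squares and round the vectors to multiples of 1/N: the rounding error plus [lam / 4]
    is diagonally dominant, and [lam / 2] is left for the Laplacian. *)
Lemma elliptic_decomp (lam Lam : R) : 0 < lam -> exists (Q : nat) (cmax : R),
  (0 < Q)%N /\ 0 <= cmax /\
  forall a : 'M[R]_m, elliptic lam Lam a ->
  exists s : seq (R * 'rV[int]_m),
  [/\ forall cv, cv \in s -> 0 <= cv.1 /\ inbox Q cv.2,
      forall k l, a k l = (lam / 2) * (k == l)%:R
         + \sum_(cv <- s) cv.1 * ((cv.2 0 k)%:~R * (cv.2 0 l)%:~R) &
      \sum_(cv <- s) cv.1 <= cmax].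
Proof.
move=> lam0; pose L := `|Lam| + 1; have L0 : 1 <= L by rewrite lerDr.
(* This size makes every row sum of the rounding error at most [lam / 4]. *)
pose N := (Num.bound (m%:R * (m%:R * (2 * L + 1)) * 4 / lam)).+1.
have N0 : 0 < N%:R :> R by rewrite ltr0n.
have N1 : 1 <= N%:R :> R by rewrite ler1n.
pose d := (2 * L + 1) / N%:R.
have d0 : 0 <= d by rewrite divr_ge0 //; lra.
have dN : m%:R * (m%:R * d) <= lam / 4.
  have : m%:R * (m%:R * (2 * L + 1)) * 4 / lam <= N%:R.
    apply: ltW; apply: lt_le_trans (archi_boundP _) _; last by rewrite ler_nat leqnSn.
    by rewrite divr_ge0 ?mulr_ge0 //; lra.
  rewrite ler_pdivrMr // => h.
  rewrite /d !mulrA ler_pdivrMr //; rewrite !mulrA in h; lra.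
clearbody N.
pose Q := (Num.bound (2 * (N%:R * L))).+2.
exists Q, (m%:R + m%:R * lam); split => //; split; first by rewrite addr_ge0 // mulr_ge0 // ltW.
move=> a [asym alam aLam].
pose a' := a - (3 * lam / 4)%:M.
have a'p : psd a'.
  split; first by rewrite linearB /= tr_scalar_mx asym.
  move=> x; rewrite mulmxBr mulmxBl mxE [X in _ + X]mxE mul_mx_scalar -scalemxAl [X in _ - X]mxE.
  have xx : (x *m x^T) 0 0 = \sum_i x 0 i ^+ 2.
    by rewrite mxE; apply: eq_bigr => i _; rewrite mxE expr2.
  rewrite xx; have := alam x.
  have : 0 <= \sum_i x 0 i ^+ 2 by apply: sumr_ge0 => i _; rewrite sqr_ge0.
  move: (\sum_i _) => q q0; nra.
have [s [ss a'E]] := psd_decomp a'p.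
have ub (u : 'rV[R]_m) i : u \in s -> `|u 0 i| <= L.
  move=> us; have : u 0 i * u 0 i <= a' i i.
    by rewrite a'E (big_rem u) //= lerDl sumr_ge0 // => v _; rewrite -expr2 sqr_ge0.
  have : a' i i <= `|Lam|.
    rewrite !mxE eqxx mulr1n; have := aLam i i; rewrite ler_norml => /andP[_ h].
    have := ler_norm Lam; lra.
  rewrite /L; have := normr_ge0 Lam; move: `|Lam| => M M0 h1 h2.
  rewrite ler_norml; apply/andP; split; nra.
pose q (u : 'rV[R]_m) : 'rV[int]_m := \row_i Num.floor (u 0 i * N%:R).
pose qr u i : R := (q u 0 i)%:~R / N%:R.
have qrE (u : 'rV[R]_m) i : qr u i <= u 0 i < qr u i + 1 / N%:R.
  rewrite /qr -mulrDl ler_pdivrMr // ltr_pdivlMr // mxE.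
  by have := floor_itv (u 0 i * N%:R); rewrite rmorphD.
have qd (u : 'rV[R]_m) i : `|u 0 i - qr u i| <= 1 / N%:R.
  by have /andP[h1 h2] := qrE u i; rewrite ler_norml; apply/andP; split; [have : 0 < 1 / N%:R :> R by rewrite divr_gt0|]; lra.
have N1' : 1 / N%:R <= 1 :> R by rewrite ler_pdivrMr // mul1r.
have qb (u : 'rV[R]_m) i : u \in s -> `|qr u i| <= L + 1.
  move=> us; have := ub u i us; have := qd u i; rewrite !ler_norml.
  by move=> /andP[h1 h2] /andP[h3 h4]; apply/andP; split; lra.
pose E : 'M[R]_m := \matrix_(i, j) \sum_(u <- s) (u 0 i * u 0 j - qr u i * qr u j).
have Eb i j : `|E i j| <= m%:R * d.
  rewrite mxE; apply: (le_trans (ler_norm_sum _ _ _)).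
  have -> : m%:R * d = \sum_(u <- s) d.
    by rewrite big_const_seq count_predT iter_addr_0 ss mulr_natl.
  rewrite big_seq_cond [leRHS]big_seq_cond; apply: ler_sum => u; rewrite andbT => us.
  have -> : u 0 i * u 0 j - qr u i * qr u j = u 0 i * (u 0 j - qr u j) + (u 0 i - qr u i) * qr u j.
    by ring.
  apply: (le_trans (ler_normD _ _)); rewrite [X in X + _]normrM [X in _ + X]normrM.
  have h1 := ub u i us; have h2 := qb u j us; have h3 := qd u i; have h4 := qd u j.
  have -> : d = L * (1 / N%:R) + 1 / N%:R * (L + 1) by rewrite /d; field; rewrite gt_eqF.
  by apply: lerD; apply: ler_pM.
pose F : 'M[R]_m := (lam / 4)%:M + E.
have Fsym : F^T = F.
  rewrite linearD /= tr_scalar_mx; congr (_ + _); apply/matrixP => i j; rewrite !mxE.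
  by apply: eq_bigr => u _; ring.
have Frow i : \sum_j `|E i j| <= lam / 4.
  apply: le_trans dN; apply: (@le_trans _ _ (\sum_(j < m) (m%:R * d))).
    by apply: ler_sum => j _; exact: Eb.
  by rewrite sumr_const card_ord -[leLHS]mulr_natl.
have Fd i : \sum_(j | j != i) `|F i j| <= F i i.
  have := Frow i; rewrite (bigD1 i) //=.
  have -> : \sum_(j | j != i) `|F i j| = \sum_(j | j != i) `|E i j|.
    by apply: eq_bigr => j ji; rewrite mxE [_%:M _ _]mxE eq_sym (negbTE ji) mulr0n add0r.
  rewrite [F i i]mxE [_%:M _ _]mxE eqxx mulr1n => h.
  have := ler_norm (- E i i); rewrite normrN; lra.
have [s' [s'P FE s'c]] := diag_dominant Fsym Fd.
pose s1 : seq (R * _) := [seq (1 / N%:R ^+ 2, q u) | u <- s].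
exists (s1 ++ s'); split.
- move=> cv; rewrite mem_cat => /orP[/mapP[u us ->] /=|/s'P[h1 h2]]; last first.
    by split => //; apply: inboxW h2.
  split; first by rewrite divr_ge0 // exprn_ge0 // ltW.
  apply/inboxP => i; rewrite -(ler_nat R) natr_absz.
  have := qb u i us; rewrite /qr normrM [X in _ * X]gtr0_norm ?invr_gt0 // ler_pdivrMr // intr_norm => h.
  apply: (le_trans h).
  have -> : Q%:R = (Num.bound (2 * (N%:R * L)))%:R + 2 :> R by rewrite /Q -addn2 natrD.
  have NL0 : 0 <= 2 * (N%:R * L) by rewrite !mulr_ge0 //; lra.
  have := archi_boundP NL0.
  have : N%:R * L + N%:R <= 2 * (N%:R * L) by nra.
  lra.
- move=> k l; rewrite big_cat big_map /=.
  have -> : a k l = a' k l + (3 * lam / 4) * (k == l)%:R.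
    by rewrite !mxE -mulr_natr; ring.
  have := FE k l; rewrite mxE [_%:M _ _]mxE -mulr_natr mxE sumrB -a'E => h.
  have -> : \sum_(u <- s) 1 / N%:R ^+ 2 * ((q u 0 k)%:~R * (q u 0 l)%:~R)
    = \sum_(u <- s) qr u k * qr u l.
    by apply: eq_bigr => u _; rewrite /qr; field; rewrite gt_eqF.
  lra.
rewrite big_cat big_map /=; apply: lerD.
  have -> : m%:R = \sum_(u <- s) 1 :> R.
    by rewrite big_const_seq count_predT iter_addr_0 ss.
  apply: ler_sum => u _; rewrite ler_pdivrMr ?exprn_gt0 // mul1r.
  by rewrite -[leLHS](expr1n _ 2) lerXn2r // nnegrE ltW.
apply: (le_trans s'c).
have -> : m%:R * lam = \sum_(i < m) lam by rewrite sumr_const card_ord mulr_natl.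
apply: ler_sum => i _; rewrite mxE [_%:M _ _]mxE eqxx mulr1n.
have := Frow i; rewrite (bigD1 i) //=.
have : 0 <= \sum_(j | j != i) `|E i j| by apply: sumr_ge0.
have := ler_norm (E i i); lra.
Qed.

End Elliptic.

Lemma min_pos (R : realType) (T : eqType) (s : seq T) (f : T -> R) :
  (forall x, 0 < f x) -> exists d, 0 < d /\ forall x, x \in s -> d <= f x.
Proof.
move=> f0; elim: s => [|y s [d [d0 h]]]; first by exists 1.
exists (Num.min d (f y)); split; first by rewrite lt_min d0 f0.
by move=> x; rewrite inE ge_min => /orP[/eqP ->|/h ->] //; rewrite lexx orbT.
Qed.

(** * Second order calculus *)

Section Norm.
Variables (R : realType) (n : nat).
Implicit Types (x v : 'rV[R]_n).

Lemma row_norm_le x i : `|x 0 i| <= `|x|.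
Proof.
have -> : `|x| = mx_norm x by [].
rewrite mx_normrE; exact: (le_bigmax _ (fun ij : 'I_1 * 'I_n => `|x ij.1 ij.2|) (0, i)).
Qed.

Lemma row_normP x (c : R) : 0 <= c -> (forall i, `|x 0 i| <= c) <-> `|x| <= c.
Proof.
move=> c0; split => [h|h i]; last exact: le_trans (row_norm_le x i) h.
have -> : `|x| = mx_norm x by [].
rewrite mx_normrE; apply: bigmax_le => // -[i j] _ /=.
by rewrite (ord1 i).
Qed.

Lemma cont_ed (f : 'rV[R]_n -> R) : continuous f <->
  forall x e, 0 < e -> exists r, 0 < r /\ forall v, `|v| <= r -> `|f (x + v) - f x| <= e.
Proof.
split=> [fc x e e0|h x].
  have /cvgrPdist_le/(_ e e0)/nbhs_normP[r /= r0 hr] := fc x.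
  exists (r / 2); split; first by rewrite divr_gt0.
  move=> v vr; rewrite distrC; apply: hr => /=.
  by rewrite opprD addrA subrr add0r normrN; lra.
apply/(@cvgrPdist_le _ _ _ _ (nbhs_filter x)) => e e0; have [r [r0 hr]] := h x e e0.
apply: (@filterS _ (nbhs x) _ (ball x r)); last exact: nbhsx_ballx.
move=> y; rewrite -ball_normE /= => yr.
by have := hr (y - x); rewrite (addrC x) subrK (distrC y) (distrC (f y)); apply; exact: ltW.
Qed.

Lemma bounded_on_ball (f : 'rV[R]_n -> R) (r : R) : continuous f ->
  exists M, 0 <= M /\ forall x, `|x| <= r -> `|f x| <= M.
Proof.
move=> fc.
have cpt : compact [set x : 'rV[R]_n | `|x| <= r].
  apply: bounded_closed_compact.
    by exists r; split; [exact: num_real | move=> M rM x /= xr; apply: le_trans xr (ltW rM)].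
  apply: (@closed_comp _ _ _ [set y : R | y <= r]); last exact: closed_le.
  by move=> x _; exact: norm_continuous.
have : compact (f @` [set x : 'rV[R]_n | `|x| <= r]).
  by apply: continuous_compact => //; exact: continuous_subspaceT.
move/compact_bounded => [M [_ h]]; exists (`|M| + 1); split; first by rewrite addr_ge0.
move=> x xr; apply: h; last by exists x.
by have := ler_norm M; lra.
Qed.

Lemma unif_cont_ball (f : 'rV[R]_n -> R) (r e : R) : continuous f -> 0 < e ->
  exists d, 0 < d /\ forall x v, `|x| <= r -> `|v| <= d -> `|f (x + v) - f x| <= e.
Proof.
move=> fc e0.
have cpt : compact [set x : 'rV[R]_n | `|x| <= r].
  apply: bounded_closed_compact.
    by exists r; split; [exact: num_real | move=> M rM x /= xr; apply: le_trans xr (ltW rM)].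
  apply: (@closed_comp _ _ _ [set y : R | y <= r]); last exact: closed_le.
  by move=> x _; exact: norm_continuous.
have /choice[d dP] : forall x, exists d, 0 < d /\ forall v, `|v| <= d -> `|f (x + v) - f x| <= e / 2.
  by move=> x; apply: (cont_ed f).1 => //; rewrite divr_gt0.
move: cpt; rewrite compact_cover => /(_ _ [set: 'rV[R]_n] (fun x => ball x (d x / 2))).
case=> [x _|x _|D _ cov].
- exact: ball_open.
- by exists x => //; apply: ballxx; rewrite divr_gt0 //; case: (dP x).
have [d' [d'0 hd']] : exists d', 0 < d' /\ forall x, x \in finmap.enum_fset D -> d' <= d x / 2.
  by apply: min_pos => x; rewrite divr_gt0 //; case: (dP x).
exists d'; split=> //.
move=> x v xr vd; have [y yD /=] := cov x xr.
rewrite -ball_normE /= => xy.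
have [d0 hy] := dP y.
have vd' : `|v| <= d y / 2.
  exact: le_trans vd (hd' _ yD).
have h1 := hy (x - y); have h2 := hy (x + v - y).
move: h1 h2; rewrite !(addrC y) !subrK => h1 h2.
have -> : f (x + v) - f x = (f (x + v) - f y) - (f x - f y) by ring.
apply: (le_trans (ler_normB _ _)).
have : `|f x - f y| <= e / 2 by apply: h1; rewrite distrC; lra.
have : `|f (x + v) - f y| <= e / 2.
  apply: h2; rewrite addrAC; apply: (le_trans (ler_normD _ _)); rewrite (distrC x y); lra.
lra.
Qed.

End Norm.

Section C2.
Variables (R : realType) (n : nat).
Implicit Types (x v : 'rV[R]_n) (u : 'rV[R]_n -> R) (G : 'rV[R]_n -> 'rV[R]_n)
  (H : 'rV[R]_n -> 'M[R]_n).

Definition dot (g v : 'rV[R]_n) : R := \sum_i g 0 i * v 0 i.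
Definition qf (H : 'M[R]_n) (v w : 'rV[R]_n) : R := \sum_i \sum_j H i j * (v 0 i * w 0 j).

(** Regularity is kept as a second order expansion of Peano type, with gradient and Hessian given as
    data. Products, sums, affine changes and extension to further variables are then plain algebra,
    without iterated directional derivatives. *)
Definition taylor2 u G H := forall x e, 0 < e -> exists r, 0 < r /\ forall v, `|v| <= r ->
  `|u (x + v) - u x - dot (G x) v - qf (H x) v v / 2| <= e * `|v| ^+ 2.

Definition C2 u G H := [/\ taylor2 u G H, continuous u,
  forall i, continuous (fun x => G x 0 i) & forall i j, continuous (fun x => H x i j)].

Lemma dot_le (g v : 'rV[R]_n) K : (forall i, `|g 0 i| <= K) -> `|dot g v| <= n%:R * K * `|v|.
Proof.
move=> gK; apply: (le_trans (ler_norm_sum _ _ _)).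
apply: (@le_trans _ _ (\sum_(i < n) K * `|v|)).
  by apply: ler_sum => i _; rewrite normrM ler_pM // row_norm_le.
by rewrite sumr_const card_ord -[leLHS]mulr_natl mulrA.
Qed.

Lemma qf_le (H : 'M[R]_n) (v w : 'rV[R]_n) K : (forall i j, `|H i j| <= K) ->
  `|qf H v w| <= n%:R ^+ 2 * K * (`|v| * `|w|).
Proof.
move=> HK; apply: (le_trans (ler_norm_sum _ _ _)).
apply: (@le_trans _ _ (\sum_(i < n) \sum_(j < n) K * (`|v| * `|w|))).
  apply: ler_sum => i _; apply: (le_trans (ler_norm_sum _ _ _)).
  by apply: ler_sum => j _; rewrite !normrM ler_pM ?mulr_ge0 // ler_pM // row_norm_le.
rewrite sumr_const sumr_const card_ord -mulrnA -[leLHS]mulr_natl natrM; lra.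
Qed.

Lemma dotN (g : 'rV[R]_n) v : dot g (- v) = - dot g v.
Proof. by rewrite /dot -sumrN; apply: eq_bigr => i _; rewrite mxE mulrN. Qed.

Lemma qfN (H : 'M[R]_n) v : qf H (- v) (- v) = qf H v v.
Proof. by apply: eq_bigr => i _; apply: eq_bigr => j _; rewrite !mxE mulrNN. Qed.

Lemma dotZ (g : 'rV[R]_n) v t : dot g (t *: v) = t * dot g v.
Proof. by rewrite /dot mulr_sumr; apply: eq_bigr => i _; rewrite mxE mulrCA. Qed.

Lemma qfZ (H : 'M[R]_n) v t : qf H (t *: v) (t *: v) = t ^+ 2 * qf H v v.
Proof.
rewrite /qf mulr_sumr; apply: eq_bigr => i _; rewrite mulr_sumr; apply: eq_bigr => j _.
by rewrite !mxE; ring.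
Qed.

(** Adding the expansions at [v] and [- v] cancels the gradient and bounds the Hessian form. A step
    of length [t] along an axis, whose quadratic terms are of order [t ^ 2], then excludes a nonzero
    gradient. *)
Lemma C2_max u G H x : C2 u G H -> (forall y, u y <= u x) ->
  (forall i, G x 0 i = 0) /\ (forall v, qf (H x) v v <= 0).
Proof.
case=> tay _ _ _ umax.
have hess v : qf (H x) v v <= 0.
  apply/ler_addgt0Pl => e e0; rewrite addr0.
  have e'0 : 0 < e / (2 * (`|v| ^+ 2 + 1)).
    by rewrite divr_gt0 // mulr_gt0 // ltr_wpDl // exprn_ge0.
  have [r [r0 hr]] := tay x _ e'0.
  pose t := r / (`|v| + 1).
  have v1 : 0 < `|v| + 1 by rewrite ltr_wpDl.
  have t0 : 0 < t by rewrite divr_gt0.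
  have tv : `|t *: v| <= r.
    rewrite normrZ gtr0_norm // /t mulrAC ler_pdivrMr // ler_pM2l //; lra.
  have h1 := hr _ tv; have tv' : `|- (t *: v)| <= r by rewrite normrN.
  have h2 := hr _ tv'; rewrite dotN qfN in h2.
  have q1 := umax (x + t *: v); have q2 := umax (x - t *: v).
  rewrite normrN in h2; rewrite qfZ normrZ gtr0_norm // in h1 h2.
  have key : t ^+ 2 * qf (H x) v v <= 2 * (e / (2 * (`|v| ^+ 2 + 1)) * (t * `|v|) ^+ 2).
    move: h1 h2; rewrite !ler_norml => /andP[h1 h1'] /andP[h2 h2'].
    move: q1 q2 h1 h1' h2 h2'.
    move: (u (x + t *: v)) (u (x - t *: v)) (u x) (dot _ _) (t ^+ 2 * qf _ _ _) => a1 a2 a3 a4 a5.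
    move: (_ / _ * (t * `|v|) ^+ 2) => a6; lra.
  have t2 : 0 < t ^+ 2 by rewrite exprn_gt0.
  rewrite -(ler_pM2l t2); apply: (le_trans key).
  have -> : 2 * (e / (2 * (`|v| ^+ 2 + 1)) * (t * `|v|) ^+ 2)
    = t ^+ 2 * (e * `|v| ^+ 2 / (`|v| ^+ 2 + 1)).
    rewrite exprMn; have : 0 <= `|v| ^+ 2 by rewrite exprn_ge0.
    clearbody t; move: (`|v| ^+ 2) (t ^+ 2) => q tt q0; field.
    by rewrite gt_eqF // ltr_wpDl.
  rewrite ler_pM2l // ler_pdivrMr ?ltr_wpDl ?exprn_ge0 //.
  by rewrite ler_pM2l //; lra.
split => // i; apply/eqP; rewrite eq_le.
suff h (s : R) : `|s| = 1 -> s * G x 0 i <= 0.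
  have := h 1 (normr1 _); have := h (-1); rewrite normrN1 => /(_ erefl); lra.
move=> s1; apply/ler_addgt0Pl => e e0; rewrite addr0.
have [r [r0 hr]] := tay x 1 ltr01.
pose K := `|qf (H x) (delta_mx 0 i) (delta_mx 0 i)| / 2 + 1.
have K0 : 0 < K by rewrite ltr_wpDl // divr_ge0.
pose t := Num.min (Num.min r 1) (e / K).
have t0 : 0 < t by rewrite !lt_min r0 ltr01 divr_gt0.
have tr : t <= r by rewrite /t !ge_min lexx.
have tK : t * K <= e.
  rewrite -ler_pdivlMr // /t ge_min lexx orbT //.
pose v : 'rV[R]_n := (t * s) *: delta_mx 0 i.
have d1 : `|delta_mx 0 i : 'rV[R]_n| <= 1.
  by apply/row_normP => // j; rewrite mxE; case: (_ && _); rewrite ?normr1 ?normr0.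
have vt : `|v| <= t.
  by rewrite normrZ normrM s1 mulr1 gtr0_norm // ger_pMr.
have := hr v (le_trans vt tr); have := umax (x + v).
have -> : dot (G x) v = t * s * G x 0 i.
  rewrite dotZ; congr (_ * _); rewrite /dot (bigD1 i) //= mxE !eqxx mulr1 big1 ?addr0 // => j ji.
  by rewrite mxE (negbTE ji) andbF mulr0.
rewrite qfZ exprMn -(real_normK (num_real s)) s1 expr1n mulr1 => h1.
have h2 : `|v| ^+ 2 <= t ^+ 2 by rewrite lerXn2r ?nnegrE // ltW.
rewrite ler_norml => /andP[h3 _].
have h4 := ler_norm (- qf (H x) (delta_mx 0 i) (delta_mx 0 i)); rewrite normrN in h4.
have h5 : t * (s * G x 0 i) <= t * (t * K).
  rewrite /K; move: h1 h2 h3 h4; move: (qf _ _ _) => q.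
  have : t ^+ 2 = t * t by rewrite expr2.
  have := sqr_ge0 t.
  move: (`|q|) (t ^+ 2) => Q tt; nra.
rewrite ler_pM2l // in h5; lra.
Qed.

End C2.

Section Taylor.
Variables (R : realType) (n : nat).
Implicit Types (x y v d : 'rV[R]_n) (w u : 'rV[R]_n -> R).

Lemma scale1R (h : R) : h *: (1 : R) = h.
Proof. by rewrite -[RHS]mulr1. Qed.

Lemma line_derive w y d (s : R) : derivable w (y + s *: d) d ->
  is_derive s 1 (fun s : R => w (y + s *: d)) (derive w (y + s *: d) d).
Proof.
move=> dw.
have E : (fun h : R => h^-1 *: (((fun s : R => w (y + s *: d)) \o shift s) (h *: 1) - w (y + s *: d)))
  = (fun h : R => h^-1 *: ((w \o shift (y + s *: d)) (h *: d) - w (y + s *: d))).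
  apply/funext => h /=; congr (_ *: (w _ - _)).
  by rewrite scale1R scalerDl addrCA.
by split; [rewrite /derivable E | rewrite /derive E].
Qed.

Lemma mvt_line w y d (c : R) : (forall x, derivable w x d) -> exists s,
  `|s| <= `|c| /\ w (y + c *: d) - w y = c * derive w (y + s *: d) d.
Proof.
move=> dw; pose g (s : R) := w (y + s *: d).
have gd (s : R) : is_derive s 1 g (derive w (y + s *: d) d) by apply: line_derive.
have gc (a b : R) : {within `[a, b], continuous g}.
  apply: derivable_within_continuous => s _; by case: (gd s).
have g0 : g 0 = w y by rewrite /g scale0r addr0.
have [c0|c0] := leP 0 c.
  have [s + h] := MVT_segment c0 (fun s _ => gd s) (gc 0 c).
  rewrite in_itv /= => /andP[s0 sc]; exists s; split; first by rewrite !ger0_norm.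
  by move: h; rewrite g0 subr0 mulrC.
have [s + h] := MVT_segment (ltW c0) (fun s _ => gd s) (gc c 0).
rewrite in_itv /= => /andP[cs s0]; exists s; split; first by rewrite !ler0_norm ?lerN2 // ltW.
by move: h; rewrite g0 sub0r mulrN mulrC => /eqP; rewrite -eqr_opp opprB opprK => /eqP.
Qed.

(** Continuous partial derivatives give differentiability: [x] is joined to [x + v] through the
    truncations [tr k], one coordinate at a time, with the mean value theorem on each edge. *)
Lemma first_order w : (forall i x, derivable w x (delta_mx 0 i)) ->
  (forall i, continuous (fun x => derive w x (delta_mx 0 i))) ->
  forall x e, 0 < e -> exists r, 0 < r /\ forall v, `|v| <= r ->
   `|w (x + v) - w x - \sum_i derive w x (delta_mx 0 i) * v 0 i| <= e * `|v|.
Proof.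
move=> dw cw x e e0; have e'0 : 0 < e / n.+1%:R by rewrite divr_gt0.
have /choice[r rP] : forall i, exists r, 0 < r /\ forall v, `|v| <= r ->
    `|derive w (x + v) (delta_mx 0 i) - derive w x (delta_mx 0 i)| <= e / n.+1%:R.
  by move=> i; exact: (cont_ed _).1 (cw i) x _ e'0.
have [d [d0 hd]] : exists d : R, 0 < d /\ forall i, i \in enum 'I_n -> d <= r i.
  by apply: min_pos => i; case: (rP i).
exists d; split => // v vd.
pose tr k : 'rV[R]_n := \row_(j < n) if (j < k)%N then v 0 j else 0.
have H k : (k <= n)%N -> `|w (x + tr k) - w x - \sum_(i < n | (i < k)%N) derive w x (delta_mx 0 i) * v 0 i|
    <= k%:R * (e / n.+1%:R * `|v|).
  elim: k => [_|k IH kn].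
    have -> : tr 0%N = 0 by apply/rowP => j; rewrite !mxE.
    by rewrite addr0 big1 // !subrr normr0 mul0r.
  pose i := Ordinal kn.
  have trS : tr k.+1 = tr k + v 0 i *: delta_mx 0 i.
    apply/rowP => j; rewrite !mxE ltnS leq_eqVlt eqxx /=.
    case: (eqVneq j i) => [->|ji] /=; first by rewrite eqxx ltnn add0r mulr1.
    have -> : (nat_of_ord j == k) = false by apply/eqP => jk; move/eqP: ji; apply; exact/val_inj.
    by rewrite mulr0 addr0.
  have [s [sv hs]] := mvt_line (x + tr k) (v 0 i) (dw i).
  rewrite trS addrA (bigD1 i) //=.
  have -> : \sum_(j < n | (j < k.+1)%N && (j != i)) derive w x (delta_mx 0 j) * v 0 j
     = \sum_(j < n | (j < k)%N) derive w x (delta_mx 0 j) * v 0 j.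
    apply: eq_bigl => j; rewrite ltnS leq_eqVlt.
    case: (eqVneq j i) => [->|ji] /=; first by rewrite ltnn andbF.
    have -> : (nat_of_ord j == k) = false by apply/eqP => jk; move/eqP: ji; apply; exact/val_inj.
    by rewrite andbT.
  have -> : forall S T, w (x + tr k + v 0 i *: delta_mx 0 i) - w x - (S + T)
     = (w (x + tr k) - w x - T) + (w (x + tr k + v 0 i *: delta_mx 0 i) - w (x + tr k) - S).
    by move=> S T; ring.
  apply: (le_trans (ler_normD _ _)); rewrite -natr1 mulrDl mul1r lerD ?IH 1?ltnW //.
  rewrite hs -addrA.
  have -> : forall a b, v 0 i * a - b * v 0 i = (a - b) * v 0 i by move=> a b; ring.
  rewrite normrM; apply: ler_pM => //; last exact: row_norm_le.
  have [_] := rP i; apply.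
  apply: (@le_trans _ _ d); last by apply: hd; rewrite mem_enum.
  apply: le_trans vd; apply/row_normP => // j; rewrite !mxE eqxx /=.
  case: (eqVneq j i) => [->|ji].
    by rewrite /= ltnn add0r mulr1; apply: le_trans sv (row_norm_le _ _).
  rewrite mulr0 addr0; case: ifP => _; first exact: row_norm_le.
  by rewrite normr0.
have := H n (leqnn n).
have -> : tr n = v by apply/rowP => j; rewrite mxE ltn_ord.
rewrite (eq_bigl predT) => [h|i]; last by rewrite ltn_ord.
apply: (le_trans h); rewrite mulrA ler_wpM2r // mulrCA ger_pMr //.
by rewrite ler_pdivrMr // mul1r ler_nat.
Qed.

Lemma first_order_derive w : (forall i x, derivable w x (delta_mx 0 i)) ->
  (forall i, continuous (fun x => derive w x (delta_mx 0 i))) ->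
  forall x v (t : R), is_derive t 1 (fun s : R => w (x + s *: v))
    (\sum_i derive w (x + t *: v) (delta_mx 0 i) * v 0 i).
Proof.
move=> dw cw x v t.
set D := \sum_i _.
have L : (fun h : R => h^-1 *: (((fun s : R => w (x + s *: v)) \o shift t) (h *: 1) - w (x + t *: v)))
    @ 0^' --> D.
  apply/cvgrPdist_le => e e0.
  have e'0 : 0 < e / (`|v| + 1) by rewrite divr_gt0 // ltr_wpDl.
  have [r [r0 hr]] := first_order dw cw (x + t *: v) e'0.
  near=> h.
  have h0 : h != 0 by near: h; exact: nbhs_dnbhs_neq.
  have hn : 0 < `|h| by rewrite normr_gt0.
  have hv : `|h *: v| <= r.
    rewrite normrZ.
    have : `|h| <= r / (`|v| + 1).
      near: h; apply: dnbhs0_le; by rewrite divr_gt0 // ltr_wpDl.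
    rewrite ler_pdivlMr ?ltr_wpDl // => hh; apply: le_trans hh.
    by rewrite ler_wpM2l //; lra.
  have /= := hr _ hv.
  have -> : x + (h *: 1 + t) *: v = x + t *: v + h *: v.
    by rewrite scale1R scalerDl addrA addrAC.
  have -> : \sum_i derive w (x + t *: v) (delta_mx 0 i) * (h *: v) 0 i = h * D.
    by rewrite /D mulr_sumr; apply: eq_bigr => i _; rewrite mxE mulrCA.
  move: (w _ - w _) => W hW.
  have -> : D - h^-1 *: W = - (h^-1 * (W - h * D)).
    by rewrite /GRing.scale /=; field.
  rewrite normrN normrM normrV ?unitfE // mulrC ler_pdivrMr //.
  apply: (le_trans hW); rewrite normrZ mulrC -mulrA [leRHS]mulrC ler_wpM2l //.
  rewrite mulrCA ger_pMr // ler_pdivrMr ?ltr_wpDl // mul1r; lra.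
split; first by apply/cvg_ex; exists D.
exact: cvg_lim.
Unshelve. all: by end_near. Qed.

(** The mean value theorem on [0, 1] is applied to the second order remainder along the segment; its
    derivative is the first order remainder of the gradient, small by [first_order]. *)
Lemma Ck2_C2 u : Ck 2 u ->
  C2 u (fun x => \row_i pder [:: i] u x) (fun x => \matrix_(i, j) pder [:: i; j] u x).
Proof.
case=> uc ud.
have d1 i x : derivable u x (delta_mx 0 i) by apply: (ud [::] i x).
have c1 i : continuous (fun x => derive u x (delta_mx 0 i)) by apply: (uc [:: i]).
have d2 j i x : derivable (pder [:: j] u) x (delta_mx 0 i) by apply: (ud [:: j]).
have c2 i j : continuous (fun x => derive (pder [:: j] u) x (delta_mx 0 i)).
  by apply: (uc [:: i; j]).
split; last 3 first.
- by apply: (uc [::]).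
- move=> i; have -> : (fun x => (\row_i0 pder [:: i0] u x) 0 i) = pder [:: i] u.
    by apply/funext => x; rewrite mxE.
  exact: (uc [:: i]).
- move=> i j.
  have -> : (fun x => (\matrix_(i0, j0) pder [:: i0; j0] u x) i j) = pder [:: i; j] u.
    by apply/funext => x; rewrite mxE.
  exact: (uc [:: i; j]).
move=> x e e0; have e'0 : 0 < e / n.+1%:R by rewrite divr_gt0.
have /choice[r rP] : forall j, exists r, 0 < r /\ forall v, `|v| <= r ->
   `|pder [:: j] u (x + v) - pder [:: j] u x
     - \sum_i derive (pder [:: j] u) x (delta_mx 0 i) * v 0 i| <= e / n.+1%:R * `|v|.
  by move=> j; apply: first_order => //; exact: d2.
have [d [d0 hd]] : exists d : R, 0 < d /\ forall i, i \in enum 'I_n -> d <= r i.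
  by apply: min_pos => i; case: (rP i).
exists d; split => // v vd.
set D := dot _ v; set q := qf _ v v.
pose g (t : R) := u (x + t *: v) - t * D - t ^+ 2 * q / 2.
pose g' (t : R) := \sum_i pder [:: i] u (x + t *: v) * v 0 i - D - t * q.
have gd (t : R) : is_derive t 1 g (g' t).
  have h1 := first_order_derive d1 c1 x v t.
  have h2 : is_derive t 1 (fun t : R => t * D) D.
    by apply: is_derive_eq; rewrite scaler0 add0r /GRing.scale /= mulr1.
  have h3 : is_derive t 1 (fun t : R => t ^+ 2 * q / 2) (t * q).
    apply: is_derive_eq; rewrite !scaler0 !add0r !scale1R; rewrite /GRing.scale /=; lra.
  exact: is_derive_eq.
have gc (a b : R) : {within `[a, b], continuous g}.
  apply: derivable_within_continuous => s _; by case: (gd s).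
have [t + h] := MVT_segment ler01 (fun s _ => gd s) (gc 0 1).
rewrite in_itv /= => /andP[t0 t1].
move: h; rewrite /g !scale1r !scale0r addr0 !mul0r expr0n /= !mul0r !subr0 mulr1 expr1n !mul1r.
have -> : u (x + v) - D - q / 2 - u x = u (x + v) - u x - D - q / 2 by ring.
move=> ->.
have -> : g' t = \sum_j (pder [:: j] u (x + t *: v) - pder [:: j] u x
   - \sum_i derive (pder [:: j] u) x (delta_mx 0 i) * (t *: v) 0 i) * v 0 j.
  rewrite /g' /D /dot /q /qf -sumrB exchange_big /= mulr_sumr -sumrB; apply: eq_bigr => j _.
  rewrite mxE !mulrBl; congr (_ - _); rewrite mulr_sumr mulr_suml; apply: eq_bigr => i _.
  by rewrite !mxE /=; ring.
apply: (le_trans (ler_norm_sum _ _ _)).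
apply: (@le_trans _ _ (\sum_(j < n) (e / n.+1%:R * `|v|) * `|v|)).
  apply: ler_sum => j _; rewrite normrM; apply: ler_pM => //; last exact: row_norm_le.
  have tv : `|t *: v| <= `|v|.
    by rewrite normrZ ger0_norm // -[leRHS]mul1r ler_wpM2r.
  have [_ h] := rP j; apply: le_trans (h _ _) _.
    apply: le_trans tv (le_trans vd _); apply: hd; by rewrite mem_enum.
  by rewrite ler_wpM2l // ltW.
rewrite sumr_const card_ord -[leLHS]mulr_natl -mulrA -expr2 mulrA ler_wpM2r ?exprn_ge0 //.
by rewrite mulrCA ger_pMr // ler_pdivrMr // mul1r ler_nat.
Qed.

End Taylor.

Section Closure.
Variables (R : realType) (n : nat).
Implicit Types (x v : 'rV[R]_n) (u : 'rV[R]_n -> R).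

Lemma dotDl (g h v : 'rV[R]_n) : dot (g + h) v = dot g v + dot h v.
Proof. by rewrite /dot -big_split /=; apply: eq_bigr => i _; rewrite mxE mulrDl. Qed.

Lemma dotZl (c : R) (g v : 'rV[R]_n) : dot (c *: g) v = c * dot g v.
Proof. by rewrite /dot mulr_sumr; apply: eq_bigr => i _; rewrite mxE mulrA. Qed.

Lemma dot0l (v : 'rV[R]_n) : dot 0 v = 0.
Proof. by rewrite /dot big1 // => i _; rewrite mxE mul0r. Qed.

Lemma qfDl (H1 H2 : 'M[R]_n) v w : qf (H1 + H2) v w = qf H1 v w + qf H2 v w.
Proof.
rewrite /qf -big_split /=; apply: eq_bigr => i _; rewrite -big_split /=.
by apply: eq_bigr => j _; rewrite mxE mulrDl.
Qed.

Lemma qfZl c (H1 : 'M[R]_n) v w : qf (c *: H1) v w = c * qf H1 v w.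
Proof.
rewrite /qf mulr_sumr; apply: eq_bigr => i _; rewrite mulr_sumr.
by apply: eq_bigr => j _; rewrite mxE -mulrA.
Qed.

Lemma qf0l v w : qf (0 : 'M[R]_n) v w = 0.
Proof. by rewrite /qf big1 // => i _; rewrite big1 // => j _; rewrite mxE mul0r. Qed.

Lemma qf_outer (g h v w : 'rV[R]_n) : qf (g^T *m h) v w = dot g v * dot h w.
Proof.
rewrite /qf /dot mulr_suml; apply: eq_bigr => i _; rewrite mulr_sumr.
by apply: eq_bigr => j _; rewrite mxE big_ord1 mxE; ring.
Qed.

(** Quantitative companion of [C2]: one constant for the function, its derivatives and a cubic
    remainder at all points. The Peano form gives no rate, and the comparison with lattice
    differences needs one. *)
Definition t3 (K : R) u (G : 'rV[R]_n -> 'rV[R]_n) (H : 'rV[R]_n -> 'M[R]_n) := forall x, [/\ `|u x| <= K, forall i, `|G x 0 i| <= K,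
  forall i j, `|H x i j| <= K & forall v, `|v| <= 1 ->
  `|u (x + v) - u x - dot (G x) v - qf (H x) v v / 2| <= K * `|v| ^+ 3].

Definition gmul u1 (G1 : 'rV[R]_n -> 'rV[R]_n) u2 (G2 : 'rV[R]_n -> 'rV[R]_n) x := u1 x *: G2 x + u2 x *: G1 x.
Definition hmul u1 (G1 : 'rV[R]_n -> 'rV[R]_n) (H1 : 'rV[R]_n -> 'M[R]_n)
  u2 (G2 : 'rV[R]_n -> 'rV[R]_n) (H2 : 'rV[R]_n -> 'M[R]_n) x : 'M[R]_n :=
  u1 x *: H2 x + u2 x *: H1 x + (G1 x)^T *m G2 x + (G2 x)^T *m G1 x.

(** Algebra common to both product rules, with [rho] left free: a small multiple of the squared norm
    of [v] serves the Peano remainder, a multiple of its cube the cubic one. *)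
Lemma prod_remainder (K s rho u1 l1 Q1 r1 u2 l2 Q2 r2 : R) :
  0 <= s <= 1 -> 0 <= rho <= K ->
  `|u1| <= K -> `|l1| <= K * s -> `|Q1| <= K * s ^+ 2 -> `|r1| <= rho ->
  `|u2| <= K -> `|l2| <= K * s -> `|Q2| <= K * s ^+ 2 -> `|r2| <= rho ->
  `|(u1 + l1 + Q1 + r1) * (u2 + l2 + Q2 + r2) - u1 * u2 - (u1 * l2 + u2 * l1)
    - (u1 * Q2 + u2 * Q1 + l1 * l2)| <= 3 * K ^+ 2 * s ^+ 3 + 7 * K * rho.
Proof.
move=> /andP[s0 s1] /andP[rho0 rhoK] hu1 hl1 hQ1 hr1 hu2 hl2 hQ2 hr2.
have K0 : 0 <= K by exact: le_trans rhoK.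
have s2 : s ^+ 2 <= 1 by rewrite expr_le1.
have nM (a b A B : R) : `|a| <= A -> `|b| <= B -> `|a * b| <= A * B.
  by move=> ha hb; rewrite normrM ler_pM.
have Ks : K * s <= K by nra.
have Ks2 : K * s ^+ 2 <= K by nra.
have -> : (u1 + l1 + Q1 + r1) * (u2 + l2 + Q2 + r2) - u1 * u2 - (u1 * l2 + u2 * l1)
    - (u1 * Q2 + u2 * Q1 + l1 * l2)
  = (l1 * Q2 + Q1 * l2 + Q1 * Q2) + (r1 * (u2 + l2 + Q2 + r2) + (u1 + l1 + Q1) * r2) by ring.
have A1 := nM _ _ _ _ hl1 hQ2; have A2 := nM _ _ _ _ hQ1 hl2; have A3 := nM _ _ _ _ hQ1 hQ2.
have B2 : `|u2 + l2 + Q2 + r2| <= 4 * K.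
  apply: (le_trans (ler_normD _ _)).
  by move: (ler_normD (u2 + l2) Q2) (ler_normD u2 l2); lra.
have B1 : `|u1 + l1 + Q1| <= 3 * K.
  apply: (le_trans (ler_normD _ _)).
  by move: (ler_normD u1 l1); lra.
have A4 := nM _ _ _ _ hr1 B2; have A5 := nM _ _ _ _ B1 hr2.
apply: (le_trans (ler_normD _ _)); apply: lerD.
  apply: (le_trans (ler_normD _ _)); move: (ler_normD (l1 * Q2) (Q1 * l2)).
  have : K * s * (K * s ^+ 2) = K ^+ 2 * s ^+ 3 by ring.
  have : K * s ^+ 2 * (K * s) = K ^+ 2 * s ^+ 3 by ring.
  have : K * s ^+ 2 * (K * s ^+ 2) <= K ^+ 2 * s ^+ 3.
    have -> : K * s ^+ 2 * (K * s ^+ 2) = K ^+ 2 * s ^+ 3 * s by ring.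
    by rewrite ler_piMr // mulr_ge0 // exprn_ge0.
  lra.
apply: (le_trans (ler_normD _ _)); lra.
Qed.

Lemma C2_cst (c : R) : C2 (fun _ : 'rV[R]_n => c) (fun=> 0) (fun=> 0).
Proof.
split=> [x e e0|x|i x|i j x]; try exact: cst_continuous.
exists 1; split => // v _; rewrite dot0l qf0l subrr mul0r !subr0 normr0.
by rewrite mulr_ge0 ?exprn_ge0 // ltW.
Qed.

Lemma C2D u1 G1 H1 u2 G2 H2 : C2 u1 G1 H1 -> C2 u2 G2 H2 ->
  C2 (fun x => u1 x + u2 x) (fun x => G1 x + G2 x) (fun x => H1 x + H2 x).
Proof.
move=> [t1 c1 g1 h1] [t2 c2 g2 h2]; split=> [x e e0|x|i|i j].
- have e2 : 0 < e / 2 by rewrite divr_gt0.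
  have [r1 [r10 hr1]] := t1 x _ e2; have [r2 [r20 hr2]] := t2 x _ e2.
  exists (Num.min r1 r2); split => [|v]; first by rewrite lt_min r10.
  rewrite le_min => /andP[/hr1 A1 /hr2 A2]; rewrite dotDl qfDl.
  have -> : u1 (x + v) + u2 (x + v) - (u1 x + u2 x) - (dot (G1 x) v + dot (G2 x) v)
      - (qf (H1 x) v v + qf (H2 x) v v) / 2
    = (u1 (x + v) - u1 x - dot (G1 x) v - qf (H1 x) v v / 2)
     + (u2 (x + v) - u2 x - dot (G2 x) v - qf (H2 x) v v / 2) by lra.
  by apply: (le_trans (ler_normD _ _)); lra.
- exact: (cvgD (c1 x) (c2 x)).
- have -> : (fun x => (G1 x + G2 x) 0 i) = (fun x => G1 x 0 i + G2 x 0 i).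
    by apply/funext => x; rewrite mxE.
  by move=> x; exact: (cvgD (g1 i x) (g2 i x)).
- have -> : (fun x => (H1 x + H2 x) i j) = (fun x => H1 x i j + H2 x i j).
    by apply/funext => x; rewrite mxE.
  by move=> x; exact: (cvgD (h1 i j x) (h2 i j x)).
Qed.

Lemma C2M u1 G1 H1 u2 G2 H2 : C2 u1 G1 H1 -> C2 u2 G2 H2 ->
  C2 (fun x => u1 x * u2 x) (gmul u1 G1 u2 G2) (hmul u1 G1 H1 u2 G2 H2).
Proof.
move=> [t1 c1 g1 h1] [t2 c2 g2 h2]; split=> [x e e0|x|i|i j].
- pose S (G : 'rV[R]_n) (H : 'M[R]_n) : R := \sum_i `|G 0 i| + \sum_i \sum_j `|H i j|.
  pose B := S (G1 x) (H1 x) + S (G2 x) (H2 x).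
  have S0 G H : 0 <= S G H.
    by rewrite addr_ge0 ?sumr_ge0 // => i _; rewrite sumr_ge0.
  have GB (G : 'rV[R]_n) (H : 'M[R]_n) i : `|G 0 i| <= S G H.
    rewrite /S (bigD1 i) //= -addrA lerDl addr_ge0 ?sumr_ge0 // => j _; by rewrite sumr_ge0.
  have HB (G : 'rV[R]_n) (H : 'M[R]_n) i j : `|H i j| <= S G H.
    apply: (@le_trans _ _ (\sum_i \sum_j `|H i j|)); last by rewrite lerDr sumr_ge0.
    rewrite (bigD1 i) //= (bigD1 j) //= -addrA lerDl addr_ge0 ?sumr_ge0 // => k _.
    by rewrite sumr_ge0.
  pose K := `|u1 x| + `|u2 x| + (n%:R + n%:R ^+ 2) * B + 1.
  have B0 : 0 <= B by rewrite addr_ge0.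
  have n0 : 0 <= n%:R :> R by [].
  have K1 : 1 <= K.
    by rewrite /K lerDr !addr_ge0 // mulr_ge0 // addr_ge0 // exprn_ge0.
  have K0 : 0 < K by exact: lt_le_trans K1.
  (* Both terms of [prod_remainder] must stay below half of the target: this gives [e / (14 * K)]
     here and [e / (6 * K ^+ 2)] in the radius [r]. *)
  pose e' := Num.min (e / (14 * K)) 1.
  have e'0 : 0 < e' by rewrite lt_min ltr01 divr_gt0 // mulr_gt0.
  have [r1 [r10 hr1]] := t1 x _ e'0; have [r2 [r20 hr2]] := t2 x _ e'0.
  pose r := Num.min (Num.min r1 r2) (Num.min 1 (e / (6 * K ^+ 2))).
  exists r; split => [|v]; first by rewrite !lt_min r10 r20 ltr01 divr_gt0 // mulr_gt0 // exprn_gt0.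
  rewrite !le_min => /andP[/andP[/hr1 A1 /hr2 A2] /andP[v1 v2]].
  have dK (G : 'rV[R]_n) (H : 'M[R]_n) : S G H <= B -> `|dot G v| <= K * `|v|.
    move=> SB; apply: (le_trans (dot_le v (GB G H))); apply: ler_wpM2r => //.
    have : n%:R * S G H <= n%:R * B by rewrite ler_wpM2l.
    have : 0 <= n%:R ^+ 2 * B by rewrite mulr_ge0 // exprn_ge0.
    rewrite /K mulrDl; have := normr_ge0 (u1 x); have := normr_ge0 (u2 x); lra.
  have qK (G : 'rV[R]_n) (H : 'M[R]_n) : S G H <= B -> `|qf H v v / 2| <= K * `|v| ^+ 2.
    move=> SB; rewrite normrM [X in _ * X]ger0_norm //.
    have := qf_le v v (HB G H); rewrite -expr2.
    have h3 : n%:R ^+ 2 * S G H * `|v| ^+ 2 <= K * `|v| ^+ 2.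
      apply: ler_wpM2r; first by rewrite exprn_ge0.
      have : n%:R ^+ 2 * S G H <= n%:R ^+ 2 * B by rewrite ler_wpM2l // exprn_ge0.
      have : 0 <= n%:R * B by rewrite mulr_ge0.
      rewrite /K mulrDl; have := normr_ge0 (u1 x); have := normr_ge0 (u2 x); lra.
    have := normr_ge0 (qf H v v); lra.
  have SB1 : S (G1 x) (H1 x) <= B by rewrite lerDl.
  have SB2 : S (G2 x) (H2 x) <= B by rewrite lerDr.
  have uK1 : `|u1 x| <= K.
    rewrite /K -!addrA lerDl !addr_ge0 // mulr_ge0 // addr_ge0 // exprn_ge0.
  have uK2 : `|u2 x| <= K.
    rewrite /K -!addrA addrCA lerDl !addr_ge0 // mulr_ge0 // addr_ge0 // exprn_ge0.
  have vv : 0 <= `|v| ^+ 2 <= 1 by rewrite exprn_ge0 // expr_le1.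
  have e'1 : e' <= 1 by rewrite /e' ge_min lexx orbT.
  have rhoK : 0 <= e' * `|v| ^+ 2 <= K.
    case/andP: vv => vv0 vv1; rewrite mulr_ge0 ?(ltW e'0) //=; apply: le_trans K1; by rewrite mulr_ile1 // ltW.
  have v01 : 0 <= `|v| <= 1 by rewrite normr_ge0.
  have := prod_remainder v01 rhoK uK1 (dK _ _ SB1) (qK _ _ SB1) A1 uK2 (dK _ _ SB2) (qK _ _ SB2) A2.
  rewrite /gmul /hmul !dotDl !dotZl !qfDl !qfZl !qf_outer.
  have E (a l q b : R) : a + l + q + (b - a - l - q) = b by ring.
  rewrite !E => h.
  have -> : u1 (x + v) * u2 (x + v) - u1 x * u2 x - (u1 x * dot (G2 x) v + u2 x * dot (G1 x) v) -
    (u1 x * qf (H2 x) v v + u2 x * qf (H1 x) v v + dot (G1 x) v * dot (G2 x) v +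
     dot (G2 x) v * dot (G1 x) v) / 2
   = u1 (x + v) * u2 (x + v) - u1 x * u2 x - (u1 x * dot (G2 x) v + u2 x * dot (G1 x) v) -
    (u1 x * (qf (H2 x) v v / 2) + u2 x * (qf (H1 x) v v / 2) + dot (G1 x) v * dot (G2 x) v) by field.
  apply: (le_trans h).
  have k1 : 7 * K * (e' * `|v| ^+ 2) <= e / 2 * `|v| ^+ 2.
    rewrite mulrA ler_wpM2r ?exprn_ge0 //.
    have : e' <= e / (14 * K) by rewrite /e' ge_min lexx.
    rewrite ler_pdivlMr ?mulr_gt0 //; lra.
  have k2 : 3 * K ^+ 2 * `|v| ^+ 3 <= e / 2 * `|v| ^+ 2.
    have -> : 3 * K ^+ 2 * `|v| ^+ 3 = 3 * K ^+ 2 * `|v| * `|v| ^+ 2 by ring.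
    rewrite ler_wpM2r ?exprn_ge0 //.
    move: v2; rewrite ler_pdivlMr ?mulr_gt0 ?exprn_gt0 //; lra.
  lra.
- exact: (cvgM (c1 x) (c2 x)).
- have -> : (fun x => gmul u1 G1 u2 G2 x 0 i) = (fun x => u1 x * G2 x 0 i + u2 x * G1 x 0 i).
    by apply/funext => x; rewrite /gmul !mxE.
  by move=> x; exact: (cvgD (cvgM (c1 x) (g2 i x)) (cvgM (c2 x) (g1 i x))).
- have -> : (fun x => hmul u1 G1 H1 u2 G2 H2 x i j)
    = (fun x => u1 x * H2 x i j + u2 x * H1 x i j + G1 x 0 i * G2 x 0 j + G2 x 0 i * G1 x 0 j).
    by apply/funext => x; rewrite /hmul !mxE !big_ord1 !mxE.
  by move=> x; exact: (cvgD (cvgD (cvgD (cvgM (c1 x) (h2 i j x)) (cvgM (c2 x) (h1 i j x)))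
    (cvgM (g1 i x) (g2 j x))) (cvgM (g2 i x) (g1 j x))).
Qed.

Lemma C2Z c u G H : C2 u G H -> C2 (fun x => c * u x) (fun x => c *: G x) (fun x => c *: H x).
Proof.
move=> Cu; have := C2M (C2_cst c) Cu.
by rewrite /gmul /hmul; under [X in C2 _ X _ -> _]eq_fun do rewrite scaler0 addr0;
  under [X in C2 _ _ X -> _]eq_fun do rewrite scaler0 trmx0 mul0mx mulmx0 !addr0.
Qed.

Lemma C2_sum (T : Type) (s : seq T) (u : T -> 'rV[R]_n -> R) (G : T -> 'rV[R]_n -> 'rV[R]_n)
  (H : T -> 'rV[R]_n -> 'M[R]_n) : (forall k : T, C2 (u k) (G k) (H k)) ->
  C2 (fun x => \sum_(k <- s) u k x) (fun x => \sum_(k <- s) G k x) (fun x => \sum_(k <- s) H k x).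
Proof.
move=> Cu; elim: s => [|k s IH].
  under [X in C2 X]eq_fun do rewrite big_nil.
  under [X in C2 _ X]eq_fun do rewrite big_nil.
  under [X in C2 _ _ X]eq_fun do rewrite big_nil.
  exact: C2_cst.
under [X in C2 X]eq_fun do rewrite big_cons.
under [X in C2 _ X]eq_fun do rewrite big_cons.
under [X in C2 _ _ X]eq_fun do rewrite big_cons.
exact: C2D.
Qed.

Lemma C2_affine (c : R) (d : 'rV[R]_n) u G H : 0 < c -> C2 u G H ->
  C2 (fun x => u (c *: (x - d))) (fun x => c *: G (c *: (x - d)))
     (fun x => c ^+ 2 *: H (c *: (x - d))).
Proof.
move=> c0 [t1 c1 g1 h1].
have cc f : continuous f -> continuous (fun x : 'rV[R]_n => f (c *: (x - d)) : R).
  move/cont_ed => fc; apply/cont_ed => x e e0; have [r [r0 hr]] := fc (c *: (x - d)) e e0.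
  exists (r / c); split=> [|v vr]; first by rewrite divr_gt0.
  rewrite addrAC scalerDr; apply: hr.
  by rewrite normrZ gtr0_norm // mulrC -ler_pdivlMr.
split=> [x e e0|x|i|i j].
- have e'0 : 0 < e / c ^+ 2 by rewrite divr_gt0 // exprn_gt0.
  have [r [r0 hr]] := t1 (c *: (x - d)) _ e'0.
  exists (r / c); split=> [|v vr]; first by rewrite divr_gt0.
  have cv : `|c *: v| <= r.
    by rewrite normrZ gtr0_norm // mulrC -ler_pdivlMr.
  have := hr _ cv; rewrite dotZ qfZ dotZl qfZl normrZ gtr0_norm // exprMn mulrA divfK ?gt_eqF ?exprn_gt0 //.
  by rewrite -scalerDr [x - d + v]addrAC.
- exact: cc c1 x.
- have -> : (fun x => (c *: G (c *: (x - d))) 0 i) = (fun x => c * G (c *: (x - d)) 0 i).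
    by apply/funext => x; rewrite mxE.
  by move=> x; exact: (cvgM (cvg_cst c) (cc _ (g1 i) x)).
- have -> : (fun x => (c ^+ 2 *: H (c *: (x - d))) i j) = (fun x => c ^+ 2 * H (c *: (x - d)) i j).
    by apply/funext => x; rewrite mxE.
  by move=> x; exact: (cvgM (cvg_cst (c ^+ 2)) (cc _ (h1 i j) x)).
Qed.

Lemma t3M K1 u1 G1 H1 K2 u2 G2 H2 : t3 K1 u1 G1 H1 -> t3 K2 u2 G2 H2 ->
  exists K, t3 K (fun x => u1 x * u2 x) (gmul u1 G1 u2 G2) (hmul u1 G1 H1 u2 G2 H2).
Proof.
move=> T1 T2; pose B := `|K1| + `|K2|.
have B0 : 0 <= B by rewrite addr_ge0.
have K1B : K1 <= B by have := ler_norm K1; have := normr_ge0 K2; rewrite /B; lra.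
have K2B : K2 <= B by have := ler_norm K2; have := normr_ge0 K1; rewrite /B; lra.
pose K := (n%:R + n%:R ^+ 2 + 1) * B.
have n0 : 0 <= n%:R :> R by [].
have n2 : 0 <= n%:R ^+ 2 :> R by rewrite exprn_ge0.
have BK : B <= K by rewrite /K -[leLHS]mul1r ler_wpM2r //; lra.
have nBK : n%:R * B <= K by rewrite /K ler_wpM2r //; lra.
have n2BK : n%:R ^+ 2 * B <= K by rewrite /K ler_wpM2r //; lra.
have K0 : 0 <= K by exact: le_trans BK.
exists (4 * K ^+ 2 + 3 * K ^+ 2 + 7 * K * K) => x.
have [a1 a2 a3 a4] := T1 x; have [b1 b2 b3 b4] := T2 x.
have nM (a b : R) : `|a| <= K -> `|b| <= K -> `|a * b| <= K ^+ 2.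
  by move=> ha hb; rewrite normrM expr2 ler_pM.
have LK1 (a : R) : `|a| <= K1 -> `|a| <= K by move=> h; apply: le_trans h (le_trans K1B BK).
have LK2 (a : R) : `|a| <= K2 -> `|a| <= K by move=> h; apply: le_trans h (le_trans K2B BK).
have KK : 0 <= K ^+ 2 by rewrite exprn_ge0.
have KKK : 0 <= K * K by rewrite mulr_ge0.
split.
- have := nM _ _ (LK1 _ a1) (LK2 _ b1); lra.
- move=> i; rewrite /gmul !mxE.
  have := nM _ _ (LK1 _ a1) (LK2 _ (b2 i)); have := nM _ _ (LK2 _ b1) (LK1 _ (a2 i)).
  have := ler_normD (u1 x * G2 x 0 i) (u2 x * G1 x 0 i); lra.
- move=> i j; rewrite /hmul !mxE !big_ord1 !mxE.
  have := nM _ _ (LK1 _ a1) (LK2 _ (b3 i j)); have := nM _ _ (LK2 _ b1) (LK1 _ (a3 i j)).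
  have := nM _ _ (LK1 _ (a2 i)) (LK2 _ (b2 j)); have := nM _ _ (LK2 _ (b2 i)) (LK1 _ (a2 j)).
  move: (u1 x * H2 x i j) (u2 x * H1 x i j) (G1 x 0 i * G2 x 0 j) (G2 x 0 i * G1 x 0 j) => p q r s.
  have := ler_normD (p + q + r) s; have := ler_normD (p + q) r; have := ler_normD p q; lra.
move=> v v1.
have v0 : 0 <= `|v| by [].
have v3 : `|v| ^+ 3 <= 1 by rewrite expr_le1.
have v30 : 0 <= `|v| ^+ 3 by rewrite exprn_ge0.
have dK (G : 'rV[R]_n) : (forall i, `|G 0 i| <= B) -> `|dot G v| <= K * `|v|.
  move=> GB; apply: (le_trans (dot_le v GB)); exact: ler_wpM2r.
have qK (H : 'M[R]_n) : (forall i j, `|H i j| <= B) -> `|qf H v v / 2| <= K * `|v| ^+ 2.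
  move=> HB; rewrite normrM [X in _ * X]ger0_norm //.
  have := qf_le v v HB; rewrite -expr2 => h.
  have : n%:R ^+ 2 * B * `|v| ^+ 2 <= K * `|v| ^+ 2 by rewrite ler_wpM2r // exprn_ge0.
  have := normr_ge0 (qf H v v); lra.
have rhoK : 0 <= K * `|v| ^+ 3 <= K.
  by rewrite mulr_ge0 //= ler_piMr.
have A1 : `|u1 (x + v) - u1 x - dot (G1 x) v - qf (H1 x) v v / 2| <= K * `|v| ^+ 3.
  apply: le_trans (a4 v v1) _; rewrite ler_wpM2r //; exact: le_trans BK.
have A2 : `|u2 (x + v) - u2 x - dot (G2 x) v - qf (H2 x) v v / 2| <= K * `|v| ^+ 3.
  apply: le_trans (b4 v v1) _; rewrite ler_wpM2r //; exact: le_trans BK.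
have v01 : 0 <= `|v| <= 1 by rewrite normr_ge0.
have := prod_remainder v01 rhoK (LK1 _ a1) (dK _ (fun i => le_trans (a2 i) K1B))
  (qK _ (fun i j => le_trans (a3 i j) K1B)) A1 (LK2 _ b1) (dK _ (fun i => le_trans (b2 i) K2B))
  (qK _ (fun i j => le_trans (b3 i j) K2B)) A2.
rewrite /gmul /hmul !dotDl !dotZl !qfDl !qfZl !qf_outer.
have E (a l q b : R) : a + l + q + (b - a - l - q) = b by ring.
rewrite !E => h.
have -> : u1 (x + v) * u2 (x + v) - u1 x * u2 x - (u1 x * dot (G2 x) v + u2 x * dot (G1 x) v) -
    (u1 x * qf (H2 x) v v + u2 x * qf (H1 x) v v + dot (G1 x) v * dot (G2 x) v +
     dot (G2 x) v * dot (G1 x) v) / 2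
   = u1 (x + v) * u2 (x + v) - u1 x * u2 x - (u1 x * dot (G2 x) v + u2 x * dot (G1 x) v) -
    (u1 x * (qf (H2 x) v v / 2) + u2 x * (qf (H1 x) v v / 2) + dot (G1 x) v * dot (G2 x) v) by field.
apply: (le_trans h); have := mulr_ge0 KK v30; lra.
Qed.

End Closure.

Section Lsub.
Variables (R : realType) (m k : nat).

Lemma dot_row_mx0 (g : 'rV[R]_m) (v : 'rV[R]_(m + k)) :
  dot (row_mx g 0) v = dot g (lsubmx v).
Proof.
rewrite /dot big_split_ord /= [X in _ + X]big1 ?addr0 => [|i _].
  by apply: eq_bigr => i _; rewrite row_mxEl mxE.
by rewrite row_mxEr mxE mul0r.
Qed.

Lemma qf_block_mx0 (H : 'M[R]_m) (v w : 'rV[R]_(m + k)) :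
  qf (block_mx H 0 0 0) v w = qf H (lsubmx v) (lsubmx w).
Proof.
rewrite /qf big_split_ord /= [X in _ + X]big1 ?addr0 => [|i _].
  apply: eq_bigr => i _; rewrite big_split_ord /= [X in _ + X]big1 ?addr0 => [|j _].
    by apply: eq_bigr => j _; rewrite block_mxEul !mxE.
  by rewrite block_mxEur mxE mul0r.
rewrite big_split_ord /= !big1 ?addr0 // => j _.
  by rewrite block_mxEdr mxE mul0r.
by rewrite block_mxEdl mxE mul0r.
Qed.

Lemma lsubmx_norm (v : 'rV[R]_(m + k)) : `|lsubmx v| <= `|v|.
Proof. by apply/row_normP => // i; rewrite mxE; exact: row_norm_le. Qed.

Lemma rsubmx_norm (v : 'rV[R]_(m + k)) : `|rsubmx v| <= `|v|.
Proof. by apply/row_normP => // i; rewrite mxE; exact: row_norm_le. Qed.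

Lemma cont_lsub (f : 'rV[R]_m -> R) : continuous f ->
  continuous (fun x : 'rV[R]_(m + k) => f (lsubmx x)).
Proof.
move/cont_ed => fc; apply/cont_ed => x e e0.
have [r [r0 hr]] := fc (lsubmx x) e e0; exists r; split => // v vr.
by rewrite linearD; apply: hr; apply: le_trans vr; exact: lsubmx_norm.
Qed.

Lemma cont_rsub (f : 'rV[R]_k -> R) : continuous f ->
  continuous (fun x : 'rV[R]_(m + k) => f (rsubmx x)).
Proof.
move/cont_ed => fc; apply/cont_ed => x e e0.
have [r [r0 hr]] := fc (rsubmx x) e e0; exists r; split => // v vr.
by rewrite linearD; apply: hr; apply: le_trans vr; exact: rsubmx_norm.
Qed.

Lemma C2_lsub (u : 'rV[R]_m -> R) G H : C2 u G H ->
  C2 (fun x : 'rV[R]_(m + k) => u (lsubmx x)) (fun x => row_mx (G (lsubmx x)) 0)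
     (fun x => block_mx (H (lsubmx x)) 0 0 0).
Proof.
move=> [t c g h]; split.
- move=> x e e0; have [r [r0 hr]] := t (lsubmx x) e e0.
  exists r; split => // v vr; rewrite dot_row_mx0 qf_block_mx0 linearD /=.
  apply: (le_trans (hr _ (le_trans (lsubmx_norm v) vr))).
  by rewrite ler_wpM2l ?(ltW e0) // lerXn2r ?nnegrE // lsubmx_norm.
- exact: cont_lsub.
- move=> i; case: (split_ordP i) => j ->.
    have -> : (fun x : 'rV[R]_(m + k) => (row_mx (G (lsubmx x)) 0 : 'rV[R]_(m + k)) 0 (lshift k j))
      = (fun x => G (lsubmx x) 0 j) by apply/funext => x; rewrite row_mxEl.
    exact: cont_lsub (g j).
  have -> : (fun x : 'rV[R]_(m + k) => (row_mx (G (lsubmx x)) 0 : 'rV[R]_(m + k)) 0 (rshift m j))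
      = (fun=> 0) by apply/funext => x; rewrite row_mxEr mxE.
  exact: cst_continuous.
- move=> i j; case: (split_ordP i) => i' ->; case: (split_ordP j) => j' ->.
  + have -> : (fun x : 'rV[R]_(m + k) => (block_mx (H (lsubmx x)) 0 0 0 : 'M[R]_(m + k)) (lshift k i') (lshift k j'))
      = (fun x => H (lsubmx x) i' j') by apply/funext => x; rewrite block_mxEul.
    exact: cont_lsub (h i' j').
  + rewrite [X in continuous X](_ : _ = fun=> 0); first exact: cst_continuous.
    by apply/funext => x; rewrite block_mxEur mxE.
  + rewrite [X in continuous X](_ : _ = fun=> 0); first exact: cst_continuous.
    by apply/funext => x; rewrite block_mxEdl mxE.
  + rewrite [X in continuous X](_ : _ = fun=> 0); first exact: cst_continuous.
    by apply/funext => x; rewrite block_mxEdr mxE.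
Qed.

End Lsub.

(** * Interpolation of lattice functions *)

Section Bump.
Variable R : realType.

(** [beta] is the cube of this positive part: the lowest integer power with a Lipschitz second
    derivative. Two derivatives and a cubic remainder suffice, so an explicit piecewise polynomial
    replaces a smooth bump. *)
Definition ppart (t : R) : R := Num.max 0 (1 - t ^+ 2).
Definition beta (t : R) : R := ppart t ^+ 3.
Definition beta' (t : R) : R := - (6 * t * ppart t ^+ 2).
Definition beta'' (t : R) : R := - (6 * ppart t ^+ 2) + 24 * t ^+ 2 * ppart t.

Lemma ppart_ge0 t : 0 <= ppart t. Proof. by rewrite le_max lexx. Qed.

Lemma ppart_le1 t : ppart t <= 1.
Proof. by rewrite ge_max ler01 gerBl sqr_ge0. Qed.

Lemma ppart_out t : 1 <= `|t| -> ppart t = 0.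
Proof.
move=> t1; apply/max_idPl; rewrite subr_le0 -(real_normK (num_real t)).
by rewrite expr_ge1.
Qed.

Lemma beta_ge0 t : 0 <= beta t. Proof. by rewrite exprn_ge0 // ppart_ge0. Qed.

Lemma beta_le1 t : beta t <= 1.
Proof. by rewrite expr_le1 // ?ppart_ge0 ?ppart_le1. Qed.

Lemma beta_out t : 1 <= `|t| -> beta t = 0.
Proof. by move=> t1; rewrite /beta ppart_out // expr0n. Qed.

Lemma beta_in t : `|t| <= 2^-1 -> 27 / 64 <= beta t.
Proof.
move=> t1; have : 3 / 4 <= ppart t.
  rewrite le_max; apply/orP; right; rewrite -(real_normK (num_real t)).
  by have := normr_ge0 t; nra.
move=> h; have -> : 27 / 64 = (3 / 4) ^+ 3 :> R by field.
by rewrite /beta lerXn2r ?nnegrE // ?ppart_ge0.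
Qed.

Lemma cube_plus (s d : R) :
  `|Num.max 0 (s + d) ^+ 3 - Num.max 0 s ^+ 3 - 3 * Num.max 0 s ^+ 2 * d
    - 3 * Num.max 0 s * d ^+ 2| <= `|d| ^+ 3.
Proof.
have [s0|s0] := leP 0 s; have [sd0|sd0] := leP 0 (s + d).
- rewrite (_ : _ - _ = d ^+ 3); last by ring.
  by rewrite normrX.
- have d0 : d <= 0 by lra.
  have -> : 0 ^+ 3 - s ^+ 3 - 3 * s ^+ 2 * d - 3 * s * d ^+ 2 = (- (s + d)) ^+ 3 - (- d) ^+ 3 by ring.
  have h1 : 0 <= (- (s + d)) ^+ 3 by rewrite exprn_ge0; lra.
  have h2 : (- (s + d)) ^+ 3 <= (- d) ^+ 3 by rewrite lerXn2r ?nnegrE; lra.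
  by rewrite (ler0_norm d0) ler_norml; apply/andP; split; lra.
- have d0 : 0 <= d by lra.
  rewrite !expr0n /= !mulr0 !mul0r !subr0 (ger0_norm d0) ger0_norm ?exprn_ge0 //.
  by rewrite lerXn2r ?nnegrE; lra.
- rewrite !expr0n /= !mulr0 !mul0r !subr0 normr0 exprn_ge0 //.
Qed.

(** [cube_plus] is used at [s = 1 - t^2] with its increment [d]; the terms of order at least three
    in [r] are the only further error. If [t] is at least 2 in modulus, everything vanishes. The
    constant 200 is generous and shared with the bounds on the derivatives. *)
Lemma beta_taylor t r : `|r| <= 1 ->
  `|beta (t + r) - beta t - beta' t * r - beta'' t * r ^+ 2 / 2| <= 200 * `|r| ^+ 3.
Proof.
move=> r1; have r3 : 0 <= `|r| ^+ 3 by rewrite exprn_ge0.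
have [t2|t2] := leP 2 `|t|.
  have h1 : 1 <= `|t + r|.
    have : `|t| - `|r| <= `|t + r| by exact: lerB_dist_normD || rewrite lerBlDr -[X in `|X| <= _](addrK r t) ler_normB.
    lra.
  rewrite (beta_out h1) (@beta_out t) /beta' /beta'' ?(@ppart_out t); try lra.
  by rewrite !expr0n /= !mulr0 oppr0 !mul0r add0r !mul0r !subr0 normr0 mulr_ge0.
pose s := 1 - t ^+ 2; pose d := - (2 * t * r) - r ^+ 2.
have sd : 1 - (t + r) ^+ 2 = s + d by rewrite /s /d; ring.
have := cube_plus s d; rewrite -sd -/(ppart t) -/(ppart (t + r)).
rewrite -/(beta t) -/(beta (t + r)); set p := ppart t => h.
have p0 : 0 <= p by exact: ppart_ge0.
have p1 : p <= 1 by exact: ppart_le1.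
have -> : beta (t + r) - beta t - beta' t * r - beta'' t * r ^+ 2 / 2
  = (beta (t + r) - beta t - 3 * p ^+ 2 * d - 3 * p * d ^+ 2) + 3 * p * (4 * t + r) * r ^+ 3.
  by rewrite /beta' /beta'' -/p /d; field.
apply: (le_trans (ler_normD _ _)).
have dr : `|d| <= 5 * `|r|.
  have -> : d = - ((2 * t + r) * r) by rewrite /d; ring.
  rewrite normrN normrM; apply: ler_pM => //.
  by apply: (le_trans (ler_normD _ _)); rewrite normrM ger0_norm //; lra.
have d3 : `|d| ^+ 3 <= 125 * `|r| ^+ 3.
  have -> : 125 * `|r| ^+ 3 = (5 * `|r|) ^+ 3 by ring.
  by rewrite lerXn2r ?nnegrE // mulr_ge0.
have e3 : `|3 * p * (4 * t + r) * r ^+ 3| <= 27 * `|r| ^+ 3.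
  rewrite normrM normrX ler_wpM2r // normrM.
  have : `|4 * t + r| <= 9.
    by apply: (le_trans (ler_normD _ _)); rewrite normrM ger0_norm //; lra.
  rewrite ger0_norm; last by rewrite mulr_ge0.
  by have := normr_ge0 (4 * t + r); nra.
lra.
Qed.

Lemma beta'_le t : `|beta' t| <= 200.
Proof.
have p0 := ppart_ge0 t; have p1 := ppart_le1 t.
have [t1|t1] := leP 1 `|t|; first by rewrite /beta' ppart_out // expr0n mulr0 oppr0 normr0.
move: t1; rewrite ltr_norml => /andP[t1 t2].
have : ppart t ^+ 2 <= 1 by rewrite expr_le1.
have : 0 <= ppart t ^+ 2 by rewrite exprn_ge0.
rewrite /beta' -mulrA; move: (ppart t ^+ 2) => a a0 a1.
have h1 : - 1 <= t * a by nra.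
have h2 : t * a <= 1 by nra.
by rewrite ler_norml; apply/andP; split; lra.
Qed.

Lemma beta''_le t : `|beta'' t| <= 200.
Proof.
have p0 := ppart_ge0 t; have p1 := ppart_le1 t.
have [t1|t1] := leP 1 `|t|.
  by rewrite /beta'' ppart_out // expr0n !mulr0 oppr0 addr0 normr0.
have p2 : ppart t ^+ 2 <= 1 by rewrite expr_le1.
have p20 : 0 <= ppart t ^+ 2 by rewrite exprn_ge0.
have t2 : t ^+ 2 <= 1 by rewrite -(real_normK (num_real t)) expr_le1 // ltW.
have t20 := sqr_ge0 t.
have : t ^+ 2 * ppart t <= 1 by rewrite mulr_ile1.
have : 0 <= t ^+ 2 * ppart t by rewrite mulr_ge0.
rewrite /beta'' -[24 * _ * _]mulrA ler_norml; move: (t ^+ 2 * _) (ppart t ^+ 2) p2 p20 => a b ? ? ? ?.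
apply/andP; split; lra.
Qed.

Lemma ppart_cont : continuous ppart.
Proof.
have -> : ppart = (fun=> 0) \max (fun t : R => 1 - t ^+ 2) by apply/funext.
move=> t; apply: (@continuous_max _ R _ _ t); first exact: cst_continuous.
by apply: cvgB; [exact: cvg_cst | exact: exprn_continuous].
Qed.

Lemma beta_cont : [/\ continuous beta, continuous beta' & continuous beta''].
Proof.
have pX k : continuous (fun t => ppart t ^+ k).
  by move=> t; apply: (@continuous_comp _ _ _ ppart (fun x => x ^+ k));
    [exact: ppart_cont | exact: exprn_continuous].
split=> t.
- exact: pX.
- apply: cvgN; apply: cvgM; last exact: pX.
  by apply: cvgM; [exact: cvg_cst | exact: cvg_id].
- apply: cvgD.
    by apply: cvgN; apply: cvgM; [exact: cvg_cst | exact: pX].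
  apply: cvgM; last exact: ppart_cont.
  by apply: cvgM; [exact: cvg_cst | exact: exprn_continuous].
Qed.

Variable n : nat.

Definition bump1 (i : 'I_n) (x : 'rV[R]_n) : R := beta (x 0 i).

Lemma dot_delta (c : R) i (v : 'rV[R]_n) : dot (c *: delta_mx 0 i) v = c * v 0 i.
Proof.
rewrite dotZl /dot (bigD1 i) //= mxE !eqxx mul1r big1 ?addr0 // => j ji.
by rewrite mxE (negbTE ji) andbF mul0r.
Qed.

Lemma qf_delta (c : R) i (v w : 'rV[R]_n) : qf (c *: delta_mx i i) v w = c * (v 0 i * w 0 i).
Proof.
rewrite qfZl /qf (bigD1 i) //= (bigD1 i) //= mxE !eqxx mul1r.
rewrite !big1 ?addr0 // => [j ji|j ji]; last by rewrite mxE (negbTE ji) andbF mul0r.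
by rewrite big1 // => l _; rewrite mxE (negbTE ji) mul0r.
Qed.

Lemma cont_coord i (f : R -> R) : continuous f -> continuous (fun x : 'rV[R]_n => f (x 0 i)).
Proof.
by move=> fc x; apply: continuous_comp; [exact: coord_continuous | exact: fc].
Qed.

Lemma bump1_reg i : exists G H K, [/\ C2 (bump1 i) G H, t3 K (bump1 i) G H &
  forall x : 'rV[R]_n, 1 <= `|x 0 i| -> G x = 0 /\ H x = 0].
Proof.
have [b0 b1 b2] := beta_cont.
exists (fun x => beta' (x 0 i) *: delta_mx 0 i), (fun x => beta'' (x 0 i) *: delta_mx i i), 200.
have tay x v : `|v| <= 1 -> `|bump1 i (x + v) - bump1 i x - dot (beta' (x 0 i) *: delta_mx 0 i) v
   - qf (beta'' (x 0 i) *: delta_mx i i) v v / 2| <= 200 * `|v| ^+ 3.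
  move=> v1; have vi := row_norm_le v i.
  have := beta_taylor (x 0 i) (le_trans vi v1).
  rewrite dot_delta qf_delta /bump1 mxE -expr2 => h; apply: (le_trans h).
  by rewrite ler_wpM2l // lerXn2r ?nnegrE.
split; last 2 first.
- move=> x; split => [|j|j l|v v1]; last exact: tay.
  - by rewrite ger0_norm ?beta_ge0 //; have := beta_le1 (x 0 i); rewrite /bump1; lra.
  - rewrite !mxE; case: (_ && _); rewrite ?mulr1 ?mulr0 ?normr0 //; exact: beta'_le.
  - rewrite !mxE; case: (_ && _); rewrite ?mulr1 ?mulr0 ?normr0 //; exact: beta''_le.
- by move=> x x1; rewrite /beta' /beta'' ppart_out // expr0n !mulr0 oppr0 addr0 !scale0r.
split.
- move=> x e e0; exists (Num.min 1 (e / 200)); split=> [|v].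
    by rewrite lt_min ltr01 divr_gt0.
  rewrite le_min => /andP[v1 v2]; apply: (le_trans (tay x v v1)).
  have -> : 200 * `|v| ^+ 3 = 200 * `|v| * `|v| ^+ 2 by ring.
  by rewrite ler_wpM2r ?exprn_ge0 // mulrC -ler_pdivlMr.
- exact: cont_coord.
- move=> j; rewrite (_ : (fun x => _) = (fun x : 'rV[R]_n => beta' (x 0 i) * (delta_mx 0 i : 'rV[R]_n) 0 j)); last first.
    by apply/funext => x; rewrite mxE.
  by move=> x; exact: (cvgM (@cont_coord i _ b1 x) (cvg_cst ((delta_mx 0 i : 'rV[R]_n) 0 j))).
- move=> j l; rewrite (_ : (fun x => _) = (fun x : 'rV[R]_n => beta'' (x 0 i) * (delta_mx i i : 'M[R]_n) j l)); last first.
    by apply/funext => x; rewrite mxE.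
  by move=> x; exact: (cvgM (@cont_coord i _ b2 x) (cvg_cst ((delta_mx i i : 'M[R]_n) j l))).
Qed.

(** The product runs over a list, so that regularity follows by induction from [C2M] and [t3M]. *)
Definition bump (x : 'rV[R]_n) : R := \prod_(i <- enum 'I_n) beta (x 0 i).

Lemma bump_reg : exists G H K, [/\ C2 bump G H, t3 K bump G H &
  forall (x : 'rV[R]_n) i, 1 <= `|x 0 i| -> H x = 0].
Proof.
suff [G [H [K [c t o]]]] : exists G H K, [/\ C2 bump G H, t3 K bump G H &
  forall (x : 'rV[R]_n) (i : 'I_n), i \in enum 'I_n -> 1 <= `|x 0 i| -> G x = 0 /\ H x = 0].
  exists G, H, K; split => // x i xi; by case: (o x i _ xi); rewrite ?mem_enum.
rewrite /bump; elim: (enum 'I_n) => [|i s [G [H [K [c t o]]]]].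
  exists (fun=> 0), (fun=> 0), 1.
  under [X in C2 X]eq_fun do rewrite big_nil.
  under [X in t3 _ X]eq_fun do rewrite big_nil.
  split => //; first exact: C2_cst.
  move=> x; split => [|i|i j|v v1]; rewrite ?mxE ?normr0 ?normr1 //.
  by rewrite dot0l qf0l subrr mul0r !subr0 normr0 mul1r exprn_ge0.
have [G1 [H1 [K1 [c1 t1 o1]]]] := bump1_reg i.
have [K2 t2] := t3M t1 t.
exists (gmul (bump1 i) G1 (fun x => \prod_(i <- s) beta (x 0 i)) G).
exists (hmul (bump1 i) G1 H1 (fun x => \prod_(i <- s) beta (x 0 i)) G H), K2.
under [X in C2 X]eq_fun do rewrite big_cons.
under [X in t3 _ X]eq_fun do rewrite big_cons.
split => //; first exact: C2M.
move=> x j; rewrite in_cons => /orP[/eqP ->|js] xj.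
  have [g h] := o1 x xj; rewrite /gmul /hmul g h /bump1 beta_out // !scale0r !scaler0.
  by rewrite trmx0 mul0mx mulmx0 !addr0.
have [g h] := o x j js xj; rewrite /gmul /hmul g h.
have -> : \prod_(i0 <- s) beta (x 0 i0) = 0 by rewrite (big_rem j) //= beta_out // mul0r.
by rewrite !scale0r !scaler0 trmx0 mul0mx mulmx0 !addr0.
Qed.

Lemma bump_ge0 (x : 'rV[R]_n) : 0 <= bump x.
Proof. by rewrite prodr_ge0 // => i _; exact: beta_ge0. Qed.

Lemma bump_le1 (x : 'rV[R]_n) : bump x <= 1.
Proof.
rewrite /bump; elim: (enum 'I_n) => [|i s IH]; first by rewrite big_nil.
rewrite big_cons mulr_ile1 ?beta_ge0 ?beta_le1 // prodr_ge0 // => j _; exact: beta_ge0.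
Qed.

Lemma bump_out (x : 'rV[R]_n) i : 1 <= `|x 0 i| -> bump x = 0.
Proof.
by move=> xi; rewrite /bump big_enum (bigD1 i) //= beta_out // mul0r.
Qed.

Lemma bump_in (x : 'rV[R]_n) : (forall i, `|x 0 i| <= 2^-1) -> (27 / 64) ^+ n <= bump x.
Proof.
move=> xi; rewrite /bump big_enum -[X in _ ^+ X](card_ord n) -prodr_const /=.
apply: ler_prod => i _; rewrite beta_in // andbT; lra.
Qed.

End Bump.

(** * Lattice nodes and interpolation weights *)

Section Mesh.
Variables (R : realType) (m : nat).
Lemma sum_le_sub (T : eqType) (s t : seq T) (F : T -> R) : uniq s -> uniq t ->
  {subset s <= t} -> (forall k, k \in t -> 0 <= F k) -> \sum_(k <- s) F k <= \sum_(k <- t) F k.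
Proof.
move=> us ut st F0.
have pt : perm_eq t (s ++ [seq k <- t | k \notin s]).
  apply: uniq_perm => //.
    rewrite cat_uniq us filter_uniq // andbT /=; apply/hasPn => k.
    by rewrite mem_filter => /andP[].
  move=> k; rewrite mem_cat mem_filter; case: (boolP (k \in s)) => //= ks.
  by rewrite st.
rewrite (perm_big _ pt) big_cat /= lerDl big_seq sumr_ge0 // => k.
by rewrite mem_filter => /andP[_ /F0].
Qed.

Lemma sum_eq_supp (T : eqType) (s t : seq T) (F : T -> R) : uniq s -> uniq t ->
  (forall k, F k != 0 -> (k \in s) = (k \in t)) -> \sum_(k <- s) F k = \sum_(k <- t) F k.
Proof.
move=> us ut st.
have E r : \sum_(k <- r) F k = \sum_(k <- [seq k <- r | F k != 0]) F k.
  rewrite big_filter [LHS](bigID (fun k => F k == 0)) /= [X in X + _]big1 ?add0r //.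
  by move=> k /eqP.
rewrite E [RHS]E; apply: perm_big; apply: uniq_perm; rewrite ?filter_uniq // => k.
by rewrite !mem_filter; case: (boolP (F k != 0)) => //= /st.
Qed.

Implicit Types (k v : 'rV[int]_m) (y : 'rV[R]_m).

Lemma count_grid_cube (s : seq 'rV[int]_m) y (L : nat) : uniq s ->
  (forall k, k \in s -> forall i, `|(k 0 i)%:~R - y 0 i| <= L%:R / 2) ->
  (size s <= (L.+1) ^ m)%N.
Proof.
move=> us ks.
pose a i : int := Num.ceil (y 0 i - L%:R / 2).
have bd k i : k \in s -> 0 <= k 0 i - a i <= L%:Z.
  move=> /ks /(_ i); rewrite ler_distl => /andP[h1 h2].
  have h3 : a i <= k 0 i by rewrite /a ceil_le_int.
  rewrite subr_ge0 h3 /= lerBlDr -(ler_int R) rmorphD /=.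
  have := ceil_ge (y 0 i - L%:R / 2); rewrite -/(a i) => h4.
  have -> : (L%:Z)%:~R = L%:R :> R by [].
  lra.
pose g k : {ffun 'I_m -> 'I_L.+1} := [ffun i => inord `|k 0%R i - a i|%N].
have -> : (L.+1 ^ m)%N = #|{ffun 'I_m -> 'I_L.+1}| by rewrite card_ffun !card_ord.
have ug : uniq (map g s).
  rewrite map_inj_in_uniq // => k k' kin k'in E.
  apply/rowP => i; have := congr1 (fun h : {ffun 'I_m -> 'I_L.+1} => (h i : nat)) E.
  have /andP[p1 q1] := bd k i kin; have /andP[p2 q2] := bd k' i k'in.
  rewrite !ffunE !inordK; [|move: (k' 0%R i - a i) p2 q2 => z; lia|
    move: (k 0%R i - a i) p1 q1 => z; lia].
  move=> e; have : k 0 i - a i = k' 0 i - a i.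
    by rewrite -(gez0_abs p1) -(gez0_abs p2) e.
  by move/(congr1 (fun z => z + a i)); rewrite !subrK.
by rewrite -(size_map g) -(card_uniqP ug) max_card.
Qed.

Definition node (N : nat) k : 'rV[R]_m := \row_i ((k 0 i)%:~R / N%:R ^+ 4).

(** An interval of length 1/N holds about [N^3] nodes per coordinate, whence the divisor: on bounded
    sets the sum over the nodes lies between two constants independent of [N]. *)
Definition theta (N : nat) k y : R := bump (N%:R *: (y - node N k)) / N%:R ^+ (3 * m).

Lemma theta_ge0 N k y : 0 <= theta N k y.
Proof. by rewrite divr_ge0 ?bump_ge0. Qed.

Lemma theta_le N k y : theta N k y <= (N%:R ^+ (3 * m))^-1.
Proof. by rewrite -[X in _ <= X]mul1r ler_wpM2r ?bump_le1. Qed.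

Lemma theta_supp N k y : (0 < N)%N -> theta N k y != 0 ->
  forall i, `|y 0 i - node N k 0 i| < N%:R^-1.
Proof.
move=> N0 t i; have Np : 0 < N%:R :> R by rewrite ltr0n.
rewrite ltNge; apply: contraNN t => h; rewrite /theta (@bump_out _ _ _ i) ?mul0r //.
by rewrite !mxE normrM ger0_norm // mulrC -ler_pdivrMr // mul1r; move: h; rewrite mxE.
Qed.

Lemma theta_shift N k v y : theta N k (y + node N v) = theta N (k - v) y.
Proof.
rewrite /theta; congr (bump (_ *: _) / _); apply/rowP => i; rewrite !mxE.
rewrite intrD intrN; ring.
Qed.

Lemma inbox_theta N D k y : (0 < N)%N -> `|y| <= D%:R -> theta N k y != 0 ->
  inbox (D.+1 * N ^ 4) k.
Proof.
move=> N0 yD /(theta_supp N0) h; apply/inboxP => i.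
have N4 : 0 < N%:R ^+ 4 :> R by rewrite exprn_gt0 // ltr0n.
rewrite -(ler_nat R) natr_absz natrM natrX intr_norm -ler_pdivrMr //.
have := h i; rewrite mxE => hi; have yi := le_trans (row_norm_le y i) yD.
have N1 : N%:R^-1 <= 1 :> R by rewrite invf_le1 ?ltr0n // ler1n.
have -> : `|(k 0 i)%:~R| / N%:R ^+ 4 = `|(k 0 i)%:~R / N%:R ^+ 4| :> R.
  by rewrite normrM normfV (ger0_norm (ltW N4)).
rewrite -natr1; have := ler_normD ((k 0 i)%:~R / N%:R ^+ 4 - y 0 i) (y 0 i).
rewrite subrK distrC; lra.
Qed.

Lemma sum_theta_box N D P P' y (F : 'rV[int]_m -> R) : (0 < N)%N -> `|y| <= D%:R ->
  (D.+1 * N ^ 4 <= P)%N -> (D.+1 * N ^ 4 <= P')%N ->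
  \sum_(k <- zbox m P) theta N k y * F k = \sum_(k <- zbox m P') theta N k y * F k.
Proof.
move=> N0 yD hP hP'; apply: sum_eq_supp; rewrite ?zbox_uniq // => k.
rewrite mulf_eq0 negb_or => /andP[/(inbox_theta N0 yD) kb _].
by rewrite !mem_zbox (inboxW hP kb) (inboxW hP' kb).
Qed.

Lemma near_count N (s : seq 'rV[int]_m) y (L : nat) : (0 < N)%N -> uniq s ->
  \sum_(k <- s | [forall i, `|y 0 i - node N k 0 i| <= L%:R / N%:R]) (N%:R ^+ (3 * m))^-1
    <= (2 * L + 1)%:R ^+ m :> R.
Proof.
move=> N0 us; rewrite -big_filter big_const_seq count_predT iter_addr_0 -[_ *+ size _]mulr_natr.
have Np : 0 < N%:R :> R by rewrite ltr0n.
set s' := [seq _ <- _ | _].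
have : (size s' <= (2 * L * N ^ 3).+1 ^ m)%N.
  apply: (@count_grid_cube _ (N%:R ^+ 4 *: y)); first by rewrite filter_uniq.
  move=> k; rewrite mem_filter => /andP[/forallP h _] i; have := h i; rewrite !mxE => hi.
  have -> : (k 0 i)%:~R - N%:R ^+ 4 * y 0 i = - (N%:R ^+ 4 * (y 0 i - (k 0 i)%:~R / N%:R ^+ 4)) :> R.
    by field; rewrite gt_eqF.
  rewrite normrN normrM ger0_norm ?exprn_ge0 //.
  have -> : (2 * L * N ^ 3)%:R / 2 = N%:R ^+ 4 * (L%:R / N%:R) :> R.
    by rewrite natrM natrX natrM; field; rewrite gt_eqF.
  by rewrite ler_wpM2l ?exprn_ge0.
rewrite -(ler_nat R) natrX => h; rewrite mulrC ler_pdivrMr ?exprn_gt0 //; apply: (le_trans h).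
rewrite exprM -exprMn lerXn2r ?nnegrE ?mulr_ge0 ?exprn_ge0 //.
rewrite -natrX -natrM ler_nat mulnDl mul1n -addn1 leq_add2l expn_gt0 N0 //.
Qed.

Lemma sum_theta_le N (s : seq 'rV[int]_m) y : (0 < N)%N -> uniq s ->
  \sum_(k <- s) theta N k y <= 3 ^+ m.
Proof.
move=> N0 us; rewrite (bigID (fun k => theta N k y == 0)) /= big1 ?add0r; last by move=> k /eqP.
apply: (le_trans _ (near_count y 1 N0 us)).
rewrite big_mkcond [X in _ <= X]big_mkcond; apply: ler_sum => k _.
case: ifPn => [t|_]; last by case: ifP => // _; rewrite invr_ge0.
case: ifPn => [_|/forallPn[i]]; first exact: theta_le.
by rewrite mul1r ltW ?theta_supp.
Qed.

(** Starting at the integer part of [N^4 y], about [N^3 / 2] consecutive nodes per coordinate are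
    within half the bump width, where the bump is at least [(27 / 64)^m]. The bound [4 J >= N^3]
    turns this into [(27 / 256)^m]. *)
Lemma mass_ge N D P y : (1 < N)%N -> `|y| <= D%:R -> (D.+1 * N ^ 4 <= P)%N ->
  (27 / 256) ^+ m <= \sum_(k <- zbox m P) theta N k y.
Proof.
move=> N1 yD hP; have N0 : (0 < N)%N := ltnW N1.
have Np : 0 < N%:R :> R by rewrite ltr0n.
have N3 : (2 ^ 3 <= N ^ 3)%N by rewrite leq_exp2r.
pose J := (N ^ 3 %/ 2)%N.
have J0 : (2 <= J)%N by rewrite /J; lia.
have J4 : (N ^ 3 <= 4 * J)%N by rewrite /J; lia.
have J2 : (2 * J <= N ^ 3)%N by rewrite /J; lia.
pose kf (f : {ffun 'I_m -> 'I_J}) : 'rV[int]_m :=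
  \row_i (Num.floor (y 0 i * N%:R ^+ 4) + (f i)%:Z).
have kfE f i : (kf f 0 i)%:~R = (Num.floor (y 0 i * N%:R ^+ 4))%:~R + (f i)%:R :> R.
  by rewrite mxE intrD.
have kfi : injective kf.
  move=> f f' /rowP E; apply/ffunP => i; have := E i; rewrite !mxE => /addrI e.
  by apply/val_inj; case: e.
have th f : (27 / 64) ^+ m / N%:R ^+ (3 * m) <= theta N (kf f) y.
  rewrite ler_wpM2r ?invr_ge0 ?exprn_ge0 //; apply: bump_in => i.
  have nE : node N (kf f) 0 i = ((Num.floor (y 0 i * N%:R ^+ 4))%:~R + (f i)%:R) / N%:R ^+ 4.
    by rewrite [LHS]mxE kfE.
  rewrite 3!mxE nE.
  have -> : N%:R * (y 0 i - ((Num.floor (y 0 i * N%:R ^+ 4))%:~R + (f i)%:R) / N%:R ^+ 4)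
     = ((y 0 i * N%:R ^+ 4 - (Num.floor (y 0 i * N%:R ^+ 4))%:~R) - (f i)%:R) / N%:R ^+ 3 :> R.
    by field; rewrite gt_eqF.
  rewrite normrM normfV (ger0_norm (exprn_ge0 3 (ltW Np))) ler_pdivrMr ?exprn_gt0 //.
  have := floor_itv (y 0 i * N%:R ^+ 4); move=> /andP[]; rewrite intrD => f1 f2.
  have fJ : (f i)%:R + 1 <= J%:R :> R by rewrite natr1 ler_nat.
  have J2' : 2 * J%:R <= N%:R ^+ 3 :> R by rewrite -natrX -natrM ler_nat.
  have J0' : 2 <= J%:R :> R by rewrite (ler_nat R 2).
  have f0 : 0 <= (f i)%:R :> R by [].
  rewrite ler_norml; lra.
have kin f : kf f \in zbox m P.
  rewrite mem_zbox; apply: (inboxW hP); apply: (@inbox_theta _ _ _ y) => //.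
  by rewrite gt_eqF // (lt_le_trans _ (th f)) // divr_gt0 // exprn_gt0 //; lra.
apply: (@le_trans _ _ (\sum_(k <- [seq kf f | f : {ffun 'I_m -> 'I_J}]) theta N k y)); last first.
  apply: sum_le_sub; rewrite ?zbox_uniq //.
    by rewrite map_inj_uniq // enum_uniq.
    by move=> k /mapP[f _ ->].
  by move=> k _; exact: theta_ge0.
rewrite big_map big_enum /=.
apply: (@le_trans _ _ (\sum_(f : {ffun 'I_m -> 'I_J}) (27 / 64) ^+ m / N%:R ^+ (3 * m))); last exact: ler_sum.
rewrite sumr_const card_ffun !card_ord -[X in _ <= X]mulr_natl natrX exprM -exprVn -exprMn -exprMn.
have p0 : 0 <= J%:R * (27 / 64 / N%:R ^+ 3) :> R.
  by rewrite mulr_ge0 // divr_ge0 ?exprn_ge0 //; lra.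
have q0 : 0 <= 27 / 256 :> R by lra.
rewrite lerXn2r ?nnegrE //.
have : N%:R ^+ 3 <= 4 * J%:R :> R by rewrite -natrX -natrM ler_nat.
rewrite mulrA ler_pdivlMr ?exprn_gt0 //; lra.
Qed.

End Mesh.

Ltac pos := repeat first [ by [] | assumption | apply: mulr_ge0 | apply: divr_ge0 | rewrite invr_ge0
  | apply: exprn_ge0 | apply: addr_ge0 | by apply: ltW ].

Section Pucci.
Variables (R : realType) (m : nat).
Implicit Types (k v : 'rV[int]_m) (y : 'rV[R]_m).

Lemma bump_second : exists G H K, C2 (@bump R m) G H /\ 0 <= K /\
  (forall (x : 'rV[R]_m) i, 1 <= `|x 0 i| -> H x = 0) /\
  (forall x v : 'rV[R]_m, `|v| <= 1 ->
    `|bump (x + v) + bump (x - v) - 2 * bump x - qf (H x) v v| <= K * `|v| ^+ 3).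
Proof.
have [G [H [K [c t o]]]] := bump_reg R m.
have K0 : 0 <= K by have [h _ _ _] := t 0; apply: le_trans h.
exists G, H, (2 * K); split => //; split; first by rewrite mulr_ge0.
split => // x v v1; have [_ _ _ h] := t x.
have h1 := h v v1; have := h (- v); rewrite normrN dotN qfN => /(_ v1) h2.
have -> : bump (x + v) + bump (x - v) - 2 * bump x - qf (H x) v v =
  (bump (x + v) - bump x - dot (G x) v - qf (H x) v v / 2) +
  (bump (x - v) - bump x - - dot (G x) v - qf (H x) v v / 2) by field.
by rewrite (le_trans (ler_normD _ _)) // -mulrA mulr_natl mulr2n lerD.
Qed.

(** A step [v N^-4] is of order [N^-3] on the scale of the bump, so the cubic remainder is of order
    [N^-9]. Only nodes within 2/N of [y] matter, and by [near_count] their normalized number is at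
    most [5^m]. *)
Lemma theta_second (Q : nat) : exists G H (C : R), [/\ forall N k, (0 < N)%N -> C2 (theta N k) (G N k) (H N k), 0 <= C &
  forall N y (s : seq 'rV[int]_m) (u : 'rV[int]_m -> R) (U : R) v, (Q < N)%N -> (0 < N)%N -> uniq s -> (forall k, `|u k| <= U) ->
   inbox Q v ->
   `|\sum_(k <- s) u k * (theta N k (y + node R N v) + theta N k (y - node R N v) - 2 * theta N k y
      - qf (H N k y) (node R N v) (node R N v))| <= C * U / N%:R ^+ 9].
Proof.
have [G [H [K [c [K0 [ho sd]]]]]] := bump_second.
exists (fun N k y => (N%:R ^+ (3 * m))^-1 *: (N%:R *: G (N%:R *: (y - node R N k)))).
exists (fun N k y => (N%:R ^+ (3 * m))^-1 *: (N%:R ^+ 2 *: H (N%:R *: (y - node R N k)))).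
exists (5 ^+ m * K * Q%:R ^+ 3); split.
- move=> N k N0; have Np : 0 < N%:R :> R by rewrite ltr0n.
  have := C2Z (N%:R ^+ (3 * m))^-1 (C2_affine (node R N k) Np c).
  by rewrite /theta; under [X in C2 X _ _ -> _]eq_fun do rewrite mulrC.
- by rewrite !mulr_ge0 ?exprn_ge0.
move=> N y s u U v QN N0 us uU vQ.
have Np : 0 < N%:R :> R by rewrite ltr0n.
have U0 : 0 <= U by apply: le_trans (uU 0).
pose x : 'rV[R]_m := node R N v.
have N4 : 0 < N%:R ^+ 4 :> R by rewrite exprn_gt0.
have xle : `|x| <= Q%:R / N%:R ^+ 4.
  apply/row_normP => [|i]; first by rewrite divr_ge0 // ltW.
  rewrite mxE normrM normfV (ger0_norm (ltW N4)) ler_pM2r ?invr_gt0 //.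
  by have /inboxP/(_ i) := vQ; rewrite -(ler_nat R) natr_absz intr_norm.
have x1 : `|N%:R *: x| <= Q%:R / N%:R ^+ 3.
  rewrite normrZ ger0_norm //; apply: (le_trans (ler_wpM2l (ltW Np) xle)).
  by rewrite le_eqVlt; apply/orP; left; apply/eqP; field; rewrite gt_eqF.
have N1 : 1 <= N%:R :> R by rewrite ler1n.
have QN' : Q%:R <= N%:R :> R by rewrite ler_nat ltnW.
have N31 : N%:R <= N%:R ^+ 3 :> R by rewrite -[X in X <= _]expr1 ler_weXn2l.
have x2 : `|N%:R *: x| <= 1.
  by apply: (le_trans x1); rewrite ler_pdivrMr ?exprn_gt0 // mul1r (le_trans QN').
rewrite (le_trans (ler_norm_sum _ _ _)) //.
pose near k := [forall i, `|y 0 i - node R N k 0 i| <= 2 / N%:R].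
have far k : ~~ near k -> theta N k (y + x) + theta N k (y - x) - 2 * theta N k y
  - qf ((N%:R ^+ (3 * m))^-1 *: (N%:R ^+ 2 *: H (N%:R *: (y - node R N k)))) x x = 0.
  move=> /forallPn[i]; rewrite -ltNge => hi.
  have xi : `|x 0 i| <= N%:R^-1.
    apply: (le_trans (row_norm_le x i)); apply: (le_trans xle).
    rewrite ler_pdivrMr // mulrC; apply: (le_trans QN'); apply: (le_trans N31).
    by rewrite le_eqVlt; apply/orP; left; apply/eqP; field; rewrite gt_eqF.
  have i2 : 2 / N%:R = N%:R^-1 + N%:R^-1 :> R by ring.
  have z (w : 'rV[R]_m) : `|w 0 i| <= N%:R^-1 -> theta N k (y + w) = 0.
    move=> wi; apply/eqP; apply: contraTT isT => /(theta_supp N0)/(_ i).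
    rewrite mxE; have := ler_normB (y 0 i + w 0 i - node R N k 0 i) (w 0 i).
    have -> : y 0 i + w 0 i - node R N k 0 i - w 0 i = y 0 i - node R N k 0 i by ring.
    by move=> h1 h2; exfalso; move: hi wi h1 h2; rewrite i2; lra.
  have -> := z x xi; have := z (- x); rewrite mxE normrN => ->//.
  have := z 0; rewrite mxE normr0 invr_ge0 addr0 => -> //.
  rewrite (ho _ i) ?scaler0 ?qf0l; first by ring.
  rewrite !mxE normrM ger0_norm // mulrC -ler_pdivrMr // mul1r; move: hi; rewrite mxE.
  by rewrite i2; have : 0 < N%:R^-1 :> R by [rewrite invr_gt0]; lra.
have nearb k : `|u k * (theta N k (y + x) + theta N k (y - x) - 2 * theta N k y
  - qf ((N%:R ^+ (3 * m))^-1 *: (N%:R ^+ 2 *: H (N%:R *: (y - node R N k)))) x x)|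
   <= U * (K * (Q%:R / N%:R ^+ 3) ^+ 3) * (N%:R ^+ (3 * m))^-1.
  rewrite normrM -mulrA ler_pM //.
  have -> : qf ((N%:R ^+ (3 * m))^-1 *: (N%:R ^+ 2 *: H (N%:R *: (y - node R N k)))) x x
     = qf (H (N%:R *: (y - node R N k))) (N%:R *: x) (N%:R *: x) / N%:R ^+ (3 * m).
    by rewrite !qfZl qfZ; ring.
  rewrite /theta.
  have -> : N%:R *: (y + x - node R N k) = N%:R *: (y - node R N k) + N%:R *: x.
    by rewrite -scalerDr addrAC.
  have -> : N%:R *: (y - x - node R N k) = N%:R *: (y - node R N k) - N%:R *: x.
    by rewrite -scalerBr addrAC.
  set b1 := bump _; set b2 := bump _; set b3 := bump _; set q := qf _ _ _.
  have -> : b1 / N%:R ^+ (3 * m) + b2 / N%:R ^+ (3 * m) - 2 * (b3 / N%:R ^+ (3 * m)) - q / N%:R ^+ (3 * m)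
    = (b1 + b2 - 2 * b3 - q) / N%:R ^+ (3 * m) by ring.
  rewrite normrM normfV (ger0_norm (exprn_ge0 _ (ltW Np))) ler_wpM2r ?invr_ge0 ?exprn_ge0 //.
  apply: (le_trans (sd _ _ x2)); rewrite ler_wpM2l // lerXn2r ?nnegrE //.
rewrite (bigID near) /= [X in _ + X]big1 ?addr0; last by move=> k /far ->; rewrite mulr0 normr0.
apply: (@le_trans _ _ (\sum_(k <- s | near k) U * (K * (Q%:R / N%:R ^+ 3) ^+ 3) * (N%:R ^+ (3 * m))^-1)).
  by apply: ler_sum => k _; exact: nearb.
rewrite -mulr_sumr; apply: (@le_trans _ _ (U * (K * (Q%:R / N%:R ^+ 3) ^+ 3) * 5 ^+ m)).
  rewrite ler_wpM2l //; first by rewrite !mulr_ge0 ?exprn_ge0 ?divr_ge0 ?exprn_ge0.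
  exact: (near_count y 2 N0 us).
by rewrite le_eqVlt; apply/orP; left; apply/eqP; field; rewrite gt_eqF.
Qed.

Lemma qf_lin (T : Type) (s : seq T) (c : T -> R) (M : T -> 'M[R]_m) (v w : 'rV[R]_m) :
  qf (\sum_(k <- s) c k *: M k) v w = \sum_(k <- s) c k * qf (M k) v w.
Proof.
elim: s => [|k s IH]; first by rewrite !big_nil qf0l.
by rewrite !big_cons qfDl qfZl IH.
Qed.

Lemma qf_node (N : nat) (H : 'M[R]_m) v : qf H (node R N v) (node R N v) =
  (\sum_i \sum_j H i j * ((v 0 i)%:~R * (v 0 j)%:~R)) / N%:R ^+ 8.
Proof.
rewrite mulr_suml; apply: eq_bigr => i _; rewrite mulr_suml; apply: eq_bigr => j _.
by rewrite !mxE -!mulrA; congr (_ * (_ * _)); rewrite mulrCA; congr (_ * _); rewrite -invfM -exprD.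
Qed.

Lemma sum_theta_shift N P Q y v (u : 'rV[int]_m -> R) : inbox Q v ->
  (forall k, ~~ inbox P k -> u k = 0) ->
  \sum_(k <- zbox m P) u k * theta N k (y + node R N v)
  = \sum_(j <- zbox m (P + Q)) theta N j y * u (j + v).
Proof.
move=> vQ u0.
have -> : \sum_(j <- zbox m (P + Q)) theta N j y * u (j + v)
  = \sum_(k <- [seq j + v | j <- zbox m (P + Q)]) theta N (k - v) y * u k.
  by rewrite [RHS]big_map; apply: eq_bigr => j _; rewrite addrK.
under eq_bigr do rewrite theta_shift mulrC.
apply: sum_eq_supp => [||k]; first exact: zbox_uniq.
  by rewrite map_inj_uniq ?zbox_uniq //; exact: addIr.
rewrite mulf_eq0 negb_or => /andP[_ uk].
have kP : inbox P k by apply: contraNT uk => /u0 ->.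
rewrite mem_zbox kP; apply/esym/mapP; exists (k - v); last by rewrite subrK.
by rewrite mem_zbox inboxD // inboxN.
Qed.

(** Summation by parts: translating [y] by a node amounts to translating the index. As [u] vanishes
    outside the box [P], no boundary terms appear once the box is enlarged by [Q]. *)
Lemma sum_theta_ddiff N P Q y v (u : 'rV[int]_m -> R) : inbox Q v ->
  (forall k, ~~ inbox P k -> u k = 0) ->
  \sum_(k <- zbox m P) u k * (theta N k (y + node R N v) + theta N k (y - node R N v) - 2 * theta N k y)
  = \sum_(j <- zbox m (P + Q)) theta N j y * ddiff u v j.
Proof.
move=> vQ u0; have nN : - node R N v = node R N (- v).
  by apply/rowP => i; rewrite !mxE intrN mulNr.
rewrite nN; under eq_bigr => k _ do rewrite mulrBr mulrDr (mulrCA _ 2).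
rewrite sumrB big_split /= (sum_theta_shift _ _ vQ u0) (@sum_theta_shift _ _ Q) ?inboxN // -mulr_sumr.
have -> : \sum_(k <- zbox m P) u k * theta N k y = \sum_(j <- zbox m (P + Q)) theta N j y * u j.
  under eq_bigr do rewrite mulrC.
  apply: sum_eq_supp => [||k]; rewrite ?zbox_uniq // mulf_eq0 negb_or => /andP[_ uk].
  have kP : inbox P k by apply: contraNT uk => /u0 ->.
  by rewrite !mem_zbox kP (inboxW _ kP) // leq_addr.
rewrite mulr_sumr -big_split -sumrB /=; apply: eq_bigr => j _.
by rewrite /ddiff; ring.
Qed.

(* [w] is a constant minus the interpolation of the lattice supersolution.  The mesh N^-4 is much finer than
   the interpolation scale N^-1, so second differences approximate second derivatives up to O(1/N). *)
Lemma pucci_test (lam Lam : R) (D : nat) : (0 < m)%N -> 0 < lam ->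
  exists (K : R) (N0 : nat), 0 <= K /\
  forall (N : nat) (f : 'rV[int]_m -> R) (eps : R), (N0 < N)%N -> 0 < eps ->
  (forall k, 0 <= f k) ->
  \sum_(k <- zbox m (D.+1 * N ^ 4)) f k ^+ m <= eps ^+ m * N%:R ^+ (4 * m) ->
  exists w G H, C2 w G H /\ (forall y, 0 <= w y <= K * eps) /\
    forall y a, `|y| <= D%:R -> elliptic lam Lam a ->
    \sum_(k <- zbox m (D.+1 * N ^ 4)) theta N k y * f k
      <= \sum_i \sum_j a i j * H y i j + K * eps / N%:R.
Proof.
move=> m0 lam0; have [Q [cmax [Q0 [c0 dec]]]] := elliptic_decomp m Lam lam0.
have [Gt [Ht [C [tC2 C0 ts]]]] := theta_second Q.
pose a0 := lam / 2; have a00 : 0 < a0 by rewrite divr_gt0.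
have a0p := ltW a00.
pose U1 := (2 * m * (D.+1 + Q))%:R / a0; have U10 : 0 <= U1 by rewrite divr_ge0 // ltW.
pose K1 := U1 * 3 ^+ m; have K10 : 0 <= K1 by rewrite mulr_ge0 // exprn_ge0.
pose K2 := (a0 * m%:R + cmax) * C * U1.
have K20 : 0 <= K2 by apply: mulr_ge0 => //; apply: mulr_ge0 => //; apply: addr_ge0 => //; rewrite mulr_ge0 // ltW.
exists (K1 + K2), (maxn Q 1); split; first exact: addr_ge0.
move=> N f eps; rewrite gtn_max => /andP[QN N1] eps0 f0.
set P := (D.+1 * N ^ 4)%N => fs; have N0 : (0 < N)%N := ltnW N1.
have Np : 0 < N%:R :> R by rewrite ltr0n.
have Nx e : 0 < N%:R ^+ e :> R by rewrite exprn_gt0.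
have Nx' e : 0 <= N%:R ^+ e :> R by rewrite ltW.
have epsp := ltW eps0.
(* Second differences over steps [N^-4] carry the factor [N^-8], which is put into the right-hand
   side here. *)
pose g k := if inbox P k then f k / N%:R ^+ 8 else 0.
have g0 k : 0 <= g k by rewrite /g; case: ifP => // _; rewrite divr_ge0 // ltW.
have gM k : g k <= \sum_(k <- zbox m P) g k.
  case: (boolP (inbox P k)) => kP; last by rewrite {1}/g (negbTE kP) sumr_ge0.
  by rewrite (big_rem k) ?mem_zbox //= lerDl sumr_ge0.
have [u [u0 uout ueq ucon]] := lattice_obstacle P a00 c0 Q0 m0 g0 gM.
(* All powers of [N] cancel in the lattice estimate: [P + Q] is at most a constant times [N^4], the
   field carries [N^-8], and the hypothesis on the power sum contributes [N^4]. *)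
have uU k : u k <= U1 * eps.
  have := lattice_abp a00 Q0 m0 g0 u0 uout ucon k.
  have -> : \sum_(k <- zbox m P) (g k / a0) ^+ m
     = (N%:R ^+ 8 * a0)^-1 ^+ m * \sum_(k <- zbox m P) f k ^+ m.
    rewrite mulr_sumr big_seq [RHS]big_seq; apply: eq_bigr => j.
    by rewrite mem_zbox /g => ->; rewrite -exprMn; congr (_ ^+ _); field; rewrite !gt_eqF.
  have ip : 0 <= (N%:R ^+ 8 * a0)^-1 ^+ m by rewrite exprn_ge0 // invr_ge0 mulr_ge0 ?ltW.
  move=> h; have {h} := le_trans h (ler_wpM2l _ (ler_wpM2l ip fs)).
  rewrite exprn_ge0 // => /(_ isT); rewrite exprM -!exprMn ler_pXn2r // ?nnegrE //; last first.
    by pos.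
  move/le_trans; apply.
  have -> : U1 * eps = (2 * m)%:R * (D.+1 + Q)%:R * (eps / a0) by rewrite /U1 natrM; ring.
  have -> : (2 * m * (P + Q))%:R * ((N%:R ^+ 8 * a0)^-1 * (eps * N%:R ^+ 4))
    = (2 * m)%:R * ((P + Q)%:R / N%:R ^+ 4) * (eps / a0).
    by rewrite (natrM _ (2 * m)); field; rewrite !gt_eqF.
  rewrite ler_wpM2r //; first by pos.
  rewrite ler_wpM2l // ler_pdivrMr //.
  by rewrite -natrX -natrM ler_nat mulnDl leq_add2l leq_pmulr // expn_gt0 N0.
have uUn k : `|u k| <= U1 * eps by rewrite ger0_norm.
pose Hw y : 'M[R]_m := \sum_(k <- zbox m P) u k *: Ht N k y.
have WC2 := C2_sum (zbox m P) (fun k => C2Z (u k) (tC2 N k N0)).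
have wC2 := C2D (@C2_cst R m (K1 * eps)) (C2Z (-1) WC2).
exists (fun y => K1 * eps + -1 * \sum_(k <- zbox m P) u k * theta N k y).
exists (fun y => 0 + -1 *: \sum_(k <- zbox m P) u k *: Gt N k y), (fun y => 0 + -1 *: Hw y).
split => //; split.
  move=> y; rewrite mulN1r; apply/andP; split; last first.
    apply: (@le_trans _ _ (K1 * eps)); last by rewrite ler_wpM2r ?lerDl // ltW.
    by rewrite gerBl sumr_ge0 // => k _; rewrite mulr_ge0 ?theta_ge0.
  rewrite subr_ge0 /K1 mulrAC.
  apply: (@le_trans _ _ (U1 * eps * \sum_(k <- zbox m P) theta N k y)).
    by rewrite mulr_sumr; apply: ler_sum => k _; rewrite ler_wpM2r ?theta_ge0.
  by rewrite ler_wpM2l ?sum_theta_le ?zbox_uniq // mulr_ge0 // ltW.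
move=> y a yD ell; have [s [sp aE sc]] := dec a ell.
pose E := C * (U1 * eps) / N%:R ^+ 9.
have E0 : 0 <= E by pos.
pose S v := \sum_(j <- zbox m (P + Q)) theta N j y * ddiff u v j.
have qS v : inbox Q v -> qf (Hw y) (node R N v) (node R N v) <= S v + E.
  move=> vQ; have := ts N y (zbox m P) u _ v QN N0 (zbox_uniq _ _) uUn vQ.
  under eq_bigr do rewrite mulrBr.
  rewrite sumrB (sum_theta_ddiff _ _ vQ uout) /Hw qf_lin -/(S v) -/E ler_norml; lra.
have trE : (\sum_i \sum_j a i j * Hw y i j) / N%:R ^+ 8
   = a0 * \sum_i qf (Hw y) (node R N (delta_mx 0 i)) (node R N (delta_mx 0 i))
   + \sum_(cv <- s) cv.1 * qf (Hw y) (node R N cv.2) (node R N cv.2).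
  have -> : \sum_i \sum_j a i j * Hw y i j = \sum_i a0 * Hw y i i
     + \sum_(cv <- s) cv.1 * \sum_i \sum_j Hw y i j * ((cv.2 0 i)%:~R * (cv.2 0 j)%:~R).
    under [X in _ = _ + X]eq_bigr do rewrite mulr_sumr.
    rewrite [X in _ = _ + X]exchange_big -big_split /=; apply: eq_bigr => i _.
    under [X in _ = _ + X]eq_bigr do rewrite mulr_sumr.
    rewrite exchange_big /=.
    under eq_bigr do rewrite aE mulrDl mulr_suml.
    rewrite big_split /=; congr (_ + _).
      rewrite (bigD1 i) //= eqxx mulr1 big1 ?addr0 // => j; rewrite eq_sym => /negbTE ->.
      by rewrite mulr0 mul0r.
    by apply: eq_bigr => j _; apply: eq_bigr => cv _; ring.
  rewrite mulrDl -!mulr_sumr mulr_suml; congr (_ + _).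
    rewrite -mulrA mulr_suml; congr (_ * _); apply: eq_bigr => i _; rewrite qf_node.
    congr (_ / _); rewrite (bigD1 i) //= (bigD1 i) //= mxE !eqxx !mulr1.
    rewrite !big1 ?addr0 // => j ji; last by rewrite mxE (negbTE ji) andbF !mulr0.
    by rewrite big1 // => l _; rewrite mxE (negbTE ji) andbF mul0r mulr0.
  by apply: eq_bigr => cv _; rewrite qf_node mulrA.
(* For the decomposition of the given [a], the weighted second differences of [u] are at most the
   lattice operator: positive parts bound each of them and [cmax] bounds the total weight. *)
have key : a0 * (\sum_i S (delta_mx 0 i)) + \sum_(cv <- s) cv.1 * S cv.2
   <= - ((\sum_(k <- zbox m P) theta N k y * f k) / N%:R ^+ 8).
  have -> : - ((\sum_(k <- zbox m P) theta N k y * f k) / N%:R ^+ 8)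
     = \sum_(j <- zbox m (P + Q)) theta N j y * (- g j).
    rewrite -(sum_theta_box (P := P) _ N0 yD) ?leq_addr // -mulNr -sumrN mulr_suml.
    rewrite big_seq [RHS]big_seq; apply: eq_bigr => j; rewrite mem_zbox /g => ->; ring.
  rewrite exchange_big mulr_sumr; under [X in _ + X <= _]eq_bigr do rewrite mulr_sumr.
  rewrite [X in _ + X <= _]exchange_big -big_split /=; apply: ler_sum => j _.
  have [->|tj] := eqVneq (theta N j y) 0.
    rewrite !mul0r; under eq_bigr do rewrite mul0r.
    by rewrite big1_eq mulr0 add0r; under eq_bigr do rewrite mul0r mulr0; rewrite big1_eq.
  rewrite -mulr_sumr mulrCA; under [X in _ + X <= _]eq_bigr do rewrite mulrCA.
  rewrite -mulr_sumr -mulrDr ler_wpM2l ?theta_ge0 //.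
  apply: le_trans (ueq j (inbox_theta N0 yD tj)); rewrite lerD2l.
  set Sp := \sum_(v <- zbox m Q | v != 0) _.
  have Sp0 : 0 <= Sp by rewrite sumr_ge0 // => v _; rewrite le_max lexx.
  apply: (@le_trans _ _ (\sum_(cv <- s) cv.1 * Sp)); last by rewrite -mulr_suml ler_wpM2r.
  rewrite big_seq [X in _ <= X]big_seq; apply: ler_sum => cv /sp[cv0 cvQ]; rewrite ler_wpM2l //.
  have [->|v0] := eqVneq cv.2 0.
    by rewrite /ddiff addr0 subr0 (_ : _ - _ = 0) //; ring.
  rewrite /Sp (big_rem cv.2) ?mem_zbox //= v0.
  have : 0 <= \sum_(v <- rem cv.2 (zbox m Q) | v != 0) Num.max 0 (ddiff u v j).
    by rewrite sumr_ge0 // => v _; rewrite le_max lexx.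
  have : ddiff u cv.2 j <= Num.max 0 (ddiff u cv.2 j) by rewrite le_max lexx orbT.
  lra.
have tr_le : (\sum_i \sum_j a i j * Hw y i j) / N%:R ^+ 8 <=
   - ((\sum_(k <- zbox m P) theta N k y * f k) / N%:R ^+ 8) + (a0 * m%:R + cmax) * E.
  rewrite trE; apply: (@le_trans _ _ (a0 * (\sum_i (S (delta_mx 0 i) + E)) + \sum_(cv <- s) cv.1 * (S cv.2 + E))).
    apply: lerD.
      rewrite ler_wpM2l //; apply: ler_sum => i _; apply: qS; exact: inbox_delta.
    rewrite big_seq [X in _ <= X]big_seq; apply: ler_sum => cv /sp[cv0 cvQ].
    by rewrite ler_wpM2l // qS.
  rewrite big_split /= sumr_const card_ord.
  under [X in _ + X <= _]eq_bigr do rewrite mulrDr.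
  rewrite big_split /= -mulr_suml -[E *+ m]mulr_natr.
  have := ler_wpM2r E0 sc; move: key; set X1 := \sum_i _; set X2 := \sum_(cv <- s) _ * S _; lra.
have -> : \sum_i \sum_j a i j * (0 + -1 *: Hw y) i j = - \sum_i \sum_j a i j * Hw y i j.
  rewrite -sumrN; apply: eq_bigr => i _; rewrite -sumrN; apply: eq_bigr => j _.
  by rewrite !mxE; ring.
move: tr_le; rewrite -lerBlDl -mulNr -mulrBl ler_pdivrMr //.
have -> : (a0 * m%:R + cmax) * E * N%:R ^+ 8 = K2 * eps / N%:R.
  by rewrite /E /K2; field; rewrite gt_eqF.
have : 0 <= K1 * eps / N%:R by pos.
rewrite (mulrDl K1) (mulrDl _ _ N%:R^-1); lra.
Qed.

End Pucci.

(** * Probability laws *)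

Section Expectation.
Variables (R : realType) (d : measure_display) (T : measurableType d).
Implicit Types (P : probability T R) (f g : T -> R).

(** Bounded measurable functions are integrable for every probability at once, so the calculus of
    [ex] needs no integrability condition tied to the law. *)
Definition adm f := measurable_fun setT f /\ exists M, forall x, `|f x| <= M.

Definition ex P f : R := Rintegral P setT f.

Lemma adm_cst (c : R) : adm (fun=> c).
Proof. by split; [exact: measurable_cst | exists `|c|]. Qed.

Lemma admD f g : adm f -> adm g -> adm (fun x => f x + g x).
Proof.
move=> [mf [M hM]] [mg [N hN]]; split; first exact: measurable_funD.
by exists (M + N) => x; rewrite (le_trans (ler_normD _ _)) // lerD.
Qed.

Lemma admM f g : adm f -> adm g -> adm (fun x => f x * g x).
Proof.
move=> [mf [M hM]] [mg [N hN]]; split; first exact: measurable_funM.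
by exists (M * N) => x; rewrite normrM ler_pM.
Qed.

Lemma admZ c f : adm f -> adm (fun x => c * f x).
Proof. by apply: admM; exact: adm_cst. Qed.

Lemma admN f : adm f -> adm (fun x => - f x).
Proof. by move/(admZ (-1)); under eq_fun do rewrite mulN1r. Qed.

Lemma admB f g : adm f -> adm g -> adm (fun x => f x - g x).
Proof. by move=> af ag; apply: admD => //; exact: admN. Qed.

Lemma adm_sum (I : Type) (s : seq I) (F : I -> T -> R) : (forall i, adm (F i)) ->
  adm (fun x => \sum_(i <- s) F i x).
Proof.
move=> aF; elim: s => [|i s IH].
  by under eq_fun do rewrite big_nil; exact: adm_cst.
by under eq_fun do rewrite big_cons; exact: admD.
Qed.

Lemma adm_abs f : adm f -> adm (fun x => `|f x|).
Proof.
move=> [mf [M hM]]; split; last by exists M => x; rewrite normr_id.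
by apply: measurableT_comp => //; exact: measurable_normr.
Qed.

Lemma adm_indic (A : set T) : measurable A -> adm (\1_A : T -> R).
Proof.
move=> mA; split; first exact: measurable_indic.
by exists 1 => x; rewrite indicE; case: (_ \in _); rewrite ?normr1 ?normr0.
Qed.

Lemma adm_comp d' (T' : measurableType d') (h : T -> T') (f : T' -> R) :
  measurable_fun setT h -> measurable_fun setT f -> (exists M, forall x, `|f x| <= M) -> adm (f \o h).
Proof.
move=> mh mf [M hM]; split; first exact: measurableT_comp.
by exists M => x /=.
Qed.

Lemma adm_integrable P f : adm f -> P.-integrable setT (EFin \o f).
Proof.
move=> [mf [M hM]]; apply: measurable_bounded_integrable => //.
  by have := probability_setT P => /= ->; rewrite ltry.
by exists M; split; [exact: num_real | move=> N MN x _; apply: le_trans (hM x) (ltW MN)].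
Qed.

Lemma ex_EFin P f : adm f -> (\int[P]_x (f x)%:E)%E = (ex P f)%:E.
Proof. by move=> /(adm_integrable P) /integrable_fin_num fn; rewrite /ex /Rintegral fineK // fn. Qed.

Lemma ex_cst P c : ex P (fun=> c) = c.
Proof. by rewrite /ex Rintegral_cst //; have := probability_setT P => /= ->; rewrite mulr1. Qed.

Lemma exD P f g : adm f -> adm g -> ex P (fun x => f x + g x) = ex P f + ex P g.
Proof. by move=> af ag; rewrite /ex RintegralD //; exact: adm_integrable. Qed.

Lemma exB P f g : adm f -> adm g -> ex P (fun x => f x - g x) = ex P f - ex P g.
Proof. by move=> af ag; rewrite /ex RintegralB //; exact: adm_integrable. Qed.

Lemma exZ P c f : adm f -> ex P (fun x => c * f x) = c * ex P f.
Proof. by move=> af; rewrite /ex RintegralZl //; exact: adm_integrable. Qed.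

Lemma ex_sum P (I : Type) (s : seq I) (F : I -> T -> R) : (forall i, adm (F i)) ->
  ex P (fun x => \sum_(i <- s) F i x) = \sum_(i <- s) ex P (F i).
Proof.
move=> aF; elim: s => [|i s IH].
  by under [in LHS]eq_fun do rewrite big_nil; rewrite ex_cst big_nil.
by under [in LHS]eq_fun do rewrite big_cons; rewrite exD ?big_cons ?IH //; exact: adm_sum.
Qed.

Lemma ex_le P f g : adm f -> adm g -> (forall x, f x <= g x) -> ex P f <= ex P g.
Proof. by move=> af ag fg; rewrite /ex le_Rintegral //; exact: adm_integrable. Qed.

Lemma ex_ge0 P f : (forall x, 0 <= f x) -> 0 <= ex P f.
Proof. by move=> f0; exact: Rintegral_ge0. Qed.

Lemma ex_abs P f : adm f -> `|ex P f| <= ex P (fun x => `|f x|).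
Proof. by move=> af; rewrite /ex le_normr_Rintegral //; exact: adm_integrable. Qed.

Lemma ex_le_cst P f c : adm f -> (forall x, f x <= c) -> ex P f <= c.
Proof. by move=> af fc; rewrite -[c](ex_cst P); apply: ex_le => //; exact: adm_cst. Qed.

Lemma ex_norm_le P f c : adm f -> (forall x, `|f x| <= c) -> `|ex P f| <= c.
Proof.
move=> af fc; apply: (le_trans (ex_abs P af)); apply: ex_le_cst => //; exact: adm_abs.
Qed.

End Expectation.

Lemma push_law (R : realType) d d' (T : measurableType d) (T' : measurableType d')
  (P : probability T R) (h : T -> T') : measurable_fun setT h ->
  exists Q : probability T' R,
   (forall F : T' -> \bar R, measurable_fun setT F -> (forall y, (0 <= F y)%E) ->
     (\int[Q]_y F y = \int[P]_x F (h x))%E) /\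
   (forall f : T' -> R, adm f -> ex Q f = ex P (f \o h)).
Proof.
move=> mh.
pose X : {mfun T >-> T'} := HB.pack h (isMeasurableFun.Build _ _ _ _ h mh).
exists (distribution P X); split => [F mF F0|f [mf [M hM]]].
  by rewrite ge0_integral_distribution.
rewrite /ex /Rintegral integral_distribution //.
- exact: measurableT_comp.
- by apply: adm_integrable; apply: adm_comp => //; exists M.
Qed.

Section FiniteLaw.
Variables (R : realType) (d : measure_display) (T : measurableType d).
Variables (n : nat) (x : 'I_n.+1 -> T) (p : 'I_n.+1 -> R).
Hypotheses (p0 : forall i, 0 <= p i) (p1 : \sum_i p i = 1).

Definition finmeas : {measure set T -> \bar R} :=
  [the measure _ _ of msum (fun i : nat => [the measure _ _ of
    mscale (NngNum (p0 (inord i))) [the measure _ _ of \d_(x (inord i))]]) n.+1].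

Definition finlaw (_ : \sum_i p i = 1) := fun A : set T => finmeas A.

Let finlaw0 : finlaw p1 set0 = 0%E. Proof. exact: measure0. Qed.
Let finlaw_ge0 A : (0 <= finlaw p1 A)%E. Proof. exact: measure_ge0. Qed.
Let finlaw_sa : semi_sigma_additive (finlaw p1). Proof. exact: measure_semi_sigma_additive. Qed.
HB.instance Definition _ := isMeasure.Build _ _ _ (finlaw p1) finlaw0 finlaw_ge0 finlaw_sa.

Let finlaw1 : finlaw p1 setT = 1%E.
Proof.
rewrite /finlaw /finmeas /= /msum.
under eq_bigr do rewrite /= /mscale /= diracT mule1.
by rewrite sumEFin; congr EFin; rewrite -p1; apply: eq_bigr => i _; rewrite inord_val.
Qed.

HB.instance Definition _ := Measure_isProbability.Build _ _ _ (finlaw p1) finlaw1.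

Lemma ge0_integral_finlaw (f : T -> R) : measurable_fun setT f -> (forall y, 0 <= f y) ->
  (\int[finlaw p1]_y (f y)%:E = (\sum_i p i * f (x i))%:E)%E.
Proof.
move=> mf f0.
have mF : measurable_fun setT (EFin \o f) by exact/measurable_EFinP.
have f0' y : [set: T] y -> (0 <= (EFin \o f) y)%E by rewrite /= lee_fin.
pose md (i : nat) : {measure set T -> \bar R} :=
  mscale (NngNum (p0 (inord i))) (\d_(x (inord i))).
transitivity (\int[msum md n.+1]_y (EFin \o f) y)%E; first by [].
rewrite (ge0_integral_measure_sum md measurableT f0' mF) -sumEFin; apply: eq_bigr => i _.
rewrite ge0_integral_mscale //.
by rewrite integral_dirac //= diracT mul1e inord_val.
Qed.

End FiniteLaw.

(** Integrability is claimed for unbounded measurable functions too, because [V] has to be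
    integrated; the signed case is reduced to positive and negative parts. *)
Lemma finite_law (R : realType) (d : measure_display) (T : measurableType d) (n : nat)
  (x : 'I_n.+1 -> T) (p : 'I_n.+1 -> R) : simplex p ->
  exists P : probability T R, forall f : T -> R, measurable_fun setT f ->
    P.-integrable setT (EFin \o f) /\ (\int[P]_y (f y)%:E = (\sum_i p i * f (x i))%:E)%E.
Proof.
move=> [p0 p1]; exists (finlaw x p0 p1) => f mf.
have H := ge0_integral_finlaw x p0 p1.
have mF : measurable_fun setT (EFin \o f) by exact/measurable_EFinP.
have mp : measurable_fun setT (fun y => Num.max (f y) 0) by apply: measurable_maxr.
have mn : measurable_fun setT (fun y => Num.max (- f y) 0).
  by apply: measurable_maxr => //; exact: measurableT_comp.
split.
  apply/integrableP; split => //.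
  rewrite (_ : (fun y => _) = (fun y => `|f y|%:E)); last by apply/funext => y.
  by rewrite H ?ltry // => //; exact: measurableT_comp.
rewrite integralE.
rewrite (_ : (EFin \o f)^\+%E = (fun y => (Num.max (f y) 0)%:E)); last first.
  by apply/funext => y; rewrite funeposE EFin_max.
rewrite (_ : (EFin \o f)^\-%E = (fun y => (Num.max (- f y) 0)%:E)); last first.
  by apply/funext => y; rewrite funenegE EFin_max.
rewrite !H //; try by move=> y; rewrite le_max lexx orbT.
rewrite -EFinB -sumrB; congr EFin; apply: eq_bigr => i _; rewrite -mulrBr; congr (_ * _).
by case: (lerP (f (x i)) 0); case: (lerP (- f (x i)) 0); lra.
Qed.

Section RdMeasurable.
Variables (R : realType) (n : nat).

Lemma cont_meas (f : 'rV[R]_n -> R) : continuous f -> measurable_fun setT (f : Rd R n -> R).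
Proof.
move=> /continuousP cf; apply: (measurability _ (RGenOpens.measurableE R)).
move=> _ [_ [a [b ->] <-]]; rewrite setTI.
by apply: sub_sigma_algebra; apply: cf; exact: interval_open.
Qed.

Lemma coord_meas (i : 'I_n) : measurable_fun setT ((fun x => x 0 i) : Rd R n -> R).
Proof. by apply: cont_meas => x; exact: coord_continuous. Qed.

(** A countable basis of cubes with rational centres reduces the measurability of vector valued maps
    to that of their coordinates. *)
Lemma open_box_basis (U : set 'rV[R]_n) : open U ->
  U = \bigcup_(qr : 'rV[rat]_n * nat)
   (if `[< [set x : 'rV[R]_n | forall i, `|x 0 i - ratr (qr.1 0 i)| < qr.2.+1%:R^-1] `<=` U >]
    then [set x : 'rV[R]_n | forall i, `|x 0 i - ratr (qr.1 0 i)| < qr.2.+1%:R^-1] else set0).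
Proof.
move=> oU; apply/seteqP; split => [x Ux|x [qr _]]; last first.
  by case: asboolP => // h; exact: h.
have : nbhs x U by rewrite nbhsE /=; exists U.
move/nbhs_normP => [e /= e0 he].
pose r := Num.truncn (2 / e); have re : r.+1%:R^-1 < e / 2.
  rewrite -[e / 2]invrK ltf_pV2 ?posrE ?invr_gt0 ?divr_gt0 // invf_div.
  by have := truncnS_gt (2 / e).
have r0 : 0 < r.+1%:R^-1 :> R by [].
pose t : R := r.+1%:R^-1; have tE : t = r.+1%:R^-1 by [].
clearbody t; rewrite -tE in re r0.
have /choice[q hq] : forall i : 'I_n, exists q : rat, `|x 0 i - ratr q| < t.
  move=> i; have xx : x 0 i - t < x 0 i + t.
    by move: r0; lra.
  have [q] := rat_in_itvoo xx.
  rewrite in_itv /= => /andP[h1 h2]; exists q; rewrite ltr_norml; apply/andP; split; lra.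
exists (\row_i q i, r) => //=; rewrite -tE; case: asboolP => [_ i|]; first by rewrite mxE.
case=> y hy; apply: he => /=.
apply: (@le_lt_trans _ _ (t + t)); last by rewrite [X in _ < X](splitr e) ltrD.
apply/row_normP => [|i]; first by rewrite addr_ge0 // ltW.
have := hy i; have := hq i; rewrite !mxE => h1 h2.
have := ler_normB (x 0 i - ratr (q i)) (y 0 i - ratr (q i)).
have -> : x 0 i - ratr (q i) - (y 0 i - ratr (q i)) = x 0 i - y 0 i by ring.
lra.
Qed.

Lemma meas_Rd (d : measure_display) (T : measurableType d) (h : T -> 'rV[R]_n) :
  (forall i, measurable_fun setT (fun t => h t 0 i)) -> measurable_fun setT (h : T -> Rd R n).
Proof.
move=> mh; apply: (@measurability _ _ _ (Rd R n) _ _ (@open 'rV[R]_n)) => //.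
move=> _ [U oU <-]; rewrite setTI (open_box_basis oU) preimage_bigcup.
apply: countable_bigcupT_measurable => // qr; case: ifP => _; last by rewrite preimage_set0.
rewrite (_ : _ @^-1` _ = \bigcap_(i : 'I_n) ((fun t => `|h t 0 i - ratr (qr.1 0 i)|) @^-1` `]-oo, qr.2.+1%:R^-1[)); last first.
  by apply/seteqP; split => [t ht i _|t ht i] /=; [rewrite in_itv /=; exact: ht|have := ht i I; rewrite /= in_itv].
apply: fin_bigcap_measurable => // i _; rewrite -[X in measurable X]setTI.
apply: (_ : measurable_fun setT _) => //.
apply: measurableT_comp => //.
exact: measurable_funB.
Qed.

End RdMeasurable.

Section BoxLaw.
Variable R : realType.
Implicit Types (lo hi : nat -> R).

Definition rcons_rV (n : nat) (yt : Rd R n * R) : 'rV[R]_n.+1 :=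
  \row_j (if j == n :> nat then yt.2 else coord (yt.1 : 'rV[R]_n) j).

Lemma coord_ord (n : nat) (y : 'rV[R]_n) (j : 'I_n) : coord y j = y 0 j.
Proof. by rewrite /coord valK. Qed.

Lemma coord_row (n : nat) (x : nat -> R) j : (j < n)%N -> coord (\row_(i < n) x i) j = x j.
Proof. by move=> jn; rewrite -[j]/(nat_of_ord (Ordinal jn)) coord_ord mxE. Qed.

Lemma rcons_rV_meas n : measurable_fun setT (@rcons_rV n : _ -> Rd R n.+1).
Proof.
apply: meas_Rd => j; rewrite /rcons_rV.
under eq_fun do rewrite mxE; case: (j == n :> nat); first exact: measurable_snd.
apply: (measurableT_comp (f := fun y : Rd R n => coord (y : 'rV[R]_n) j)); last exact: measurable_fst.
rewrite /coord; case: (insub _) => [j'|]; last exact: measurable_cst.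
exact: coord_meas.
Qed.

(** The iterated integral is the volume times the expectation under a probability, built by
    induction as the image of a product with a uniform law, with Tonelli's theorem for the order of
    integration. All later work on cubes is done with this law. *)
Lemma box_law (n : nat) lo hi : (forall i, lo i < hi i) ->
  exists P : probability (Rd R n) R, forall F : Rd R n -> \bar R,
    measurable_fun setT F -> (forall y, (0 <= F y)%E) ->
    (itint n lo hi (fun x => F (\row_(j < n) x j))
      = (\prod_(i < n) (hi i - lo i))%:E * \int[P]_y F y)%E.
Proof.
move=> lohi; elim: n => [|n [P IH]].
  have z : 0 = 0 :> nat by [].
  exists [the probability _ _ of @dirac _ (Rd R 0) (0 : 'rV[R]_0) R] => F mF F0 /=.
  rewrite big_ord0 mul1e integral_dirac // diracT mul1e; congr F.
  by apply/rowP; case.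
have uab := lohi n.
have [Q [HQ _]] := push_law (P \x uniform_prob uab)%E (@rcons_rV_meas n).
exists Q => F mF F0 /=.
have mFr : measurable_fun setT (F \o @rcons_rV n) by apply: measurableT_comp => //; exact: rcons_rV_meas.
have Fr0 z : (0 <= (F \o @rcons_rV n) z)%E by exact: F0.
have E t : itint n lo hi (fun x => F (\row_(j < n.+1) (if j == n :> nat then t else x j)))
   = ((\prod_(i < n) (hi i - lo i))%:E * \int[P]_y F (rcons_rV (y, t)))%E.
  rewrite -(IH (fun y => F (rcons_rV (y, t)))) //; last first.
    by apply: (measurable_fun_pair1 (f := F \o @rcons_rV n)).
  congr (itint _ _ _ _); apply/funext => x; congr F; apply/rowP => j; rewrite !mxE /=.
  case: eqP => // jn; rewrite coord_row //; have := ltn_ord j; rewrite ltnS leq_eqVlt.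
  by case/orP => // /eqP.
under eq_integral do rewrite E.
have mI : measurable_fun setT (fun t => \int[P]_y F (rcons_rV (y, t)))%E.
  exact: (@measurable_fun_fubini_tonelli_G _ _ _ _ _ P _ mFr Fr0).
have p0 : (0 <= \prod_(i < n) (hi i - lo i)).
  by rewrite prodr_ge0 // => i _; rewrite subr_ge0 ltW.
rewrite ge0_integralZl //; last 2 first.
- exact: measurable_funTS.
- by move=> t _; apply: integral_ge0.
have -> : (\int[Q]_y F y = \int[uniform_prob uab]_t \int[P]_y F (rcons_rV (y, t)))%E.
  rewrite HQ //.
  have e := @fubini_tonelli2 _ _ _ _ _ P (uniform_prob uab) _ mFr Fr0; rewrite /fubini_G /= in e.
  exact: e.
rewrite (integral_uniform uab) //; last first.
  by move=> t; apply: integral_ge0.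
rewrite muleA big_ord_recr /= EFinM -(muleA (\prod_(i < n) _)%:E) -EFinM.
by rewrite mulfV ?mulr1 // subr_eq0 gt_eqF.
Qed.

Lemma itint_mask (n : nat) lo hi lo' hi' (g : (nat -> R) -> \bar R) :
  (forall i, lo i <= lo' i /\ hi' i <= hi i) ->
  itint n lo' hi' g =
  itint n lo hi (fun x => if all (fun i => lo' i <= x i <= hi' i) (iota 0 n) then g x else 0%E).
Proof.
move=> sub; elim: n g => [|n IH] g //=.
transitivity (\int[lebesgue_measure]_(t in `[lo n, hi n] `&` `[lo' n, hi' n])
   itint n lo' hi' (fun x => g (fun i => if i == n then t else x i)))%E.
  congr (integral _ _ _); rewrite setIidr // => t /=; rewrite !in_itv /= => /andP[t1 t2].
  by have [s1 s2] := sub n; rewrite (le_trans s1 t1) (le_trans t2 s2).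
rewrite integral_mkcondr; apply: eq_integral => t _; rewrite patchE.
have al x : all (fun i => lo' i <= (if i == n then t else x i) <= hi' i) (iota 0 n.+1)
   = all (fun i => lo' i <= x i <= hi' i) (iota 0 n) && (lo' n <= t <= hi' n).
  rewrite -addn1 iotaD all_cat /= add0n eqxx andbT; congr (_ && _).
  by apply: eq_in_all => i; rewrite mem_iota /= add0n => /ltn_eqF ->.
case: ifPn; rewrite ?inE /= ?in_itv /= => tI.
  rewrite IH; congr (itint _ _ _ _); apply/funext => x.
  by have := al x; rewrite /= => ->; rewrite tI andbT.
transitivity (itint n lo hi (fun _ => 0%E)).
  elim: (n) lo hi {IH al sub} => //= k IHk lo hi; rewrite -IHk integral0_eq //.
congr (itint _ _ _ _); apply/funext => x.
have := al x; rewrite /= => ->; move: tI; rewrite ?notin_setE /= ?in_itv /= => /negP/negbTE ->.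
by rewrite andbF.
Qed.

End BoxLaw.

Section CubeAverage.
Variables (R : realType) (n : nat).
Implicit Types (c : 'rV[R]_n) (r : R) (f g : Rd R n -> R).

Lemma cube_meas c r : measurable (cube c r : set (Rd R n)).
Proof.
rewrite (_ : cube c r = \bigcap_(i : 'I_n) ((fun x : Rd R n => `|x 0 i - c 0 i|) @^-1` `]-oo, r])); last first.
  by apply/seteqP; split => [t ht i _|t ht i] /=; [rewrite in_itv /=; exact: ht|have := ht i I; rewrite /= in_itv].
apply: fin_bigcap_measurable => // i _; rewrite -[X in measurable X]setTI.
apply: (_ : measurable_fun setT _) => //.
apply: measurableT_comp => //; apply: measurable_funB => //; exact: coord_meas.
Qed.

Lemma ucube_ex c r : exists P : probability (Rd R n) R, 0 < r ->
  forall F : Rd R n -> \bar R, measurable_fun setT F -> (forall y, (0 <= F y)%E) ->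
  (cube_int c r F = ((2 * r) ^+ n)%:E * \int[P]_y F y)%E.
Proof.
have [r0|r0] := ltP 0 r; last first.
  by exists [the probability _ _ of @dirac _ (Rd R n) (0 : 'rV[R]_n) R].
have [i|P HP] := @box_law R n (fun i => coord c i - r) (fun i => coord c i + r).
  by move: r0; lra.
exists P => _ F mF F0; rewrite /cube_int HP //; congr (_%:E * _)%E.
rewrite -[X in _ ^+ X](card_ord n) -prodr_const; apply: eq_bigr => i _; ring.
Qed.

(* Uniform law on the cube; unspecified for r <= 0. *)
Definition ucube c r : probability (Rd R n) R := projT1 (cid (ucube_ex c r)).

Definition avg c r f : R := ex (ucube c r) f.

Lemma ucube_int c r (F : Rd R n -> \bar R) : 0 < r ->
  measurable_fun setT F -> (forall y, (0 <= F y)%E) ->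
  (cube_int c r F = ((2 * r) ^+ n)%:E * \int[ucube c r]_y F y)%E.
Proof. by move=> r0; exact: (projT2 (cid (ucube_ex c r)) r0). Qed.

Lemma avg_cube_int c r f : 0 < r -> adm f -> (forall y, 0 <= f y) ->
  cube_int c r (fun y => (f y)%:E) = ((2 * r) ^+ n * avg c r f)%:E.
Proof.
move=> r0 af f0; have [mf _] := af.
rewrite (@ucube_int c r (EFin \o f)) //.
  by rewrite EFinM -(ex_EFin _ af).
exact/measurable_EFinP.
Qed.

Lemma adm_cube c r : adm (\1_(cube c r) : Rd R n -> R).
Proof. by apply: adm_indic; exact: cube_meas. Qed.

Lemma avg_sub c r c' r' f : 0 < r' -> (forall i, `|c' 0 i - c 0 i| + r' <= r) -> r' <= r ->
  adm f -> (forall y, 0 <= f y) ->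
  (2 * r') ^+ n * avg c' r' f = (2 * r) ^+ n * avg c r (fun y => f y * \1_(cube c' r') y).
Proof.
move=> r'0 sub rr af f0; apply: EFin_inj; rewrite -!avg_cube_int //.
- rewrite /cube_int (@itint_mask _ n (fun i => coord c i - r) (fun i => coord c i + r)).
    congr itint; apply/funext => x.
    have -> : all (fun i => coord c' i - r' <= x i <= coord c' i + r') (iota 0 n)
        = ((\row_(j < n) x j) \in (cube c' r')).
      apply/allP/idP => [h|]; rewrite ?inE.
        move=> i; have := h i; rewrite mem_iota /= add0n ltn_ord => /(_ isT).
        by rewrite coord_ord mxE ler_norml lerBlDl lerBDr => /andP[h1 h2]; apply/andP; split; lra.
      move=> h i; rewrite mem_iota /= add0n => ilt; have := h (Ordinal ilt).
      rewrite mxE /= -(coord_ord c' (Ordinal ilt)) /= ler_norml => /andP[h1 h2]; apply/andP; split; lra.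
    by rewrite indicE; case: ifP => _; rewrite ?mulr1 ?mulr0.
  move=> i; rewrite /coord; case: insubP => [j _ _|_]; last by split; lra.
  by have := sub j; have := ler_norm (c' 0 j - c 0 j); have := ler_norm (c 0 j - c' 0 j); rewrite distrC; split; lra.
- exact: lt_le_trans rr.
- by apply: admM => //; exact: adm_cube.
- by move=> y; rewrite mulr_ge0 // indicE; case: (_ \in _).
Qed.

(** The law of the cube comes without a statement on its support; [avg_sub] with both cubes equal
    shows that the part of [f] off the cube has mean zero. *)
Lemma avg_mask c r f : 0 < r -> adm f -> avg c r f = avg c r (fun y => f y * \1_(cube c r) y).
Proof.
move=> r0 af; have ac := adm_cube c r; have af1 := admM af ac.
pose h y := `|f y - f y * \1_(cube c r) y|.
have ah : adm h by apply: adm_abs; exact: admB.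
have h0 : avg c r h = 0.
  have rn : 0 < (2 * r) ^+ n by rewrite exprn_gt0 // mulr_gt0.
  apply: (mulfI (lt0r_neq0 rn)); rewrite mulr0 (avg_sub (c := c) (r := r)) //; last first.
  - by move=> y; exact: normr_ge0.
  - by move=> i; rewrite subrr normr0 add0r.
  rewrite (_ : (fun y => _) = (fun=> 0)); first by rewrite /avg ex_cst mulr0.
  by apply/funext => y; rewrite /h indicE; case: (_ \in _); rewrite ?mulr1 ?mulr0 // subrr normr0.
apply/eqP; rewrite -subr_eq0 -normr_le0 -h0 /avg -exB //; exact: (ex_abs _ (admB af af1)).
Qed.

Lemma avg_le_on c r f g : 0 < r -> adm f -> adm g ->
  (forall y, cube c r y -> f y <= g y) -> avg c r f <= avg c r g.
Proof.
move=> r0 af ag fg; rewrite (avg_mask _ r0 af) (avg_mask _ r0 ag).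
have ac := adm_cube c r; apply: ex_le; [exact: admM|exact: admM|] => y.
rewrite indicE; case: (boolP (y \in cube c r)) => [|_]; last by rewrite !mulr0.
by rewrite inE !mulr1 => /fg.
Qed.

Lemma avg_overlap (T : Type) (s : seq T) (cc : T -> 'rV[R]_n) (rho L : R) c r f :
  0 < rho -> rho <= r -> (forall k i, `|cc k 0 i - c 0 i| + rho <= r) ->
  (forall y, \sum_(k <- s) \1_(cube (cc k) rho) y <= L) -> adm f -> (forall y, 0 <= f y) ->
  \sum_(k <- s) (2 * rho) ^+ n * avg (cc k) rho f <= L * (2 * r) ^+ n * avg c r f.
Proof.
move=> rho0 rr sub ov af f0.
under eq_bigr => k _ do rewrite (avg_sub rho0 (sub k) rr af f0).
rewrite -mulr_sumr /avg -ex_sum; last by move=> k; apply: admM => //; exact: adm_cube.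
have rn : 0 <= (2 * r) ^+ n by rewrite exprn_ge0 // mulr_ge0 // (le_trans (ltW rho0)).
rewrite -mulrA mulrCA ler_wpM2l // -exZ //; apply: ex_le.
- by apply: adm_sum => k; apply: admM => //; exact: adm_cube.
- exact: admZ.
- by move=> y; rewrite -mulr_sumr mulrC ler_wpM2r.
Qed.

End CubeAverage.

(** * Binary words recording membership in countably many sets *)

Section Words.
Variables (R : realType) (d : measure_display) (T : measurableType d) (E : nat -> set T).
Hypothesis mE : forall j, measurable (E j).

Definition word (l : nat) (x : T) : seq bool := [seq `[< E j x >] | j <- iota 0 l].

Lemma size_word l x : size (word l x) = l.
Proof. by rewrite size_map size_iota. Qed.

Lemma wordS l x : word l.+1 x = rcons (word l x) `[< E l x >].
Proof. by rewrite /word -addn1 iotaD map_cat /= add0n cats1. Qed.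

Lemma take_word k l x : (k <= l)%N -> take k (word l x) = word k x.
Proof. by move=> kl; rewrite -map_take take_iota (minn_idPl kl). Qed.

Definition cell (s : seq bool) (x : T) : R := (word (size s) x == s)%:R.

Lemma cell_rcons s b x : cell (rcons s b) x = cell s x * (`[< E (size s) x >] == b)%:R.
Proof. by rewrite /cell size_rcons wordS eqseq_rcons -natrM mulnb. Qed.

Lemma adm_cell s : adm (cell s).
Proof.
elim/last_ind: s => [|s b IH]; first by rewrite (_ : cell [::] = fun=> 1) //; exact: adm_cst.
rewrite (_ : cell (rcons s b) = fun x => cell s x * (`[< E (size s) x >] == b)%:R); last first.
  by apply/funext => x; exact: cell_rcons.
apply: admM => //; rewrite (_ : (fun x => _) = (\1_(if b then E (size s) else ~` E (size s)) : T -> R)); last first.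
  apply/funext => x; rewrite indicE; congr (_%:R); congr nat_of_bool.
  case: b; case: asboolP => h; rewrite ?in_setC /=.
  - by rewrite mem_set.
  - by rewrite memNset.
  - by rewrite mem_set.
  - by rewrite memNset.
by apply: adm_indic; case: b => //; exact: measurableC.
Qed.

Lemma cell_split s x : cell s x = cell (rcons s false) x + cell (rcons s true) x.
Proof. by rewrite !cell_rcons -mulrDr; case: `[< _ >]; rewrite /= ?addr0 ?add0r mulr1. Qed.

Lemma sum_cell l x (g : seq bool -> R) : \sum_(s : l.-tuple bool) cell s x * g s = g (word l x).
Proof.
have sz : size (word l x) == l by rewrite size_word.
rewrite (bigD1 (Tuple sz)) //= /cell size_word eqxx mul1r big1 ?addr0 // => s.
by rewrite size_tuple -val_eqE /= eq_sym => /negbTE ->; rewrite mul0r.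
Qed.

Lemma adm_word l (g : seq bool -> R) : adm (fun x => g (word l x)).
Proof.
rewrite (_ : (fun x => _) = fun x => \sum_(s : l.-tuple bool) cell s x * g s); last first.
  by apply/funext => x; rewrite sum_cell.
by apply: adm_sum => s; apply: admM; [exact: adm_cell | exact: adm_cst].
Qed.

Lemma ex_word (P : probability T R) l (g : seq bool -> R) :
  ex P (fun x => g (word l x)) = \sum_(s : l.-tuple bool) ex P (cell s) * g s.
Proof.
rewrite (_ : (fun x => _) = fun x => \sum_(s : l.-tuple bool) g s * cell s x); last first.
  by apply/funext => x; rewrite -sum_cell; apply: eq_bigr => s _; rewrite mulrC.
rewrite ex_sum => [|s]; last by apply: admZ; exact: adm_cell.
by apply: eq_bigr => s _; rewrite exZ 1?mulrC //; exact: adm_cell.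
Qed.

(** Cell probabilities lie in [0, 1] and words are countable, so one diagonal subsequence makes all
    of them converge; nonnegativity, total mass and the splitting relation pass to the limit. *)
Lemma word_subseq (P : nat -> probability T R) : exists phi (c : seq bool -> R),
  [/\ forall k, (phi k < phi k.+1)%N,
   forall s, (fun k => ex (P (phi k)) (cell s)) @ \oo --> c s,
   forall s, 0 <= c s, c [::] = 1 & forall s, c s = c (rcons s false) + c (rcons s true)].
Proof.
pose w j : seq bool := odflt [::] (unpickle j).
have [n j|phi [l [phiS lP]]] := @diag_subseq R (fun n j => ex (P n) (cell (w j))) (fun=> 1).
  have h := @ex_norm_le _ _ _ (P n) (cell (w j)) 1 (adm_cell _); apply: h.
  by move=> x; rewrite ger0_norm /cell // lern1 leq_b1.
exists phi, (fun s => l (pickle s)).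
have cP s : (fun k => ex (P (phi k)) (cell s)) @ \oo --> l (pickle s).
  by have := lP (pickle s); rewrite /w pickleK.
split=> // [s||s].
- by apply: (cvgn_ge (cP s)) => k; apply: ex_ge0 => x; rewrite ler0n.
- rewrite -(cvg_lim _ (cP [::])) //; apply: cvg_lim => //.
  rewrite (_ : cell [::] = fun=> 1) //; under eq_fun do rewrite ex_cst; exact: cvg_cst.
- rewrite -(cvg_lim _ (cP s)) //; apply: cvg_lim => //.
  rewrite (_ : cell s = fun x => cell (rcons s false) x + cell (rcons s true) x); last first.
    by apply/funext => x; exact: cell_split.
  under eq_fun => k do rewrite (exD _ (adm_cell _) (adm_cell _)).
  exact: cvgD.
Qed.

End Words.


(* Nested subdivision of [0,1): the interval of the word [s] has length [c s]. *)
Section Coding.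
Variables (R : realType) (c : seq bool -> R).
Hypotheses (c0 : forall s, 0 <= c s) (c1 : c [::] = 1)
  (cS : forall s, c s = c (rcons s false) + c (rcons s true)).

(** Left endpoint of the interval of [s]: at every digit [true] the interval of the sibling [false]
    has been passed over. *)
Let F (s : seq bool) : R := \sum_(j < size s | nth false s j) c (rcons (take j s) false).

Let F_rcons s b : F (rcons s b) = F s + (if b then c (rcons s false) else 0).
Proof.
rewrite /F size_rcons big_mkcond big_ord_recr /= nth_rcons ltnn eqxx.
rewrite -cats1 take_size_cat //; congr (_ + _).
rewrite [RHS]big_mkcond; apply: eq_bigr => j _.
by rewrite nth_cat ltn_ord take_cat ltn_ord.
Qed.

Let st0 (u : R) := fix st0 l := if l is l'.+1
  then rcons (st0 l') (F (st0 l') + c (rcons (st0 l') false) <= u) else [::].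

Let F_range s : 0 <= F s /\ F s + c s <= 1.
Proof.
elim/last_ind: s => [|s b [h1 h2]]; first by rewrite /F big_ord0 add0r c1.
rewrite F_rcons; move: h2; rewrite (cS s); have := c0 (rcons s false); have := c0 (rcons s true).
by case: b; split; lra.
Qed.

Let size_st0 u l : size (st0 u l) = l.
Proof. by elim: l => //= l IH; rewrite size_rcons IH. Qed.

Let st0_range u l : 0 <= u < 1 -> F (st0 u l) <= u < F (st0 u l) + c (st0 u l).
Proof.
move=> u01; elim: l => [|l /andP[h1 h2]] /=; first by rewrite /F big_ord0 add0r c1.
move: h2; rewrite F_rcons (cS (st0 u l)).
by case: (leP (F (st0 u l) + c (rcons (st0 u l) false)) u) => [h|h] h2; apply/andP; split; lra.
Qed.

Let st0_eq u s : 0 <= u < 1 -> (st0 u (size s) == s) = (F s <= u < F s + c s).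
Proof.
move=> u01; apply/eqP/idP => [<-|]; first exact: st0_range.
elim/last_ind: s => [//|s b IH]; rewrite F_rcons size_rcons /= => h.
have -> : st0 u (size s) = s.
  apply: IH; move: h; rewrite (cS s); have := c0 (rcons s false); have := c0 (rcons s true).
  by case: b => p q /andP[h1 h2]; apply/andP; split; lra.
congr rcons; case: b h => /andP[h1 h2]; [apply/idP|apply/negbTE; rewrite -ltNge]; lra.
Qed.

(** Reals outside [0, 1) are sent to 0, so that every real has digits; the uniform law on the unit
    interval does not see the change. *)
Let kap (t : R) : R := t * \1_(`[0, 1[%classic : set R) t.

Let kap01 t : 0 <= kap t < 1.
Proof.
rewrite /kap indicE; case: (boolP (t \in _)) => [|_]; last by rewrite mulr0 lexx ltr01.
by rewrite inE /= in_itv /= mulr1.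
Qed.

Let kap_meas : measurable_fun setT kap.
Proof. by apply: measurable_funM => //; exact: measurable_indic. Qed.

Lemma coding : exists (U : probability R R) (st : nat -> R -> seq bool),
  [/\ forall l t, size (st l t) = l, forall l t, take l (st l.+1 t) = st l t,
   forall l t, 0 < c (st l t) &
   forall s, adm (fun t : R => (st (size s) t == s)%:R : R) /\
     ex U (fun t => (st (size s) t == s)%:R) = c s].
Proof.
have mid : measurable_fun setT (id : R -> R) by exact: measurable_id.
have [U [_ UP]] := push_law (uniform_prob (ltr01 : 0 < 1 :> R)) mid.
exists U, (fun l t => st0 (kap t) l); split=> [l t|l t|l t|s]; first exact: size_st0.
- by rewrite /= -cats1 take_size_cat ?size_st0.
- by have := st0_range l (kap01 t); lra.
have E t : (st0 (kap t) (size s) == s)%:R = (\1_(`[F s, F s + c s[%classic : set R) (kap t)) :> R.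
  rewrite st0_eq // indicE; congr (nat_of_bool _)%:R; apply/idP/idP.
    by move=> h; rewrite inE /= in_itv.
  by rewrite inE /= in_itv.
have af : adm (fun t : R => (st0 (kap t) (size s) == s)%:R : R).
  under eq_fun do rewrite E; apply: (adm_comp (h := kap) (f := \1_(`[F s, F s + c s[%classic : set R))) => //.
  by exists 1 => x; rewrite indicE; case: (_ \in _); rewrite ?normr1 ?normr0.
split => //; rewrite UP // /comp; apply: EFin_inj; rewrite -ex_EFin //.
have [mf _] := af.
rewrite integral_uniform //; last exact/measurable_EFinP.
rewrite subr0 invr1 mul1e -integral_itv_bndo_bndc; last first.
  by apply: measurable_funTS; exact/measurable_EFinP.
have [F0 F1] := F_range s.
transitivity (\int[@lebesgue_measure R]_(t in `[0%R, 1%R[) (\1_(`[F s, F s + c s[%classic : set R) t)%:E)%E.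
  by apply: eq_integral => t tI /=; rewrite E; congr ((\1__ _)%:E); rewrite /kap indicE tI mulr1.
rewrite integral_indic //= setIidl; last first.
  by move=> t /=; rewrite !in_itv /= => /andP[h1 h2]; apply/andP; split; lra.
rewrite lebesgue_measure_itv /= lte_fin ltrDl; case: ltP => [_|h].
  by rewrite -EFinB addrAC subrr add0r.
by congr EFin; apply/eqP; rewrite eq_le h c0.
Qed.

End Coding.

Lemma cvgn_sum (R : realType) (I : Type) (s : seq I) (u : I -> nat -> R) (l : I -> R) :
  (forall i, u i @ \oo --> l i) -> (fun k => \sum_(i <- s) u i k) @ \oo --> \sum_(i <- s) l i.
Proof.
move=> ul; elim: s => [|i s IH].
  by under eq_fun do rewrite big_nil; rewrite big_nil; exact: cvg_cst.
by under eq_fun do rewrite big_cons; rewrite big_cons; exact: cvgD.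
Qed.

(** * Compactness of tight laws *)

Section CompactSupport.
Variables (R : realType) (n : nat).
Implicit Types (x y : 'rV[R]_n).

(** All rational half-spaces orthogonal to the axes, numbered through [pickle]; integers that are no
    code give the empty set. *)
Definition halfspace (j : nat) : set (Rd R n) :=
  if @unpickle ('I_n * rat)%type j is Some iq then [set x | x 0 iq.1 < ratr iq.2] else set0.

Lemma halfspace_meas j : measurable (halfspace j).
Proof.
rewrite /halfspace; case: unpickle => [[i q]|] //=.
rewrite (_ : (fun x : Rd R n => _) = (fun x : Rd R n => x 0 i) @^-1` `]-oo, ratr q[); last first.
  by apply/seteqP; split => x /=; rewrite in_itv.
rewrite -[X in measurable X]setTI; exact: coord_meas.
Qed.

Notation hword := (word halfspace).

Lemma word_mem l x y j : hword l x = hword l y -> (j < l)%N -> halfspace j x -> halfspace j y.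
Proof.
move=> e jl; have := congr1 (fun s => nth false s j) e.
rewrite !(nth_map 0%N) ?size_iota // nth_iota // add0n => e' h.
by apply/asboolP; rewrite -e'; apply/asboolP.
Qed.

(** In a bounded region finitely many half-spaces, with thresholds at multiples of 1/N, confine each
    coordinate to an interval of length 1/N. A word long enough to contain their numbers determines
    the point up to [delta]. *)
Lemma word_close (rho delta : R) : 0 < delta -> exists l, forall l' x y, (l <= l')%N ->
  hword l' x = hword l' y -> `|x| <= rho -> `|x - y| <= delta.
Proof.
move=> d0; pose N := (Num.truncn delta^-1).+1.
have N0 : 0 < N%:R :> R by rewrite ltr0n.
have Nd : N%:R^-1 <= delta.
  by rewrite -[delta]invrK lef_pV2 ?posrE ?invr_gt0 // ltW // truncnS_gt.
pose J := (Num.truncn (`|rho| * N%:R)).+3.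
pose q (z : int) : rat := z%:~R / N%:R.
have qE z : ratr (q z) = z%:~R / N%:R :> R by rewrite fmorph_div /= ratr_int ratr_nat.
pose g (ij : 'I_n * 'I_(2 * J).+1) : nat := (pickle (ij.1, q ((ij.2)%:Z - J%:Z))).+1.
exists (\max_ij g ij) => l' x y ll e xr.
have H (i : 'I_n) z : (`|z| <= J)%N -> (pickle (i, q z) < l')%N.
  move=> zJ; apply: leq_trans ll.
  pose j : 'I_(2 * J).+1 := inord `|(z + J%:Z)%R|%N.
  have jE : (j : nat)%:Z - J%:Z = z by rewrite inordK; lia.
  by have := leq_bigmax (F := g) (i, j); rewrite /g /= jE.
have hE i z w : halfspace (pickle (i, q z)) w = (w 0 i < z%:~R / N%:R) :> Prop.
  by rewrite /halfspace pickleK /= qE.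
apply/row_normP => [|i]; first exact: ltW.
apply: le_trans Nd; rewrite !mxE.
pose z := Num.floor (x 0 i * N%:R).
have /andP[f1 f2] := floor_itv (x 0 i * N%:R); rewrite -/z in f1 f2.
have xi := le_trans (row_norm_le x i) xr.
have xN : `|x 0 i * N%:R| <= `|rho| * N%:R.
  by rewrite normrM (ger0_norm (ltW N0)) ler_pM2r // (le_trans xi) // ler_norm.
have zJ : (`|z|.+1 <= J)%N.
  rewrite /J ltnS -(ler_nat R) natr_absz intr_norm -natr1.
  have := truncnS_gt (`|rho| * N%:R); move: xN f1 f2; rewrite intrD (_ : 1%:~R = 1) //.
  set T := (_.+1)%:R; set zz := z%:~R; rewrite !ler_norml => /andP[a b] c d e1.
  by apply/andP; split; lra.
have x1 : ~ halfspace (pickle (i, q z)) y.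
  move/(word_mem (esym e) (H i z (ltnW zJ))); rewrite hE ltr_pdivlMr // => /lt_le_trans/(_ f1).
  by rewrite ltxx.
have x2 : halfspace (pickle (i, q (z + 1))) y.
  apply: (word_mem e); first by apply: H; move: zJ; clear; lia.
  by rewrite hE ltr_pdivlMr.
move: x1 x2; rewrite !hE => /negP; rewrite -leNgt intrD mulrDl mul1r => y1 y2.
move: f1 f2; rewrite -ler_pdivrMr // intrD -ltr_pdivlMr // mulrDl mul1r => f1 f2.
by rewrite ler_norml; apply/andP; split; lra.
Qed.

(** The default 0 is returned for a word that no point has; such words have weight zero in the
    limit. *)
Definition wpt (s : seq bool) : 'rV[R]_n := xget 0 [set x | hword (size s) x = s].

Lemma wptP l x : hword l (wpt (hword l x)) = hword l x.
Proof.
rewrite /wpt; case: xgetP => [y _ /=|/(_ x)]; rewrite size_word //.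
by move=> /(_ erefl).
Qed.

Lemma limn_esup_range (u : nat -> R) (a b : R) l : (forall l', (l <= l')%N -> a <= u l' <= b) ->
  a <= fine (limn_esup (fun l => (u l)%:E)) <= b.
Proof.
move=> h.
have hi : (limn_esup (fun l => (u l)%:E) <= b%:E)%E.
  rewrite limn_esup_lim; apply: lime_le; first exact: is_cvg_esups.
  exists l => // k /= lk; apply: ge_ereal_sup => _ [j /= kj <-]; rewrite lee_fin.
  by have /andP[] := h j (leq_trans lk kj).
have lo : (a%:E <= limn_esup (fun l => (u l)%:E))%E.
  rewrite limn_esup_lim; apply: lime_ge; first exact: is_cvg_esups.
  exists l => // k /= lk; apply: (@le_trans _ _ (u k)%:E).
    by rewrite lee_fin; have /andP[] := h k lk.
  by rewrite /esups; apply: ereal_sup_ubound; exists k => //=.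
by case: (limn_esup _) hi lo => [r| |] //=; rewrite !lee_fin => -> ->.
Qed.

(** The limit weights are realized by a random infinite word on the real line, from which [X] reads
    off a point. Up to small mass, a continuous function of compact support is close to a function
    of the first [l] letters, under the given laws and under the limit alike, and expectations of
    such functions converge by the choice of the subsequence. *)
Lemma tight_cvg (P : nat -> probability (Rd R n) R) :
  (forall e, 0 < e -> exists rho, forall k, ex (P k) (\1_[set x : 'rV[R]_n | rho < `|x|]) <= e) ->
  exists phi (Q : probability (Rd R n) R), (forall k, (phi k < phi k.+1)%N) /\
    forall f : 'rV[R]_n -> R, continuous f -> (exists rho, forall x, rho < `|x| -> f x = 0) ->
      (fun k => ex (P (phi k)) f) @ \oo --> ex Q f.
Proof.
move=> tight.
have [phi [c [phiS cP c0 c1 cS]]] := word_subseq halfspace_meas P.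
have [U [st [stsz stT stc stP]]] := coding c0 c1 cS.
have stW l t : hword l (wpt (st l t)) = st l t.
  rewrite /wpt; case: xgetP => [y _ /=|]; rewrite stsz // => h.
  have := stc l t; suff -> : c (st l t) = 0 by rewrite ltxx.
  rewrite -(cvg_lim _ (cP (st l t))) //; apply: cvg_lim => //.
  rewrite (_ : cell R halfspace (st l t) = fun=> 0); first by under eq_fun do rewrite ex_cst; exact: cvg_cst.
  apply/funext => x; rewrite /cell stsz; case: eqP => // e.
  by have := h x; rewrite /= e.
have stT' l t j : take l (st (l + j)%N t) = st l t.
  elim: j => [|j IH]; first by rewrite addn0 -{1}(stsz l t) take_size.
  rewrite -[RHS]IH -(stT (l + j)%N t) take_takel ?leq_addr //; congr take.
  by rewrite addnS.
(* The upper limit is measurable with no convergence to be checked; where a long prefix has its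
   representative in a bounded region, all later ones stay close to it, and so does [X]. *)
pose X t : 'rV[R]_n := \row_i fine (limn_esup (fun l => (wpt (st l t) 0 i)%:E)).
have sumst l t (g : seq bool -> R) :
    \sum_(s : l.-tuple bool) (st (size s) t == s)%:R * g s = g (st l t).
  have sz : size (st l t) == l by rewrite stsz.
  rewrite (bigD1 (Tuple sz)) //= stsz eqxx mul1r big1 ?addr0 // => s.
  by rewrite size_tuple -val_eqE /= eq_sym => /negbTE ->; rewrite mul0r.
have adm_st l (g : seq bool -> R) : adm (fun t : R => g (st l t)).
  rewrite (_ : (fun t => _) = fun t => \sum_(s : l.-tuple bool) (st (size s) t == s)%:R * g s); last first.
    by apply/funext => t; rewrite sumst.
  by apply: adm_sum => s; apply: admM; [case: (stP s) | exact: adm_cst].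
have ex_st l (g : seq bool -> R) : ex U (fun t : R => g (st l t)) = \sum_(s : l.-tuple bool) c s * g s.
  rewrite (_ : (fun t => _) = fun t => \sum_(s : l.-tuple bool) g s * (st (size s) t == s)%:R); last first.
    by apply/funext => t; rewrite -[LHS]sumst; apply: eq_bigr => s _; rewrite mulrC.
  rewrite ex_sum => [|s]; last by apply: admZ; case: (stP s).
  by apply: eq_bigr => s _; have [a e] := stP s; rewrite exZ // e mulrC.
have mX : measurable_fun setT (X : R -> Rd R n).
  apply: meas_Rd => i; under eq_fun do rewrite mxE.
  apply: (measurableT_comp (f := fine)) => //; apply: measurable_fun_limn_esup => l.
  by apply/measurable_EFinP; case: (adm_st l (fun s => wpt s 0 i)).
have [Q [_ QP]] := push_law U mX.
exists phi, Q; split => // f fc [rho0 f0].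
have [M0 [M00 fM0]] := bounded_on_ball rho0 fc.
have fM x : `|f x| <= M0.
  by case: (lerP `|x| rho0) => [/fM0 //|/f0 ->]; rewrite normr0.
have af : adm (f : Rd R n -> R) by split; [exact: cont_meas | exists M0].
apply/cvgrPdist_le => e e0.
(* The errors add up to [3 * e1 + 2 * M0 * e1], the last term coming from words whose representative
   leaves the ball. *)
pose e1 := e / (4 + 2 * M0).
have e10 : 0 < e1 by rewrite divr_gt0 //; lra.
have [rho1 hrho1] := tight e1 e10.
(* The margin 1 accounts for passing from a point of the ball [rho1] to the representative of its
   word. *)
pose rho := Num.max rho0 (rho1 + 1).
have [delta [d0 fd]] := unif_cont_ball rho fc e10.
have [l1 hl1] := word_close rho d0.
have [l2 hl2] := word_close rho1 ltr01.
pose l := maxn l1 l2.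
have hX t : `|wpt (st l t)| <= rho -> `|X t - wpt (st l t)| <= delta.
  move=> wr; apply/row_normP => [|i]; first exact: ltW.
  rewrite !mxE ler_norml lerBrDr lerBlDr.
  apply: (@limn_esup_range _ _ _ l) => l' ll'.
  have : `|wpt (st l t) - wpt (st l' t)| <= delta.
    apply: (hl1 l) => //; first exact: leq_maxl.
    by rewrite stW -[RHS](take_word _ _ ll') stW -(subnKC ll') stT'.
  move/(le_trans (row_norm_le _ i)); rewrite !mxE ler_norml => /andP[a b].
  by apply/andP; split; lra.
have tailc : \sum_(s : l.-tuple bool) c s * (rho < `|wpt s|)%R%:R <= e1.
  have cv : (fun k => \sum_(s : l.-tuple bool) ex (P (phi k)) (cell R halfspace s) * (rho < `|wpt s|)%R%:R)
      @ \oo --> \sum_(s : l.-tuple bool) c s * (rho < `|wpt s|)%R%:R.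
    apply: cvgn_sum => s; apply: cvgM; [exact: cP | exact: cvg_cst].
  apply: (cvgn_le cv) => k; apply: le_trans (hrho1 (phi k)).
  rewrite -(ex_word halfspace_meas _ _ (fun s => (rho < `|wpt s|)%R%:R)).
  have mn : measurable [set x : Rd R n | rho1 < `|x : 'rV[R]_n|].
    rewrite -[X in measurable X]setTI.
    have mnorm : measurable_fun setT (fun x : Rd R n => `|x : 'rV[R]_n|).
      by apply: cont_meas; exact: norm_continuous.
    rewrite (_ : [set x | _] = (fun x : Rd R n => `|x : 'rV[R]_n|) @^-1` `]rho1, +oo[); last first.
      by apply/seteqP; split => x /=; rewrite in_itv /= andbT.
    exact: mnorm.
  apply: ex_le; [exact: (adm_word halfspace_meas l (fun s => (rho < `|wpt s|)%R%:R))|exact: adm_indic|].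
  move=> x; rewrite indicE; case: ltP => // w; rewrite mem_set //= ltNge; apply/negP => xr.
  have := hl2 l x (wpt (hword l x)) (leq_maxr _ _); rewrite wptP => /(_ erefl xr) h.
  move: w; rewrite /rho gt_max => /andP[_]; rewrite ltNge => /negP; apply.
  have := ler_normB x (x - wpt (hword l x)); rewrite opprB addrC subrK; lra.
have D1 k : `|ex (P (phi k)) f - \sum_(s : l.-tuple bool) ex (P (phi k)) (cell R halfspace s) * f (wpt s)| <= e1.
  rewrite -(ex_word halfspace_meas _ _ (fun s => f (wpt s))).
  have aw := adm_word halfspace_meas l (fun s => f (wpt s)).
  rewrite -exB //; apply: ex_norm_le; first exact: admB.
  move=> x; have w := wptP l x; have l1l : (l1 <= l)%N by exact: leq_maxl.
  case: (lerP `|x| rho) => xr.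
    have := fd x (wpt (hword l x) - x) xr; rewrite distrC => /(_ (hl1 l _ _ l1l (esym w) xr)).
    by rewrite (addrC x) subrK distrC.
  case: (lerP `|wpt (hword l x)| rho) => yr.
    have := fd (wpt (hword l x)) (x - wpt (hword l x)) yr; rewrite distrC => /(_ (hl1 l _ _ l1l w yr)).
    by rewrite (addrC (wpt _)) subrK.
  have r0 : rho0 <= rho by rewrite le_max lexx.
  by rewrite !f0 ?subrr ?normr0 ?ltW //; exact: le_lt_trans r0 _.
have D2 : `|ex Q f - \sum_(s : l.-tuple bool) c s * f (wpt s)| <= e1 + 2 * M0 * e1.
  rewrite QP // -(ex_st l (fun s => f (wpt s))) -exB; last 2 first.
  - by apply: (adm_comp mX); [exact: cont_meas | exists M0].
  - exact: (adm_st l (fun s => f (wpt s))).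
  have afX : adm (f \o X) by apply: (adm_comp mX); [exact: cont_meas | exists M0].
  apply: (le_trans (ex_abs _ (admB afX (adm_st l (fun s => f (wpt s)))))).
  apply: (@le_trans _ _ (ex U (fun t => e1 + 2 * M0 * (rho < `|wpt (st l t)|)%R%:R))).
    apply: ex_le.
    - by apply: adm_abs; apply: admB => //; exact: (adm_st l (fun s => f (wpt s))).
    - apply: admD; [exact: adm_cst | apply: admZ; exact: (adm_st l (fun s => (rho < `|wpt s|)%R%:R))].
    move=> t /=; case: ltP => w.
      rewrite mulr1; apply: (le_trans (ler_normB _ _)).
      by have := fM (X t); have := fM (wpt (st l t)); have := ltW e10; lra.
    rewrite mulr0 addr0; have := fd _ (X t - wpt (st l t)) w (hX t w).
    by rewrite (addrC (wpt _)) subrK.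
  rewrite exD; [|exact: adm_cst|apply: admZ; exact: (adm_st l (fun s => (rho < `|wpt s|)%R%:R))].
  rewrite ex_cst exZ; last exact: (adm_st l (fun s => (rho < `|wpt s|)%R%:R)).
  by rewrite lerD2l ler_wpM2l // ?mulr_ge0 // (ex_st l (fun s => (rho < `|wpt s|)%R%:R)).
have cv : (fun k => \sum_(s : l.-tuple bool) ex (P (phi k)) (cell R halfspace s) * f (wpt s))
    @ \oo --> \sum_(s : l.-tuple bool) c s * f (wpt s).
  by apply: cvgn_sum => s; apply: cvgM; [exact: cP | exact: cvg_cst].
move/cvgrPdist_le : cv => /(_ e1 e10); apply: filterS => k D3.
have eE : e1 + 2 * M0 * e1 + e1 + e1 <= e.
  have -> : e = e1 * (4 + 2 * M0) by rewrite /e1 divfK // gt_eqF //; lra.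
  have := ltW e10; lra.
apply: le_trans eE; have := D1 k; move: D2 D3; set a := ex Q f; set b := ex _ _.
set g := \sum_(s : _) _; set h := \sum_(s : _) _ => D2 D3 D1k.
have -> : a - b = (a - g) + (g - h) - (b - h) by ring.
apply: (le_trans (ler_normB _ _)); apply: lerD => //; apply: (le_trans (ler_normD _ _)).
exact: lerD.
Qed.

End CompactSupport.

Section VCompact.
Variables (R : realType) (n : nat).
Implicit Types (x : 'rV[R]_n) (f V : 'rV[R]_n -> R).

Lemma norm_le_enorm x : `|x| <= enorm x.
Proof.
apply/row_normP => [|i]; first exact: sqrtr_ge0.
rewrite -sqrtr_sqr /enorm ler_wsqrtr // (bigD1 i) //= lerDl sumr_ge0 // => j _.
exact: sqr_ge0.
Qed.

Lemma enorm_le x : enorm x <= n%:R * `|x|.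
Proof.
rewrite -[X in _ <= X]ger0_norm ?mulr_ge0 // -sqrtr_sqr /enorm ler_wsqrtr //.
apply: (@le_trans _ _ (\sum_(i < n) `|x| ^+ 2)).
  apply: ler_sum => i _; rewrite -[x 0 i ^+ 2]ger0_norm ?sqr_ge0 // normrX.
  by rewrite lerXn2r ?nnegrE // row_norm_le.
rewrite sumr_const card_ord -[_ *+ n]mulr_natl exprMn ler_wpM2r ?exprn_ge0 //.
by rewrite expr2 -natrM ler_nat; case: (n) => // m; rewrite leq_pmulr.
Qed.

Definition cutoff (rho : R) x : R := Num.max 0 (Num.min 1 (rho + 1 - `|x|)).

Lemma cutoff_ge0 rho x : 0 <= cutoff rho x. Proof. by rewrite le_max lexx. Qed.

Lemma cutoff_le1 rho x : cutoff rho x <= 1.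
Proof. by rewrite ge_max ler01 ge_min lexx. Qed.

Lemma cutoff_in rho x : `|x| <= rho -> cutoff rho x = 1.
Proof. by move=> h; rewrite /cutoff min_l ?max_r //; lra. Qed.

Lemma cutoff_out rho x : rho + 1 <= `|x| -> cutoff rho x = 0.
Proof. by move=> h; rewrite /cutoff max_l // ge_min; apply/orP; right; lra. Qed.

Lemma cutoff_mono rho rho' x : rho <= rho' -> cutoff rho x <= cutoff rho' x.
Proof.
move=> h; rewrite /cutoff ge_max le_max lexx /= le_max; apply/orP; right.
by rewrite le_min !ge_min lexx /=; apply/orP; right; lra.
Qed.

Lemma cutoff_cont rho : continuous (cutoff rho).
Proof.
apply/cont_ed => x e e0; exists e; split => // v ve.
have h1 := ler_normD x v; have h2 := ler_normB (x + v) v; rewrite addrK in h2.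
have h3 := normr_ge0 v.
rewrite /cutoff !maxEle !minEle.
have : `|(rho + 1 - `|x + v|) - (rho + 1 - `|x|)| <= e by rewrite ler_norml; apply/andP; split; lra.
move: (rho + 1 - _) (rho + 1 - _) => a b; rewrite !ler_norml => /andP[? ?].
by case: (leP 1 a) => ?; case: (leP 1 b) => ?; rewrite ?ler01;
  case: (leP 0 a) => ?; case: (leP 0 b) => ?; apply/andP; split; lra.
Qed.

Lemma cutoffM_cont rho f : continuous f -> continuous (fun x => cutoff rho x * f x).
Proof. by move=> fc x; exact: (cvgM (@cutoff_cont rho x) (fc x)). Qed.

Lemma adm_cont_supp f rho : continuous f -> (forall x, rho < `|x| -> f x = 0) -> adm (f : Rd R n -> R).
Proof.
move=> fc f0; split; first exact: cont_meas.
have [M [M0 fM]] := bounded_on_ball rho fc; exists M => x.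
by case: (lerP `|x| rho) => [/fM //|/f0 ->]; rewrite normr0.
Qed.

Lemma adm_cutoffM rho f : continuous f -> adm ((fun x => cutoff rho x * f x) : Rd R n -> R).
Proof.
move=> fc; apply: (@adm_cont_supp _ (rho + 1)); first exact: cutoffM_cont.
by move=> x /ltW /cutoff_out ->; rewrite mul0r.
Qed.

Variable V : 'rV[R]_n -> R.
Hypotheses (Vc : continuous V) (V0 : forall x, 0 <= V x)
  (Vinf : forall M : R, exists r : R, forall x, r < enorm x -> M < V x).

Let mV : measurable_fun setT (V : Rd R n -> R). Proof. exact: cont_meas. Qed.

Lemma coercive_norm M : exists r, forall x, r < `|x| -> M < V x.
Proof.
have [r h] := Vinf M; exists r => x xr; apply: h; exact: lt_le_trans xr (norm_le_enorm x).
Qed.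

Lemma inPRV_inPV Rb mu : inPRV V Rb mu -> inPV V mu.
Proof.
move=> h; apply/integrableP; split; first exact/measurable_EFinP.
rewrite (eq_integral (fun x : Rd R n => (V x)%:E)).
  by apply: le_lt_trans h _; rewrite ltry.
by move=> x _; rewrite /= ger0_norm.
Qed.

Lemma ex_le_V Rb mu f : inPRV V Rb mu -> adm (f : Rd R n -> R) -> (forall x, 0 <= f x) -> (forall x, f x <= V x) ->
  ex mu f <= Rb.
Proof.
move=> h af f0 fV; rewrite -lee_fin -(ex_EFin mu af); apply: le_trans h.
have [mf _] := af; apply: ge0_le_integral => //.
- by move=> x _; rewrite lee_fin.
- exact/measurable_EFinP.
- exact/measurable_EFinP.
- by move=> x _; rewrite lee_fin.
Qed.

(** Markov's inequality: outside some ball [V] exceeds [(|Rb| + 1) / e]. *)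
Lemma V_tight Rb e : 0 < e -> exists rho, forall mu, inPRV V Rb mu ->
  ex mu (\1_[set x : 'rV[R]_n | rho < `|x|]) <= e.
Proof.
move=> e0; pose M := (`|Rb| + 1) / e; have M0 : 0 < M by rewrite divr_gt0 // ltr_wpDl.
have [r hr] := coercive_norm M; exists r => mu h.
have mn : measurable ([set x | r < `|x|] : set (Rd R n)).
  rewrite -[X in measurable X]setTI.
  have mnorm : measurable_fun setT (fun x : Rd R n => `|x : 'rV[R]_n|).
    by apply: cont_meas; exact: norm_continuous.
  rewrite (_ : [set x | _] = (fun x : Rd R n => `|x : 'rV[R]_n|) @^-1` `]r, +oo[); last first.
    by apply/seteqP; split => x /=; rewrite in_itv /= andbT.
  exact: mnorm.
have ai := @adm_indic R _ (Rd R n) _ mn.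
have le : ex mu (fun x => M * \1_[set x : 'rV[R]_n | r < `|x|] x) <= Rb.
  apply: (ex_le_V h).
  - exact: admZ.
  - by move=> x; rewrite indicE; apply: mulr_ge0; first exact: ltW.
  - move=> x; rewrite indicE; case: (boolP (x \in _)) => [|_]; last by rewrite mulr0.
    by rewrite inE /= mulr1 => /hr /ltW.
move: le; rewrite exZ // mulrC -ler_pdivlMr // => /le_trans; apply.
rewrite /M invf_div mulrA ler_pdivrMr ?ltr_wpDl // mulrC ler_wpM2l ?ltW //.
by have := ler_norm Rb; lra.
Qed.

(** Monotone convergence along the cutoffs: the moment bound can be checked on functions of compact
    support, to which the convergence of laws applies. *)
Lemma inPRV_lim Rb (mu : probability (Rd R n) R) : (forall k : nat, ex mu (fun x => cutoff k%:R x * V x) <= Rb) -> inPRV V Rb mu.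
Proof.
move=> h; pose g (k : nat) (x : Rd R n) : \bar R := (cutoff k%:R x * V x)%:E.
have mg k : measurable_fun setT (g k).
  by apply/measurable_EFinP; apply: cont_meas; exact: cutoffM_cont.
have g0 k x : setT x -> (0 <= g k x)%E by rewrite lee_fin mulr_ge0 // cutoff_ge0.
have gnd x : setT x -> {homo g ^~ x : k l / (k <= l)%N >-> (k <= l)%E}.
  by move=> _ k l kl; rewrite lee_fin ler_wpM2r // cutoff_mono // ler_nat.
have cv := @cvg_monotone_convergence _ _ _ mu _ measurableT g mg g0 gnd.
rewrite /inPRV (_ : (fun x => _) = fun x : Rd R n => limn (g ^~ x)); last first.
  apply/funext => x; apply/esym/lim_near_cst => //.
  exists (Num.truncn `|x : 'rV[R]_n|).+1 => // k /= kx; rewrite /g cutoff_in ?mul1r //.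
  by rewrite ltW // (lt_le_trans (truncnS_gt _)) // ler_nat.
rewrite -(cvg_lim _ cv) //; apply: lime_le; first by apply/cvg_ex; eexists; exact: cv.
by apply: nearW => k; rewrite (ex_EFin mu (adm_cutoffM _ Vc)) lee_fin.
Qed.

(** Beyond the radius [rho] the function is at most [e V], so cutting it off costs [e Rb] at most,
    uniformly over the laws with this moment bound. This extends convergence from compact supports
    to the [V]-weak class. *)
Lemma V_cutoff_close Rb mu f e rho : inPRV V Rb mu -> continuous f -> 0 <= e ->
  (forall x, rho < `|x| -> `|f x| <= e * V x) ->
  mu.-integrable setT (fun x : Rd R n => (f x)%:E) /\
  `|Rintegral mu setT f - ex mu (fun x => cutoff rho x * f x)| <= e * Rb.
Proof.
move=> h fc e0 fV; have iV := inPRV_inPV h.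
have [M [M0 fM]] := bounded_on_ball rho fc.
have iMV : mu.-integrable setT (fun x : Rd R n => (M + e * V x)%:E).
  rewrite (_ : (fun x => _) = (fun x : Rd R n => M%:E + e%:E * (V x)%:E)%E); last first.
    by apply/funext => x; rewrite EFinD EFinM.
  apply: integrableD => //; last exact: integrableZl.
  exact: (adm_integrable mu (adm_cst _ M)).
have intf : mu.-integrable setT (fun x : Rd R n => (f x)%:E).
  apply: (le_integrable measurableT _ _ iMV).
    by apply/measurable_EFinP; exact: cont_meas.
  move=> x _; rewrite lee_fin [leRHS]ger0_norm ?addr_ge0 ?mulr_ge0 //.
  case: (lerP `|x : 'rV[R]_n| rho) => [/fM xM|/fV xV]; first by rewrite ler_wpDr ?mulr_ge0.
  exact: ler_wpDl.
split => //.
have ac := adm_integrable mu (adm_cutoffM rho fc).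
rewrite /ex -RintegralB //.
have iB : mu.-integrable setT (EFin \o (fun x : Rd R n => f x - cutoff rho x * f x)).
  by have := integrableB measurableT intf ac; apply: eq_integrable.
apply: (le_trans (le_normr_Rintegral measurableT iB)).
apply: (@le_trans _ _ (Rintegral mu setT (fun x : Rd R n => e * V x))).
  apply: le_Rintegral => //.
  - have := integrable_abse iB; apply: eq_integrable => //.
  - have := integrableZl measurableT e iV; apply: eq_integrable => // x _ /=.
  - move=> x _; case: (lerP `|x : 'rV[R]_n| rho) => [xr|/fV xV].
      by rewrite cutoff_in // mul1r subrr normr0 mulr_ge0.
    apply: le_trans xV; rewrite -{1}[f x]mul1r -mulrBl normrM ler_piMl //.
    by rewrite ger0_norm ?subr_ge0 ?cutoff_le1 // lerBlDr lerDl cutoff_ge0.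
rewrite RintegralZl // ler_wpM2l // -lee_fin /Rintegral fineK //.
by have := integrable_fin_num measurableT iV.
Qed.

Theorem V_compact Rb (mu : nat -> probability (Rd R n) R) : (forall k, inPRV V Rb (mu k)) ->
  exists phi (nu : probability (Rd R n) R), [/\ forall k, (phi k < phi k.+1)%N, inPRV V Rb nu,
    Vweak_cvg V (fun k => mu (phi k)) nu &
    forall f : 'rV[R]_n -> R, continuous f -> (exists rho, forall x, rho < `|x| -> f x = 0) ->
      (fun k => ex (mu (phi k)) f) @ \oo --> ex nu f].
Proof.
move=> h; have [e e0|phi [nu [phiS cv]]] := tight_cvg (P := mu).
  by have [rho H] := V_tight Rb e0; exists rho => k; exact: H.
have supp rho f : exists rho', forall x, rho' < `|x| -> cutoff rho x * f x = 0.
  by exists (rho + 1) => x /ltW /cutoff_out ->; rewrite mul0r.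
have hn : inPRV V Rb nu.
  apply: inPRV_lim => k; apply: (cvgn_le (cv _ (@cutoffM_cont k%:R _ Vc) (supp _ _))) => j.
  apply: (ex_le_V (h _)); first exact: adm_cutoffM.
    by move=> x; rewrite mulr_ge0 // cutoff_ge0.
  by move=> x; rewrite ler_piMl // cutoff_le1.
have Rb0 : 0 <= Rb.
  by rewrite -lee_fin; apply: le_trans hn; apply: integral_ge0 => x _; rewrite lee_fin.
exists phi, nu; split => // f fc fV.
have bnd e : 0 < e -> exists rho, forall x, rho < `|x| -> `|f x| <= e * V x.
  move=> e0; have [r hr] := fV e e0; have [r' hr'] := coercive_norm 0.
  exists (Num.max r r') => x; rewrite gt_max => /andP[xr xr'].
  have Vp := hr' x xr'; have := hr x (lt_le_trans xr (norm_le_enorm x)).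
  by rewrite normrM normfV (ger0_norm (V0 x)) ltr_pdivrMr // => /ltW.
have [r1 hr1] := bnd 1 ltr01.
have fin nu' : inPRV V Rb nu' -> (\int[nu']_(x in setT) (f x)%:E)%E = (Rintegral nu' setT f)%:E.
  move=> hnu; have [intf _] := V_cutoff_close hnu fc ler01 hr1.
  by rewrite /Rintegral fineK //; exact: integrable_fin_num intf.
rewrite (fin nu hn) (_ : (fun p => _) = fun p => (Rintegral (mu (phi p)) setT f)%:E); last first.
  by apply/funext => p; exact: fin.
apply: cvg_EFin; first by apply: nearW.
apply/cvgrPdist_le => e e0 /=.
pose e1 := e / (2 * Rb + 1).
have e10 : 0 < e1 by rewrite divr_gt0 //; lra.
have [rho hrho] := bnd e1 e10.
move/cvgrPdist_le: (cv _ (@cutoffM_cont rho _ fc) (supp rho f)) => /(_ e1 e10); apply: filterS => k.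
have [_ h1] := V_cutoff_close hn fc (ltW e10) hrho.
have [_ h2] := V_cutoff_close (h (phi k)) fc (ltW e10) hrho => h3.
have -> : e = e1 * Rb + e1 + e1 * Rb.
  have -> : e = e1 * (2 * Rb + 1) by rewrite /e1 divfK // gt_eqF //; lra.
  by ring.
move: h1 h2 h3; set a := Rintegral nu _ _; set b := Rintegral _ _ _; set c := ex nu _; set d := ex _ _.
move=> h1 h2 h3; have -> : a - b = (a - c) + (c - d) - (b - d) by ring.
apply: (le_trans (ler_normB _ _)); apply: lerD => //.
by apply: (le_trans (ler_normD _ _)); apply: lerD.
Qed.

End VCompact.

(** * Approximation in mean by continuous functions *)

Section ContinuousReal.
Variables (R : realType) (T : topologicalType).
Implicit Types (f g : T -> R).

Lemma cont_cst (c : R) : continuous (fun _ : T => c).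
Proof. by move=> x; exact: cvg_cst. Qed.

Lemma contD f g : continuous f -> continuous g -> continuous (fun x => f x + g x).
Proof. by move=> fc gc x; exact: (cvgD (fc x) (gc x)). Qed.

Lemma contB f g : continuous f -> continuous g -> continuous (fun x => f x - g x).
Proof. by move=> fc gc x; exact: (cvgB (fc x) (gc x)). Qed.

Lemma contM f g : continuous f -> continuous g -> continuous (fun x => f x * g x).
Proof. by move=> fc gc x; exact: (cvgM (fc x) (gc x)). Qed.

Lemma cont_norm f : continuous f -> continuous (fun x => `|f x|).
Proof. by move=> fc x; exact: (cvg_norm (fc x)). Qed.

Lemma cont_sum (I : Type) (s : seq I) (F : I -> T -> R) :
  (forall i, continuous (F i)) -> continuous (fun x => \sum_(i <- s) F i x).
Proof.
move=> Fc; elim: s => [|i s IH].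
  by under eq_fun do rewrite big_nil; exact: cont_cst.
by under eq_fun do rewrite big_cons; exact: contD.
Qed.

Lemma max_lip (c a b : R) : `|Num.max c a - Num.max c b| <= `|a - b|.
Proof.
have h1 := ler_norm (a - b); have h2 := ler_norm (b - a); rewrite distrC in h2.
have h3 := normr_ge0 (a - b).
by rewrite ler_norml; case: (lerP c a); case: (lerP c b) => ? ?; apply/andP; split; lra.
Qed.

Lemma min_lip (c a b : R) : `|Num.min c a - Num.min c b| <= `|a - b|.
Proof.
have h1 := ler_norm (a - b); have h2 := ler_norm (b - a); rewrite distrC in h2.
have h3 := normr_ge0 (a - b).
by rewrite ler_norml; case: (lerP c a); case: (lerP c b) => ? ?; apply/andP; split; lra.
Qed.

Lemma cont_clip (c d : R) f : continuous f -> continuous (fun x => Num.max c (Num.min d (f x))).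
Proof.
move=> fc x; apply/(@cvgrPdist_le _ _ _ _ (nbhs_filter x)) => e e0.
have /(@cvgrPdist_le _ _ _ _ (nbhs_filter x))/(_ e e0) := fc x; apply: filterS => y.
by apply: le_trans; apply: le_trans (min_lip d _ _); exact: max_lip.
Qed.

End ContinuousReal.

Section L1Approximation.
Variables (R : realType) (n : nat) (P1 P2 : probability (Rd R n) R).

Lemma ex_cvg0 (P : probability (Rd R n) R) (f : nat -> Rd R n -> R) M :
  (forall k, adm (f k)) -> (forall k x, `|f k x| <= M) ->
  (forall x, (fun k => f k x) @ \oo --> 0) -> (fun k => ex P (f k)) @ \oo --> 0.
Proof.
move=> af fM f0.
have mf k : measurable_fun setT (EFin \o f k) by apply/measurable_EFinP; case: (af k).
have h := @dominated_cvg _ _ _ P setT measurableT (fun k => EFin \o f k) (fun=> 0%E) (fun=> M%:E) mf.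
have {h} : (fun k => \int[P]_(x in setT) (f k x)%:E)%E @ \oo --> (\int[P]_(x in setT) 0)%E.
  apply: h => //.
  - by move=> x _; apply: cvg_EFin; [exact: nearW | exact: f0].
  - exact: (adm_integrable P (adm_cst _ M)).
  - by move=> k x _; rewrite lee_fin.
rewrite integral0 => /fine_cvgP[_ h]; apply: cvg_trans h; apply: near_eq_cvg.
by apply: nearW => k /=.
Qed.

Let E (f : Rd R n -> R) : R := ex P1 f + ex P2 f.

Let EM f g : adm f -> adm g -> (forall x, f x <= g x) -> E f <= E g.
Proof. by move=> af ag fg; apply: lerD; exact: ex_le. Qed.

Let ED f g : adm f -> adm g -> E (fun x => f x + g x) = E f + E g.
Proof. by move=> af ag; rewrite /E !exD // addrACA. Qed.

Let EZ c f : adm f -> E (fun x => c * f x) = c * E f.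
Proof. by move=> af; rewrite /E !exZ // mulrDr. Qed.

Let Esum (I : Type) (s : seq I) (F : I -> Rd R n -> R) : (forall i, adm (F i)) ->
  E (fun x => \sum_(i <- s) F i x) = \sum_(i <- s) E (F i).
Proof. by move=> aF; rewrite /E !ex_sum // big_split. Qed.

Definition unit_cont (h : 'rV[R]_n -> R) := continuous h /\ forall x, 0 <= h x <= 1.

Lemma adm_unit h : unit_cont h -> adm (h : Rd R n -> R).
Proof.
move=> [hc h01]; split; first exact: cont_meas.
by exists 1 => x; have /andP[a b] := h01 x; rewrite ger0_norm.
Qed.

(** One continuous function has to serve two laws at once, so the error is measured in their sum
    [E]. The approximable sets turn out to form a sigma-algebra containing the open sets. *)
Definition set_approx (A : set (Rd R n)) := measurable A /\
  forall e, 0 < e -> exists h, unit_cont h /\ E (fun x => `|\1_A x - h x|) <= e.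

Lemma set_approxC A : set_approx A -> set_approx (~` A).
Proof.
move=> [mA HA]; split; first exact: measurableC.
move=> e e0; have [h [[hc h01] he]] := HA e e0.
exists (fun x => 1 - h x); split.
  split=> [|x]; first by apply: contB => //; exact: cont_cst.
  by have /andP[a b] := h01 x; apply/andP; split; lra.
rewrite (_ : (fun x => _) = (fun x => `|\1_A x - h x|)) //; apply/funext => x.
rewrite -normrN !indicE in_setC; congr `|_|; case: (x \in A) => /=; ring.
Qed.

Lemma set_approxI A B : set_approx A -> set_approx B -> set_approx (A `&` B).
Proof.
move=> [mA HA] [mB HB]; split; first exact: measurableI.
move=> e e0; have e2 : 0 < e / 2 by rewrite divr_gt0.
have [h [uh he]] := HA _ e2; have [k [uk ke]] := HB _ e2.
have [hc h01] := uh; have [kc k01] := uk.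
exists (fun x => h x * k x); split.
  split=> [|x]; first exact: contM.
  by have /andP[a b] := h01 x; have /andP[c d] := k01 x; rewrite mulr_ge0 //= mulr_ile1.
have aA := @adm_indic R _ _ _ mA; have aB := @adm_indic R _ _ _ mB.
have aI := @adm_indic R _ _ _ (measurableI _ _ mA mB).
have ah := adm_unit uh; have ak := adm_unit uk.
have a1 := adm_abs (admB aA ah); have a2 := adm_abs (admB aB ak).
apply: (@le_trans _ _ (E (fun x => `|\1_A x - h x| + `|\1_B x - k x|))).
  apply: EM; [by apply: adm_abs; apply: admB => //; exact: admM | exact: admD|].
  move=> x; rewrite !indicE in_setI; have /andP[a b] := h01 x; have /andP[c d] := k01 x.
  have -> : ((x \in A) && (x \in B))%:R - h x * k x
    = ((x \in A)%:R - h x) * (x \in B)%:R + h x * ((x \in B)%:R - k x) :> R.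
    by case: (x \in A); case: (x \in B) => /=; ring.
  apply: (le_trans (ler_normD _ _)); rewrite !normrM; apply: lerD.
    by rewrite ler_piMr // ger0_norm // lern1 leq_b1.
  by rewrite ler_piMl // ger0_norm.
by rewrite ED // (splitr e) lerD.
Qed.

Lemma set_approx_limit (A : set (Rd R n)) (B : nat -> set (Rd R n)) : measurable A -> (forall k, set_approx (B k)) ->
  (forall x, \forall k \near \oo, (x \in B k) = (x \in A)) -> set_approx A.
Proof.
move=> mA HB BA; split => // e e0; have e2 : 0 < e / 2 by rewrite divr_gt0.
pose f k (x : Rd R n) : R := `|\1_A x - \1_(B k) x|.
have aA := @adm_indic R _ _ _ mA.
have aB k : adm (\1_(B k) : Rd R n -> R) by apply: adm_indic; case: (HB k).
have af k : adm (f k) by apply: adm_abs; exact: admB.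
have f1 k x : `|f k x| <= 1.
  by rewrite /f normr_id !indicE; case: (_ \in A); case: (_ \in B k); rewrite ?subrr ?subr0 ?sub0r ?normrN ?normr0 ?normr1.
have f0 x : (fun k => f k x) @ \oo --> 0.
  apply: cvg_near_cst; apply: filterS (BA x) => k h.
  by rewrite /f !indicE h subrr normr0.
have : (fun k => ex P1 (f k) + ex P2 (f k)) @ \oo --> (0 + 0 : R).
  by apply: cvgD; [exact: (ex_cvg0 P1 af f1 f0) | exact: (ex_cvg0 P2 af f1 f0)].
rewrite addr0; move/cvgrPdist_le => /(_ _ e2) [k _ /(_ k (leqnn k))] /=; rewrite sub0r normrN => hk.
have [h [uh he]] := (HB k).2 _ e2; exists h; split => //; have ah := adm_unit uh.
have a2 := adm_abs (admB (aB k) ah).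
apply: (@le_trans _ _ (E (fun x => f k x + `|\1_(B k) x - h x|))).
  apply: EM; [by apply: adm_abs; exact: admB | exact: admD|] => x.
  rewrite /f; apply: le_trans (ler_normD _ _); by rewrite addrA subrK.
rewrite ED // (splitr e) lerD //; exact: le_trans (ler_norm _) hk.
Qed.

Lemma set_approxU A B : set_approx A -> set_approx B -> set_approx (A `|` B).
Proof.
by move=> hA hB; rewrite -[A]setCK -[B]setCK -setCI; apply: set_approxC; apply: set_approxI; exact: set_approxC.
Qed.

Lemma set_approx0 : set_approx set0.
Proof.
split => // e e0; exists (fun=> 0); split; first by split=> [|x]; [exact: cont_cst | rewrite lexx ler01].
rewrite (_ : (fun x => _) = (fun=> 0)); first by rewrite /E !ex_cst addr0 ltW.
by apply/funext => x; rewrite indicE in_set0 subrr normr0.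
Qed.

Lemma set_approx_bigcup (F : nat -> set (Rd R n)) : (forall k, set_approx (F k)) ->
  set_approx (\bigcup_k F k).
Proof.
move=> HF; apply: (@set_approx_limit _ (fun N => \big[setU/set0]_(k < N) F k)).
- by apply: bigcupT_measurable => k; case: (HF k).
- elim=> [|N IH]; first by rewrite big_ord0; exact: set_approx0.
  by rewrite big_ord_recr /=; exact: set_approxU.
move=> x; case: (boolP (x \in \bigcup_k F k)) => [|xn].
  rewrite inE => -[k _ Fk]; exists k.+1 => // N /= kN; rewrite mem_set //.
  by rewrite -bigcup_mkord; exists k.
apply: nearW => N; apply: memNset; rewrite -bigcup_mkord => -[k _ Fk].
by move/negP: xn; apply; rewrite inE; exists k.
Qed.

Lemma set_approx_strip (i : 'I_n) (q r : R) : set_approx [set x : 'rV[R]_n | `|x 0 i - q| < r].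
Proof.
have fc : continuous (fun x : 'rV[R]_n => r - `|x 0 i - q|).
  apply: contB; first exact: cont_cst.
  apply: cont_norm; apply: contB; [exact: coord_continuous | exact: cont_cst].
pose h k (x : 'rV[R]_n) := Num.max 0 (Num.min 1 (k%:R * (r - `|x 0 i - q|))).
have mA : measurable ([set x : 'rV[R]_n | `|x 0 i - q| < r] : set (Rd R n)).
  rewrite (_ : [set x | _] = (fun x : Rd R n => r - `|x 0 i - q|) @^-1` `]0, +oo[); last first.
    by apply/seteqP; split => x /=; rewrite in_itv /= andbT subr_gt0.
  by rewrite -[X in measurable X]setTI; apply: (cont_meas fc).
have aA := @adm_indic R _ _ _ mA.
have uh k : unit_cont (h k).
  split=> [|x]; last by rewrite /h le_max lexx /= ge_max ler01 ge_min lexx.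
  by apply: cont_clip; apply: contM => //; exact: cont_cst.
split => // e e0.
pose f k (x : Rd R n) : R := `|\1_[set x : 'rV[R]_n | `|x 0 i - q| < r] x - h k x|.
have af k : adm (f k) by apply: adm_abs; apply: admB => //; exact: adm_unit.
have f1 k x : `|f k x| <= 1.
  have /andP[a b] := (uh k).2 x.
  by rewrite /f normr_id indicE; case: (_ \in _); rewrite ler_norml; apply/andP; split; rewrite /=; lra.
have f0 x : (fun k => f k x) @ \oo --> 0.
  apply: cvg_near_cst; case: (ltP `|x 0 i - q| r) => xr.
    have d0 : 0 < r - `|x 0 i - q| by rewrite subr_gt0.
    exists (Num.truncn (r - `|x 0 i - q|)^-1).+1 => // k /= hk.
    rewrite /f indicE mem_set // /h min_l ?max_r ?subrr ?normr0 //.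
    rewrite -ler_pdivrMr // mul1r ltW // (lt_le_trans (truncnS_gt _)) // ler_nat //.
  apply: nearW => k; rewrite /f indicE memNset /h /=; last by rewrite ltNge xr.
  rewrite max_l ?subrr ?normr0 // ge_min; apply/orP; right; rewrite mulr_ge0_le0 // subr_le0 //.
have : (fun k => ex P1 (f k) + ex P2 (f k)) @ \oo --> (0 + 0 : R).
  by apply: cvgD; [exact: (ex_cvg0 P1 af f1 f0) | exact: (ex_cvg0 P2 af f1 f0)].
rewrite addr0; move/cvgrPdist_le => /(_ _ e0) [k _ /(_ k (leqnn k))] /=; rewrite sub0r normrN => hk.
exists (h k); split => //; exact: le_trans (ler_norm _) hk.
Qed.

Lemma set_approx_open (U : set 'rV[R]_n) : open U -> set_approx U.
Proof.
move=> oU; rewrite (open_box_basis oU).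
pose F (qr : 'rV[rat]_n * nat) : set (Rd R n) :=
  (if `[< [set x : 'rV[R]_n | forall i, `|x 0 i - ratr (qr.1 0 i)| < qr.2.+1%:R^-1] `<=` U >]
    then [set x : 'rV[R]_n | forall i, `|x 0 i - ratr (qr.1 0 i)| < qr.2.+1%:R^-1] else set0).
have HF qr : set_approx (F qr).
  rewrite /F; case: ifP => _; last exact: set_approx0.
  pose G (s : seq 'I_n) := [set x : 'rV[R]_n | forall i, i \in s -> `|x 0 i - ratr (qr.1 0 i)| < qr.2.+1%:R^-1].
  rewrite (_ : [set x | _] = G (enum 'I_n)); last first.
    by apply/seteqP; split => x h i; [move=> _; exact: h | apply: h; rewrite mem_enum].
  elim: (enum 'I_n) => [|i s IH].
    by rewrite (_ : G [::] = ~` set0); [exact: (set_approxC set_approx0)|apply/seteqP; split=> [x _ []|x _ i]].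
  rewrite (_ : G (i :: s) = [set x : 'rV[R]_n | `|x 0 i - ratr (qr.1 0 i)| < qr.2.+1%:R^-1] `&` G s).
    by apply: set_approxI => //; exact: set_approx_strip.
  apply/seteqP; split => [x h|x [h1 h2] j].
    by split=> [|j js]; apply: h; rewrite inE ?eqxx ?js ?orbT.
  by rewrite inE => /orP[/eqP -> //|]; exact: h2.
have -> : \bigcup_qr F qr = \bigcup_k (if unpickle k is Some qr then F qr else set0).
  apply/seteqP; split => [x [qr _ xF]|x [k _]].
    by exists (pickle qr) => //; rewrite pickleK.
  by case: unpickle => // qr xF; exists qr.
by apply: set_approx_bigcup => k; case: unpickle => [qr|]; [exact: HF | exact: set_approx0].
Qed.

Lemma set_approx_meas (A : set (Rd R n)) : measurable A -> set_approx A.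
Proof.
move=> mA; have : (<<s @open 'rV[R]_n >> `<=` set_approx).
  apply: smallest_sub; last exact: set_approx_open.
  split; first exact: set_approx0.
    by move=> B HB; rewrite setTD; exact: set_approxC.
  exact: set_approx_bigcup.
exact.
Qed.

Lemma layer_count (N : nat) (s : R) : 0 <= s ->
  (N%:R <= s -> \sum_(j < N) (j.+1%:R <= s)%R%:R = N%:R :> R) /\
  (s <= N%:R -> s - 1 <= \sum_(j < N) (j.+1%:R <= s)%R%:R <= s :> bool).
Proof.
move=> s0; elim: N => [|N [IH1 IH2]].
  by rewrite big_ord0; split=> // s1; apply/andP; split; lra.
rewrite big_ord_recr /=; have N1 : N.+1%:R = N%:R + 1 :> R by rewrite natr1.
case: (leP N.+1%:R s) => h; rewrite N1 in h *.
  by rewrite IH1 ?mulr1n; [split=> // h2; apply/andP; split; lra | lra].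
split; first by move=> h2; lra.
move=> _; rewrite addr0; case: (leP N%:R s) => h2; last by apply: IH2; exact: ltW.
by rewrite IH1 //; apply/andP; split; lra.
Qed.

(** Up to an error [w], a bounded function is a constant plus [w] times the sum of the indicators of
    its upper level sets with step [w]. Approximating these sets does the rest, and clipping to
    [-M, M] restores the bound. *)
Lemma L1_approx (g : Rd R n -> R) (M e : R) : measurable_fun setT g -> (forall x, `|g x| <= M) -> 0 < e ->
  exists h : 'rV[R]_n -> R, [/\ continuous h, forall x, `|h x| <= M,
    ex P1 (fun x => `|g x - h x|) <= e & ex P2 (fun x => `|g x - h x|) <= e].
Proof.
move=> mg gM e0; have ag : adm g by split => //; exists M.
have M0 : 0 <= M by apply: le_trans (gM 0).
pose N := (Num.truncn (8 * (M + 1) / e)).+1; have N0 : 0 < N%:R :> R by rewrite ltr0n.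
pose w : R := 2 * (M + 1) / N%:R; have w0 : 0 < w by rewrite divr_gt0 //; lra.
have we : w <= e / 4.
  have := ltW (truncnS_gt (8 * (M + 1) / e)); rewrite -/N ler_pdivrMr // => h.
  by rewrite /w ler_pdivrMr //; lra.
pose A (j : nat) : set (Rd R n) := [set x | - (M + 1) + w * j.+1%:R <= g x].
have mA j : measurable (A j).
  rewrite (_ : A j = g @^-1` `[- (M + 1) + w * j.+1%:R, +oo[); last first.
    by apply/seteqP; split => x /=; rewrite in_itv /= andbT.
  by rewrite -[X in measurable X]setTI; apply: mg.
have e2 : 0 < e / (4 * (M + 1)) by rewrite divr_gt0 //; lra.
have /choice[h hP] : forall j : nat, exists h, unit_cont h /\ E (fun x => `|\1_(A j) x - h x|) <= e / (4 * (M + 1)).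
  by move=> j; have [_] := set_approx_meas (mA j); apply.
pose H (x : 'rV[R]_n) := - (M + 1) + \sum_(j < N) w * h j x.
have Hc : continuous H.
  apply: contD; first exact: cont_cst.
  apply: cont_sum => j; apply: contM; first exact: cont_cst.
  by have [[hc _] _] := hP j.
have ah j : adm (h j : Rd R n -> R) by apply: adm_unit; case: (hP j).
have aj j : adm (fun x : Rd R n => `|\1_(A j) x - h j x|).
  by apply: adm_abs; apply: admB => //; exact: adm_indic.
pose H' x := Num.max (- M) (Num.min M (H x)).
have H'c : continuous H' by exact: cont_clip.
have H'M x : `|H' x| <= M.
  by rewrite /H' ler_norml le_max lexx ge_max ge_min lexx andbT /=; lra.
have key x : `|g x - H' x| <= w + \sum_(j < N) w * `|\1_(A j) x - h j x|.
  have gx := gM x.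
  apply: (@le_trans _ _ `|g x - H x|).
    have e1 : g x = Num.max (- M) (Num.min M (g x)).
      by move: gx; rewrite ler_norml => /andP[? ?]; rewrite min_r // max_r.
    by rewrite {1}e1; apply: le_trans (min_lip M _ _); exact: max_lip.
  pose s := (g x + (M + 1)) / w.
  have s0 : 0 <= s by rewrite divr_ge0 ?ltW //; move: gx; rewrite ler_norml => /andP[? ?]; lra.
  have sN : s <= N%:R.
    rewrite ler_pdivrMr // /w mulrCA mulfV ?gt_eqF // mulr1.
    by move: gx; rewrite ler_norml => /andP[? ?]; lra.
  have [_ /(_ sN) /andP[c1 c2]] := layer_count N s0.
  have Aj j : \1_(A j) x = (j.+1%:R <= s)%R%:R :> R.
    rewrite indicE /s ler_pdivlMr //.
    have -> : (j.+1%:R * w <= g x + (M + 1)) = (- (M + 1) + w * j.+1%:R <= g x).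
      by rewrite -lerBlDr; congr (_ <= _); ring.
    congr (nat_of_bool _)%:R.
    by apply/idP/idP; [rewrite inE /= => ->|move=> ?; rewrite inE].
  pose S := \sum_(j < N) (j.+1%:R <= s)%R%:R : R.
  have gS : `|g x - (- (M + 1) + w * S)| <= w.
    have -> : g x = - (M + 1) + w * s by rewrite /s mulrC divfK ?gt_eqF //; ring.
    have -> : - (M + 1) + w * s - (- (M + 1) + w * S) = w * (s - S) by ring.
    rewrite normrM (ger0_norm (ltW w0)); apply: ler_piMr; first exact: ltW.
    by rewrite ler_norml; apply/andP; split; rewrite /S; lra.
  have -> : g x - H x = (g x - (- (M + 1) + w * S)) + \sum_(j < N) w * (\1_(A j) x - h j x).
    under [X in _ = _ + X]eq_bigr do rewrite Aj mulrBr.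
    by rewrite sumrB -mulr_sumr /H -/S; ring.
  apply: (le_trans (ler_normD _ _)); apply: lerD => //.
  apply: (le_trans (ler_norm_sum _ _ _)); apply: ler_sum => j _.
  by rewrite normrM (ger0_norm (ltW w0)).
have aH' : adm (H' : Rd R n -> R) by split; [exact: cont_meas | exists M].
have agH : adm (fun x : Rd R n => `|g x - H' x|) by apply: adm_abs; exact: admB.
have aS : adm (fun x : Rd R n => \sum_(j < N) w * `|\1_(A j) x - h j x|).
  by apply: adm_sum => j; apply: admZ.
have tot : E (fun x => `|g x - H' x|) <= e.
  apply: (@le_trans _ _ (E (fun x => w + \sum_(j < N) w * `|\1_(A j) x - h j x|))).
    by apply: EM => //; apply: admD => //; exact: adm_cst.
  rewrite ED //; last exact: adm_cst.
  rewrite Esum; last by move=> j; exact: admZ.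
  apply: (@le_trans _ _ (2 * w + \sum_(j < N) w * (e / (4 * (M + 1))))).
    apply: lerD; first by rewrite /E !ex_cst; lra.
    apply: ler_sum => j _; rewrite EZ //.
    by apply: ler_wpM2l; [exact: ltW | case: (hP j)].
  rewrite sumr_const card_ord -[_ *+ N]mulr_natl.
  have -> : N%:R * (w * (e / (4 * (M + 1)))) = e / 2.
    by rewrite /w; field; rewrite !gt_eqF //; lra.
  lra.
have nn P : 0 <= ex P (fun x : Rd R n => `|g x - H' x|) by apply: ex_ge0.
by exists H'; split => //; move: tot (nn P1) (nn P2); rewrite /E; lra.
Qed.

End L1Approximation.

(** * Averaged coefficients *)

Section Smoothing.
Variables (R : realType) (m : nat).
Implicit Types (y : 'rV[R]_m) (F : Rd R m -> R).

Definition mass (N P : nat) y : R := \sum_(k <- zbox m P) theta N k y.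

(* On the region of interest the maximum is the mass itself; it makes the weights continuous everywhere. *)
Definition wt (N P : nat) y k : R := theta N k y / Num.max ((27 / 256) ^+ m) (mass N P y).

Let cm0 : 0 < (27 / 256 : R) ^+ m. Proof. by apply: exprn_gt0; apply: divr_gt0; rewrite ltr0n. Qed.

Let den_gt0 N P y : 0 < Num.max ((27 / 256) ^+ m) (mass N P y).
Proof. by rewrite lt_max cm0. Qed.

Lemma wt_ge0 N P y k : 0 <= wt N P y k.
Proof. by apply: divr_ge0; [exact: theta_ge0 | exact: ltW]. Qed.

Lemma wt_le N P y k : wt N P y k <= theta N k y / (27 / 256) ^+ m.
Proof. by rewrite ler_wpM2l ?theta_ge0 // lef_pV2 ?posrE // le_max lexx. Qed.

Lemma wt_sum N D P y : (1 < N)%N -> `|y| <= D%:R -> (D.+1 * N ^ 4 <= P)%N ->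
  \sum_(k <- zbox m P) wt N P y k = 1.
Proof.
move=> N1 yD hP; rewrite -mulr_suml max_r; last exact: (mass_ge N1 yD hP).
by rewrite mulfV // gt_eqF // (lt_le_trans cm0) // (mass_ge N1 yD hP).
Qed.

Lemma wt_supp N P y k : (0 < N)%N -> wt N P y k != 0 -> `|node R N k - y| <= N%:R^-1.
Proof.
move=> N0; rewrite mulf_eq0 negb_or => /andP[/(theta_supp N0) h _].
apply/row_normP => [|i]; first by rewrite invr_ge0.
by rewrite !mxE distrC ltW //; have := h i; rewrite mxE.
Qed.

Lemma theta_cont N k : (0 < N)%N -> continuous (theta (R := R) (m := m) N k).
Proof.
move=> N0; have [G [H [C [C2t _ _]]]] := @theta_second R m 0.
by have [] := C2t N k N0.
Qed.

Lemma wt_cont N P k : (0 < N)%N -> continuous (fun y => wt N P y k).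
Proof.
move=> N0; have mc : continuous (mass N P) by apply: cont_sum => j; exact: theta_cont.
have dc : continuous (fun y => Num.max ((27 / 256) ^+ m) (mass N P y)).
  move=> y; apply/(@cvgrPdist_le _ _ _ _ (nbhs_filter y)) => e e0.
  have /(@cvgrPdist_le _ _ _ _ (nbhs_filter y))/(_ e e0) := mc y; apply: filterS => x.
  by apply: le_trans; exact: max_lip.
move=> y; have d0 : Num.max ((27 / 256) ^+ m) (mass N P y) != 0 by rewrite gt_eqF.
exact: (cvgM (@theta_cont N k N0 y) (cvgV d0 (dc y))).
Qed.

(** Half the mesh [N^-4]: the cubes of this radius around the nodes tile the space, overlapping only
    in faces. *)
Definition hw (N : nat) : R := (N%:R ^+ 4)^-1 / 2.

Lemma hw_gt0 N : (0 < N)%N -> 0 < hw N.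
Proof. by move=> N0; rewrite divr_gt0 // invr_gt0 exprn_gt0 // ltr0n. Qed.

Lemma hw_le N : (0 < N)%N -> hw N <= N%:R^-1.
Proof.
move=> N0; rewrite /hw ler_pdivrMr //; have N1 : 1 <= N%:R :> R by rewrite ler1n.
have : (N%:R ^+ 4)^-1 <= N%:R^-1 :> R.
  by rewrite lef_pV2 ?posrE ?exprn_gt0 ?ltr0n // -[X in X <= _]expr1 ler_weXn2l.
have : 0 < N%:R^-1 :> R by rewrite invr_gt0 ltr0n.
lra.
Qed.

(** Cell means, at scale [N^-4], are what (H2) controls. Blended with weights of width 1/N they give
    a mean over points within 2/N of [y], dominated by a field of the kind covered by the lattice
    estimate. *)
Definition smooth_avg (D N : nat) y F : R :=
  \sum_(k <- zbox m (D.+1 * N ^ 4)) wt N (D.+1 * N ^ 4) y k * avg (node R N k) (hw N) F.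

Lemma cell_close N y k y' : (0 < N)%N -> `|node R N k - y| <= N%:R^-1 ->
  cube (node R N k) (hw N) y' -> `|y' - y| <= 2 / N%:R.
Proof.
move=> N0 ky ycell.
have : `|y' - node R N k| <= hw N.
  by apply/row_normP => [|i]; [rewrite ltW // hw_gt0 | rewrite !mxE; have := ycell i; rewrite !mxE].
have := ler_normD (y' - node R N k) (node R N k - y); rewrite addrA subrK.
have := hw_le N0; have -> : 2 / N%:R = N%:R^-1 + N%:R^-1 :> R by ring.
lra.
Qed.

Lemma smooth_avg_le D N y F c : (1 < N)%N -> `|y| <= D%:R -> adm F ->
  (forall y', `|y' - y| <= 2 / N%:R -> F y' <= c) -> smooth_avg D N y F <= c.
Proof.
move=> N1 yD aF Fc; have N0 := ltnW N1.
rewrite -[c]mul1r -(wt_sum N1 yD (leqnn _)) mulr_suml; apply: ler_sum => k _.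
have [->|w0] := eqVneq (wt N (D.+1 * N ^ 4) y k) 0; first by rewrite !mul0r.
rewrite ler_wpM2l ?wt_ge0 // -[c](ex_cst (ucube (node R N k) (hw N))).
apply: avg_le_on => //; [exact: hw_gt0 | exact: adm_cst |].
by move=> y' /(cell_close N0 (wt_supp N0 w0)) /Fc.
Qed.

Lemma smooth_avgZ D N y c F : adm F -> smooth_avg D N y (fun x => c * F x) = c * smooth_avg D N y F.
Proof.
move=> aF; rewrite mulr_sumr; apply: eq_bigr => k _.
by rewrite /avg exZ // mulrCA.
Qed.

Lemma smooth_avgB D N y F F' : adm F -> adm F' ->
  smooth_avg D N y (fun x => F x - F' x) = smooth_avg D N y F - smooth_avg D N y F'.
Proof.
move=> aF aF'; rewrite -sumrB; apply: eq_bigr => k _.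
by rewrite /avg exB // mulrBr.
Qed.

Lemma smooth_avg_sum D N y (I : Type) (s : seq I) (F : I -> Rd R m -> R) : (forall i, adm (F i)) ->
  smooth_avg D N y (fun x => \sum_(i <- s) F i x) = \sum_(i <- s) smooth_avg D N y (F i).
Proof.
move=> aF; rewrite /smooth_avg exchange_big; apply: eq_bigr => k _.
by rewrite /avg ex_sum // mulr_sumr.
Qed.

Lemma smooth_avg_ge D N y F c : (1 < N)%N -> `|y| <= D%:R -> adm F ->
  (forall y', `|y' - y| <= 2 / N%:R -> c <= F y') -> c <= smooth_avg D N y F.
Proof.
move=> N1 yD aF Fc; rewrite -lerN2 -mulN1r -smooth_avgZ //; apply: smooth_avg_le => //.
  exact: admZ.
by move=> y' /Fc; rewrite mulN1r lerN2.
Qed.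

Lemma smooth_avg_abs D N y F : adm F ->
  `|smooth_avg D N y F| <= smooth_avg D N y (fun x => `|F x|).
Proof.
move=> aF; apply: (le_trans (ler_norm_sum _ _ _)); apply: ler_sum => k _.
by rewrite normrM (ger0_norm (wt_ge0 _ _ _ _)) ler_wpM2l ?wt_ge0 // /avg ex_abs.
Qed.

End Smoothing.

(** A bound [t + K G] with [t] arbitrarily small carries convergence of the integrals from [G] to
    [g]. As [G] may be unbounded with infinite integral for some [p], finiteness is extracted from
    the convergence itself. *)
Lemma avg_cvg_dominated (R : realType) (m : nat) (c : 'rV[R]_m) (r : R) (g G : nat -> Rd R m -> R) :
  0 < r -> (forall p, adm (g p)) -> (forall p y, 0 <= g p y) ->
  (forall p, measurable_fun setT (G p)) -> (forall p y, 0 <= G p y) ->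
  (forall t, 0 < t -> exists K, 0 <= K /\ forall p y, g p y <= t + K * G p y) ->
  (fun p => cube_int c r (fun y => (G p y)%:E)) @ \oo --> 0%E ->
  (fun p => avg c r (g p)) @ \oo --> 0.
Proof.
move=> r0 ag g0 mG G0 gG Gcvg; apply/cvgrPdist_le => e e0.
have e2 : 0 < e / 2 by rewrite divr_gt0.
have [K [K0 hK]] := gG _ e2; pose v : R := (2 * r) ^+ m.
have v0 : 0 < v by rewrite exprn_gt0 // mulr_gt0.
have w0 : 0 < v * (e / 2) / (K + 1) by rewrite divr_gt0 ?mulr_gt0 // ltr_wpDl.
have /fine_cvgP[Gfin /cvgrPdist_le/(_ _ w0)] := Gcvg.
apply: filterS2 Gfin => p Gf; rewrite /= !sub0r !normrN => small.
have I0 y : (0 <= (G p y)%:E)%E by rewrite lee_fin.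
have mGE : measurable_fun setT (fun y => (G p y)%:E) by exact/measurable_EFinP.
rewrite ger0_norm; last exact: ex_ge0.
rewrite -lee_fin -ex_EFin //.
have E1 : (\int[ucube c r]_y (g p y)%:E <= (e / 2)%:E + K%:E * \int[ucube c r]_y (G p y)%:E)%E.
  have mH : measurable_fun setT (fun y => e / 2 + K * G p y) by apply: measurable_funD => //; exact: measurable_funM.
  apply: (@le_trans _ _ (\int[ucube c r]_y (e / 2 + K * G p y)%:E)%E).
    apply: ge0_le_integral => //.
    - by move=> y _; rewrite lee_fin.
    - by apply/measurable_EFinP; have [] := ag p.
    - exact/measurable_EFinP.
    - by move=> y _; rewrite lee_fin.
  rewrite (_ : (fun y => (e / 2 + K * G p y)%:E) = fun y => ((e / 2)%:E + K%:E * (G p y)%:E)%E) //.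
  rewrite ge0_integralD //; last 3 first.
  - by move=> y _; rewrite lee_fin ltW.
  - by move=> y _; rewrite mule_ge0 // lee_fin.
  - by apply: measurable_funeM.
  rewrite integral_cst //= probability_setT mule1 leeD2l // ge0_integralZl //.
apply: (le_trans E1); move: small Gf; rewrite (ucube_int _ r0 mGE I0) -/v.
have : (0 <= \int[ucube c r]_y (G p y)%:E)%E by apply: integral_ge0.
case: (\int[ucube c r]_y (G p y)%:E)%E => [I| |] //=; last first.
  by rewrite mulry gtr0_sg // mul1e.
rewrite lee_fin => Ige0; rewrite (ger0_norm (mulr_ge0 (ltW v0) Ige0)) => small _.
rewrite -EFinM -EFinD lee_fin.
have : I <= e / 2 / (K + 1).
  by rewrite -(ler_pM2l v0) (le_trans small) // -!mulrA.
have K1 : 0 < K + 1 by rewrite ltr_wpDl.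
rewrite ler_pdivlMr // => h; have : I * K <= I * (K + 1) by rewrite ler_wpM2l // lerDl.
by rewrite mulrC; lra.
Qed.

Section Coefficients.
Variables (R : realType) (m k : nat) (gamma : R).
Variables (A : probability (Rd R (m + k)) R -> 'rV[R]_(m + k) -> 'M[R]_(m + k))
  (b : probability (Rd R (m + k)) R -> 'rV[R]_(m + k) -> 'rV[R]_(m + k))
  (V : 'rV[R]_(m + k) -> R).
Hypotheses (Ameas : forall mu i j, measurable_fun setT (fun x : Rd R (m + k) => A mu x i j))
  (bmeas : forall mu i, measurable_fun setT (fun x : Rd R (m + k) => b mu x 0 i)).
Hypotheses (h12 : H12 V A b) (h13 : H13 V A b) (gamma0 : 0 < gamma) (h2 : H2 gamma V A b).
Implicit Types (mu : probability (Rd R (m + k)) R) (x : 'rV[R]_(m + k)) (y : 'rV[R]_m) (z : 'rV[R]_k).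

(** Second and first order coefficients form one family, with jets indexed alike, so that the
    operator is a single sum and each estimate is done once. *)
Definition ix : finType := ('I_(m + k) * 'I_(m + k) + 'I_(m + k))%type.
Implicit Types (o : ix).

Definition cf o mu x : R := match o with inl ij => A mu x ij.1 ij.2 | inr i => b mu x 0 i end.

Definition jet (G : 'rV[R]_(m + k)) (H : 'M[R]_(m + k)) o : R :=
  match o with inl ij => H ij.1 ij.2 | inr i => G 0 i end.

Lemma sum_ix (F : ix -> R) : \sum_o F o = \sum_i \sum_j F (inl (i, j)) + \sum_i F (inr i).
Proof.
rewrite pair_bigA /= big_sumType /=; congr (_ + _); apply: eq_bigr => ij _.
by case: ij.
Qed.

Lemma cf_meas o mu : measurable_fun setT (cf o mu : Rd R (m + k) -> R).
Proof. by case: o => [[i j]|i]; rewrite /cf. Qed.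

Lemma cf_bound Rb r : 0 < Rb -> exists M, 0 <= M /\ forall mu x o, inPRV V Rb mu -> `|x| <= r -> `|cf o mu x| <= M.
Proof.
move=> Rb0; have r0 : 0 < `|r| + 1 by rewrite ltr_wpDl.
have /choice[M0 hM0] := fun ij : 'I_(m + k) * 'I_(m + k) => h12 Rb0 0 r0 ij.1 ij.2.
pose M := \sum_ij `|M0 ij|; exists M; split; first by rewrite sumr_ge0.
have le ij : M0 ij <= M.
  by rewrite /M (bigD1 ij) //= (le_trans (ler_norm _)) // lerDl sumr_ge0.
move=> mu x o hmu xr.
have xc : cube 0 (`|r| + 1) x.
  move=> i; rewrite mxE subr0 (le_trans (row_norm_le x i)) // (le_trans xr) //.
  by have := ler_norm r; lra.
case: o => [ij|i] /=.
  have := le ij; have := hM0 ij x mu xc hmu; have := normr_ge0 (b mu x 0 ij.1); lra.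
have := le (i, i); have := hM0 (i, i) x mu xc hmu; have := normr_ge0 (A mu x i i); rewrite /=; lra.
Qed.

Lemma cf_mod Rb r e : 0 < Rb -> 0 < e -> exists delta, 0 < delta /\
  forall mu y z z' o, inPRV V Rb mu -> `|y| <= r -> `|z| <= r -> `|z'| <= r -> `|z - z'| <= delta ->
    `|cf o mu (row_mx y z) - cf o mu (row_mx y z')| <= e.
Proof.
move=> Rb0 e0; have r0 : 0 < `|r| + 1 by rewrite ltr_wpDl.
have [om [om0 [omc [omm [om00 hom]]]]] := h13 Rb0 0 r0.
have [s [s0 hs]] : exists s, 0 < s /\ forall t, 0 <= t -> t <= s -> om t <= e.
  have [_ /cvgrPdist_le/(_ e e0)] := (continuous_within_itvcyP 0 om).1 omc.
  move=> /nbhs_normP[s /= s0 hs]; exists (s / 2); split; first by rewrite divr_gt0.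
  move=> t; rewrite le_eqVlt => /predU1P[<- _|t0 ts]; first by rewrite om00 ltW.
  apply: (le_trans (ler_norm _)); rewrite -normrN -[- om t]add0r -om00; apply: hs => //=.
  by rewrite sub0r normrN gtr0_norm //; lra.
pose c : R := k%:R + 1; have c0 : 0 < c by rewrite ltr_wpDl.
exists (s / c); split; first by rewrite divr_gt0.
move=> mu y z z' o hmu yr zr z'r zz.
have inc n (w : 'rV[R]_n) (c' : 'rV[R]_n) : (forall i, c' 0 i = 0) -> `|w| <= r -> cube c' (`|r| + 1) w.
  move=> c'0 wr i; rewrite c'0 subr0 (le_trans (row_norm_le w i)) // (le_trans wr) //.
  by have := ler_norm r; lra.
have e1 : enorm (z - z') <= s.
  apply: (le_trans (enorm_le _)); rewrite ler_pdivlMr // in zz.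
  by apply: le_trans zz; rewrite mulrC ler_wpM2l // /c lerDl.
have y0 i : lsubmx (0 : 'rV[R]_(m + k)) 0 i = 0 by rewrite !mxE.
have z0 i : rsubmx (0 : 'rV[R]_(m + k)) 0 i = 0 by rewrite !mxE.
have H i j := hom i j z z' (inc _ _ _ z0 zr) (inc _ _ _ z0 z'r) y mu (inc _ _ _ y0 yr) hmu.
have ome : om (enorm (z - z')) <= e by apply: hs => //; exact: sqrtr_ge0.
case: o => [[i j]|i] /=.
  by apply: le_trans ome; apply: le_trans (H i j); rewrite lerDl.
by apply: le_trans ome; apply: le_trans (H i i); rewrite lerDr.
Qed.

Lemma slice_meas (f : Rd R (m + k) -> R) z : measurable_fun setT f ->
  measurable_fun setT ((fun y => f (row_mx y z)) : Rd R m -> R).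
Proof.
move=> mf; have mr : measurable_fun setT ((fun y => row_mx y z) : Rd R m -> Rd R (m + k)).
  apply: meas_Rd => i; rewrite -[i](@fintype.splitK m k); case: (fintype.split i) => j /=.
    by under eq_fun do rewrite row_mxEl; exact: coord_meas.
  by under eq_fun do rewrite row_mxEr; exact: measurable_cst.
exact: (measurableT_comp mf mr).
Qed.

(** The coefficients are only locally bounded; this factor makes them bounded measurable, with a
    radius large enough to be inactive where they are evaluated. *)
Definition ballind (D : R) x : R := (`|x| <= D)%R%:R.

Lemma ballind_adm D : adm (ballind D : Rd R (m + k) -> R).
Proof.
have -> : ballind D = \1_[set x : 'rV[R]_(m + k) | `|x| <= D].
  apply/funext => x; rewrite indicE /ballind; congr (nat_of_bool _)%:R.
  by apply/idP/idP => [h|]; [exact/mem_set | move/set_mem].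
apply: adm_indic; rewrite [X in measurable X](_ : _ = (fun x : 'rV[R]_(m + k) => `|x|) @^-1` `]-oo, D]).
  by rewrite -[X in measurable X]setTI; apply: (cont_meas (@norm_continuous _ _)).
by apply/funext => x; rewrite /= in_itv.
Qed.

Lemma slice_adm (f : Rd R (m + k) -> R) z : adm f -> adm ((fun y => f (row_mx y z)) : Rd R m -> R).
Proof. by case=> mf [M fM]; split; [exact: slice_meas | exists M => y]. Qed.

Lemma cf_trunc_adm o mu D Rb : 0 < Rb -> inPRV V Rb mu ->
  adm ((fun x => ballind D x * cf o mu x) : Rd R (m + k) -> R).
Proof.
move=> Rb0 hmu; split; first by apply: measurable_funM; [have [] := ballind_adm D | exact: cf_meas].
have [M [M0 hM]] := cf_bound D Rb0; exists M => x; rewrite /ballind.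
by case: (boolP (`|(x : 'rV[R]_(m + k))| <= D)) => h /=; rewrite ?mul1r ?mul0r ?normr0 // hM.
Qed.

Lemma cf_diff_adm o mu mu' D Rb z : 0 < Rb -> inPRV V Rb mu -> inPRV V Rb mu' ->
  adm ((fun y => ballind D (row_mx y z) * `|cf o mu' (row_mx y z) - cf o mu (row_mx y z)|) : Rd R m -> R).
Proof.
move=> Rb0 hmu hmu'.
apply: (@slice_adm (fun x => ballind D x * `|cf o mu' x - cf o mu x|)).
rewrite (_ : (fun x => _) = fun x => `|ballind D x * cf o mu' x - ballind D x * cf o mu x|).
  by apply: adm_abs; apply: admB; apply: cf_trunc_adm Rb0 _.
by apply/funext => x; rewrite -mulrBr normrM [`|ballind _ _|]ger0_norm ?ler0n.
Qed.

(** All three forms of (H2) are reduced to convergence in mean on cubes of a slice: for [m = 0] the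
    slice is a point, otherwise the exponent is lowered to 1 by [avg_cvg_dominated]. *)
Lemma cf_cvg Rb (mun : nat -> probability (Rd R (m + k)) R) mu o (c : 'rV[R]_m) r z D : 0 < Rb ->
  (forall p, inPRV V Rb (mun p)) -> inPRV V Rb mu -> Vweak_cvg V mun mu -> 0 < r ->
  (fun p => avg c r (fun y => ballind D (row_mx y z) * `|cf o (mun p) (row_mx y z) - cf o mu (row_mx y z)|))
    @ \oo --> 0.
Proof.
move=> Rb0 hmun hmu wc r0.
(* (H2) treats an entry of [A] and a component of [b] together; for a drift component the second
   index is arbitrary, here [i] again. *)
pose ij : 'I_(m + k) * 'I_(m + k) := match o with inl ij => ij | inr i => (i, i) end.
have ag p := cf_diff_adm o D z Rb0 hmu (hmun p).
have ind1 x : 0 <= ballind D x <= 1 by rewrite /ballind; case: (`|x| <= D); rewrite /= ?lexx ?ler01.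
have g0 p y : 0 <= ballind D (row_mx y z) * `|cf o (mun p) (row_mx y z) - cf o mu (row_mx y z)|.
  by rewrite mulr_ge0 //; case/andP: (ind1 (row_mx y z)).
have gle p y : ballind D (row_mx y z) * `|cf o (mun p) (row_mx y z) - cf o mu (row_mx y z)|
   <= `|cf o mu (row_mx y z) - cf o (mun p) (row_mx y z)|.
  by rewrite [leRHS]distrC ler_piMl //; case/andP: (ind1 (row_mx y z)).
have mdiff o' p : measurable_fun setT ((fun y => `|cf o' mu (row_mx y z) - cf o' (mun p) (row_mx y z)|) : Rd R m -> R).
  by apply: measurableT_comp => //; apply: measurable_funB; apply: slice_meas; exact: cf_meas.
have sumle (Phi : R -> R) p y : (forall t, 0 <= t -> 0 <= Phi t) ->
    Phi `|cf o mu (row_mx y z) - cf o (mun p) (row_mx y z)| <=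
    Phi `|A mu (row_mx y z) ij.1 ij.2 - A (mun p) (row_mx y z) ij.1 ij.2|
    + Phi `|b mu (row_mx y z) 0 ij.1 - b (mun p) (row_mx y z) 0 ij.1|.
  by move=> P0; rewrite /ij /cf; case: (o) => [[i j]|i] /=; rewrite ?lerDl ?lerDr P0.
have mG (Phi : R -> R) p : measurable_fun setT Phi -> measurable_fun setT
   ((fun y => Phi `|A mu (row_mx y z) ij.1 ij.2 - A (mun p) (row_mx y z) ij.1 ij.2|
    + Phi `|b mu (row_mx y z) 0 ij.1 - b (mun p) (row_mx y z) 0 ij.1|) : Rd R m -> R).
  move=> mP; apply: measurable_funD; apply: (measurableT_comp mP).
    exact: (mdiff (inl ij)).
  exact: (mdiff (inr ij.1)).
have concl (Phi : R -> R) : measurable_fun setT Phi -> (forall t, 0 <= t -> 0 <= Phi t) ->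
   (forall t, 0 < t -> exists K, 0 <= K /\ forall s, 0 <= s -> s <= t + K * Phi s) ->
   (fun p => cube_int c r (fun y => (Phi `|A mu (row_mx y z) ij.1 ij.2 - A (mun p) (row_mx y z) ij.1 ij.2|
    + Phi `|b mu (row_mx y z) 0 ij.1 - b (mun p) (row_mx y z) 0 ij.1|)%:E)) @ \oo --> 0%E ->
   (fun p => avg c r (fun y => ballind D (row_mx y z) * `|cf o (mun p) (row_mx y z) - cf o mu (row_mx y z)|))
    @ \oo --> 0.
  move=> mP P0 young; apply: avg_cvg_dominated => // [p|p y|t t0].
  - exact: mG.
  - by rewrite addr_ge0 ?P0.
  have [K [K0 hK]] := young t t0; exists K; split => // p y.
  apply: (le_trans (gle p y)); apply: (le_trans (hK _ (normr_ge0 _))).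
  by rewrite lerD2l ler_wpM2l // sumle.
have := h2 Rb0 hmun hmu wc ij.1 ij.2; case: eqP => m0 H2.
  have [y0 y0E] : exists y0 : 'rV[R]_m, forall y, y = y0.
    by exists 0 => y; apply/rowP => i; move: (ltn_ord i); rewrite [X in (_ < X)%N]m0.
  have /cvgrPdist_le H2' := H2 (row_mx y0 z).
  apply/cvgrPdist_le => e /H2'; apply: filterS => p; rewrite !sub0r !normrN.
  set q := _ + _ => qe; have qe' : q <= e by apply: le_trans qe; exact: ler_norm.
  apply: ex_norm_le => // y; rewrite ger0_norm //; apply: le_trans qe'.
  apply: (le_trans (gle p y)); rewrite (y0E y); apply: (le_trans (sumle id p y0 _)) => //.
  by rewrite lerD // distrC.
move: H2; case: eqP => m1 H2.
  apply: (concl (fun t => t `^ (1 + gamma))); last exact: H2.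
  - exact: measurable_powR.
  - by move=> t _; exact: powR_ge0.
  (* If [s > t], then [s] is at most [t^-gamma] times [s^(1 + gamma)]; otherwise [s <= t]. The
     exponent [m] is treated in the same way afterwards. *)
  move=> t t0; exists (t `^ (- gamma)); split => [|s s0]; first exact: powR_ge0.
  have [st|ts] := leP s t; first by rewrite (le_trans st) // lerDl mulr_ge0 ?powR_ge0.
  have s1 : 0 < s by exact: lt_trans ts.
  apply: (@le_trans _ _ (t `^ (- gamma) * s `^ (1 + gamma))); last by rewrite lerDr ltW.
  have -> : s `^ (1 + gamma) = s * s `^ gamma by rewrite powRD ?powRr1 // (gt_eqF s1) implybT.
  rewrite powRN ler_pdivlMl ?powR_gt0 //.
  by rewrite mulrC ler_wpM2l // ge0_ler_powR ?nnegrE // ltW.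
apply: (concl (fun t => t ^+ m)); last exact: H2.
- exact: exprn_measurable.
- by move=> t t0; exact: exprn_ge0.
move=> t t0; exists (t ^+ m.-1)^-1; split => [|s s0]; first by rewrite invr_ge0 exprn_ge0 // ltW.
have tm : 0 < t ^+ m.-1 by rewrite exprn_gt0.
have [st|ts] := leP s t; first by rewrite (le_trans st) // lerDl mulr_ge0 ?exprn_ge0 ?invr_ge0 // ltW.
apply: (@le_trans _ _ ((t ^+ m.-1)^-1 * s ^+ m)); last by rewrite lerDr ltW.
have mE : m = m.-1.+1 by case: (m) m0.
rewrite [in leRHS]mE ler_pdivlMl // exprS mulrC ler_wpM2l // lerXn2r ?nnegrE // ltW //.
Qed.

End Coefficients.

Lemma max_on_ball (R : realType) (n : nat) (f : 'rV[R]_n -> R) (r : R) : 0 <= r -> continuous f ->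
  exists x, `|x| <= r /\ forall y, `|y| <= r -> f y <= f x.
Proof.
move=> r0 fc; pose K := [set x : 'rV[R]_n | `|x| <= r].
have cpt : compact K.
  apply: bounded_closed_compact.
    by exists r; split; [exact: num_real | move=> M rM x /= xr; apply: le_trans xr (ltW rM)].
  apply: (@closed_comp _ _ _ [set y : R | y <= r]); last exact: closed_le.
  by move=> x _; exact: norm_continuous.
have K0 : K !=set0 by exists 0; rewrite /K /= normr0.
have [x /set_mem xK xmax] := EVT_max_rV K0 cpt (continuous_subspaceT fc).
by exists x; split => // y yr; apply: xmax; exact/mem_set.
Qed.

Lemma ball_net (R : realType) (n D : nat) (e : R) : 0 < e -> exists q (x : 'I_q.+1 -> 'rV[R]_n),
  (forall j, `|x j| <= D%:R) /\ forall y, `|y| <= D%:R -> exists j, `|x j - y| <= e.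
Proof.
move=> e0; pose P := (Num.bound e^-1).+1.
have P0 : 0 < P%:R :> R by rewrite ltr0n.
have Pe : P%:R^-1 <= e.
  rewrite -[e]invrK lef_pV2 ?posrE ?invr_gt0 //; apply/ltW/(lt_le_trans (archi_boundP _)).
    by rewrite invr_ge0 ltW.
  by rewrite ler_nat.
pose pt (k : 'rV[int]_n) : 'rV[R]_n := \row_i ((k 0 i)%:~R / P%:R).
pose s := [seq pt k | k <- zbox n (D * P)].
have mem_s k : inbox (D * P) k -> pt k \in s by move=> kb; apply: map_f; rewrite mem_zbox.
have s0 : (0 < size s)%N.
  have : pt 0 \in s by apply: mem_s; apply/inboxP => i; rewrite mxE.
  by case: (s).
exists (size s).-1, (fun j => nth 0 s j); split=> [j|y yD].
  have : nth 0 s j \in s by rewrite mem_nth // -[X in (_ < X)%N](prednK s0).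
  move=> /mapP[k]; rewrite mem_zbox => /inboxP kb ->; apply/row_normP => // i; rewrite mxE.
  rewrite normrM normfV [`|P%:R|]ger0_norm // ler_pdivrMr // -natrM.
  by rewrite -intr_norm -abszE -[X in _ <= X]pmulrn ler_nat.
pose k : 'rV[int]_n := \row_i Num.floor (y 0 i * P%:R).
have kr i : y 0 i * P%:R - 1 <= (k 0 i)%:~R <= y 0 i * P%:R.
  rewrite mxE floor_le_tmp andbT; have := floorD1_gt (y 0 i * P%:R); rewrite intrD; lra.
have kb : inbox (D * P) k.
  apply/inboxP => i; have yi := le_trans (row_norm_le y i) yD.
  rewrite -lez_nat abszE mxE ler_norml; apply/andP; split.
    rewrite floor_ge_int rmorphN /= -pmulrn natrM.
    by move: yi; rewrite ler_norml => /andP[h _]; rewrite -mulNr ler_pM2r.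
  rewrite -(ler_int R); apply: (le_trans (floor_le_tmp _)); rewrite -pmulrn natrM.
  by move: yi; rewrite ler_norml => /andP[_ h]; rewrite ler_pM2r.
have jl : (index (pt k) s < (size s).-1.+1)%N by rewrite prednK // index_mem mem_s.
exists (Ordinal jl); rewrite /= nth_index ?mem_s //; apply: le_trans Pe.
apply/row_normP => [|i]; first by rewrite invr_ge0.
rewrite !mxE -[y 0 i](mulfK (negbT (gt_eqF P0))) -mulrBl normrM normfV [`|P%:R|]ger0_norm //.
rewrite ler_piMl ?invr_ge0 // ler_norml; have := kr i; rewrite mxE mulfK ?(gt_eqF P0) //; lra.
Qed.

Lemma sum_option (R : nmodType) (I : finType) (F : option I -> R) :
  \sum_w F w = F None + \sum_i F (Some i).
Proof.
rewrite (bigD1 None) //= (reindex_omap Some id) => [|[i|]] //=.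
by congr (_ + _); apply: eq_bigl => i; rewrite eqxx.
Qed.

(** * Finitely supported almost solutions *)

Section Approximants.
Variables (R : realType) (m k : nat) (gamma : R).
Variables (A : probability (Rd R (m + k)) R -> 'rV[R]_(m + k) -> 'M[R]_(m + k))
  (b : probability (Rd R (m + k)) R -> 'rV[R]_(m + k) -> 'rV[R]_(m + k))
  (V : 'rV[R]_(m + k) -> R) (C Lam : R).
Hypotheses (mk0 : (0 < m + k)%N) (Apsd : forall mu x, psd (A mu x))
  (Ameas : forall mu i j, measurable_fun setT (fun x : Rd R (m + k) => A mu x i j))
  (bmeas : forall mu i, measurable_fun setT (fun x : Rd R (m + k) => b mu x 0 i))
  (Vck : Ck 2 V) (V0 : forall x, 0 <= V x)
  (Vinf : forall M : R, exists r : R, forall x, r < enorm x -> M < V x).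
Hypotheses (h12 : H12 V A b) (gamma0 : 0 < gamma) (h2 : H2 gamma V A b).
Hypotheses (C0 : 0 < C) (Lam0 : 0 < Lam)
  (lyap : forall mu, inPV V mu -> forall x, Lop (A mu) (b mu) V x <= C - Lam * V x).
Implicit Types (mu : probability (Rd R (m + k)) R) (x : 'rV[R]_(m + k)) (o : ix m k) (J : ix m k -> R).

Definition Lpt mu x J : R := \sum_o cf A b o mu x * J o.

Definition cfbar (D N : nat) mu x o : R := smooth_avg D N (lsubmx x)
  (fun y' => ballind (D%:R + 2) (row_mx y' (rsubmx x)) * cf A b o mu (row_mx y' (rsubmx x))).

Definition Lbar D N mu x J : R := \sum_o cfbar D N mu x o * J o.

Definition jetV x := jet (\row_i pder [:: i] V x) (\matrix_(i, j) pder [:: i; j] V x).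

Let Vc : continuous V. Proof. by have := Ck2_C2 Vck; case. Qed.

Lemma LptE mu u x : Lop (A mu) (b mu) u x =
  Lpt mu x (jet (\row_i pder [:: i] u x) (\matrix_(i, j) pder [:: i; j] u x)).
Proof.
rewrite /Lpt sum_ix /=; congr (_ + _); last by apply: eq_bigr => i _; rewrite mxE.
by apply: eq_bigr => i _; apply: eq_bigr => j _; rewrite mxE.
Qed.

Lemma row_near x (y' : 'rV[R]_m) (t : R) : 0 <= t -> `|y' - lsubmx x| <= t -> `|row_mx y' (rsubmx x) - x| <= t.
Proof.
move=> t0 h; apply/row_normP => // i; rewrite -[x in _ - x]hsubmxK mxE [X in _ + X]mxE.
rewrite -[i](@fintype.splitK m k); case: (fintype.split i) => j /=.
  by rewrite !row_mxEl; move: h => /(row_normP _ t0)/(_ j); rewrite !mxE.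
by rewrite !row_mxEr subrr normr0.
Qed.

Lemma Lbar_avg D N Rb mu x J : 0 < Rb -> inPRV V Rb mu ->
  Lbar D N mu x J = smooth_avg D N (lsubmx x)
    (fun y' => ballind (D%:R + 2) (row_mx y' (rsubmx x)) * Lpt mu (row_mx y' (rsubmx x)) J) /\
  adm ((fun y' => ballind (D%:R + 2) (row_mx y' (rsubmx x)) * Lpt mu (row_mx y' (rsubmx x)) J) : Rd R m -> R).
Proof.
move=> Rb0 hmu; pose F o y' := J o * (ballind (D%:R + 2) (row_mx y' (rsubmx x)) * cf A b o mu (row_mx y' (rsubmx x))).
have aT o : adm ((fun y' => ballind (D%:R + 2) (row_mx y' (rsubmx x)) * cf A b o mu (row_mx y' (rsubmx x))) : Rd R m -> R).
  apply: (@slice_adm _ _ _ (fun x => ballind (D%:R + 2) x * cf A b o mu x)).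
  exact: (cf_trunc_adm Ameas bmeas h12 _ _ Rb0 hmu).
have aF o : adm (F o : Rd R m -> R) by apply: admZ; exact: aT.
have E : (fun y' => ballind (D%:R + 2) (row_mx y' (rsubmx x)) * Lpt mu (row_mx y' (rsubmx x)) J) =
   (fun y' => \sum_(o <- index_enum (ix m k)) F o y').
  by apply/funext => y'; rewrite /Lpt mulr_sumr; apply: eq_bigr => o _; rewrite /F mulrA mulrC.
rewrite E; split; last exact: adm_sum.
transitivity (\sum_o smooth_avg D N (lsubmx x) (F o)); last by rewrite -(smooth_avg_sum _ _ _ _ aF).
apply: eq_bigr => o _; rewrite mulrC -(smooth_avgZ _ _ _ _ (aT o)) //.
Qed.

Let indin D N x y' : (1 < N)%N -> `|x| <= D%:R -> `|y' - lsubmx x| <= 2 / N%:R ->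
  ballind (D%:R + 2) (row_mx y' (rsubmx x)) = 1 /\ `|row_mx y' (rsubmx x) - x| <= 2 / N%:R.
Proof.
move=> N1 xD h; have N2 : 2 / N%:R <= 1 :> R by rewrite ler_pdivrMr ?ltr0n ?(ltnW N1) // mul1r ler_nat.
have h' := row_near (divr_ge0 (ler0n _ _) (ler0n _ _)) h; split => //.
rewrite /ballind (_ : (`|row_mx y' (rsubmx x)| <= _) = true) //.
by have := ler_normD (row_mx y' (rsubmx x) - x) x; rewrite subrK; lra.
Qed.

(** For a fixed jet [Lbar] is a weighted mean, of total weight 1, of the operator at points within
    2/N, so one-sided bounds there are inherited. *)
Lemma Lbar_le D N Rb mu x J c : 0 < Rb -> inPRV V Rb mu -> (1 < N)%N -> `|x| <= D%:R ->
  (forall x', `|x' - x| <= 2 / N%:R -> Lpt mu x' J <= c) -> Lbar D N mu x J <= c.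
Proof.
move=> Rb0 hmu N1 xD h; have [-> a] := Lbar_avg D N x J Rb0 hmu.
apply: smooth_avg_le => // [|y' /(indin N1 xD)[-> /h]]; last by rewrite mul1r.
exact: le_trans (lsubmx_norm x) xD.
Qed.

Lemma Lbar_ge D N Rb mu x J c : 0 < Rb -> inPRV V Rb mu -> (1 < N)%N -> `|x| <= D%:R ->
  (forall x', `|x' - x| <= 2 / N%:R -> c <= Lpt mu x' J) -> c <= Lbar D N mu x J.
Proof.
move=> Rb0 hmu N1 xD h; have [-> a] := Lbar_avg D N x J Rb0 hmu.
apply: smooth_avg_ge => // [|y' /(indin N1 xD)[-> /h]]; last by rewrite mul1r.
exact: le_trans (lsubmx_norm x) xD.
Qed.

Lemma Lpt_bound Rb r : 0 < Rb -> exists M, 0 <= M /\ forall mu x J t, inPRV V Rb mu -> `|x| <= r ->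
  (forall o, `|J o| <= t) -> `|Lpt mu x J| <= M * t.
Proof.
move=> Rb0; have [M [M0 hM]] := cf_bound h12 r Rb0.
exists (\sum_(o : ix m k) M); split; first by rewrite sumr_ge0.
move=> mu x J t hmu xr Jt; apply: (le_trans (ler_norm_sum _ _ _)); rewrite mulr_suml.
by apply: ler_sum => o _; rewrite normrM ler_pM // hM.
Qed.

Lemma LptB mu x J J' : Lpt mu x (fun o => J o - J' o) = Lpt mu x J - Lpt mu x J'.
Proof. by rewrite -sumrB; apply: eq_bigr => o _; rewrite mulrBr. Qed.

Lemma LbarB D N mu x J J' : Lbar D N mu x (fun o => J o - J' o) = Lbar D N mu x J - Lbar D N mu x J'.
Proof. by rewrite -sumrB; apply: eq_bigr => o _; rewrite mulrBr. Qed.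

Lemma Lbar_sum D N mu x (I : Type) (s : seq I) (q : I -> R) (J : I -> ix m k -> R) :
  Lbar D N mu x (fun o => \sum_(i <- s) q i * J i o) = \sum_(i <- s) q i * Lbar D N mu x (J i).
Proof.
rewrite /Lbar; under eq_bigr do rewrite mulr_sumr.
rewrite exchange_big; apply: eq_bigr => i _; rewrite mulr_sumr.
by apply: eq_bigr => o _; rewrite mulrCA.
Qed.

Lemma Lbar_bound Rb D : 0 < Rb -> exists M, 0 <= M /\ forall N mu x J t, inPRV V Rb mu -> (1 < N)%N -> `|x| <= D%:R ->
  (forall o, `|J o| <= t) -> `|Lbar D N mu x J| <= M * t.
Proof.
move=> Rb0; have [M [M0 hM]] := Lpt_bound (D%:R + 2) Rb0; exists M; split => // N mu x J t hmu N1 xD Jt.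
have N2 : 2 / N%:R <= 1 :> R by rewrite ler_pdivrMr ?ltr0n ?(ltnW N1) // mul1r ler_nat.
have key x' : `|x' - x| <= 2 / N%:R -> `|Lpt mu x' J| <= M * t.
  by move=> xx; apply: hM => //; have := ler_normD (x' - x) x; rewrite subrK; lra.
rewrite ler_norml; apply/andP; split.
  by apply: (Lbar_ge Rb0 hmu N1 xD) => x' /key; rewrite ler_norml => /andP[].
by apply: (Lbar_le Rb0 hmu N1 xD) => x' /key; rewrite ler_norml => /andP[].
Qed.

(** The jet is taken at the maximum point [x0] and the coefficients near [x]: nonnegative
    definiteness gives the sign wherever the matrix is evaluated. *)
Lemma Lbar_max_le0 D N Rb mu x (u : 'rV[R]_(m + k) -> R) G H x0 : 0 < Rb -> inPRV V Rb mu -> (1 < N)%N -> `|x| <= D%:R ->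
  C2 u G H -> (forall y, u y <= u x0) -> Lbar D N mu x (jet (G x0) (H x0)) <= 0.
Proof.
move=> Rb0 hmu N1 xD uC2 umax; apply: (Lbar_le Rb0 hmu N1 xD) => x' _.
have [G0 H0] := C2_max uC2 umax; rewrite /Lpt sum_ix /=.
rewrite [X in _ + X]big1 => [|i _]; last by rewrite G0 mulr0.
by rewrite addr0; apply: psd_trace_nonpos.
Qed.

Lemma jetV_cont o : continuous (fun x => jetV x o).
Proof.
have [_ _ Gc Hc] := Ck2_C2 Vck.
by case: o => [[i j]|i] /=; rewrite /jetV /=; [exact: Hc | exact: Gc].
Qed.

(** The hypothesis on [V] has the jet at the point where the coefficients are taken. Freezing it at
    [x] costs less than 1/2, uniformly over laws of bounded moment, once 2/N is below the moduli of
    continuity of [V] and of its jet. *)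
Lemma Lbar_lyap D Rb : 0 < Rb -> exists N0, forall N mu x, (N0 < N)%N -> inPRV V Rb mu -> `|x| <= D%:R ->
  Lbar D N mu x (jetV x) <= C + 1 / 2 - Lam * V x.
Proof.
move=> Rb0; have [M [M0 hM]] := Lpt_bound (D%:R + 2) Rb0.
have L0 : 0 < M + Lam + 1 by rewrite ltr_wpDl // addr_ge0 // ltW.
pose t := 1 / 4 / (M + Lam + 1).
have t0 : 0 < t by rewrite !divr_gt0.
have [d0 [d00 hd0]] := unif_cont_ball D%:R Vc t0.
have /choice[dl hdl] := fun o : ix m k => unif_cont_ball D%:R (@jetV_cont o) t0.
have [d [d_0 hd]] := @min_pos R _ (index_enum (ix m k)) dl (fun o => (hdl o).1).
have dm0 : 0 < Num.min d d0 by rewrite lt_min d_0.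
exists (maxn 1 (Num.bound (2 / Num.min d d0))) => N mu x.
rewrite gtn_max => /andP[N1 Nb] hmu xD.
have N0 : 0 < N%:R :> R by rewrite ltr0n ltnW.
have N2 : 2 / N%:R <= 1 :> R by rewrite ler_pdivrMr // mul1r ler_nat.
have Nd : 2 / N%:R <= Num.min d d0.
  rewrite ler_pdivrMr // mulrC -ler_pdivrMr //; apply: ltW; apply: (lt_le_trans (archi_boundP _)).
    by rewrite divr_ge0 // ltW.
  by rewrite ler_nat ltnW.
apply: (Lbar_le Rb0 hmu N1 xD) => x' xx.
have xx' : `|x' - x| <= Num.min d d0 by exact: le_trans Nd.
have := lyap (inPRV_inPV Vc V0 hmu) x'; rewrite LptE -/(jetV x').
have : `|Lpt mu x' (fun o => jetV x o - jetV x' o)| <= M * t.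
  apply: hM => // [|o]; first by have := ler_normD (x' - x) x; rewrite subrK; lra.
  rewrite distrC -[x'](subrKC x); apply: (hdl o).2 => //.
  by move: xx'; rewrite le_min => /andP[h _]; apply: (le_trans h); apply: hd; rewrite mem_index_enum.
rewrite LptB => h1 h3.
have h2' : `|V x' - V x| <= t.
  rewrite -[x'](subrKC x); apply: hd0 => //.
  by move: xx'; rewrite le_min => /andP[_ h].
have h4 : Lam * (V x - V x') <= Lam * t.
  by rewrite ler_wpM2l ?(ltW Lam0) //; move: h2'; rewrite distrC; apply: le_trans; exact: ler_norm.
have h5 : M * t + Lam * t <= 1 / 4.
  have -> : 1 / 4 = (M + Lam + 1) * t by rewrite /t [RHS]mulrC divfK // gt_eqF.
  rewrite -mulrDl ler_wpM2r ?(ltW t0) //; lra.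
have := ler_norm (Lpt mu x' (jetV x) - Lpt mu x' (jetV x')); move: h4; rewrite mulrBr; lra.
Qed.


(** The reason for averaging: along [mun] the coefficients need not converge at a point, but their
    cell means do. *)
Lemma Lbar_cvg D N Rb (mun : nat -> probability (Rd R (m + k)) R) mu x J : 0 < Rb -> (1 < N)%N ->
  (forall p, inPRV V Rb (mun p)) -> inPRV V Rb mu -> Vweak_cvg V mun mu ->
  (fun p => Lbar D N (mun p) x J) @ \oo --> Lbar D N mu x J.
Proof.
move=> Rb0 N1 hmun hmu wc.
have aT mu' o : inPRV V Rb mu' -> adm ((fun y' => ballind (D%:R + 2) (row_mx y' (rsubmx x)) * cf A b o mu' (row_mx y' (rsubmx x))) : Rd R m -> R).
  move=> hmu'; apply: (@slice_adm _ _ _ (fun x => ballind (D%:R + 2) x * cf A b o mu' x)).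
  exact: (cf_trunc_adm Ameas bmeas h12 _ _ Rb0 hmu').
apply: cvgn_sum => o; apply: cvgM; last exact: cvg_cst.
apply: cvgn_sum => j; apply: cvgM; first exact: cvg_cst.
apply/cvgrPdist_le => e e0.
have /cvgrPdist_le/(_ e e0) := cf_cvg Ameas bmeas h12 gamma0 h2 o (node R N j) (rsubmx x) (D%:R + 2) Rb0 hmun hmu wc (hw_gt0 R (ltnW N1)).
apply: filterS => p; rewrite sub0r normrN => small.
rewrite distrC /avg -exB; [|exact: aT|exact: aT].
apply: le_trans small; apply: (le_trans (ex_abs _ _)); first by apply: admB; exact: aT.
rewrite [leRHS]ger0_norm; last by apply: ex_ge0 => y; rewrite mulr_ge0 // ler0n.
apply: ex_le => [||y]; first by apply: adm_abs; apply: admB; exact: aT.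
  exact: (cf_diff_adm Ameas bmeas h12 o (D%:R + 2) (rsubmx x) Rb0 hmu (hmun p)).
by rewrite -mulrBr normrM [`|ballind _ _|]ger0_norm // ler0n.
Qed.

(** [Lam * R0 = C + 1] exceeds the constant [C + 1 / 2] of the averaged Lyapunov inequality. *)
Let R0 : R := (C + 1) / Lam.

(** The order of quantifiers matters: [D] and [N0] depend only on the support radius [r0], so the
    finite family may be chosen after the mesh and be as large as the lattice requires. Ky Fan's
    points form a net of the ball of radius [D], fine enough for the jets of that family. *)
Lemma approximant (r0 : R) : exists D N0 : nat, r0 <= D%:R /\ (1 < N0)%N /\ forall N, (N0 <= N)%N ->
  forall (I : finType) (u : I -> 'rV[R]_(m + k) -> R) G H,
  (forall i, C2 (u i) (G i) (H i)) -> (forall i x, r0 <= `|x| -> u i x = 0) -> forall eta, 0 < eta ->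
  exists n (x : 'I_n.+1 -> 'rV[R]_(m + k)) p mu, [/\ simplex p, forall j, `|x j| <= D%:R,
    forall f : 'rV[R]_(m + k) -> R, measurable_fun setT (f : Rd R (m + k) -> R) ->
      mu.-integrable setT (fun y : Rd R (m + k) => (f y)%:E) /\
      (\int[mu]_y (f y)%:E = (\sum_i p i * f (x i))%:E)%E,
    \sum_j p j * V (x j) <= R0 + eta &
    forall i, `|\sum_j p j * Lbar D N mu (x j) (jet (G i (x j)) (H i (x j)))| <= eta].
Proof.
(* All test functions vanish at [x1], and [V] exceeds [V x1] beyond the radius [rB]. So outside the
   ball of radius [D] the function to be maximized is at most its value at [x1], and its maximum
   over the ball is global. *)
pose x1 : 'rV[R]_(m + k) := const_mx `|r0|.
have x1n : r0 <= `|x1|.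
  by apply: le_trans (row_norm_le x1 (Ordinal mk0)); rewrite mxE normr_id ler_norm.
have [rB hB] := coercive_norm Vinf (V x1).
pose D := (Num.bound (`|r0| + `|x1| + `|rB|)).
have DB : `|r0| + `|x1| + `|rB| <= D%:R by apply/ltW/archi_boundP; rewrite !addr_ge0.
have r0D : r0 <= D%:R by have := ler_norm r0; have := normr_ge0 x1; have := normr_ge0 rB; lra.
have x1D : `|x1| <= D%:R by have := normr_ge0 r0; have := normr_ge0 rB; lra.
have rBD : rB <= D%:R by have := ler_norm rB; have := normr_ge0 x1; have := normr_ge0 r0; lra.
have [Rm [Rm0 hRm]] := bounded_on_ball D%:R Vc.
have Rm1 : 0 < Rm + 1 by rewrite ltr_wpDl.
have [N1 hN1] := Lbar_lyap D Rm1.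
have [M [M0 hM]] := Lbar_bound D Rm1.
exists D, (maxn 2 N1.+1); split => //; split; first by rewrite leq_max.
move=> N; rewrite geq_max => /andP[N2 NN1] I u G H uC2 uout eta eta0.
pose U (w : option I) := if w is Some i then u i else V.
pose GU w := if w is Some i then G i else fun x => \row_i pder [:: i] V x.
pose HU w := if w is Some i then H i else fun x => \matrix_(i, j) pder [:: i; j] V x.
have UC2 w : C2 (U w) (GU w) (HU w) by case: w => [i|]; [exact: uC2 | exact: Ck2_C2].
pose J w x := jet (GU w x) (HU w x).
have Jc w o : continuous (fun x => J w x o).
  by have [_ _ Gc Hc] := UC2 w; case: o => [[i j]|i]; [exact: Hc | exact: Gc].
have /choice[BJ hBJ] := fun wo : option I * ix m k => bounded_on_ball D%:R (@Jc wo.1 wo.2).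
pose BB := \sum_wo BJ wo.
have BJle w o x : `|x| <= D%:R -> `|J w x o| <= BB.
  move=> xD; apply: (le_trans ((hBJ (w, o)).2 x xD)).
  by rewrite /BB (bigD1 (w, o)) //= lerDl sumr_ge0 // => wo _; have [] := hBJ wo.
have BB0 : 0 <= BB by rewrite sumr_ge0 // => wo _; have [] := hBJ wo.
pose q0 := M * BB + Rm.
have q00 : 0 <= q0 by rewrite addr_ge0 ?mulr_ge0.
(* The proof ends with the sum of the [g p i ^+ 2] plus [Lam * ph p ^+ 2] bounded by [tgt]; the two
   terms of the minimum then bound each [g p i] and [ph p] by [eta]. *)
pose tgt := Num.min (eta ^+ 2) (Lam * eta ^+ 2).
have tgt0 : 0 < tgt by rewrite lt_min exprn_gt0 // mulr_gt0 // exprn_gt0.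
pose card : R := \sum_(w : option I) q0.
have card0 : 0 <= card by rewrite sumr_ge0.
have Mc : 0 < M * card + 1 by rewrite ltr_wpDl // mulr_ge0.
(* Error allowed in each jet between the maximum point and the nearest point of the net. *)
pose e1 := tgt / (M * card + 1).
have e10 : 0 < e1 by rewrite divr_gt0.
have /choice[dl hdl] := fun wo : option I * ix m k => unif_cont_ball D%:R (@Jc wo.1 wo.2) e10.
have [dd [dd0 hdd]] := @min_pos R _ (index_enum (option I * ix m k)%type) dl (fun wo : option I * ix m k => (hdl wo).1).
have [n [x [xD xnet]]] := @ball_net R (m + k) D dd dd0.
have /choice[law hlaw] : forall p : 'I_n.+1 -> R, exists mu, simplex p ->
    forall f : 'rV[R]_(m + k) -> R, measurable_fun setT (f : Rd R (m + k) -> R) ->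
      mu.-integrable setT (fun y : Rd R (m + k) => (f y)%:E) /\
      (\int[mu]_y (f y)%:E = (\sum_i p i * f (x i))%:E)%E.
  move=> p; have [sp|] := pselect (simplex p).
    by have [mu hmu] := @finite_law R _ (Rd R (m + k)) n x p sp; exists mu.
  move=> nsp; have [mu _] := @finite_law R _ (Rd R (m + k)) 0 (fun _ => 0) (fun _ => 1) (conj (fun _ => ler01) (big_ord1 _ _)).
  by exists mu.
have mV : measurable_fun setT (V : Rd R (m + k) -> R) by exact: cont_meas.
have Vle (p : 'I_n.+1 -> R) : simplex p -> \sum_i p i * V (x i) <= Rm.
  move=> [p0 p1]; rewrite -[Rm]mul1r -p1 mulr_suml; apply: ler_sum => i _.
  by rewrite ler_wpM2l // (le_trans (ler_norm _)) // hRm.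
have lawR p : simplex p -> inPRV V (Rm + 1) (law p).
  move=> sp; rewrite /inPRV (hlaw p sp V mV).2 lee_fin.
  by apply: (le_trans (Vle p sp)); rewrite lerDl.
pose L p j w := Lbar D N (law p) (x j) (J w (x j)).
pose g p i := \sum_j p j * L p j (Some i).
pose ph p := Num.max 0 (\sum_j p j * V (x j) - R0).
pose Psi j p := \sum_(i : I) g p i * L p j (Some i) - ph p * L p j None.
have ph0 p : 0 <= ph p by rewrite le_max lexx.
have Lle p j w : simplex p -> `|L p j w| <= M * BB.
  by move=> sp; apply: hM => //; [exact: lawR | move=> o; exact: BJle].
have gle p i : simplex p -> `|g p i| <= M * BB.
  move=> sp; have [p0 p1] := sp; apply: (le_trans (ler_norm_sum _ _ _)).
  rewrite -[M * BB]mul1r -p1 mulr_suml; apply: ler_sum => j _.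
  by rewrite normrM (ger0_norm (p0 j)) ler_wpM2l // Lle.
have R00 : 0 <= R0 by rewrite divr_ge0 ?ltW // addr_gt0.
have phle p : simplex p -> ph p <= Rm.
  by move=> sp; rewrite ge_max Rm0 /=; have := Vle p sp; lra.
have Lcvg (p_ : nat -> 'I_n.+1 -> R) p j w : (forall k, simplex (p_ k)) -> simplex p ->
    (forall i, (fun k => p_ k i) @ \oo --> p i) -> (fun k => L (p_ k) j w) @ \oo --> L p j w.
  move=> sp_ sp cp.
  apply: (@Lbar_cvg D N (Rm + 1) (fun l => law (p_ l)) (law p) (x j) (J w (x j)) Rm1 N2 (fun l => lawR _ (sp_ l)) (lawR p sp)).
  move=> f fc _; have mf : measurable_fun setT (f : Rd R (m + k) -> R) by exact: cont_meas.
  rewrite (hlaw p sp f mf).2 (_ : (fun l => _) = EFin \o (fun l => \sum_i p_ l i * f (x i))).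
    by apply: cvg_EFin; [exact: nearW | apply: cvgn_sum => i; apply: cvgM; [exact: cp | exact: cvg_cst]].
  by apply/funext => l; exact: (hlaw (p_ l) (sp_ l) f mf).2.
have [j' p_ p sp_ sp cp|p [sp hp]] := @ky_fan R n Psi.
  have cg i : (fun k => g (p_ k) i) @ \oo --> g p i.
    by apply: cvgn_sum => j; apply: cvgM; [exact: cp | exact: Lcvg].
  have cph : (fun k => ph (p_ k)) @ \oo --> ph p.
    have cs : (fun k => \sum_j p_ k j * V (x j) - R0) @ \oo --> \sum_j p j * V (x j) - R0.
      by apply: cvgB; [apply: cvgn_sum => j; apply: cvgM; [exact: cp | exact: cvg_cst] | exact: cvg_cst].
    apply/cvgrPdist_le => e e0; have /cvgrPdist_le/(_ e e0) := cs.
    by apply: filterS => l; apply: le_trans; exact: max_lip.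
  apply: cvgB; first by apply: cvgn_sum => i; apply: cvgM; [exact: cg | exact: Lcvg].
  by apply: cvgM; [exact: cph | exact: Lcvg].
have [p0 p1] := sp.
pose q w := if w is Some i then g p i else - ph p.
have qle w : `|q w| <= q0.
  rewrite /q /q0; case: w => [i|]; first by apply: (le_trans (gle p i sp)); rewrite lerDl.
  by rewrite normrN ger0_norm // (le_trans (phle p sp)) // lerDr mulr_ge0.
pose W y := \sum_(w : option I) q w * U w y.
have WC2 := @C2_sum R (m + k) _ (index_enum (option I)) (fun w y => q w * U w y) _ _ (fun w => C2Z (q w) (UC2 w)).
have Wc : continuous W by have [] := WC2.
have [xs [xsD xsmax]] := max_on_ball (ler0n R D) Wc.
have Wout y : r0 <= `|y| -> W y = - ph p * V y.
  move=> hy; rewrite /W sum_option /= big1 ?addr0 // => i _ /=.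
  by rewrite uout // mulr0.
have gmax y : W y <= W xs.
  have [yD|yD] := leP `|y| D%:R; first exact: xsmax.
  apply: le_trans (xsmax x1 x1D); rewrite !Wout //; last by rewrite (le_trans r0D) // ltW.
  by rewrite !mulNr lerN2 ler_wpM2l // ltW // hB // (le_lt_trans rBD).
have [j jx] := xnet xs xsD.
have Psile : Psi j p <= tgt.
  pose Jw y o := \sum_w q w * J w y o.
  have PsiE : Psi j p = Lbar D N (law p) (x j) (Jw (x j)).
    rewrite /Jw Lbar_sum sum_option /= mulNr addrC; congr (_ - _).
  have JE y : Jw y = jet (\sum_w q w *: GU w y) (\sum_w q w *: HU w y).
    apply/funext => -[[i l]|i] /=; rewrite summxE; apply: eq_bigr => w _; by rewrite mxE.
  have := Lbar_max_le0 Rm1 (lawR p sp) N2 (xD j) WC2 gmax; rewrite -JE => h0.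
  have : `|Lbar D N (law p) (x j) (fun o => Jw (x j) o - Jw xs o)| <= M * (card * e1).
    apply: hM => // [|o]; first exact: lawR.
    rewrite -sumrB; apply: (le_trans (ler_norm_sum _ _ _)); rewrite mulr_suml; apply: ler_sum => w _.
    rewrite -mulrBr normrM ler_pM // -[x j](subrKC xs); apply: (hdl (w, o)).2 => //.
    by apply: (le_trans jx); apply: hdd; rewrite mem_index_enum.
  rewrite LbarB -PsiE => h1.
  have : M * (card * e1) <= tgt.
    by rewrite mulrA /e1 mulrCA ger_pMr // ler_pdivrMr // mul1r lerDl.
  have := ler_norm (Psi j p - Lbar D N (law p) (x j) (Jw xs)); lra.
(* Weighted by [p], the first part of [Psi] becomes a sum of squares. If [ph p] is positive, the
   [V]-moment is [R0 + ph p], and the Lyapunov inequality bounds the mean of the operator applied to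
   [V] by [- (Lam * ph p)]. *)
have lower : \sum_i g p i ^+ 2 + Lam * ph p ^+ 2 <= \sum_j p j * Psi j p.
  have -> : \sum_j p j * Psi j p = \sum_i g p i ^+ 2 - ph p * \sum_j p j * L p j None.
    rewrite /Psi; under eq_bigr do rewrite mulrBr.
    rewrite sumrB; congr (_ - _); last by rewrite mulr_sumr; apply: eq_bigr => l _; rewrite mulrCA.
    under eq_bigr do rewrite mulr_sumr.
    rewrite exchange_big; apply: eq_bigr => i _; rewrite expr2 [in RHS]/g mulr_sumr.
    by apply: eq_bigr => l _; rewrite mulrCA.
  rewrite lerD2l lerNr.
  set S := \sum_j p j * V (x j).
  have hS : \sum_j p j * L p j None <= C + 1 / 2 - Lam * S.
    have -> : C + 1 / 2 - Lam * S = \sum_j p j * (C + 1 / 2 - Lam * V (x j)).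
      under eq_bigr do rewrite mulrBr.
      rewrite sumrB -mulr_suml p1 [1 * (C + _)]mul1r; congr (_ - _); rewrite /S mulr_sumr.
      by apply: eq_bigr => l _; rewrite mulrCA.
    apply: ler_sum => l _; rewrite ler_wpM2l //.
    by apply: (hN1 N (law p) (x l)) => //; exact: lawR.
  have [phz|phn] := eqVneq (ph p) 0; first by rewrite phz mul0r expr2 !mulr0 oppr0.
  have phE : ph p = S - R0.
    by move: phn; rewrite /ph -/S; case: (ltP 0 (S - R0)) => // h; rewrite eqxx.
  have LR : Lam * S = Lam * ph p + C + 1.
    by rewrite phE /R0 mulrBr [Lam * (_ / _)]mulrC divfK ?(gt_eqF Lam0) //; lra.
  rewrite expr2 mulrCA -mulrN ler_wpM2l // (le_trans hS) // LR; lra.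
(* Ky Fan's inequality at the net point [j] nearest to the maximum. *)
have ub : \sum_j p j * Psi j p <= tgt.
  by apply: (le_trans (hp j)).
have tge : tgt <= eta ^+ 2 /\ tgt <= Lam * eta ^+ 2 by rewrite !ge_min !lexx orbT.
have phs : Lam * ph p ^+ 2 <= Lam * eta ^+ 2.
  apply: le_trans tge.2; apply: le_trans ub; apply: le_trans lower.
  by rewrite lerDr sumr_ge0 // => i _; exact: sqr_ge0.
exists n, x, p, (law p); split => // [f mf||i].
- exact: hlaw.
- have : ph p <= eta.
    by move: phs; rewrite ler_pM2l // ler_sqr ?nnegrE // ltW.
  by rewrite ge_max => /andP[_]; lra.
have : g p i ^+ 2 <= eta ^+ 2.
  apply: le_trans tge.1; apply: le_trans ub; apply: le_trans lower.
  rewrite (bigD1 i) //= -addrA lerDl addr_ge0 //; last by rewrite mulr_ge0 ?sqr_ge0 // ltW.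
  by rewrite sumr_ge0 // => l _; exact: sqr_ge0.
by rewrite -[g p i ^+ 2]real_normK ?num_real // ler_sqr ?nnegrE // ltW.
Qed.

End Approximants.

(** * The Krylov type estimate *)

Section SquareTest.
Variables (R : realType) (n : nat).
Implicit Types (a Q h : 'M[R]_n) (c P g : 'rV[R]_n).

Let S (F : 'I_n -> 'I_n -> R) : R := \sum_i \sum_j F i j.

Let SD F F' : S (fun i j => F i j + F' i j) = S F + S F'.
Proof. by rewrite /S -big_split; apply: eq_bigr => i _; rewrite big_split. Qed.

Let SZ x F : S (fun i j => x * F i j) = x * S F.
Proof. by rewrite /S mulr_sumr; apply: eq_bigr => i _; rewrite mulr_sumr. Qed.

Let Sle F B : (forall i j, `|F i j| <= B) -> `|S F| <= n%:R * (n%:R * B).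
Proof.
move=> h; have sumc (t : R) : \sum_(i < n) t = n%:R * t by rewrite sumr_const card_ord mulr_natl.
rewrite -!sumc; apply: (le_trans (ler_norm_sum _ _ _)); apply: ler_sum => i _.
by apply: (le_trans (ler_norm_sum _ _ _)); apply: ler_sum => j _.
Qed.

(* The gradient square produced by [w + w^2/kappa] absorbs every term linear in the gradient [P] of [w]. *)
Lemma square_test_lower (lam M : R) : 0 < lam -> 0 <= M -> exists K, 0 <= K /\
  forall a h Q (c g P : 'rV[R]_n) (z w kappa : R),
  0 < kappa -> 0 <= w <= kappa -> 0 <= z <= 1 ->
  (forall i j, `|a i j| <= M) -> (forall i, `|c 0 i| <= M) -> (forall i, `|g 0 i| <= M) ->
  (forall i j, `|h i j| <= M) -> lam * \sum_i P 0 i ^+ 2 <= \sum_i \sum_j a i j * (P 0 i * P 0 j) ->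
  z ^+ 2 * (1 + 2 * w / kappa) * \sum_i \sum_j a i j * Q i j - K * kappa <=
  \sum_i \sum_j a i j * (z ^+ 2 * ((1 + 2 * w / kappa) * Q i j + 2 / kappa * (P 0 i * P 0 j))
     + (w + w ^+ 2 / kappa) * (2 * z * h i j + 2 * (g 0 i * g 0 j))
     + 2 * z * (1 + 2 * w / kappa) * (g 0 i * P 0 j + P 0 i * g 0 j))
  + \sum_i c 0 i * (z ^+ 2 * ((1 + 2 * w / kappa) * P 0 i) + (w + w ^+ 2 / kappa) * (2 * z * g 0 i)).
Proof.
(* [K1] bounds the coefficients of the terms linear in [P], [K2] the terms free of [P] and [Q].
   Completing the square in [z * P] coordinate by coordinate produces [K1 ^+ 2 / (8 * lam)]. *)
move=> lam0 M0; pose K1 := 12 * (n%:R * (M * M)) + 3 * M.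
pose K2 := n%:R * (n%:R * (M * (2 * M + 2 * (M * M)))) + n%:R * (M * (2 * M)).
have K10 : 0 <= K1 by rewrite /K1; pos.
have K20 : 0 <= K2 by rewrite /K2; pos.
exists (n%:R * (K1 ^+ 2 / (8 * lam)) + 2 * K2); split.
  by rewrite addr_ge0 // !mulr_ge0 // ?sqr_ge0 // invr_ge0 mulr_ge0 // ltW.
move=> a h Q c g P z w kappa k0 /andP[w0 wk] /andP[z0 z1] aM cM gM hM ell.
set f := 1 + 2 * w / kappa; set phi := w + w ^+ 2 / kappa.
have f0 : 1 <= f by rewrite lerDl divr_ge0 ?mulr_ge0 // ltW.
have f3 : f <= 3.
  suff : 2 * w / kappa <= 2 by rewrite /f; lra.
  by rewrite ler_pdivrMr // ler_pM2l.
have phi0 : 0 <= phi by rewrite addr_ge0 // divr_ge0 ?sqr_ge0 // ltW.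
have phi2 : phi <= 2 * kappa.
  suff : w ^+ 2 / kappa <= kappa by rewrite /phi; lra.
  by rewrite ler_pdivrMr // -expr2 lerXn2r ?nnegrE // ltW.
pose cc j := 2 * f * \sum_i a i j * g 0 i + 2 * f * \sum_i a j i * g 0 i + z * f * c 0 j.
pose E := S (fun i j => a i j * (2 * z * h i j + 2 * (g 0 i * g 0 j))) + \sum_i c 0 i * (2 * z * g 0 i).
have -> : \sum_i \sum_j a i j * (z ^+ 2 * (f * Q i j + 2 / kappa * (P 0 i * P 0 j))
     + phi * (2 * z * h i j + 2 * (g 0 i * g 0 j)) + 2 * z * f * (g 0 i * P 0 j + P 0 i * g 0 j))
  + \sum_i c 0 i * (z ^+ 2 * (f * P 0 i) + phi * (2 * z * g 0 i)) =
  z ^+ 2 * f * S (fun i j => a i j * Q i j) + (z ^+ 2 * (2 / kappa)) * S (fun i j => a i j * (P 0 i * P 0 j))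
  + \sum_j (z * P 0 j) * cc j + phi * E.
  have -> : \sum_j (z * P 0 j) * cc j = (2 * z * f) * S (fun i j => a i j * (g 0 i * P 0 j))
     + (2 * z * f) * S (fun i j => a i j * (P 0 i * g 0 j)) + z ^+ 2 * f * \sum_j c 0 j * P 0 j.
    rewrite /S [X in _ * X + _ + _]exchange_big !mulr_sumr -!big_split; apply: eq_bigr => j _ /=.
    rewrite /cc !mulrDr !mulr_sumr; congr (_ + _ + _); last by ring.
      by apply: eq_bigr => i _; ring.
    by apply: eq_bigr => i _; ring.
  have -> : \sum_i c 0 i * (z ^+ 2 * (f * P 0 i) + phi * (2 * z * g 0 i)) =
    z ^+ 2 * f * (\sum_j c 0 j * P 0 j) + phi * \sum_i c 0 i * (2 * z * g 0 i).
    by rewrite !mulr_sumr -big_split; apply: eq_bigr => i _ /=; ring.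
  have -> : \sum_i \sum_j a i j * (z ^+ 2 * (f * Q i j + 2 / kappa * (P 0 i * P 0 j))
     + phi * (2 * z * h i j + 2 * (g 0 i * g 0 j)) + 2 * z * f * (g 0 i * P 0 j + P 0 i * g 0 j)) =
    z ^+ 2 * f * S (fun i j => a i j * Q i j) + (z ^+ 2 * (2 / kappa)) * S (fun i j => a i j * (P 0 i * P 0 j))
    + phi * S (fun i j => a i j * (2 * z * h i j + 2 * (g 0 i * g 0 j)))
    + (2 * z * f) * S (fun i j => a i j * (g 0 i * P 0 j)) + (2 * z * f) * S (fun i j => a i j * (P 0 i * g 0 j)).
    by rewrite -!SZ -!SD; apply: eq_bigr => i _; apply: eq_bigr => j _; ring.
  by rewrite /E; ring.
have sumc (t : R) : \sum_(i < n) t = n%:R * t by rewrite sumr_const card_ord mulr_natl.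
have ccK j : `|cc j| <= K1.
  have sa (F : 'I_n -> R) : (forall i, `|F i| <= M) -> `|\sum_i F i * g 0 i| <= n%:R * (M * M).
    move=> FM; rewrite -sumc; apply: (le_trans (ler_norm_sum _ _ _)); apply: ler_sum => i _.
    by rewrite normrM ler_pM.
  have f6 : `|2 * f| <= 6 by rewrite ger0_norm; lra.
  have b1 := ler_pM (normr_ge0 _) (normr_ge0 _) f6 (sa (a^~ j) (fun i => aM i j)).
  have b2 := ler_pM (normr_ge0 _) (normr_ge0 _) f6 (sa (a j) (fun i => aM j i)).
  have zf : `|z * f| <= 3.
    rewrite ger0_norm; last by rewrite mulr_ge0 //; lra.
    by rewrite -[3]mul1r ler_pM //; lra.
  have b3 := ler_pM (normr_ge0 _) (normr_ge0 _) zf (cM j).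
  rewrite -!normrM in b1 b2 b3; apply: (le_trans (ler_normD _ _)); rewrite /K1 lerD //.
  apply: (le_trans (ler_normD _ _)); lra.
have EK : `|E| <= K2.
  apply: (le_trans (ler_normD _ _)); rewrite /K2 lerD //.
    apply: Sle => i j; rewrite normrM ler_pM // (le_trans (ler_normD _ _)) // lerD //.
      by rewrite normrM ler_pM // ger0_norm; lra.
    by rewrite normrM ger0_norm // ler_pM2l // normrM ler_pM.
  rewrite -sumc; apply: (le_trans (ler_norm_sum _ _ _)); apply: ler_sum => i _.
  by rewrite normrM ler_pM // normrM ler_pM // ger0_norm; lra.
have phiE : - (2 * K2 * kappa) <= phi * E.
  have : `|phi * E| <= 2 * kappa * K2 by rewrite normrM (ger0_norm phi0) ler_pM.
  by rewrite ler_norml => /andP[h1 _]; move: h1; congr (_ <= _); ring.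
have quad : - (n%:R * (K1 ^+ 2 / (8 * lam)) * kappa) <=
    (z ^+ 2 * (2 / kappa)) * S (fun i j => a i j * (P 0 i * P 0 j)) + \sum_j (z * P 0 j) * cc j.
  apply: (@le_trans _ _ ((z ^+ 2 * (2 / kappa)) * (lam * \sum_i P 0 i ^+ 2) + \sum_j (z * P 0 j) * cc j)).
    rewrite !mulr_sumr -big_split -mulrA -mulrN -sumc; apply: ler_sum => j _ /=.
    have c2 : cc j ^+ 2 <= K1 ^+ 2.
      by rewrite -[cc j ^+ 2]real_normK ?num_real // lerXn2r ?nnegrE.
    have c3 : kappa * cc j ^+ 2 / (8 * lam) <= kappa * K1 ^+ 2 / (8 * lam).
      by rewrite ler_pM2r ?invr_gt0 ?mulr_gt0 // ler_pM2l.
    have : 0 <= 2 * lam / kappa * (z * P 0 j + kappa * cc j / (4 * lam)) ^+ 2.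
      by rewrite mulr_ge0 ?sqr_ge0 // divr_ge0 ?mulr_ge0 ?ltW.
    have -> : 2 * lam / kappa * (z * P 0 j + kappa * cc j / (4 * lam)) ^+ 2 =
      z ^+ 2 * (2 / kappa) * (lam * P 0 j ^+ 2) + z * P 0 j * cc j + kappa * cc j ^+ 2 / (8 * lam).
      by field; rewrite !gt_eqF.
    have -> : K1 ^+ 2 / (8 * lam) * kappa = kappa * K1 ^+ 2 / (8 * lam) by ring.
    lra.
  by rewrite lerD2r ler_wpM2l // mulr_ge0 ?sqr_ge0 // divr_ge0 // ltW.
rewrite -/(S _); lra.
Qed.

Lemma outer_mxE (u v : 'rV[R]_n) i j : (u^T *m v) i j = u 0 i * v 0 j.
Proof. by rewrite !mxE big_ord1 !mxE. Qed.

Lemma square_jet (Z W : 'rV[R]_n -> R) (GZ GW : 'rV[R]_n -> 'rV[R]_n) (HZ HW : 'rV[R]_n -> 'M[R]_n) (kappa : R) :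
  C2 Z GZ HZ -> C2 W GW HW -> exists u G H, [/\ C2 u G H, forall x, u x = Z x ^+ 2 * (W x + W x ^+ 2 / kappa),
   forall x i, G x 0 i = Z x ^+ 2 * ((1 + 2 * W x / kappa) * GW x 0 i) + (W x + W x ^+ 2 / kappa) * (2 * Z x * GZ x 0 i) &
   forall x i j, H x i j = Z x ^+ 2 * ((1 + 2 * W x / kappa) * HW x i j + 2 / kappa * (GW x 0 i * GW x 0 j))
     + (W x + W x ^+ 2 / kappa) * (2 * Z x * HZ x i j + 2 * (GZ x 0 i * GZ x 0 j))
     + 2 * Z x * (1 + 2 * W x / kappa) * (GZ x 0 i * GW x 0 j + GW x 0 i * GZ x 0 j)].
Proof.
move=> ZC2 WC2; have uC2 := C2M (C2M ZC2 ZC2) (C2D WC2 (C2Z kappa^-1 (C2M WC2 WC2))).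
do 3 eexists; split; first exact: uC2.
- by move=> y /=; ring.
- by move=> y i; rewrite /gmul !mxE; ring.
move=> y i j; rewrite /hmul /gmul; do ! rewrite ?outer_mxE mxE; ring.
Qed.
End SquareTest.

Lemma weight_lower (R : realFieldType) (z2 f S tr e : R) : 0 <= z2 <= 1 -> 1 <= f <= 3 -> 0 <= S -> 0 <= e ->
  S - e <= tr -> z2 * S - 3 * e <= z2 * f * tr.
Proof.
move=> /andP[z0 z1] /andP[f1 f3] S0 e0 h; have f0 : 0 <= f by lra.
apply: (@le_trans _ _ (z2 * f * (S - e))); last by rewrite ler_wpM2l // mulr_ge0.
rewrite mulrBr lerB //; first by rewrite ler_wpM2r // ler_peMr.
by rewrite ler_wpM2r // -[3]mul1r ler_pM.
Qed.

Section FieldTest.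
Variables (R : realType) (m k : nat).
Variables (A : probability (Rd R (m + k)) R -> 'rV[R]_(m + k) -> 'M[R]_(m + k))
  (b : probability (Rd R (m + k)) R -> 'rV[R]_(m + k) -> 'rV[R]_(m + k))
  (V : 'rV[R]_(m + k) -> R).
Hypotheses (Apsd : forall mu x, psd (A mu x)) (h11 : H11 V A) (h12 : H12 V A b).
Implicit Types (mu : probability (Rd R (m + k)) R) (x : 'rV[R]_(m + k)).

Lemma ulsub_elliptic Rb r : 0 < Rb -> exists lam M, [/\ 0 < lam, 0 <= M &
  forall mu x, inPRV V Rb mu -> `|x| <= r -> elliptic lam M (ulsubmx (A mu x)) /\
   (forall o, `|cf A b o mu x| <= M)].
Proof.
move=> Rb0; have r0 : 0 < `|r| + 1 by rewrite ltr_wpDl.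
have [lam [lam0 hlam]] := h11 Rb0 0 r0; have [M [M0 hM]] := cf_bound h12 r Rb0.
exists lam, M; split => // mu x hmu xr; split; last by move=> o; exact: hM.
have xc : cube 0 (`|r| + 1) x.
  move=> i; rewrite mxE subr0 (le_trans (row_norm_le x i)) // (le_trans xr) //.
  by have := ler_norm r; lra.
split=> [|xi|i j]; last by rewrite !mxE; exact: (hM mu x (inl (lshift k i, lshift k j))).
  by rewrite -[LHS]/((ulsubmx (A mu x))^T) -{2}(Apsd mu x).1 trmx_ulsub.
rewrite quadE; have := hlam x mu xi xc hmu; rewrite /enorm sqr_sqrtr; last by rewrite sumr_ge0 // => i _; exact: sqr_ge0.
move=> h; apply: (le_trans h); rewrite le_eqVlt; apply/orP; left; apply/eqP.
by apply: eq_bigr => i _; apply: eq_bigr => j _; rewrite !mxE mulrA.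
Qed.

Lemma sum_lshift (F : 'I_(m + k) -> 'I_(m + k) -> R) :
  (forall i j, F (rshift m i) j = 0) -> (forall i j, F i (rshift m j) = 0) ->
  \sum_i \sum_j F i j = \sum_i \sum_j F (lshift k i) (lshift k j).
Proof.
move=> F1 F2; rewrite big_split_ord /= [X in _ + X]big1 ?addr0 => [|i _]; last by rewrite big1.
by apply: eq_bigr => i _; rewrite big_split_ord /= [X in _ + X]big1 ?addr0.
Qed.

(** The function [w] acts in [y] only, and the squared bump of radius [2 r] makes the test compactly
    supported. Coefficients are taken at [x'] and the jet at [x], within distance 1, so that the
    inequality survives the averaging of the coefficients. *)
Lemma field_test Rb (r : nat) : (0 < m)%N -> 0 < Rb -> (0 < r)%N -> exists K N0, 0 <= K /\
  forall N (f : 'rV[int]_m -> R) eps, (N0 < N)%N -> 0 < eps -> (forall k, 0 <= f k) ->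
  \sum_(k <- zbox m ((2 * r).+2 * N ^ 4)) f k ^+ m <= eps ^+ m * N%:R ^+ (4 * m) ->
  exists u G H, [/\ C2 u G H,
    forall x : 'rV[R]_(m + k), (2 * r)%:R <= `|x| -> u x = 0 /\ forall o, jet (G x) (H x) o = 0 &
    forall mu x x', inPRV V Rb mu -> `|x' - x| <= 1 ->
      bump ((2 * r)%:R^-1 *: x) ^+ 2 * \sum_(k <- zbox m ((2 * r).+2 * N ^ 4)) theta N k (lsubmx x) * f k - K * eps
      <= Lpt A b mu x' (jet (G x) (H x))].
Proof.
move=> m0 Rb0 r0; have [lam [M [lam0 M0 hell]]] := ulsub_elliptic (2 * r).+1%:R Rb0.
have [Kp [N0 [Kp0 hp]]] := pucci_test M (2 * r).+1 m0 lam0.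
have [GB [HB [_ [BC2 _ _]]]] := @bump_reg R (m + k).
have rr0 : 0 < (2 * r)%:R :> R by rewrite ltr0n muln_gt0.
have rr1 : 0 < (2 * r)%:R^-1 :> R by rewrite invr_gt0.
have ZC2 := C2_affine 0 rr1 BC2; move: ZC2; set Z := (fun x => _); set GZ := (fun x => _); set HZ := (fun x => _) => ZC2.
have Z0 x : 0 <= Z x by exact: bump_ge0.
have Z1 x : Z x <= 1 by exact: bump_le1.
have Zout x : (2 * r)%:R <= `|x| -> Z x = 0.
  move=> xr; suff [i hi] : exists i, (2 * r)%:R <= `|x 0 i|.
    by apply: (bump_out (i := i)); rewrite !mxE subr0 normrM gtr0_norm // mulrC ler_pdivlMr // mul1r.
  apply: contrapT => nex; move: xr; rewrite leNgt => /negP; apply.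
  pose t := \big[Order.max/0]_i `|x 0 i|.
  have t0 : t < (2 * r)%:R.
    by apply: bigmax_lt => // i _; rewrite ltNge; apply/negP => h; apply: nex; exists i.
  apply: le_lt_trans t0; apply/row_normP => [|i]; first exact: bigmax_ge_id.
  exact: le_bigmax.
have [_ Zc GZc HZc] := ZC2.
have /choice[BG hBG] := fun i => bounded_on_ball (2 * r)%:R (GZc i).
have /choice[BH hBH] := fun ij : 'I_(m + k) * 'I_(m + k) => bounded_on_ball (2 * r)%:R (HZc ij.1 ij.2).
pose MM := M + \sum_i BG i + \sum_ij BH ij.
have sG0 : 0 <= \sum_i BG i by rewrite sumr_ge0 // => i _; have [] := hBG i.
have sH0 : 0 <= \sum_ij BH ij by rewrite sumr_ge0 // => i _; have [] := hBH i.
have MM0 : 0 <= MM by rewrite !addr_ge0.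
have [Ks [Ks0 hs]] := @square_test_lower R (m + k) lam MM lam0 MM0.
have KK : 0 < Kp + 1 by rewrite ltr_wpDl.
exists (Ks * (Kp + 1) + 3 * Kp), N0; split; first by rewrite addr_ge0 // mulr_ge0 // ltW.
move=> N f eps NN eps0 f0 fN.
have [w [Gw [Hw [wC2 [wr wpucci]]]]] := hp N f eps NN eps0 f0 fN.
(* [kap] bounds [w], which puts [1 + 2 w / kap] between 1 and 3; the added 1 keeps it positive when
   [Kp] is zero. *)
pose kap := (Kp + 1) * eps; have kap0 : 0 < kap by rewrite mulr_gt0.
have WC2 := @C2_lsub R m k _ _ _ wC2.
have [u [G [H [uC2 uE Gij Hij]]]] := square_jet kap ZC2 WC2.
(* [Z] is nonnegative, so a zero is a minimum and the gradient vanishes there. *)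
have GZ0 x : Z x = 0 -> GZ x = 0.
  move=> Zx; have Zmax y : -1 * Z y <= -1 * Z x by rewrite Zx mulr0 mulN1r oppr_le0.
  have [hG _] := C2_max (C2Z (-1) ZC2) Zmax.
  by apply/rowP => i; have := hG i; rewrite !mxE => /eqP; rewrite mulN1r oppr_eq0 => /eqP.
exists u, G, H; split => //.
  move=> x /Zout Zx; split; first by rewrite uE Zx expr2 !mul0r.
  have g0 := GZ0 x Zx; case=> [[i j]|i] /=; first by rewrite Hij g0 Zx !mxE; ring.
  by rewrite Gij g0 Zx !mxE; ring.
move=> mu x x' hmu xx.
have -> : bump ((2 * r)%:R^-1 *: x) = Z x by rewrite /Z subr0.
have Keps : Kp * eps <= kap by rewrite ler_pM2r // lerDl.
have [xr|/ltW/Zout Zx] := leP `|x| (2 * r)%:R; last first.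
  rewrite Zx expr2 !mul0r sub0r /Lpt.
  have g0 := GZ0 x Zx; rewrite big1.
    by rewrite oppr_le0 mulr_ge0 ?(ltW eps0) // addr_ge0 // mulr_ge0 // ltW.
  case=> [[i j]|i] _ /=; first by rewrite Hij g0 Zx !mxE; ring.
  by rewrite Gij g0 Zx !mxE; ring.
have x'r : `|x'| <= (2 * r).+1%:R by have := ler_normD (x' - x) x; rewrite subrK -natr1; lra.
have [ell cfM] := hell mu x' hmu x'r.
have lsr : `|lsubmx x| <= (2 * r).+1%:R.
  by apply: (le_trans (lsubmx_norm x)); apply: (le_trans xr); rewrite ler_nat.
have pu := wpucci _ _ lsr ell.
have w01 := wr (lsubmx x); move: w01 => /andP[w0 w1].
have wk : 0 <= w (lsubmx x) <= kap by rewrite w0 (le_trans w1).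
have z01 : 0 <= Z x <= 1 by rewrite Z0 Z1.
have MMle : M <= MM by rewrite /MM -addrA lerDl addr_ge0.
have ha i j : `|A mu x' i j| <= MM by apply: le_trans MMle; exact: (cfM (inl (i, j))).
have hc i : `|b mu x' 0 i| <= MM by apply: le_trans MMle; exact: (cfM (inr i)).
have hg i : `|GZ x 0 i| <= MM.
  apply: (le_trans ((hBG i).2 x xr)); rewrite /MM (bigD1 i) //=.
  have : 0 <= \sum_(j | j != i) BG j by rewrite sumr_ge0 // => j _; have [] := hBG j.
  lra.
have hh i j : `|HZ x i j| <= MM.
  apply: (le_trans ((hBH (i, j)).2 x xr)); rewrite /MM (bigD1 (i, j)) //=.
  have : 0 <= \sum_(l | l != (i, j)) BH l by rewrite sumr_ge0 // => l _; have [] := hBH l.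
  lra.
pose P : 'rV[R]_(m + k) := row_mx (Gw (lsubmx x)) 0.
have hP : lam * \sum_i P 0 i ^+ 2 <= \sum_i \sum_j A mu x' i j * (P 0 i * P 0 j).
  rewrite big_split_ord /= [X in _ + X]big1 ?addr0 => [|i _]; last by rewrite row_mxEr mxE expr2 mulr0.
  rewrite sum_lshift => [|i j|i j]; try by rewrite [P 0 (rshift _ _)]row_mxEr [(0 : 'rV_k) _ _]mxE ?mul0r !mulr0.
  have [_ h _] := ell; have := h (Gw (lsubmx x)); rewrite quadE.
  congr (_ * _ <= _); first by apply: eq_bigr => i _; rewrite row_mxEl.
  by apply: eq_bigr => i _; apply: eq_bigr => j _; rewrite /P !row_mxEl !mxE.
have := hs (A mu x') (HZ x) (block_mx (Hw (lsubmx x)) 0 0 0) (b mu x') (GZ x) P (Z x) (w (lsubmx x)) kap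
  kap0 wk z01 ha hc hg hh hP.
have -> : Lpt A b mu x' (jet (G x) (H x)) = \sum_i \sum_j A mu x' i j * H x i j + \sum_i b mu x' 0 i * G x 0 i.
  by rewrite /Lpt sum_ix.
under [X in _ <= X + _ -> _]eq_bigr do under eq_bigr do rewrite -Hij.
under [X in _ <= _ + X -> _]eq_bigr do rewrite -Gij.
apply: le_trans.
have -> : \sum_i \sum_j A mu x' i j * (block_mx (Hw (lsubmx x)) 0 0 0 : 'M[R]_(m + k)) i j =
    \sum_i \sum_j ulsubmx (A mu x') i j * Hw (lsubmx x) i j.
  rewrite sum_lshift => [|i j|i j].
  - by apply: eq_bigr => i _; apply: eq_bigr => j _; rewrite block_mxEul !mxE.
  - by rewrite /block_mx row_mx0 col_mxEd mxE mulr0.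
  - by rewrite -[block_mx _ _ _ _]trmxK tr_block_mx !trmx0 mxE /block_mx row_mx0 col_mxEd mxE mulr0.
move: pu; set S := \sum_(k0 <- zbox _ _) _; set tr := \sum_i \sum_j ulsubmx (A mu x') i j * Hw (lsubmx x) i j => pu.
have S0 : 0 <= S by rewrite sumr_ge0 // => l _; rewrite mulr_ge0 // theta_ge0.
set f' := 1 + _.
have f1 : 1 <= f' by rewrite lerDl divr_ge0 ?mulr_ge0 // ltW.
have f3 : f' <= 3.
  suff : 2 * w (lsubmx x) / kap <= 2 by rewrite /f'; lra.
  by rewrite ler_pdivrMr // ler_pM2l //; case/andP: wk.
have KN : Kp * eps / N%:R <= Kp * eps.
  by rewrite ler_piMr ?mulr_ge0 ?(ltW eps0) // invf_le1 ?ler1n ?ltr0n ?(leq_ltn_trans (leq0n _) NN).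
have h1 : Z x ^+ 2 * S - 3 * (Kp * eps) <= Z x ^+ 2 * f' * tr.
  apply: weight_lower => //.
  - by rewrite sqr_ge0 expr2 mulr_ile1.
  - by rewrite f1.
  - by rewrite mulr_ge0 // ltW.
  by rewrite lerBlDr (le_trans pu) // lerD2l.
have -> : (Ks * (Kp + 1) + 3 * Kp) * eps = 3 * (Kp * eps) + Ks * kap by rewrite /kap; ring.
by rewrite opprD addrA lerD2r.
Qed.


End FieldTest.

Section FiniteLaws.
Variables (R : realType) (n : nat).
Implicit Types (F G : 'rV[R]_n -> R).

(** The atoms and weights are kept beside the law: the finite sum [lE] makes sense for every
    function, so averaged coefficients are integrated with no proof of measurability in [x]. *)
Record flaw := Flaw {
  fsize : nat;
  fpt : 'I_fsize.+1 -> 'rV[R]_n;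
  fwt : 'I_fsize.+1 -> R;
  flawP : probability (Rd R n) R;
  fwt_simplex : simplex fwt;
  flaw_int : forall F, measurable_fun setT (F : Rd R n -> R) ->
      flawP.-integrable setT (fun y : Rd R n => (F y)%:E) /\
      (\int[flawP]_y (F y)%:E = (\sum_i fwt i * F (fpt i))%:E)%E }.

Arguments fpt : clear implicits.
Arguments fwt : clear implicits.

Variable l : flaw.

Definition lE F : R := \sum_i fwt l i * F (fpt l i).

Lemma fwt_ge0 i : 0 <= fwt l i. Proof. by have [] := fwt_simplex l. Qed.

Lemma lE_le F G D : (forall i, `|fpt l i| <= D) -> (forall x, `|x| <= D -> F x <= G x) -> lE F <= lE G.
Proof. by move=> lD FG; apply: ler_sum => i _; rewrite ler_wpM2l ?fwt_ge0 ?FG. Qed.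

Lemma lE_cst c : lE (fun=> c) = c.
Proof. by rewrite /lE -mulr_suml; have [_ ->] := fwt_simplex l; rewrite mul1r. Qed.

Lemma lED F G : lE (fun x => F x + G x) = lE F + lE G.
Proof. by rewrite -big_split; apply: eq_bigr => i _; rewrite mulrDr. Qed.

Lemma lEB F G : lE (fun x => F x - G x) = lE F - lE G.
Proof. by rewrite -sumrB; apply: eq_bigr => i _; rewrite mulrBr. Qed.

Lemma lEZ c F : lE (fun x => c * F x) = c * lE F.
Proof. by rewrite mulr_sumr; apply: eq_bigr => i _; rewrite mulrCA. Qed.

Lemma lE_sum (I : Type) (s : seq I) (F : I -> 'rV[R]_n -> R) :
  lE (fun x => \sum_(i <- s) F i x) = \sum_(i <- s) lE (F i).
Proof. by rewrite exchange_big; apply: eq_bigr => i _; rewrite mulr_sumr. Qed.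

Lemma lE_abs F : `|lE F| <= lE (fun x => `|F x|).
Proof.
apply: (le_trans (ler_norm_sum _ _ _)); apply: ler_sum => i _.
by rewrite normrM (ger0_norm (fwt_ge0 i)).
Qed.

Lemma ex_flaw F : measurable_fun setT (F : Rd R n -> R) -> ex (flawP l) F = lE F.
Proof. by move=> mF; rewrite /ex /Rintegral (flaw_int l mF).2. Qed.

End FiniteLaws.
Arguments fpt {R n} _ _.
Arguments fwt {R n} _ _.

Lemma size_zbox m P : size (zbox m P) = ((2 * P).+1 ^ m)%N.
Proof. by rewrite size_map -cardT card_ffun !card_ord. Qed.

Lemma theta0 (R : realType) m N (y : 'rV[R]_m) k : m = 0%N -> theta N k y <= 1.
Proof. by move=> m0; apply: (le_trans (theta_le _ _ _)); rewrite {1}m0 muln0 expr0 invr1. Qed.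

(** Values are rounded up to multiples of 1/n with numerators at most [n * n]. This is a finite set
    of fields, known before any law, which dominates the given field on the box and exceeds it by at
    most 1/n. *)
Lemma field_round (R : realType) m P n (f : 'rV[int]_m -> R) (M : R) : M + 1 <= n%:R -> 0 <= M ->
  (forall k, 0 <= f k <= M) ->
  exists g : {ffun seq_sub (zbox m P) -> 'I_(n * n).+1},
    forall k, let v := if insub k is Some s then (g s)%:R / n%:R else 0 in
      0 <= v /\ v <= M + 1 /\ v <= f k + n%:R^-1 /\ (k \in zbox m P -> f k <= v).
Proof.
move=> Mn M0 fM; have n0 : 0 < n%:R :> R by lra.
have n1 : 1 <= n%:R :> R by lra.
pose t k := (Num.truncn (f k * n%:R)).+1.
have tb k : f k * n%:R <= (t k)%:R <= f k * n%:R + 1.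
  have := truncn_itv (mulr_ge0 (proj1 (andP (fM k))) (ltW n0)).
  by move=> /andP[h1 h2]; rewrite (ltW h2) /= /t -natr1 lerD2r.
have tn k : (t k < (n * n).+1)%N.
  rewrite ltnS -(ler_nat R) natrM; have /andP[_ h] := tb k; apply: (le_trans h).
  have /andP[_ h2] := fM k; apply: (@le_trans _ _ (M * n%:R + 1)); first by rewrite lerD2r ler_wpM2r // ltW.
  have : (M + 1) * n%:R <= n%:R * n%:R by rewrite ler_wpM2r // ltW.
  by rewrite mulrDl mul1r; lra.
exists [ffun s => Ordinal (tn (ssval s))] => k.
have inv1 : n%:R^-1 <= 1 :> R by rewrite invf_le1.
case: insubP => [s ks sk|nk] /=; last first.
  split=> //; split; first by lra.
  split; last by rewrite (negbTE nk).
  by have /andP[f0 _] := fM k; rewrite addr_ge0 // invr_ge0 ltW.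
rewrite ffunE /= sk; have /andP[h1 h2] := tb k; have /andP[f0 f1] := fM k.
have hv : (t k)%:R / n%:R <= f k + n%:R^-1.
  by rewrite ler_pdivrMr // mulrDl mulVf ?gt_eqF.
split; first by rewrite divr_ge0.
split; first by apply: (le_trans hv); rewrite lerD.
by split=> // _; rewrite ler_pdivlMr.
Qed.

Lemma bump_ball (R : realType) m k (r : nat) (x : 'rV[R]_(m + k)) : (0 < r)%N ->
  ((27 / 64) ^+ (m + k)) ^+ 2 * ballind r%:R x <= bump ((2 * r)%:R^-1 *: x) ^+ 2.
Proof.
move=> r0; have r1 : 0 < r%:R :> R by rewrite ltr0n.
have c0 : 0 <= (27 / 64 : R) ^+ (m + k) by rewrite exprn_ge0 // divr_ge0.
rewrite /ballind; case: (boolP (`|x| <= r%:R)) => xr; last by rewrite mulr0 sqr_ge0.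
rewrite mulr1 lerXn2r ?nnegrE ?bump_ge0 //; apply: bump_in => i.
rewrite mxE normrM gtr0_norm ?invr_gt0 ?ltr0n ?muln_gt0 // natrM invfM mulrC mulrCA.
rewrite ler_piMr ?invr_ge0 // ler_pdivrMr // mul1r.
by rewrite (le_trans (row_norm_le x i)).
Qed.

Lemma cell_count (r q : nat) : (0 < q)%N -> ((2 * ((2 * r).+2 * q)).+1 <= (4 * r + 5) * q)%N.
Proof. nia. Qed.

(** * Almost solutions that carry the Krylov type estimate *)

Section LawSequence.
Variables (R : realType) (m k : nat) (gamma : R).
Variables (A : probability (Rd R (m + k)) R -> 'rV[R]_(m + k) -> 'M[R]_(m + k))
  (b : probability (Rd R (m + k)) R -> 'rV[R]_(m + k) -> 'rV[R]_(m + k))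
  (V : 'rV[R]_(m + k) -> R) (C Lam : R).
Hypotheses (mk0 : (0 < m + k)%N) (Apsd : forall mu x, psd (A mu x))
  (Ameas : forall mu i j, measurable_fun setT (fun x : Rd R (m + k) => A mu x i j))
  (bmeas : forall mu i, measurable_fun setT (fun x : Rd R (m + k) => b mu x 0 i))
  (Vck : Ck 2 V) (V0 : forall x, 0 <= V x)
  (Vinf : forall M : R, exists r : R, forall x, r < enorm x -> M < V x).
Hypotheses (h11 : H11 V A) (h12 : H12 V A b) (gamma0 : 0 < gamma) (h2 : H2 gamma V A b).
Hypotheses (C0 : 0 < C) (Lam0 : 0 < Lam)
  (lyap : forall mu, inPV V mu -> forall x, Lop (A mu) (b mu) V x <= C - Lam * V x).

Let Rb : R := (C + 1) / Lam + 1.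

Let Rb0 : 0 < Rb. Proof. by rewrite ltr_wpDl // divr_ge0 ?ltW // addr_gt0. Qed.

Definition theta_field (N r : nat) (f : 'rV[int]_m -> R) (x : 'rV[R]_(m + k)) : R :=
  \sum_(j <- zbox m ((2 * r).+2 * N ^ 4)) theta N j (lsubmx x) * f j.

Lemma theta_field_ge0 N r f x : (forall j, 0 <= f j) -> 0 <= theta_field N r f x.
Proof. by move=> f0; rewrite sumr_ge0 // => j _; rewrite mulr_ge0 // theta_ge0. Qed.

Definition field_value P n (g : {ffun seq_sub (zbox m P) -> 'I_(n * n).+1}) (j : 'rV[int]_m) : R :=
  if insub j is Some s then (g s)%:R / n%:R else 0.

Definition field_bound (l : flaw R (m + k)) D N r K eps f :=
  lE l (fun x => bump ((2 * r)%:R^-1 *: x) ^+ 2 * theta_field N r f x) <= K * eps + D.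

(** With the mesh [N] fixed, the family holds the first [n] test functions and one test function for
    each quantized field, radius and level up to [n] whose power sum is small enough, with the zero
    function for the remaining combinations. The law thus satisfies the estimate for whichever field
    is needed later. *)
Lemma law_step (u : nat -> 'rV[R]_(m + k) -> R) G H (rad : nat -> R)
    (K : nat -> R) (N0 : nat -> nat) :
  (forall j, C2 (u j) (G j) (H j)) -> (forall j x, rad j <= `|x| -> u j x = 0) ->
  ((0 < m)%N -> forall r, (0 < r)%N -> 0 <= K r /\
    forall N (f : 'rV[int]_m -> R) eps, (N0 r < N)%N -> 0 < eps -> (forall k, 0 <= f k) ->
    \sum_(k <- zbox m ((2 * r).+2 * N ^ 4)) f k ^+ m <= eps ^+ m * N%:R ^+ (4 * m) ->
    exists u G H, [/\ C2 u G H,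
      forall x : 'rV[R]_(m + k), (2 * r)%:R <= `|x| -> u x = 0 /\ forall o, jet (G x) (H x) o = 0 &
      forall mu x x', inPRV V Rb mu -> `|x' - x| <= 1 ->
        bump ((2 * r)%:R^-1 *: x) ^+ 2 * \sum_(k <- zbox m ((2 * r).+2 * N ^ 4)) theta N k (lsubmx x) * f k - K r * eps
        <= Lpt A b mu x' (jet (G x) (H x))]) ->
  forall n : nat, exists D N (l : flaw R (m + k)),
    [/\ (n <= D)%N /\ (n < N)%N /\ (1 < N)%N, forall i, `|fpt l i| <= D%:R, inPRV V Rb (flawP l),
      forall j, (j < n)%N -> `|lE l (fun x => Lbar A b D N (flawP l) x (jet (G j x) (H j x)))| <= n.+1%:R^-1 &
      (0 < m)%N -> forall r e (g : {ffun seq_sub (zbox m ((2 * n).+2 * N ^ 4)) -> 'I_(n * n).+1}),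
        (0 < r <= n)%N -> (N0 r < N)%N -> (e <= n)%N ->
        \sum_(j <- zbox m ((2 * r).+2 * N ^ 4)) field_value g j ^+ m <= e.+1%:R^-1 ^+ m * N%:R ^+ (4 * m) ->
        field_bound l n.+1%:R^-1 N r (K r) e.+1%:R^-1 (field_value g)].
Proof.
move=> uC2 uout hK n.
pose r0 := (2 * n)%:R + \sum_(j < n) `|rad j|.
have n1 : 0 < n.+1%:R^-1 :> R by rewrite invr_gt0 ltr0n.
have n2 : n.+1%:R^-1 <= 1 :> R by rewrite invf_le1 ?ltr0n // ler1n.
have sr0 : 0 <= \sum_(j < n) `|rad j| by rewrite sumr_ge0.
have radle (j : 'I_n) : rad j <= r0.
  apply: (le_trans (ler_norm _)); rewrite /r0 (bigD1 j) //= addrCA lerDl addr_ge0 //.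
  by rewrite sumr_ge0.
have [D [Na [r0D [Na1 happ]]]] := approximant mk0 Apsd Ameas bmeas Vck V0 Vinf h12 gamma0 h2 C0 Lam0 lyap r0.
pose N := maxn Na n.+1.
have NNa : (Na <= N)%N by rewrite leq_maxl.
have nN : (n < N)%N by rewrite leq_maxr.
have N1 : (1 < N)%N by exact: leq_trans Na1 NNa.
have nD : (n <= D)%N.
  rewrite -(ler_nat R); apply: le_trans r0D; rewrite /r0.
  by rewrite natrM; have : 0 <= n%:R :> R by []; lra.
pose fam := ('I_n.+1 * 'I_n.+1 * {ffun seq_sub (zbox m ((2 * n).+2 * N ^ 4)) -> 'I_(n * n).+1})%type.
pose cond (i : fam) := [/\ (0 < m)%N, (0 < i.1.1)%N, (N0 i.1.1 < N)%N &
  \sum_(j <- zbox m ((2 * i.1.1).+2 * N ^ 4)) field_value i.2 j ^+ m <= i.1.2.+1%:R^-1 ^+ m * N%:R ^+ (4 * m)].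
have fv0 (i : fam) j : 0 <= field_value i.2 j.
  by rewrite /field_value; case: insub => // s; rewrite divr_ge0.
have e0 e : 0 < e.+1%:R^-1 :> R by rewrite invr_gt0 ltr0n.
have /choice[T hT] : forall i : fam, exists T : ('rV[R]_(m + k) -> R) * ('rV[R]_(m + k) -> 'rV[R]_(m + k)) * ('rV[R]_(m + k) -> 'M[R]_(m + k)),
   [/\ C2 T.1.1 T.1.2 T.2, forall x, r0 <= `|x| -> T.1.1 x = 0 &
    cond i -> forall mu x x', inPRV V Rb mu -> `|x' - x| <= 1 ->
        bump ((2 * i.1.1)%:R^-1 *: x) ^+ 2 * theta_field N i.1.1 (field_value i.2) x - K i.1.1 * i.1.2.+1%:R^-1
        <= Lpt A b mu x' (jet (T.1.2 x) (T.2 x))].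
  move=> i; have [ci|nc] := pselect (cond i); last first.
    by exists (fun _ => 0, fun _ => 0, fun _ => 0); split => //; exact: C2_cst.
  have [m0 r0' NN hf] := ci; have [Kr hr] := hK m0 _ r0'.
  have [v [Gv [Hv [vC2 vout hv]]]] := hr N (field_value i.2) _ NN (e0 i.1.2) (fv0 i) hf.
  exists (v, Gv, Hv); split => //= x xr; apply: (vout x _).1; apply: le_trans xr.
  apply: (@le_trans _ _ (2 * n)%:R); last by rewrite lerDl.
  by rewrite ler_nat leq_mul2l /= -ltnS.
pose I : finType := ('I_n + fam)%type.
pose uu (i : I) := match i with inl j => u j | inr i => (T i).1.1 end.
pose GG (i : I) := match i with inl j => G j | inr i => (T i).1.2 end.
pose HH (i : I) := match i with inl j => H j | inr i => (T i).2 end.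
have uuC2 i : C2 (uu i) (GG i) (HH i) by case: i => [j|i]; [exact: uC2 | have [] := hT i].
have uuout i x : r0 <= `|x| -> uu i x = 0.
  case: i => [j|i]; last by have [_ h _] := hT i; exact: h.
  by move=> xr; apply: uout; exact: le_trans xr.
have [q [x [p [mu [sp xD hmu hV hI]]]]] := happ N NNa I uu GG HH uuC2 uuout _ n1.
pose l := @Flaw R (m + k) q x p mu sp hmu.
have mV : measurable_fun setT (V : Rd R (m + k) -> R).
  by apply: cont_meas; have [] := Ck2_C2 Vck.
have lR : inPRV V Rb (flawP l).
  rewrite /inPRV (flaw_int l mV).2 lee_fin; apply: (le_trans hV).
  by rewrite /Rb lerD2l.
exists D, N, l; split => //.
  by move=> j jn; exact: (hI (inl (Ordinal jn))).
move=> m0 r e g /andP[rpos rn] NN en hf.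
pose i : fam := (Ordinal (rn : (r < n.+1)%N), Ordinal (en : (e < n.+1)%N), g).
have ci : cond i by split.
have [_ _ /(_ ci) hi] := hT i.
have := hI (inr i); rewrite /= ler_norml => /andP[_ up].
rewrite /field_bound -lerBlDl -[X in _ - X](lE_cst l) -lEB; apply: le_trans up.
apply: (@lE_le _ _ l _ (fun y => Lbar A b D N mu y (jet ((T i).1.2 y) ((T i).2 y))) D%:R) => // y yD; apply: (Lbar_ge Ameas bmeas h12 Rb0 lR N1 yD) => x' xx.
apply: hi => //; apply: (le_trans xx); rewrite ler_pdivrMr ?ltr0n ?(ltnW N1) // mul1r.
by rewrite ler_nat.
Qed.

(** The usable form of the estimate. For fields bounded by [M], a small plain sum gives a small
    power sum, since a rounded value [v] satisfies [v ^+ m <= (M + 1) ^+ m * v], and rounding costs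
    1/n per node. For [m = 0] the box is a single node and [theta] is at most 1. *)
Lemma star_star (K : nat -> R) (N0 : nat -> nat) (N : nat -> nat) (l : nat -> flaw R (m + k)) :
  (forall n, (n < N n)%N) -> (forall r, (0 < r)%N -> (0 < m)%N -> 0 <= K r) ->
  (forall n, (0 < m)%N -> forall r e (g : {ffun seq_sub (zbox m ((2 * n).+2 * N n ^ 4)) -> 'I_(n * n).+1}),
        (0 < r <= n)%N -> (N0 r < N n)%N -> (e <= n)%N ->
        \sum_(j <- zbox m ((2 * r).+2 * N n ^ 4)) field_value g j ^+ m <= e.+1%:R^-1 ^+ m * (N n)%:R ^+ (4 * m) ->
        field_bound (l n) n.+1%:R^-1 (N n) r (K r) e.+1%:R^-1 (field_value g)) ->
  forall (r : nat) (M t' : R), (0 < r)%N -> 0 <= M -> 0 < t' -> exists t n0, 0 < t /\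
   forall n (f : 'rV[int]_m -> R), (n0 <= n)%N -> (forall j, 0 <= f j <= M) ->
     \sum_(j <- zbox m ((2 * r).+2 * N n ^ 4)) f j <= t * (N n)%:R ^+ (4 * m) ->
     lE (l n) (fun x => ballind r%:R x * theta_field (N n) r f x) <= t'.
Proof.
move=> nN K0 hl r M t' r0 M0 t'0.
have [m0|m0] := eqVneq m 0%N.
  exists t', 0%N; split => // n f _ fM; rewrite [in X in _ <= X]m0 muln0 expr0 mulr1 => hf.
  apply: le_trans hf; rewrite -(lE_cst (l n) (\sum_(j <- _) f j)).
  apply: ler_sum => i _; rewrite ler_wpM2l ?fwt_ge0 //.
  have f0 j : 0 <= f j by case/andP: (fM j).
  apply: (@le_trans _ _ (theta_field (N n) r f (fpt (l n) i))).
    by rewrite ler_piMl ?theta_field_ge0 // /ballind; case: (`|_| <= _).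
  by apply: ler_sum => j _; rewrite ler_piMl // theta0.
have mpos : (0 < m)%N by rewrite lt0n.
pose c : R := ((27 / 64) ^+ (m + k)) ^+ 2.
have c0 : 0 < c by rewrite !exprn_gt0 // divr_gt0.
have Kr0 := K0 r r0 mpos.
have ct : 0 < c * t' / 2 by rewrite divr_gt0 // mulr_gt0.
(* The target [c * t'] is split in halves: one for [K r / (e + 1)], one for the defect 1/(n+1) of
   the approximate equation. Here [c] bounds the squared bump from below on the ball of radius
   [r]. *)
pose e := Num.bound (K r / (c * t' / 2)).
have he : K r * e.+1%:R^-1 <= c * t' / 2.
  rewrite ler_pdivrMr ?ltr0n // mulrC -ler_pdivrMr //.
  apply/ltW/(lt_le_trans (archi_boundP _)); first by rewrite divr_ge0 // ltW.
  by rewrite ler_nat.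
pose MM : R := (M + 1) ^+ m; have MM0 : 0 < MM by rewrite exprn_gt0 // ltr_wpDl.
have e0 : 0 < e.+1%:R^-1 :> R by rewrite invr_gt0 ltr0n.
pose ee : R := e.+1%:R^-1 ^+ m; have ee0 : 0 < ee by rewrite exprn_gt0.
pose B : R := (4 * r + 5)%:R ^+ m; have B0 : 0 <= B by rewrite exprn_ge0.
pose t : R := ee / (2 * MM); have t0 : 0 < t by rewrite divr_gt0 // mulr_gt0.
pose n1 := Num.bound (B / t); pose n2 := Num.bound (c * t' / 2)^-1; pose n3 := Num.bound (M + 1).
exists t, (maxn n1 (maxn n2 (maxn n3 (maxn r (maxn e (maxn (N0 r) 1)))))); split => // n f.
rewrite !geq_max => /and5P[nn1 nn2 nn3 nr /and3P[ne nN0 npos]] fM hf.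
have npos' : 0 < n%:R :> R by rewrite ltr0n.
have Mn : M + 1 <= n%:R.
  by apply/ltW/(lt_le_trans (archi_boundP _)); rewrite ?addr_ge0 // ler_nat.
have Bn : B / n%:R <= t.
  rewrite ler_pdivrMr // mulrC -ler_pdivrMr //.
  apply/ltW/(lt_le_trans (archi_boundP _)); last by rewrite ler_nat.
  by rewrite divr_ge0 // ltW.
have tn : n.+1%:R^-1 <= c * t' / 2.
  rewrite -[c * t' / 2]invrK lef_pV2 ?posrE ?ltr0n ?invr_gt0 //.
  apply/ltW/(lt_le_trans (archi_boundP _)); first by rewrite invr_ge0 ltW.
  by rewrite ler_nat ltnW.
have [g hg] := @field_round R m ((2 * n).+2 * N n ^ 4) n f M Mn M0 fM.
have g0 j : 0 <= field_value g j by have [] := hg j.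
have Nn0 : (0 < N n)%N by exact: leq_ltn_trans (leq0n _) (nN n).
have PP : ((2 * r).+2 * N n ^ 4 <= (2 * n).+2 * N n ^ 4)%N by rewrite leq_mul // !ltnS leq_mul2l nr.
have NR : 0 < (N n)%:R ^+ (4 * m) :> R by rewrite exprn_gt0 // ltr0n.
have hgm : \sum_(j <- zbox m ((2 * r).+2 * N n ^ 4)) field_value g j ^+ m <= e.+1%:R^-1 ^+ m * (N n)%:R ^+ (4 * m).
  have step : \sum_(j <- zbox m ((2 * r).+2 * N n ^ 4)) field_value g j ^+ m <=
     MM * (\sum_(j <- zbox m ((2 * r).+2 * N n ^ 4)) f j + (size (zbox m ((2 * r).+2 * N n ^ 4)))%:R / n%:R).
    have -> : (size (zbox m ((2 * r).+2 * N n ^ 4)))%:R / n%:R = \sum_(j <- zbox m ((2 * r).+2 * N n ^ 4)) n%:R^-1 :> R.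
      by rewrite big_const_seq count_predT iter_addr_0 mulr_natl.
    rewrite -big_split mulr_sumr; apply: ler_sum => j _ /=.
    have [v0 [v1 [v2 _]]] := hg j; rewrite -/(field_value g j) in v0 v1 v2.
    apply: (@le_trans _ _ (MM * field_value g j)); last by rewrite ler_wpM2l // ltW.
    rewrite -[X in _ ^+ X](prednK mpos) exprSr ler_wpM2r //.
    apply: (@le_trans _ _ ((M + 1) ^+ m.-1)); first by rewrite lerXn2r ?nnegrE ?addr_ge0.
    by rewrite ler_weXn2l ?leq_pred // lerDr.
  apply: (le_trans step).
  have sz : (size (zbox m ((2 * r).+2 * N n ^ 4)))%:R <= B * (N n)%:R ^+ (4 * m) :> R.
    have -> : B * (N n)%:R ^+ (4 * m) = (((4 * r + 5) * N n ^ 4) ^ m)%N%:R by rewrite /B exprM -exprMn natrX natrM natrX.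
    by rewrite size_zbox ler_nat leq_exp2r // cell_count // expn_gt0 Nn0.
  have -> : e.+1%:R^-1 ^+ m * (N n)%:R ^+ (4 * m) = MM * (t * (N n)%:R ^+ (4 * m) + t * (N n)%:R ^+ (4 * m)).
    rewrite -/ee /t; field; exact: lt0r_neq0.
  rewrite ler_wpM2l ?(ltW MM0) // lerD //.
  apply: (@le_trans _ _ (B / n%:R * (N n)%:R ^+ (4 * m))); last by rewrite ler_wpM2r // ltW.
  by rewrite mulrAC ler_wpM2r // invr_ge0 ltW.
have rn : (0 < r <= n)%N by rewrite r0.
have := hl n mpos r e g rn (leq_ltn_trans nN0 (nN n)) ne hgm; rewrite /field_bound => h.
rewrite -(ler_pM2l c0) -lEZ; apply: (@le_trans _ _ (c * t' / 2 + c * t' / 2)); last by rewrite -splitr.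
apply: le_trans (le_trans h _); last by rewrite lerD.
apply: ler_sum => i _; rewrite ler_wpM2l ?fwt_ge0 // mulrA ler_pM //.
- by rewrite mulr_ge0 ?(ltW c0) // ler0n.
- by rewrite theta_field_ge0 // => j; case/andP: (fM j).
- exact: bump_ball.
rewrite /theta_field big_seq [leRHS]big_seq; apply: ler_sum => j jz; rewrite ler_wpM2l ?theta_ge0 //.
have [_ [_ [_ h']]] := hg j; apply: h'.
by move: jz; rewrite !mem_zbox; exact: inboxW.
Qed.

End LawSequence.

(** * Passage to the limit *)

Section CellSums.
Variables (R : realType) (m : nat).
Implicit Types (y : 'rV[R]_m) (F : Rd R m -> R).

Lemma wt_le1 N P y j : j \in zbox m P -> wt N P y j <= 1.
Proof.
move=> jP; have c0 : 0 < (27 / 256 : R) ^+ m by apply: exprn_gt0; apply: divr_gt0; rewrite ltr0n.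
have mx0 : 0 < Num.max ((27 / 256) ^+ m) (mass N P y) by rewrite lt_max c0.
rewrite /wt ler_pdivrMr // mul1r le_max; apply/orP; right.
rewrite /mass (bigD1_seq j) ?zbox_uniq //= lerDl sumr_ge0 // => i _; exact: theta_ge0.
Qed.

(** A point on common faces lies in at most two cells per coordinate. *)
Lemma cells_overlap N P y : (0 < N)%N ->
  \sum_(i <- zbox m P) \1_(cube (node R N i) (hw R N)) y <= 2 ^+ m :> R.
Proof.
move=> N0; pose s := [seq i <- zbox m P | y \in cube (node R N i) (hw R N)].
have -> : \sum_(i <- zbox m P) \1_(cube (node R N i) (hw R N)) y = (size s)%:R :> R.
  rewrite size_filter -sum1_count natr_sum [RHS]big_mkcond; apply: eq_bigr => i _.
  by rewrite indicE; case: (_ \in _).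
rewrite -natrX ler_nat.
have N4 : 0 < N%:R ^+ 4 :> R by rewrite exprn_gt0 // ltr0n.
apply: (@count_grid_cube R m s (N%:R ^+ 4 *: y) 1); first exact: filter_uniq (zbox_uniq _ _).
move=> i; rewrite mem_filter => /andP[/set_mem yi _] j.
have := yi j; rewrite !mxE /hw distrC => h.
rewrite -[(i 0 j)%:~R](divfK (lt0r_neq0 N4)) [_ * y 0 j]mulrC -mulrBl normrM (gtr0_norm N4).
have e1 : 1%:R / 2 / N%:R ^+ 4 = (N%:R ^+ 4)^-1 / 2 :> R by rewrite mulrAC [1%:R * _]mul1r.
by rewrite -ler_pdivlMr // e1.
Qed.

(** The cells lie in the cube of radius [2 r + 3], one more than the largest node coordinate, and
    overlap at most [2^m] times. *)
Lemma cells_avg N r F : (0 < N)%N -> adm F -> (forall y, 0 <= F y) ->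
  \sum_(i <- zbox m ((2 * r).+2 * N ^ 4)) avg (node R N i) (hw R N) F <=
  (2 ^+ m * (2 * (2 * r).+3%:R) ^+ m) * avg 0 (2 * r).+3%:R F * N%:R ^+ (4 * m).
Proof.
move=> N0 aF F0; have N4 : 0 < N%:R ^+ 4 :> R by rewrite exprn_gt0 // ltr0n.
have hN1 : hw R N <= 1.
  by apply: (le_trans (hw_le _ N0)); rewrite invf_le1 ?ltr0n // ler1n.
have r3 : 1 <= (2 * r).+3%:R :> R by rewrite ler1n.
have key : \sum_(i <- zbox m ((2 * r).+2 * N ^ 4)) (2 * hw R N) ^+ m * avg (node R N i) (hw R N) F
   <= 2 ^+ m * (2 * (2 * r).+3%:R) ^+ m * avg 0 (2 * r).+3%:R F.
  pose cc i := if i \in zbox m ((2 * r).+2 * N ^ 4) then node R N i else 0.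
  rewrite (eq_big_seq (fun i => (2 * hw R N) ^+ m * avg (cc i) (hw R N) F)) => [|i iz]; last by rewrite /cc iz.
  apply: avg_overlap => //.
  - exact: hw_gt0.
  - exact: le_trans hN1 r3.
  - move=> i j; rewrite /cc; case: ifPn => [|_]; last by rewrite !mxE subrr normr0 add0r; exact: le_trans hN1 r3.
    rewrite mem_zbox => /inboxP/(_ j) ij; rewrite !mxE subr0 normrM normfV (gtr0_norm N4).
    rewrite -[(2 * r).+3%:R]natr1 lerD // ler_pdivrMr // -natrX -natrM -intr_norm -abszE -pmulrn ler_nat.
    exact: ij.
  - move=> y; apply: le_trans (cells_overlap ((2 * r).+2 * N ^ 4) y N0).
    by rewrite big_seq [leRHS]big_seq; apply: ler_sum => i iz; rewrite /cc iz.
have hwE : 2 * hw R N = (N%:R ^+ 4)^-1 by rewrite /hw mulrC divfK.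
rewrite -mulr_sumr hwE exprVn -exprM mulrC in key.
by rewrite -ler_pdivrMr // exprn_gt0 // ltr0n.
Qed.

(** The weights are at most [theta] divided by the lower bound of the mass: an average of a
    nonnegative function becomes a field to which the Krylov type estimate applies. *)
Lemma smooth_avg_field D N (r : nat) y F : (1 < N)%N -> `|y| <= r%:R -> (r <= D)%N -> adm F -> (forall y, 0 <= F y) ->
  smooth_avg D N y F <= ((27 / 256) ^+ m)^-1 *
    \sum_(i <- zbox m ((2 * r).+2 * N ^ 4)) theta N i y * avg (node R N i) (hw R N) F.
Proof.
move=> N1 yr rD aF F0; have N0 := ltnW N1.
rewrite -(@sum_theta_box R m N r (D.+1 * N ^ 4)) //; last 2 first.
- by rewrite leq_mul // ltnS.
- by rewrite leq_mul // ltnS -ltnS -addn1 -addn1; lia.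
rewrite mulr_sumr; apply: ler_sum => i _; rewrite mulrA ler_wpM2r //; first exact: ex_ge0.
by rewrite mulrC wt_le.
Qed.

Lemma smooth_avg_close D N y F F' e : (1 < N)%N -> `|y| <= D%:R -> adm F -> adm F' ->
  (forall y', `|y' - y| <= 2 / N%:R -> `|F y' - F' y'| <= e) -> `|smooth_avg D N y F - smooth_avg D N y F'| <= e.
Proof.
move=> N1 yD aF aF' FF; have aB := admB aF aF'; rewrite -smooth_avgB // ler_norml; apply/andP; split.
  by apply: smooth_avg_ge => // y' /FF; rewrite ler_norml => /andP[].
by apply: smooth_avg_le => // y' /FF; rewrite ler_norml => /andP[].
Qed.

End CellSums.

Section LimitCoefficients.
Variables (R : realType) (m k : nat) (gamma : R).
Variables (A : probability (Rd R (m + k)) R -> 'rV[R]_(m + k) -> 'M[R]_(m + k))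
  (b : probability (Rd R (m + k)) R -> 'rV[R]_(m + k) -> 'rV[R]_(m + k))
  (V : 'rV[R]_(m + k) -> R).
Hypotheses
  (Ameas : forall mu i j, measurable_fun setT (fun x : Rd R (m + k) => A mu x i j))
  (bmeas : forall mu i, measurable_fun setT (fun x : Rd R (m + k) => b mu x 0 i)).
Hypotheses (h12 : H12 V A b) (h13 : H13 V A b) (gamma0 : 0 < gamma) (h2 : H2 gamma V A b).
Variables (Rb : R) (D N : nat -> nat) (l : nat -> flaw R (m + k)) (mu : probability (Rd R (m + k)) R).
Hypotheses (Rb0 : 0 < Rb) (nD : forall n, (n <= D n)%N) (nN : forall n, (n < N n)%N) (N1 : forall n, (1 < N n)%N)
  (lR : forall n, inPRV V Rb (flawP (l n))) (muR : inPRV V Rb mu)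
  (wc : Vweak_cvg V (fun n => flawP (l n)) mu)
  (cc : forall f : 'rV[R]_(m + k) -> R, continuous f -> (exists rho, forall x, rho < `|x| -> f x = 0) ->
      (fun n => ex (flawP (l n)) f) @ \oo --> ex mu f)
  (SS : forall (r : nat) (M t' : R), (0 < r)%N -> 0 <= M -> 0 < t' -> exists t n0, 0 < t /\
   forall n (f : 'rV[int]_m -> R), (n0 <= n)%N -> (forall j, 0 <= f j <= M) ->
     \sum_(j <- zbox m ((2 * r).+2 * N n ^ 4)) f j <= t * (N n)%:R ^+ (4 * m) ->
     lE (l n) (fun x => ballind r%:R x * theta_field (N n) r f x) <= t').
Implicit Types (x : 'rV[R]_(m + k)) (y : 'rV[R]_m) (z : 'rV[R]_k) (o : ix m k).

Let trc (rr : R) o nu z : Rd R m -> R := fun y => ballind rr (row_mx y z) * cf A b o nu (row_mx y z).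

Let trc_adm rr o nu z : inPRV V Rb nu -> adm (trc rr o nu z).
Proof.
move=> hnu; apply: (@slice_adm _ _ _ (fun x => ballind rr x * cf A b o nu x)).
exact: (cf_trunc_adm Ameas bmeas h12 _ _ Rb0 hnu).
Qed.

Let row_norm_max y z : `|row_mx y z| <= Num.max `|y| `|z|.
Proof.
apply/row_normP => [|i]; first by rewrite le_max normr_ge0.
rewrite -[i](@fintype.splitK m k); case: (fintype.split i) => j /=.
  by rewrite row_mxEl le_max row_norm_le.
by rewrite row_mxEr le_max row_norm_le orbT.
Qed.

(** One continuous [h] is close in mean to the limit coefficient both for the [y]-marginal of [mu]
    and for the uniform law of a large cube. Closeness on the cube, with (H2), makes the cell means
    of the difference at level [n] small, and the Krylov type estimate carries this over to the
    atomic laws, about which Lebesgue measure by itself says nothing. *)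
Lemma slice_limit o (r : nat) z (e : R) : (0 < r)%N -> 0 < e -> exists h : 'rV[R]_m -> R, exists n0,
  [/\ continuous h,
   ex mu (fun x => `|trc r.+2%:R o mu z (lsubmx x) - h (lsubmx x)|) <= e,
   adm ((fun x => `|trc r.+2%:R o mu z (lsubmx x) - h (lsubmx x)|) : Rd R (m + k) -> R) &
   forall n, (n0 <= n)%N -> lE (l n) (fun x => ballind r%:R x *
      `|smooth_avg (D n) (N n) (lsubmx x) (trc r.+2%:R o (flawP (l n)) z) - h (lsubmx x)|) <= e].
Proof.
move=> r0 e0.
have [M [M0 hM]] := cf_bound h12 r.+2%:R Rb0.
have trcM nu y : inPRV V Rb nu -> `|trc r.+2%:R o nu z y| <= M.
  move=> hnu; rewrite /trc /ballind; case: (boolP (`|row_mx y z| <= r.+2%:R)) => h /=; last by rewrite mul0r normr0.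
  by rewrite mul1r hM.
have lm : measurable_fun setT ((fun x => lsubmx x) : Rd R (m + k) -> Rd R m).
  by apply: meas_Rd => i; under eq_fun do rewrite mxE; exact: coord_meas.
have [P1 [_ hP1]] := push_law mu lm.
pose c : R := ((27 / 256) ^+ m)^-1; have c0 : 0 < c.
  by rewrite invr_gt0; apply: exprn_gt0; apply: divr_gt0; rewrite ltr0n.
have e4 : 0 < e / 4 / c by rewrite !divr_gt0.
have M2 : 0 <= 2 * M by rewrite mulr_ge0.
have [t [n0 [t0 hSS]]] := SS r0 M2 e4.
pose B : R := 2 ^+ m * (2 * (2 * r).+3%:R) ^+ m.
have B0 : 0 < B by rewrite mulr_gt0 ?exprn_gt0 // mulr_gt0 // ltr0n.
(* Half of [t / B] for the distance from [h] to the limit coefficient, half for that from the limit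
   to level [n]; [B] is the constant of [cells_avg]. *)
have tB : 0 < t / B / 2 by rewrite !divr_gt0.
have e1 : 0 < Num.min e (t / B / 2) by rewrite lt_min e0.
have am := @trc_adm r.+2%:R o mu z muR.
have [h [hc hMh hP hU]] := L1_approx P1 (ucube 0 (2 * r).+3%:R) am.1 (fun y => trcM mu y muR) e1.
have ah : adm (h : Rd R m -> R) by split; [exact: cont_meas | exists M].
have r3 : 0 < (2 * r).+3%:R :> R by rewrite ltr0n.
have /cvgrPdist_le/(_ _ tB) [n1 _ hn1] := cf_cvg Ameas bmeas h12 gamma0 h2 o 0 z r.+2%:R Rb0 lR muR wc r3.
have e2 : 0 < e / 2 by rewrite divr_gt0.
have [d [d0 hd]] := unif_cont_ball r%:R hc e2.
pose n2 := Num.bound (2 / d).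
exists h, (maxn n0 (maxn n1 (maxn n2 r))); split => //.
- have aC : adm ((fun y => `|trc r.+2%:R o mu z y - h y|) : Rd R m -> R) by apply: adm_abs; exact: admB.
  rewrite -(hP1 _ aC); apply: (le_trans hP); by rewrite ge_min lexx.
- have aC : adm ((fun y => `|trc r.+2%:R o mu z y - h y|) : Rd R m -> R) by apply: adm_abs; exact: admB.
  by split; [exact: (measurableT_comp aC.1 lm) | have [_ [Q hQ]] := aC; exists Q => x].
move=> n; rewrite !geq_max => /and4P[nn0 nn1 nn2 nr].
have an := @trc_adm r.+2%:R o _ z (lR n).
pose F y := `|trc r.+2%:R o (flawP (l n)) z y - h y|.
have aF : adm (F : Rd R m -> R) by apply: adm_abs; exact: admB.
pose f i := avg (node R (N n) i) (hw R (N n)) F.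
have F0 y : 0 <= F y by exact: normr_ge0.
have F2 y : F y <= 2 * M.
  by apply: (le_trans (ler_normB _ _)); rewrite mulr2n mulrDl !mul1r lerD // trcM.
have fM j : 0 <= f j <= 2 * M by rewrite /f /avg ex_ge0 //=; exact: ex_le_cst.
have Nn0 : (0 < N n)%N by exact: ltnW.
have hf : \sum_(j <- zbox m ((2 * r).+2 * N n ^ 4)) f j <= t * (N n)%:R ^+ (4 * m).
  apply: (le_trans (cells_avg r Nn0 aF F0)); rewrite -/B ler_wpM2r ?exprn_ge0 //.
  suff : avg 0 (2 * r).+3%:R F <= t / B.
    by rewrite ler_pdivlMr // mulrC.
  pose F1 y := ballind r.+2%:R (row_mx y z) * `|cf A b o (flawP (l n)) (row_mx y z) - cf A b o mu (row_mx y z)|.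
  pose F2' y := `|trc r.+2%:R o mu z y - h y|.
  have a1 : adm (F1 : Rd R m -> R) by exact: (cf_diff_adm Ameas bmeas h12 o r.+2%:R z Rb0 muR (lR n)).
  have a2 : adm (F2' : Rd R m -> R) by apply: adm_abs; exact: admB.
  apply: (@le_trans _ _ (avg 0 (2 * r).+3%:R F1 + avg 0 (2 * r).+3%:R F2')).
    rewrite /avg -exD //; apply: ex_le => //; first exact: admD.
    move=> y; rewrite /F -(subrKA (trc r.+2%:R o mu z y)); apply: (le_trans (ler_normD _ _)).
    by rewrite lerD2r /trc -mulrBr normrM [`|ballind _ _|]ger0_norm // ler0n.
  rewrite [X in _ <= X]splitr lerD //.
    by have := hn1 n nn1; rewrite /= sub0r normrN; apply: le_trans; exact: ler_norm.
  by apply: (le_trans hU); rewrite ge_min lexx orbT.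
have hS := hSS n f nn0 fM hf.
have Nd : 2 / (N n)%:R <= d.
  rewrite ler_pdivrMr ?ltr0n // mulrC -ler_pdivrMr //.
  apply/ltW/(lt_le_trans (archi_boundP _)); first by rewrite divr_ge0 // ltW.
  by rewrite ler_nat; apply: (leq_trans nn2); exact: ltnW.
apply: (@le_trans _ _ (lE (l n) (fun x => c * (ballind r%:R x * theta_field (N n) r f x) + e / 2))).
  apply: ler_sum => i _; rewrite ler_wpM2l ?fwt_ge0 //; move: (fpt (l n) i) => x.
  rewrite /ballind; case: (boolP (`|x| <= r%:R)) => xr /=; last by rewrite !mul0r mulr0 add0r ltW.
  rewrite !mul1r.
  have yr : `|lsubmx x| <= r%:R by exact: le_trans (lsubmx_norm x) xr.
  have yD : `|lsubmx x| <= (D n)%:R by apply: (le_trans yr); rewrite ler_nat (leq_trans nr).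
  rewrite -(subrKA (smooth_avg (D n) (N n) (lsubmx x) h)); apply: (le_trans (ler_normD _ _)); apply: lerD.
    rewrite -smooth_avgB //; apply: (le_trans (smooth_avg_abs _ _ _ (admB an ah))).
    exact: (@smooth_avg_field R m (D n) (N n) r (lsubmx x) F (N1 n) yr (leq_trans nr (nD n)) aF F0).
  rewrite ler_norml; apply/andP; split.
    rewrite lerBrDl; apply: smooth_avg_ge => // y' yy.
    have := hd _ (y' - lsubmx x) yr (le_trans yy Nd); rewrite subrKC ler_norml => /andP[h1 _].
    by rewrite -lerBrDl.
  rewrite lerBlDl; apply: smooth_avg_le => // y' yy.
  have := hd _ (y' - lsubmx x) yr (le_trans yy Nd); rewrite subrKC ler_norml => /andP[_ h1].
  by rewrite -lerBlDl.
rewrite lED lEZ lE_cst.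
have : c * lE (l n) (fun x => ballind r%:R x * theta_field (N n) r f x) <= e / 4.
  by rewrite mulrC -ler_pdivlMr.
lra.
Qed.

Let convex_close (T : eqType) (s : seq T) (w v : T -> R) a e :
  (forall j, 0 <= w j) -> \sum_(j <- s) w j = 1 -> (forall j, w j != 0 -> `|a - v j| <= e) ->
  `|a - \sum_(j <- s) w j * v j| <= e.
Proof.
move=> w0 w1 h; have -> : a - \sum_(j <- s) w j * v j = \sum_(j <- s) w j * (a - v j).
  by under [RHS]eq_bigr do rewrite mulrBr; rewrite sumrB -mulr_suml w1 mul1r.
apply: (le_trans (ler_norm_sum _ _ _)); rewrite -[e]mul1r -w1 mulr_suml; apply: ler_sum => j _.
rewrite normrM ger0_norm //; have [->|wj] := eqVneq (w j) 0; first by rewrite !mul0r.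
by rewrite ler_wpM2l // h.
Qed.

Let trcE rr o nu z y : `|row_mx y z| <= rr -> trc rr o nu z y = cf A b o nu (row_mx y z).
Proof. by move=> h; rewrite /trc /ballind h mul1r. Qed.

(** A slice result holds for one [z]; a partition of unity [chi] in [z] and the modulus (H1.3)
    reduce the claim to finitely many slices. The resulting [Phi] is continuous, so the expectations
    of [Phi * J] converge, and it is close to the coefficients in mean under the laws and under
    [mu]. *)
Lemma limit_coef o (J : 'rV[R]_(m + k) -> R) (r : nat) : (0 < r)%N -> continuous J ->
  (forall x, r%:R < `|x| -> J x = 0) ->
  (fun n => lE (l n) (fun x => cfbar A b (D n) (N n) (flawP (l n)) x o * J x)) @ \oo
    --> ex mu (fun x => cf A b o mu x * J x).
Proof.
move=> r0 Jc Jout; have [JM [JM0 hJM]] := bounded_on_ball r%:R Jc.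
have JMb x : `|J x| <= (JM + 1) * ballind r%:R x.
  rewrite /ballind; case: (leP `|x| r%:R) => [xr|/Jout ->]; last by rewrite normr0 mulr0.
  by rewrite mulr1 (le_trans (hJM x xr)) // lerDl.
have JM1 : 0 < JM + 1 by rewrite ltr_wpDl.
apply/cvgrPdist_le => e e0.
(* [2 * e1] times the bound [JM + 1] of [J] is [e / 3]: one [e1] for freezing [z], one for all the
   slices together. *)
pose e1 := e / (6 * (JM + 1)); have e10 : 0 < e1 by rewrite divr_gt0 // mulr_gt0.
have [dl [dl0 hmod]] := cf_mod h13 r.+2%:R Rb0 e10.
pose N' := maxn 2 (Num.bound dl^-1).
have N'1 : (1 < N')%N by rewrite leq_max.
have N'0 : (0 < N')%N by exact: ltnW.
have N'd : N'%:R^-1 <= dl.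
  rewrite -[dl]invrK lef_pV2 ?posrE ?invr_gt0 ?ltr0n //; apply/ltW/(lt_le_trans (archi_boundP _)).
    by rewrite invr_ge0 ltW.
  by rewrite ler_nat leq_maxr.
have N'le1 : N'%:R^-1 <= 1 :> R by rewrite invf_le1 ?ltr0n // ler1n.
pose P' := (r.+1 * N' ^ 4)%N; pose zs := zbox k P'.
pose chi j z := wt N' P' z j.
have chi0 j z : 0 <= chi j z by exact: wt_ge0.
have chi1 z : `|z| <= r%:R -> \sum_(j <- zs) chi j z = 1.
  by move=> zr; exact: (wt_sum N'1 zr (leqnn _)).
have chis j z : chi j z != 0 -> `|z - node R N' j| <= N'%:R^-1.
  by move=> /(wt_supp N'0); rewrite distrC.
pose L : R := (size zs)%:R + 1; have L0 : 0 < L by rewrite ltr_wpDl.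
have eL : 0 < e1 / L by rewrite divr_gt0.
have /choice[h hh] := fun j : 'rV[int]_k => slice_limit o (node R N' j) r0 eL.
have /choice[nj hn] := hh.
pose Phi x := \sum_(j <- zs) chi j (rsubmx x) * h j (lsubmx x).
have Phic : continuous Phi.
  apply: cont_sum => j; apply: contM; last by apply: cont_lsub; have [] := hn j.
  by apply: cont_rsub; exact: wt_cont.
have znear j z : `|z| <= r%:R -> `|z - node R N' j| <= N'%:R^-1 -> `|node R N' j| <= r.+1%:R.
  move=> zr zj; have := ler_normB z (z - node R N' j); rewrite subKr => h'.
  by rewrite (le_trans h') // -natr1 lerD // (le_trans zj).
have rr2 : r%:R <= r.+2%:R :> R by rewrite ler_nat (leq_trans (leqnSn r)).
have r12 : r.+1%:R <= r.+2%:R :> R by rewrite ler_nat.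
have mod1 nu y z j : inPRV V Rb nu -> `|y| <= r.+1%:R -> `|z| <= r%:R -> `|z - node R N' j| <= N'%:R^-1 ->
    `|cf A b o nu (row_mx y z) - trc r.+2%:R o nu (node R N' j) y| <= e1.
  move=> hnu yr zr zj; have zz := znear j z zr zj.
  rewrite trcE; last by rewrite (le_trans (row_norm_max _ _)) // ge_max !(le_trans _ r12).
  apply: hmod => //; [exact: le_trans yr _ | exact: le_trans zr _ | exact: le_trans zz _ | exact: le_trans zj _].
have A2 x : `|x| <= r%:R -> `|cf A b o mu x - \sum_(j <- zs) chi j (rsubmx x) * trc r.+2%:R o mu (node R N' j) (lsubmx x)| <= e1.
  move=> xr; apply: convex_close => // [|j /chis cj].
    by apply: chi1; exact: le_trans (rsubmx_norm x) xr.
  rewrite -{1}[x]hsubmxK; apply: mod1 => //; last exact: le_trans (rsubmx_norm x) xr.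
  apply: (le_trans (le_trans (lsubmx_norm x) xr)); by rewrite ler_nat.
have A1 n x : (r <= n)%N -> `|x| <= r%:R -> `|cfbar A b (D n) (N n) (flawP (l n)) x o
    - \sum_(j <- zs) chi j (rsubmx x) * smooth_avg (D n) (N n) (lsubmx x) (trc r.+2%:R o (flawP (l n)) (node R N' j))| <= e1.
  move=> rn xr; apply: convex_close => // [|j /chis cj].
    by apply: chi1; exact: le_trans (rsubmx_norm x) xr.
  have yr : `|lsubmx x| <= r%:R by exact: le_trans (lsubmx_norm x) xr.
  have zr : `|rsubmx x| <= r%:R by exact: le_trans (rsubmx_norm x) xr.
  have rD : r%:R <= (D n)%:R :> R by rewrite ler_nat (leq_trans rn).
  apply: (@smooth_avg_close R m (D n) (N n) (lsubmx x) (trc ((D n)%:R + 2) o (flawP (l n)) (rsubmx x))) => //.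
  - exact: le_trans yr rD.
  - exact: trc_adm.
  - exact: trc_adm.
  move=> y' yy.
  have N2 : 2 / (N n)%:R <= 1 :> R by rewrite ler_pdivrMr ?ltr0n ?(ltnW (N1 n)) // mul1r ler_nat.
  have y'r : `|y'| <= r.+1%:R.
    have := ler_normD (y' - lsubmx x) (lsubmx x); rewrite subrK => h'; rewrite (le_trans h') // -natr1 addrC lerD //.
    exact: le_trans yy N2.
  rewrite trcE; first exact: mod1.
  rewrite (le_trans (row_norm_max _ _)) // ge_max; apply/andP; split.
    by rewrite (le_trans y'r) // -natr1 lerD // ler1n.
  by rewrite (le_trans zr) // (le_trans rD) // lerDl.
have comb a (v : 'rV[int]_k -> R) x : `|x| <= r%:R -> `|a - \sum_(j <- zs) chi j (rsubmx x) * v j| <= e1 ->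
    `|a - Phi x| <= e1 + \sum_(j <- zs) `|v j - h j (lsubmx x)|.
  move=> xr av; rewrite -(subrKA (\sum_(j <- zs) chi j (rsubmx x) * v j)); apply: (le_trans (ler_normD _ _)).
  apply: lerD => //; rewrite -sumrB; apply: (le_trans (ler_norm_sum _ _ _)).
  rewrite big_seq [leRHS]big_seq; apply: ler_sum => j jz.
  by rewrite -mulrBr normrM ger0_norm // ler_piMl // wt_le1.
have PJc : continuous (fun x => Phi x * J x) by exact: contM.
have PJout x : r%:R < `|x| -> Phi x * J x = 0 by move=> /Jout ->; rewrite mulr0.
have aPJ := adm_cont_supp PJc PJout.
have szL : (size zs)%:R * (e1 / L) <= e1.
  by rewrite mulrCA ger_pMr // ler_pdivrMr // mul1r lerDl.
have sumc (t : R) : \sum_(j <- zs) t = (size zs)%:R * t by rewrite big_const_seq count_predT iter_addr_0 mulr_natl.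
have JE1 : (JM + 1) * (e1 + e1) = e / 3 by rewrite /e1; field; exact: lt0r_neq0.
have B2 : `|ex mu (fun x => cf A b o mu x * J x) - ex mu (fun x => Phi x * J x)| <= e / 3.
  have acf : adm ((fun x => cf A b o mu x * J x) : Rd R (m + k) -> R).
    rewrite (_ : (fun x => _) = fun x => (ballind r%:R x * cf A b o mu x) * J x).
      apply: admM; first exact: (cf_trunc_adm Ameas bmeas h12 _ _ Rb0 muR).
      exact: (adm_cont_supp Jc Jout).
    apply/funext => x; rewrite /ballind; case: (leP `|x| r%:R) => [_|/Jout ->]; by rewrite ?mul1r ?mulr0.
  rewrite -exB //; apply: (le_trans (ex_abs _ _)); first exact: admB.
  have asum : adm ((fun x => \sum_(j <- zs) `|trc r.+2%:R o mu (node R N' j) (lsubmx x) - h j (lsubmx x)|) : Rd R (m + k) -> R).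
    by apply: adm_sum => j; have [] := hn j.
  apply: (@le_trans _ _ (ex mu (fun x => (JM + 1) * (e1 + \sum_(j <- zs) `|trc r.+2%:R o mu (node R N' j) (lsubmx x) - h j (lsubmx x)|)))).
    apply: ex_le => [||x]; first by apply: adm_abs; exact: admB.
      by apply: admZ; apply: admD => //; exact: adm_cst.
    rewrite -mulrBl normrM mulrC; have [xr|xr] := leP `|x| r%:R.
      by rewrite ler_pM // ?(comb _ _ _ xr (A2 x xr)) // (le_trans (JMb x)) // /ballind xr mulr1.
    by rewrite Jout // normr0 mul0r mulr_ge0 ?(ltW JM1) // addr_ge0 ?(ltW e10) // sumr_ge0.
  rewrite exZ; last by apply: admD => //; exact: adm_cst.
  rewrite exD //; last exact: adm_cst.
  rewrite ex_cst ex_sum => [|j]; last by have [] := hn j.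
  rewrite -JE1 ler_pM2l // lerD2l (le_trans _ szL) // -sumc; apply: ler_sum => j _.
  by have [] := hn j.
have B1 n : (r <= n)%N -> (\max_(j <- zs) nj j <= n)%N ->
   `|lE (l n) (fun x => cfbar A b (D n) (N n) (flawP (l n)) x o * J x) - lE (l n) (fun x => Phi x * J x)| <= e / 3.
  move=> rn nn; rewrite -lEB; apply: (le_trans (lE_abs _ _)).
  pose sa j x := `|smooth_avg (D n) (N n) (lsubmx x) (trc r.+2%:R o (flawP (l n)) (node R N' j)) - h j (lsubmx x)|.
  apply: (@le_trans _ _ (lE (l n) (fun x => (JM + 1) * (e1 + \sum_(j <- zs) ballind r%:R x * sa j x)))).
    apply: ler_sum => i _; rewrite ler_wpM2l ?fwt_ge0 //; move: (fpt (l n) i) => x.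
    rewrite -mulrBl normrM mulrC -mulr_sumr; have [xr|xr] := leP `|x| r%:R.
      rewrite ler_pM // ?(le_trans (JMb x)) // /ballind xr ?mulr1 // mul1r.
      exact: (comb _ _ _ xr (A1 n x rn xr)).
    rewrite Jout // normr0 mul0r mulr_ge0 ?(ltW JM1) // addr_ge0 ?(ltW e10) // mulr_ge0 ?ler0n // sumr_ge0 // => j _.
    exact: normr_ge0.
  rewrite lEZ lED lE_cst lE_sum -JE1 ler_pM2l // lerD2l (le_trans _ szL) // -sumc.
  rewrite big_seq [leRHS]big_seq; apply: ler_sum => j jz; have [_ _ _] := hn j; apply.
  by apply: leq_trans nn; exact: leq_bigmax_seq.
have e3 : 0 < e / 3 by rewrite divr_gt0.
have /cvgrPdist_le/(_ _ e3) := cc PJc (ex_intro _ r%:R PJout).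
have big : \forall n \near \oo, (r <= n)%N /\ (\max_(j <- zs) nj j <= n)%N.
  exists (maxn r (\max_(j <- zs) nj j)) => // n /=; rewrite geq_max => /andP[-> ->].
  by split.
apply: filterS2 big => n [rn nn]; rewrite ex_flaw; last exact: cont_meas.
move=> B3; have := B1 n rn nn; rewrite distrC => B1'.
have -> : e = e / 3 + (e / 3 + e / 3) by field.
rewrite -(subrKA (ex mu (fun x => Phi x * J x))); apply: (le_trans (ler_normD _ _)); apply: lerD => //.
rewrite -(subrKA (lE (l n) (fun x => Phi x * J x))); apply: (le_trans (ler_normD _ _)); exact: lerD.
Qed.

End LimitCoefficients.

Section TestFunctions.
Variables (R : realType) (m k : nat).
Implicit Types (u v : 'rV[R]_(m + k) -> R) (x : 'rV[R]_(m + k)) (o : ix m k).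

Definition jetf u x := jet (\row_i pder [:: i] u x) (\matrix_(i, j) pder [:: i; j] u x).

Lemma derive_out u (r : R) (d : 'rV[R]_(m + k)) : (forall x, r < `|x| -> u x = 0) ->
  forall x, r < `|x| -> derive u x d = 0.
Proof.
move=> u0 x xr; transitivity ('D_d (fun _ : 'rV[R]_(m + k) => 0 : R) x); last exact: derive_cst.
apply: near_eq_derive.
have /cvgrPdist_lt/(_ (`|x| - r)) := @norm_continuous R _ x.
rewrite subr_gt0 => /(_ xr); apply: filterS => y xy; apply: u0.
by have := ler_norm (`|x| - `|y|); lra.
Qed.

Lemma pder_out u (r : R) s : (forall x, r < `|x| -> u x = 0) -> forall x, r < `|x| -> pder s u x = 0.
Proof. by elim: s => [|i s IH] u0 //=; apply: derive_out; exact: IH. Qed.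

Lemma jetf_out u (r : R) o x : (forall x, r < `|x| -> u x = 0) -> r < `|x| -> jetf u x o = 0.
Proof. by move=> u0 xr; case: o => [[i j]|i]; rewrite /jetf /jet mxE; exact: (pder_out _ u0). Qed.

Lemma jetf_cont u o : Ck 2 u -> continuous (fun x => jetf u x o).
Proof.
move=> /Ck2_C2[_ _ Gc Hc].
by case: o => [[i j]|i] /=; rewrite /jetf /=; [exact: Hc | exact: Gc].
Qed.

Lemma test_fun_supp u : test_fun u -> exists r : nat, (0 < r)%N /\ forall x, r%:R < `|x| -> u x = 0.
Proof.
move=> [_ /compact_bounded[M [_ hM]]]; exists (Num.bound (`|M| + 1)).+1; split => // x xr.
apply: contrapT => /eqP ux.
have : `|x| <= `|M| + 1.
  by apply: hM; [have := ler_norm M; lra | exact: subset_closure].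
have : `|M| + 1 < (Num.bound (`|M| + 1))%:R by apply: archi_boundP; rewrite addr_ge0.
by move: xr; rewrite -natr1; lra.
Qed.

(** Continuity of the jets at the single accuracy 1/(e+1) is enough, because a code is used at one
    accuracy only. *)
Let good (i e d : nat) u := [/\ Ck 2 u, forall x, i%:R < `|x| -> u x = 0 &
  forall x h o, `|h| <= d.+1%:R^-1 -> `|jetf u (x + h) o - jetf u x o| <= e.+1%:R^-1].

Lemma good_ex (i e : nat) u : Ck 2 u -> (forall x, i%:R < `|x| -> u x = 0) -> exists d, good i e d u.
Proof.
move=> uC u0; have e0 : 0 < e.+1%:R^-1 :> R by rewrite invr_gt0 ltr0n.
have /choice[dl hdl] := fun o : ix m k => unif_cont_ball (i%:R + 1) (@jetf_cont u o uC) e0.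
have [d [d0 hd]] := @min_pos R _ (index_enum (ix m k)) dl (fun o => (hdl o).1).
exists (Num.bound d^-1); split => // x h o hh.
have h1 : `|h| <= 1 by apply: (le_trans hh); rewrite invf_le1 ?ltr0n // ler1n.
have hd' : `|h| <= d.
  apply: (le_trans hh); rewrite -[leRHS]invrK lef_pV2 ?posrE ?ltr0n ?invr_gt0 //.
  by apply/ltW/(lt_trans (archi_boundP _)); rewrite ?invr_ge0 ?(ltW d0) // ltr_nat.
have [xr|xr] := leP `|x| (i%:R + 1).
  by apply: (hdl o).2 => //; apply: (le_trans hd'); apply: hd; rewrite mem_index_enum.
have xi : i%:R < `|x| by lra.
have xhi : i%:R < `|x + h| by have := ler_normB (x + h) h; rewrite addrK; lra.
by rewrite !(jetf_out _ u0) // subrr normr0 invr_ge0.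
Qed.

Definition code_type : countType := (nat * nat * nat * seq int)%type.

(* Test functions are coded by their jets rounded on a finite net, together with a support radius and a
   modulus of continuity of the jets: two functions with the same code have uniformly close jets. *)
Lemma dense_tests : exists (u : nat -> 'rV[R]_(m + k) -> R) (rad : nat -> nat),
  (forall j, (0 < rad j)%N /\ Ck 2 (u j) /\ forall x, (rad j)%:R < `|x| -> u j x = 0) /\
  forall v, test_fun v -> exists r : nat, forall e, 0 < e -> exists j, forall x o,
    `|jetf (u j) x o - jetf v x o| <= e * ballind r%:R x.
Proof.
have /choice[net hnet] : forall id : nat * nat, exists s : seq 'rV[R]_(m + k),
    forall y, `|y| <= id.1%:R -> exists2 p, p \in s & `|p - y| <= id.2.+1%:R^-1.
  move=> [i d]; have d0 : 0 < d.+1%:R^-1 :> R by rewrite invr_gt0 ltr0n.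
  have [q [x [_ hx]]] := @ball_net R (m + k) i _ d0.
  exists [seq x j | j <- enum 'I_q.+1] => y /hx[j hj]; exists (x j) => //.
  by apply: map_f; rewrite mem_enum.
pose pts i d := [seq (p, o) | p <- net (i, d), o <- enum (ix m k)].
pose word i e d v := [seq Num.floor (e.+1%:R * jetf v po.1 po.2) | po <- pts i d].
pose code i e d v : code_type := (i, e, d, word i e d v).
pose match_code (c : code_type) v := good c.1.1.1.+1 c.1.1.2 c.1.2 v /\ word c.1.1.1.+1 c.1.1.2 c.1.2 v = c.2.
have z0 : Ck 2 (fun _ : 'rV[R]_(m + k) => 0).
  have pz s : pder s (fun _ : 'rV[R]_(m + k) => 0) = fun=> 0.
    elim: s => [//|i s IH] /=; rewrite IH; apply/funext => x; exact: derive_cst.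
  by split => [s _|s i x _]; rewrite pz; [exact: cst_continuous | exact: derivable_cst].
(* The enumeration runs over codes: a code is represented by some function matching it if there is
   one, and by the zero function otherwise. *)
have /choice[rep hrep] : forall c : option code_type, exists v, Ck 2 v /\
    (exists r : nat, (0 < r)%N /\ forall x, r%:R < `|x| -> v x = 0) /\
    forall c', c = Some c' -> (exists v', match_code c' v') -> match_code c' v.
  move=> [c|]; last by exists (fun=> 0); split => //; split => //; exists 1%N.
  have [[v hv]|nv] := pselect (exists v, match_code c v).
    exists v; have [[vC v0 _] _] := hv; split => //; split; first by exists c.1.1.1.+1.
    by move=> c' [<-] _.
  exists (fun=> 0); split => //; split; first by exists 1%N.
  by move=> c' [<-] /nv.
have /choice[rd hrd] := fun c => (hrep c).2.1.
exists (fun j => rep (unpickle j)), (fun j => rd (unpickle j)); split.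
  by move=> j; have [r0 h] := hrd (unpickle j); have [vC _] := hrep (unpickle j); split.
move=> v vt; have [r [r0 vr]] := test_fun_supp vt.
exists r => e e0.
pose E := Num.bound (3 / e).
have [d gd] := good_ex E (vt.1 2%N) vr.
(* The first entry is the radius minus one, so that decoded radii are positive; [E] makes three
   errors 1/(E+1) add up to at most [e]. *)
pose c := (r.-1, E, d, word r E d v) : code_type.
exists (pickle c); rewrite pickleK.
have mc : match_code c v by rewrite /match_code /= prednK.
have [_ [_ /(_ c erefl)]] := hrep (Some c); case; first by exists v.
rewrite /= prednK // => [[uC u0 um]] wE x o.
rewrite /ballind; have [xr|xr] := leP `|x| r%:R; last by rewrite (jetf_out _ u0) // (jetf_out _ vr) // subrr normr0 mulr0.
rewrite mulr1; have [p pn px] := hnet (r, d) x xr.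
have [_ _ vm] := gd.
have hu : `|jetf (rep (Some c)) p o - jetf (rep (Some c)) x o| <= E.+1%:R^-1 by rewrite -[p](subrKC x); exact: um.
have hv : `|jetf v p o - jetf v x o| <= E.+1%:R^-1 by rewrite -[p](subrKC x); exact: vm.
have E0 : 0 < E.+1%:R :> R by rewrite ltr0n.
have hf : Num.floor (E.+1%:R * jetf (rep (Some c)) p o) = Num.floor (E.+1%:R * jetf v p o).
  have /eq_in_map := wE; move=> /(_ (p, o)); apply.
  by apply: allpairs_f => //; rewrite mem_enum.
have huv : `|jetf (rep (Some c)) p o - jetf v p o| <= E.+1%:R^-1.
  rewrite -(ler_pM2l E0) divff ?(lt0r_neq0 E0) // -[X in X * _](gtr0_norm E0) -normrM mulrBr ler_norml.
  have := floor_le_tmp (E.+1%:R * jetf (rep (Some c)) p o).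
  have := floorD1_gt (E.+1%:R * jetf (rep (Some c)) p o).
  have := floor_le_tmp (E.+1%:R * jetf v p o).
  have := floorD1_gt (E.+1%:R * jetf v p o).
  rewrite hf intrD; lra.
have hE : E.+1%:R^-1 <= e / 3.
  rewrite -[e / 3]invrK lef_pV2 ?posrE ?invr_gt0 ?divr_gt0 // invf_div.
  apply/ltW/(lt_trans (archi_boundP _)); first by rewrite divr_ge0 // ltW.
  by rewrite ltr_nat.
have h1 := ler_normD (jetf (rep (Some c)) x o - jetf (rep (Some c)) p o) (jetf (rep (Some c)) p o - jetf v x o).
have h2 := ler_normD (jetf (rep (Some c)) p o - jetf v p o) (jetf v p o - jetf v x o).
rewrite !subrKA in h1 h2; rewrite distrC in hu.
have -> : e = e / 3 + (e / 3 + e / 3) by field.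
apply: (le_trans h1); apply: lerD; first exact: le_trans hu hE.
by apply: (le_trans h2); apply: lerD; [exact: le_trans huv hE | exact: le_trans hv hE].
Qed.

End TestFunctions.

Section Solution.
Variables (R : realType) (m k : nat).
Variables (A : probability (Rd R (m + k)) R -> 'rV[R]_(m + k) -> 'M[R]_(m + k))
  (b : probability (Rd R (m + k)) R -> 'rV[R]_(m + k) -> 'rV[R]_(m + k))
  (V : 'rV[R]_(m + k) -> R).
Hypotheses
  (Ameas : forall mu i j, measurable_fun setT (fun x : Rd R (m + k) => A mu x i j))
  (bmeas : forall mu i, measurable_fun setT (fun x : Rd R (m + k) => b mu x 0 i)).
Hypotheses (h12 : H12 V A b).
Variables (Rb : R) (mu : probability (Rd R (m + k)) R).
Hypotheses (Rb0 : 0 < Rb) (muR : inPRV V Rb mu).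

Lemma adm_cf_supp o (J : 'rV[R]_(m + k) -> R) (r : R) : continuous J -> (forall x, r < `|x| -> J x = 0) ->
  adm ((fun x => cf A b o mu x * J x) : Rd R (m + k) -> R).
Proof.
move=> Jc Jout; rewrite (_ : (fun x => _) = fun x => (ballind r x * cf A b o mu x) * J x).
  by apply: admM; [exact: (cf_trunc_adm Ameas bmeas h12 _ _ Rb0 muR) | exact: (adm_cont_supp Jc Jout)].
by apply/funext => x; rewrite /ballind; case: (leP `|x| r) => [_|/Jout ->]; rewrite ?mul1r ?mulr0.
Qed.

Lemma cf_compact_integrable o (K : set 'rV[R]_(m + k)) : compact K ->
  mu.-integrable (K : set (Rd R (m + k))) (fun x => (cf A b o mu x)%:E).
Proof.
move=> Kc; have mK : measurable (K : set (Rd R (m + k))).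
  have /closed_openC oK := compact_closed (@norm_hausdorff _ _) Kc.
  by rewrite -[K]setCK; apply: measurableC; exact: sub_sigma_algebra.
have [M [_ hM]] := compact_bounded Kc.
pose r := `|M| + 1.
have aT := cf_trunc_adm Ameas bmeas h12 o r Rb0 muR.
have iT := adm_integrable mu aT.
have iK := integrableS measurableT mK (@subsetT _ _) iT.
apply: eq_integrable iK => // x /set_mem Kx /=.
rewrite /ballind (_ : (`|x| <= r) = true) ?mul1r //.
by apply: hM => //; rewrite /r; have := ler_norm M; lra.
Qed.

Lemma Lpt_integral v : test_fun v -> adm ((fun x => Lpt A b mu x (jetf v x)) : Rd R (m + k) -> R) /\
  (\int[mu]_(x in setT) (Lop (A mu) (b mu) v x)%:E = (\sum_o ex mu (fun x => cf A b o mu x * jetf v x o))%:E)%E.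
Proof.
move=> vt; have [r [_ vr]] := test_fun_supp vt.
have a o : adm ((fun x => cf A b o mu x * jetf v x o) : Rd R (m + k) -> R).
  apply: (@adm_cf_supp o _ r%:R) => [|x xr]; first exact: jetf_cont (vt.1 2%N).
  exact: jetf_out vr xr.
have aL : adm ((fun x => Lpt A b mu x (jetf v x)) : Rd R (m + k) -> R) by exact: adm_sum.
split => //; under eq_integral do rewrite LptE.
by rewrite ex_EFin // -ex_sum.
Qed.

(** Only jets enter the equation, and they are compared with an error carried by a fixed ball, where
    the coefficients are bounded; so the equation passes from the countable family to [v]. *)
Lemma Lpt_approx (u : nat -> 'rV[R]_(m + k) -> R) (v : 'rV[R]_(m + k) -> R) (rad : nat -> nat) (r : nat) : test_fun v ->
  (forall j, Ck 2 (u j) /\ forall x, (rad j)%:R < `|x| -> u j x = 0) ->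
  (forall e, 0 < e -> exists j, forall x o, `|jetf (u j) x o - jetf v x o| <= e * ballind r%:R x) ->
  (forall j, \sum_o ex mu (fun x => cf A b o mu x * jetf (u j) x o) = 0) ->
  (\int[mu]_(x in setT) (Lop (A mu) (b mu) v x)%:E)%E = 0%E.
Proof.
move=> vt hu app u0; have [_ ->] := Lpt_integral vt; congr EFin.
have [M [M0 hM]] := cf_bound h12 r%:R Rb0.
have [rv [_ vr]] := test_fun_supp vt.
have av o : adm ((fun x => cf A b o mu x * jetf v x o) : Rd R (m + k) -> R).
  apply: (@adm_cf_supp o _ rv%:R) => [|x xr]; first exact: jetf_cont (vt.1 2%N).
  exact: jetf_out vr xr.
have au j o : adm ((fun x => cf A b o mu x * jetf (u j) x o) : Rd R (m + k) -> R).
  have [uC uout] := hu j; apply: (@adm_cf_supp o _ (rad j)%:R) => [|x xr]; first exact: jetf_cont.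
  exact: jetf_out uout xr.
apply/eqP; rewrite -normr_le0; apply/ler_addgt0Pr => e e0; rewrite add0r.
pose c : R := \sum_(o : ix m k) M.
have c0 : 0 <= c by rewrite sumr_ge0.
have c1 : 0 < c + 1 by rewrite ltr_wpDl.
have [j hj] := app _ (divr_gt0 e0 c1).
pose Ev o := ex mu (fun x => cf A b o mu x * jetf v x o).
pose Eu o := ex mu (fun x => cf A b o mu x * jetf (u j) x o).
have Eu0 : \sum_o Eu o = 0 by exact: u0.
rewrite -[X in `|X|]/(\sum_o Ev o).
have sub0 (F G : ix m k -> R) : \sum_o G o = 0 -> \sum_o F o = \sum_o (F o - G o) by move=> G0; rewrite sumrB G0 subr0.
rewrite (sub0 Ev Eu Eu0).
apply: (@le_trans _ _ (c * (e / (c + 1)))); last by rewrite mulrCA ger_pMr // ler_pdivrMr // mul1r lerDl.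
apply: (le_trans (ler_norm_sum _ _ _)); rewrite mulr_suml; apply: ler_sum => o _.
rewrite /Ev /Eu -exB //; apply: ex_norm_le => [|x]; first exact: admB.
rewrite -mulrBr normrM distrC.
have := hj x o; rewrite /ballind; case: (boolP (`|(x : 'rV[R]_(m + k))| <= r%:R)) => xr /=.
  by rewrite mulr1 => h; rewrite ler_pM // hM.
by rewrite mulr0 => h; rewrite (le_anti (_ : `|jetf (u j) x o - jetf v x o| <= 0 <= _)) ?h ?normr_ge0 // mulr0 mulr_ge0 // divr_ge0 // ltW.
Qed.

End Solution.

(** The moment bound [(C + 1) / Lam + 1] is uniform along the sequence of laws, so it is inherited
    by the limit [mu]; the equation is verified on the countable family of tests and extended by
    density of the jets. *)
Theorem theorem2p1 (R : realType) (m k : nat) (gamma : R)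
  (A : probability (Rd R (m + k)) R -> 'rV[R]_(m + k) -> 'M[R]_(m + k))
  (b : probability (Rd R (m + k)) R -> 'rV[R]_(m + k) -> 'rV[R]_(m + k))
  (V : 'rV[R]_(m + k) -> R) (C Lam : R) :
  (0 < m + k)%N ->
  (forall mu x, (A mu x)^T = A mu x) ->
  (forall mu x (xi : 'rV[R]_(m + k)), 0 <= (xi *m A mu x *m xi^T) 0 0) ->
  (forall mu i j, measurable_fun setT (fun x : Rd R (m + k) => A mu x i j)) ->
  (forall mu i, measurable_fun setT (fun x : Rd R (m + k) => b mu x 0 i)) ->
  Ck 2 V -> (forall x, 0 <= V x) ->
  (forall M : R, exists r : R, forall x, r < enorm x -> M < V x) ->
  H11 V A -> H12 V A b -> H13 V A b ->
  0 < gamma -> H2 gamma V A b ->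
  0 < C -> 0 < Lam ->
  (forall mu, inPV V mu -> forall x, Lop (A mu) (b mu) V x <= C - Lam * V x) ->
  exists mu : probability (Rd R (m + k)) R, inPV V mu /\ prob_solution A b mu.
Proof.
move=> mk0 Asym Apsd Ameas bmeas Vck V0 Vinf h11 h12 h13 gamma0 h2 C0 Lam0 lyap.
have Ap mu x : psd (A mu x) by split; [exact: Asym | exact: Apsd].
have Vc : continuous V by have := Ck2_C2 Vck; case.
pose Rb : R := (C + 1) / Lam + 1.
have Rb0 : 0 < Rb by rewrite ltr_wpDl // divr_ge0 ?ltW // addr_gt0.
have [u [rad [urad udense]]] := @dense_tests R m k.
(* The constants of the Krylov type estimate are fixed for each radius beforehand, since the [n]-th
   law has to meet the estimates for radii up to [n]; a dummy pair is used when [r] or [m] is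
   zero. *)
have /choice[KN hKN] : forall r : nat, exists KN : R * nat, (0 < r)%N -> (0 < m)%N -> 0 <= KN.1 /\
    forall N (f : 'rV[int]_m -> R) eps, (KN.2 < N)%N -> 0 < eps -> (forall k, 0 <= f k) ->
    \sum_(k <- zbox m ((2 * r).+2 * N ^ 4)) f k ^+ m <= eps ^+ m * N%:R ^+ (4 * m) ->
    exists u G H, [/\ C2 u G H,
      forall x : 'rV[R]_(m + k), (2 * r)%:R <= `|x| -> u x = 0 /\ forall o, jet (G x) (H x) o = 0 &
      forall mu x x', inPRV V Rb mu -> `|x' - x| <= 1 ->
        bump ((2 * r)%:R^-1 *: x) ^+ 2 * \sum_(k <- zbox m ((2 * r).+2 * N ^ 4)) theta N k (lsubmx x) * f k - KN.1 * eps
        <= Lpt A b mu x' (jet (G x) (H x))].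
  move=> r; have [/andP[r0 m0]|nr] := boolP ((0 < r)%N && (0 < m)%N).
    have [K [N0 [K0 hK]]] := field_test Ap h11 h12 m0 Rb0 r0.
    by exists (K, N0) => _ _; split.
  by exists (0, 0%N) => r0 m0; move: nr; rewrite r0 m0.
have uC2 j : C2 (u j) (fun x => \row_i pder [:: i] (u j) x) (fun x => \matrix_(i, l) pder [:: i; l] (u j) x).
  by apply: Ck2_C2; have [_ []] := urad j.
have uout j x : (rad j)%:R + 1 <= `|x| -> u j x = 0.
  by move=> h; have [_ [_]] := urad j; apply; lra.
have /choice[D0 /choice[N0 /choice[l0 hl0]]] := law_step mk0 Ap Ameas bmeas Vck V0 Vinf h12 gamma0 h2 C0 Lam0 lyap
  uC2 uout (fun m0 r r0 => hKN r r0 m0).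
have N0n n : (n < N0 n)%N by have [[_ []]] := hl0 n.
have SS0 := @star_star R m k (fun r => (KN r).1) (fun r => (KN r).2) N0 l0 N0n
   (fun r r0 m0 => (hKN r r0 m0).1)
   (fun n m0 => let: And5 _ _ _ _ h := hl0 n in h m0).
have l0R n : inPRV V Rb (flawP (l0 n)) by have [] := hl0 n.
have [phi [mu [phiS muR wc cc]]] := V_compact Vc V0 Vinf l0R.
have phin n : (n <= phi n)%N by exact: subseq_ge.
exists mu; split; first exact: (inPRV_inPV Vc V0 muR).
split.
  move=> K Kc i j; split.
    exact: (cf_compact_integrable Ameas bmeas h12 Rb0 muR (inl (i, j)) Kc).
  exact: (cf_compact_integrable Ameas bmeas h12 Rb0 muR (inr i) Kc).
move=> v vt; have [r hr] := udense v vt.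
apply: (Lpt_approx Ameas bmeas h12 Rb0 muR vt (fun j => (urad j).2) hr) => j.
have [rj0 [ujC ujout]] := urad j.
have lim o : (fun n => lE (l0 (phi n)) (fun x => cfbar A b (D0 (phi n)) (N0 (phi n)) (flawP (l0 (phi n))) x o * jetf (u j) x o)) @ \oo
    --> ex mu (fun x => cf A b o mu x * jetf (u j) x o).
  apply: (limit_coef Ameas bmeas h12 h13 gamma0 h2 (D := fun n => D0 (phi n)) (N := fun n => N0 (phi n))
     (l := fun n => l0 (phi n)) Rb0 _ _ _ _ muR wc cc _ rj0).
  - by move=> n; apply: leq_trans (phin n) _; have [[]] := hl0 (phi n).
  - by move=> n; apply: leq_ltn_trans (phin n) _.
  - by move=> n; have [[_ []]] := hl0 (phi n).
  - by move=> n; exact: l0R.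
  - move=> r' M t' r'0 M0 t'0; have [t [n0 [t0 h]]] := SS0 r' M t' r'0 M0 t'0.
    by exists t, n0; split => // n f nn; apply: h; exact: leq_trans (phin n).
  - exact: jetf_cont.
  - by move=> x; exact: jetf_out.
have lim2 := @cvgn_sum R _ (index_enum (ix m k)) _ _ lim.
(* The same sums tend to 0: for [n > j] the [j]-th test function belongs to the family, and its
   averaged equation holds up to the reciprocal of [(phi n).+1]. *)
apply: (cvg_unique _ lim2) => //; apply/cvgrPdist_le => e e0.
exists (maxn j.+1 (Num.bound e^-1)) => // n /=; rewrite geq_max => /andP[nj ne].
rewrite sub0r normrN -lE_sum.
have [_ _ _ h _] := hl0 (phi n); apply: (le_trans (h j (leq_trans nj (phin n)))).
rewrite -[e]invrK lef_pV2 ?posrE ?ltr0n ?invr_gt0 //.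
apply/ltW/(lt_le_trans (archi_boundP _)); first by rewrite invr_ge0 ltW.
by rewrite ler_nat (leq_trans ne) // (leq_trans (phin n)).
Qed.
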